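(* Let $g\ge1$ and $(\bm w,\bm\rho)\in\mathfrak C_g$. For $x\in\mathcal D$ and $b\in\{1,\ldots,g\}$ the normalized holomorphic 1-form $\nu_b$ on $\mathcal S_g$ is given by $$\nu_b(x)-\omega^{(0)}_{w_b-w_{-b}}(x)=-d_b\,(I-A)^{-1}R(x)=-L(x)\,(I-A)^{-1}\,\overline d_b .$$
   Context: $\mathcal I_+=\{1,\ldots,g\}$, $\mathcal I=\{\pm1,\ldots,\pm g\}$. Parameters $w_a\in\mathbb C$ ($a\in\mathcal I$), $\rho_a\in\mathbb C\setminus\{0\}$ with $\rho_{-a}=\rho_a$. $\mathfrak C_g\subset\mathbb C^{3g}$ is the set of $(\bm w,\bm\rho)=(w_1,w_{-1},\rho_1,\ldots,w_g,w_{-g},\rho_g)$ with $|w_a-w_b|>|\rho_a|^{1/2}+|\rho_b|^{1/2}$ for all $a\ne b$ in $\mathcal I$. $\mathcal C_a$ is the circle with centre $w_a$ and radius $|\rho_a|^{1/2}$. $\gamma_az=w_{-a}+\rho_a/(z-w_a)$, so $\gamma_{-a}=\gamma_a^{-1}$; $\Gamma=\langle\gamma_1,\ldots,\gamma_g\rangle$ is the Schottky group, $\mathcal S_g=(\widehat{\mathbb C}\setminus\Lambda(\Gamma))/\Gamma$ ($\Lambda$ = limit set) is a compact Riemann surface of genus $g$, and $\mathcal D\subset\widehat{\mathbb C}$ is the fundamental region exterior to all the circles $\mathcal C_a$; forms are written in the coordinate of $\mathcal D$. Homology: $\alpha_a$ is the class of $\mathcal C_a$ counterclockwise (equivalently $\mathcal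 C_{-a}$ clockwise), $\beta_a$ is a path in $\mathcal D$ from $\gamma_az\in\mathcal C_{-a}$ to $z\in\mathcal C_a$. $\omega(x,y)$ is the unique symmetric bidifferential on $\mathcal S_g$ of the form $\big((x-y)^{-2}+\text{regular}\big)dx\,dy$ with $\oint_{\alpha_a}\omega(x,\cdot)=0$ for all $a\in\mathcal I_+$; $\nu_a(x)=\oint_{\beta_a}\omega(x,\cdot)$, so that $\oint_{\alpha_a}\nu_b=2\pi i\,\delta_{ab}$. Also $\omega^{(0)}_{p-q}(x)=\dfrac{dx}{x-p}-\dfrac{dx}{x-q}$. For $a\in\mathcal I$, $k\ge1$: $L_a(k,x)=\dfrac{\sqrt k\,\rho_a^{k/2}}{(x-w_a)^{k+1}}dx$ (fixed square roots with $\rho_{-a}^{1/2}=\rho_a^{1/2}$). $L(x)=(L_a(k,x))$ is the infinite row vector and $R(x)=(L_{-a}(k,x))$ the infinite column vector, indexed by $(a,k)$. $A=(A_{ab}(k,l))$ is the infinite matrix indexed by $a,b\in\mathcal I$, $k,l\ge1$, with $A_{ab}(k,l)=\dfrac{(-1)^k(k+l-1)!}{\sqrt{kl}\,(k-1)!(l-1)!}\dfrac{\rho_a^{k/2}\rho_b^{l/2}}{(w_{-a}-w_b)^{k+l}}$ if $a\ne-b$ and $A_{ab}(k,l)=0$ if $a=-b$; $(I-A)^{-1}=\sum_{n\ge0}A^n$. For $b\in\mathcal I_+$, $a\in\mathcal I$, $k\ge1$: $$d_b^a(k)=\begin{cases}\dfrac{\rho_a^{k/2}}{\sqrt k}\Big((w_{-b}-w_a)^{-k}-(w_b-w_a)^{-k}\Big),&|a|\ne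 b,\\[2mm]\mathrm{sgn}(a)\dfrac{\rho_a^{k/2}}{\sqrt k}\,(w_{-b\,\mathrm{sgn}(a)}-w_a)^{-k},&|a|=b.\end{cases}$$ $d_b=(d_b^a(k))$ is the infinite row vector and $\overline d_b=(d_b^{-a}(k))$ the infinite column vector, indexed by $(a,k)$. *)

(* Defs.v *)
From Stdlib Require Export Reals ZArith.
From Coquelicot Require Export Coquelicot.
Open Scope C_scope.

(* The letters [a] of the index set {±1,...,±g} are integers.  The parameters
   [w] and [rho] are functions on [Z], only used on that set. *)
Definition is_letter (g : nat) (a : Z) : Prop :=
  (1 <= Z.abs a <= Z.of_nat g)%Z.

(* [|rho_a|^(1/2)], the radius of the circle [C_a] with centre [w_a]. *)
Definition radius (rho : Z -> C) (a : Z) : R := sqrt (Cmod (rho a)).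

Definition in_Schottky_domain (g : nat) (w rho : Z -> C) : Prop :=
  (forall a, is_letter g a -> rho a <> 0 /\ rho (- a)%Z = rho a) /\
  (forall a b, is_letter g a -> is_letter g b -> a <> b ->
     (Cmod (w a - w b) > radius rho a + radius rho b)%R).

(* A choice [s a] of the square roots [rho_a^(1/2)]; then
   [rho_a^(k/2)] is [s a ^ k]. *)
Definition is_sqrt_choice (g : nat) (rho s : Z -> C) : Prop :=
  forall a, is_letter g a -> s a * s a = rho a /\ s (- a)%Z = s a.

Inductive Chat : Type :=
| Fin (z : C)
| Infty.

(* [ChartZ] is the coordinate z on the finite plane, [ChartT] the coordinate
   t = 1/z around the point at infinity. *)
Inductive chart : Type := ChartZ | ChartT.

Definition param (c : chart) (u : C) : Chat :=
  match c with
  | ChartZ => Fin u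
  | ChartT => if Ceq_dec u 0 then Infty else Fin (/ u)
  end.

(* Meaningless at the point outside the chart (where it is 0). *)
Definition coord (c : chart) (p : Chat) : C :=
  match c, p with
  | ChartZ, Fin z => z
  | ChartZ, Infty => 0
  | ChartT, Fin z => / z
  | ChartT, Infty => 0
  end.

Definition chart_at (p : Chat) : chart :=
  match p with Fin _ => ChartZ | Infty => ChartT end.

Definition pt_coord (p : Chat) : C := coord (chart_at p) p.

Definition locally_hat (p : Chat) (U : Chat -> Prop) : Prop :=
  locally (pt_coord p) (fun u => U (param (chart_at p) u)).

(* A 1-form is given by a function [f : Chat -> C]: at a finite point z it is
   f(z) dz, and at infinity it is f(oo) dt with t = 1/z.  A bidifferential is
   given likewise by a function [Chat -> Chat -> C].

   [jac c u] is the factor that turns this coefficient, at the point with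
   coordinate [u] in the chart [c], into the coefficient with respect to the
   differential of [c]: in the chart t one has dz = - dt / t^2. *)
Definition jac (c : chart) (u : C) : C :=
  match c with
  | ChartZ => 1
  | ChartT => if Ceq_dec u 0 then 1 else - / (u * u)
  end.

Definition bicoef (W : Chat -> Chat -> C) (c d : chart) (uv : C * C) : C :=
  W (param c (fst uv)) (param d (snd uv)) * jac c (fst uv) * jac d (snd uv).

Definition C_differentiable2 (h : C * C -> C) (uv : C * C) : Prop :=
  @ex_filterdiff C_AbsRing
    (prod_NormedModule C_AbsRing C_NormedModule C_NormedModule)
    C_NormedModule h (locally uv).

(* [m] is the derivative at [p] of a self-map of the sphere, with respect to
   the coordinates at [p] and at its image. *)
Definition is_derive_hat (f : Chat -> Chat) (p : Chat) (m : C) : Prop :=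
  is_derive (K := C_AbsRing) (V := C_NormedModule)
    (fun u => coord (chart_at (f p)) (f (param (chart_at p) u)))
    (pt_coord p) m.

Definition schottky_gen (w rho : Z -> C) (a : Z) (p : Chat) : Chat :=
  match p with
  | Fin z => if Ceq_dec z (w a) then Infty
             else Fin (w (- a)%Z + rho a / (z - w a))
  | Infty => Fin (w (- a)%Z)
  end.

(* The group generated by gamma_1, ..., gamma_g; inverses come from
   gamma_{-a} = gamma_a^{-1}. *)
Inductive schottky_group (g : nat) (w rho : Z -> C) : (Chat -> Chat) -> Prop :=
| schottky_id : schottky_group g w rho (fun p => p)
| schottky_comp : forall a f, is_letter g a -> schottky_group g w rho f ->
    schottky_group g w rho (fun p => schottky_gen w rho a (f p)).

Definition limit_set (g : nat) (w rho : Z -> C) (p : Chat) : Prop :=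
  exists (z : Chat) (f : nat -> Chat -> Chat),
    (forall n, schottky_group g w rho (f n)) /\
    (forall n m, n <> m -> exists q, f n q <> f m q) /\
    filterlim (fun n => f n z) eventually (locally_hat p).

Definition regular_set (g : nat) (w rho : Z -> C) (p : Chat) : Prop :=
  ~ limit_set g w rho p.

Definition equivalent (g : nat) (w rho : Z -> C) (p q : Chat) : Prop :=
  exists f, schottky_group g w rho f /\ f p = q.

Definition in_D (g : nat) (w rho : Z -> C) (p : Chat) : Prop :=
  match p with
  | Fin z => forall a, is_letter g a -> (Cmod (z - w a) > radius rho a)%R
  | Infty => True
  end.

(* A path in the finite plane, with its velocity. *)
Record path : Type := Path { pos : R -> C; vel : R -> C }.

Definition path_integrand (f : Chat -> C) (p : path) (t : R) : C :=
  f (Fin (pos p t)) * vel p t.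

(* [C_a], counterclockwise, on [0, 2 pi]. *)
Definition circle (w rho : Z -> C) (a : Z) : path :=
  Path (fun t => w a + RtoC (radius rho a) * (cos t, sin t))
       (fun t => RtoC (radius rho a) * (- sin t, cos t)%R).

(* Every piecewise C^1 path can be reparametrized to a C^1 one and then be
   extended beyond its end points, so the two-sided derivatives at 0 and 1 are
   no restriction. *)
Definition is_C1_path (p : path) : Prop :=
  forall t : R, (0 <= t <= 1)%R ->
    is_derive (pos p) t (vel p t) /\ continuous (vel p) t.

(* Representatives of beta_b: paths in D from gamma_b z on [C_{-b}] to z on
   [C_b]. *)
Definition is_beta (g : nat) (w rho : Z -> C) (b : Z) (p : path) : Prop :=
  is_C1_path p /\
  Cmod (pos p 1 - w b) = radius rho b /\
  Fin (pos p 0) = schottky_gen w rho b (Fin (pos p 1)) /\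
  (forall t : R, (0 < t < 1)%R -> in_D g w rho (Fin (pos p t))).

(* Forms on S_g = (regular set)/Gamma are the Gamma-invariant forms on the
   regular set. *)
Record is_canonical_bidiff (g : nat) (w rho : Z -> C)
    (W : Chat -> Chat -> C) : Prop := {
  bidiff_sym : forall p q,
    regular_set g w rho p -> regular_set g w rho q ->
    ~ equivalent g w rho p q -> W p q = W q p;
  bidiff_invariant : forall f p q m,
    schottky_group g w rho f ->
    regular_set g w rho p -> regular_set g w rho q ->
    ~ equivalent g w rho p q ->
    is_derive_hat f p m -> W (f p) q * m = W p q;
  bidiff_holomorphic : forall p q,
    regular_set g w rho p -> regular_set g w rho q ->
    ~ equivalent g w rho p q ->
    C_differentiable2 (bicoef W (chart_at p) (chart_at q))
      (pt_coord p, pt_coord q);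
  (* dx dy / (x - y)^2 has the same expression in the coordinate t = 1/z. *)
  bidiff_diagonal : forall p, regular_set g w rho p ->
    exists h : C * C -> C,
      locally (pt_coord p, pt_coord p) (fun uv : C * C =>
        C_differentiable2 h uv /\
        (fst uv <> snd uv ->
         bicoef W (chart_at p) (chart_at p) uv
           = / ((fst uv - snd uv) * (fst uv - snd uv)) + h uv));
  bidiff_alpha : forall (x : Chat) (a : Z), in_D g w rho x ->
    (1 <= a <= Z.of_nat g)%Z ->
    is_RInt (path_integrand (W x) (circle w rho a)) 0 (2 * PI) (RtoC 0)
}.

(* nu_b(x), the integral of omega(x, .) along a representative of beta_b. *)
Definition nu (W : Chat -> Chat -> C) (beta : path) (x : Chat) : C :=
  RInt (V := C_R_CompleteNormedModule) (path_integrand (W x) beta) 0 1.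

(* dx/(x-p) - dx/(x-q); at infinity it is (q - p) dt. *)
Definition omega0 (p q : C) (x : Chat) : C :=
  match x with
  | Fin z => / (z - p) - / (z - q)
  | Infty => q - p
  end.

(* Indices (a,k) with a a letter and k >= 1. *)
Definition index : Type := (Z * nat)%type.

Definition is_index (g : nat) (i : index) : Prop :=
  is_letter g (fst i) /\ (1 <= snd i)%nat.

Definition Cseries (u : nat -> C) : C :=
  (Series (fun n => Re (u n)), Series (fun n => Im (u n))).

(* [Cseries] and [index_sum] are junk when the sum diverges.  A sum over the
   unordered set of indices (a,k) converges when it converges absolutely; this
   is [index_summable], and the theorem asserts it along with the values. *)
Definition index_sum (g : nat) (F : index -> C) : C :=
  Cseries (fun k => sum_n_m (fun n : nat =>
    F (Z.of_nat n, S k) + F ((- Z.of_nat n)%Z, S k)) 1 g).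

Definition index_summable (g : nat) (F : index -> C) : Prop :=
  ex_series (fun k => sum_n_m (fun n : nat =>
    (Cmod (F (Z.of_nat n, S k)) + Cmod (F ((- Z.of_nat n)%Z, S k)))%R) 1 g).

Definition vec : Type := index -> C.
Definition mat : Type := index -> index -> C.

Definition index_eq_dec (i j : index) : {i = j} + {i <> j}.
Proof. decide equality; [apply Nat.eq_dec | apply Z.eq_dec]. Defined.

Definition mat_one : mat := fun i j => if index_eq_dec i j then 1 else 0.

Definition mat_mul (g : nat) (M N : mat) : mat :=
  fun i j => index_sum g (fun k => M i k * N k j).

Fixpoint mat_pow (g : nat) (M : mat) (n : nat) : mat :=
  match n with
  | O => mat_one
  | S m => mat_mul g (mat_pow g M m) M
  end.

Definition neumann_inverse (g : nat) (M : mat) : mat :=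
  fun i j => Cseries (fun n => mat_pow g M n i j).

Definition neumann_converges (g : nat) (M : mat) : Prop :=
  forall i j, is_index g i -> is_index g j ->
    (forall n, index_summable g (fun k => mat_pow g M n i k * M k j)) /\
    ex_series (fun n => Cmod (mat_pow g M n i j)).

(* u M v for a row vector [u] and a column vector [v]. *)
Definition vec_mat (g : nat) (u : vec) (M : mat) : vec :=
  fun j => index_sum g (fun i => u i * M i j).

Definition sandwich (g : nat) (u : vec) (M : mat) (v : vec) : C :=
  index_sum g (fun j => vec_mat g u M j * v j).

Definition sandwich_converges (g : nat) (u : vec) (M : mat) (v : vec) : Prop :=
  (forall j, is_index g j -> index_summable g (fun i => u i * M i j)) /\
  index_summable g (fun j => vec_mat g u M j * v j).

(* At infinity, dx/(x-w)^(k+1) = - t^(k-1) dt / (1 - w t)^(k+1). *)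
Definition L_form (w s : Z -> C) (a : Z) (k : nat) (x : Chat) : C :=
  match x with
  | Fin z => RtoC (sqrt (INR k)) * s a ^ k / (z - w a) ^ (k + 1)
  | Infty => if Nat.eq_dec k 1 then - (RtoC (sqrt (INR k)) * s a ^ k) else 0
  end.

Definition L_vec (w s : Z -> C) (x : Chat) : vec :=
  fun i => L_form w s (fst i) (snd i) x.

Definition R_vec (w s : Z -> C) (x : Chat) : vec :=
  fun i => L_form w s (- fst i)%Z (snd i) x.

Definition A_mat (w s : Z -> C) : mat := fun i j =>
  let (a, k) := i in
  let (b, l) := j in
  if Z.eq_dec a (- b)%Z then 0
  else RtoC ((-1) ^ k * INR (fact (k + l - 1))
             / (sqrt (INR (k * l)) * INR (fact (k - 1)) * INR (fact (l - 1))))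
       * (s a ^ k * s b ^ l / (w (- a)%Z - w b) ^ (k + l)).

Definition d_vec (w s : Z -> C) (b : Z) : vec := fun i =>
  let (a, k) := i in
  if Z.eq_dec (Z.abs a) b
  then RtoC (IZR (Z.sgn a)) * (s a ^ k / RtoC (sqrt (INR k)))
       * / (w (- (b * Z.sgn a))%Z - w a) ^ k
  else s a ^ k / RtoC (sqrt (INR k))
       * (/ (w (- b)%Z - w a) ^ k - / (w b - w a) ^ k).

Definition dbar_vec (w s : Z -> C) (b : Z) : vec :=
  fun i => d_vec w s b ((- fst i)%Z, snd i).

(* Main.v *)
(** Fix x in D and write omega(x, y) = f(y) dy.  Outside slightly shrunk circles, f minus
    its pole at x is a sum over the letters a of Laurent tails
    sum_k c_a(k) (y - w_a)^(-k-1).  The invariance f(gamma_a y) gamma_a'(y) = f(y) on C_a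
    expresses c_a(k) for k >= 1 through the Taylor coefficients of f - tail at w_{-a}, and
    the alpha-periods give c_a(0) = 0.  In terms of Y_a(k) = - c_a(k) / (sqrt k rho_a^(k/2))
    this is the linear system Y = R + A Y.

    The Neumann series of A converges because A is a strict contraction of l^2.  This is a
    Grunsky inequality for disjoint discs: the logarithmic energy of charges of total mass
    zero placed on the circles is positive, and its Fourier expansion is the quadratic form
    of A plus the identity.  Strictness comes from enlarging the discs by a factor t > 1.
    Hence Y = (I - A)^(-1) R, and the symmetry A_ab(k,l) = A_{-b,-a}(l,k) gives the row
    version L (I - A)^(-1) from it.

    Finally f has an explicit primitive Phi, and Phi - Phi o gamma_b is constant on C_b.  The
    integral of f along beta_b is therefore the difference of the mean values of Phi over C_b
    and C_{-b}, which is omega0 - d_b Y. *)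

Require Import Defs.
From Stdlib Require Import List Lia Lra Classical ClassicalEpsilon.
Import ListNotations.
Open Scope C_scope.

(** * Finite sums and geometrically bounded series *)

(** All convergence rests on one number t > 1. The conditions on the circles and the position of x
    in D are finitely many strict inequalities, so all circles may be shrunk or enlarged by t at
    once. Shrinking gives the annuli in which the Laurent tails converge, enlarging gives the factor
    1/t in the norm of A, and R, L, d and Y all decay like t^(-k). Every series is thus dominated by
    a geometric one and may be exchanged with the others.

    Circles may nearly touch, where bounds on single entries do not control the powers of A; hence
    the positivity argument. It stays finite: the charges sit at N-th roots of unity, and the kernel
    ln (|z|^2 + eps) is regular on the diagonal. One-sided bounds on the energies suffice.

    Cauchy's theory enters through means over circles. The exponential turns an annulus into a
    rectangle, so Goursat's theorem makes the mean independent of the radius, and u -> rho_a / u,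
    which is gamma_a in centred coordinates, preserves it. Invariance of omega becomes a relation
    between moments over C_a and over C_{-a}. *)

Fixpoint csum {T : Type} (l : list T) (F : T -> C) : C :=
  match l with
  | nil => 0
  | i :: l' => F i + csum l' F
  end.

Fixpoint rsum {T : Type} (l : list T) (F : T -> R) : R :=
  match l with
  | nil => 0%R
  | i :: l' => (F i + rsum l' F)%R
  end.

Lemma csum_ext {T} (l : list T) F G :
  (forall i, In i l -> F i = G i) -> csum l F = csum l G.
Proof.
  induction l as [|i l IH]; intros H; simpl; auto.
  rewrite H by (left; reflexivity). rewrite IH; auto.
  intros j Hj; apply H; right; exact Hj.
Qed.

Lemma rsum_ext {T} (l : list T) F G :
  (forall i, In i l -> F i = G i) -> rsum l F = rsum l G.
Proof.
  induction l as [|i l IH]; intros H; simpl; auto.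
  rewrite H by (left; reflexivity). rewrite IH; auto.
  intros j Hj; apply H; right; exact Hj.
Qed.

Lemma csum_app {T} (l l' : list T) F : csum (l ++ l') F = csum l F + csum l' F.
Proof. induction l as [|i l IH]; simpl; [ring | rewrite IH; ring]. Qed.

Lemma rsum_app {T} (l l' : list T) F : rsum (l ++ l') F = (rsum l F + rsum l' F)%R.
Proof. induction l as [|i l IH]; simpl; [ring | rewrite IH; ring]. Qed.

Lemma csum_map {T U} (f : T -> U) (l : list T) F :
  csum (map f l) F = csum l (fun i => F (f i)).
Proof. induction l as [|i l IH]; simpl; [ring | rewrite IH; ring]. Qed.

Lemma rsum_map {T U} (f : T -> U) (l : list T) F :
  rsum (map f l) F = rsum l (fun i => F (f i)).
Proof. induction l as [|i l IH]; simpl; [ring | rewrite IH; ring]. Qed.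

Lemma csum_plus {T} (l : list T) F G :
  csum l (fun i => F i + G i) = csum l F + csum l G.
Proof. induction l as [|i l IH]; simpl; [ring | rewrite IH; ring]. Qed.

Lemma csum_opp {T} (l : list T) F : csum l (fun i => - F i) = - csum l F.
Proof. induction l as [|i l IH]; simpl; [ring | rewrite IH; ring]. Qed.

Lemma csum_minus {T} (l : list T) F G :
  csum l (fun i => F i - G i) = csum l F - csum l G.
Proof. induction l as [|i l IH]; simpl; [ring | rewrite IH; ring]. Qed.

Lemma csum_scal {T} (l : list T) (c : C) F :
  csum l (fun i => c * F i) = c * csum l F.
Proof. induction l as [|i l IH]; simpl; [ring | rewrite IH; ring]. Qed.

Lemma csum_scal_r {T} (l : list T) (c : C) F :
  csum l (fun i => F i * c) = csum l F * c.
Proof. induction l as [|i l IH]; simpl; [ring | rewrite IH; ring]. Qed.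

Lemma csum_0 {T} (l : list T) (F : T -> C) : (forall i, In i l -> F i = 0) -> csum l F = 0.
Proof.
  intros H. rewrite (csum_ext l F (fun i => 0 * 0)).
  rewrite csum_scal; ring. intros; rewrite H by auto; ring.
Qed.

Lemma rsum_plus {T} (l : list T) F G :
  rsum l (fun i => F i + G i)%R = (rsum l F + rsum l G)%R.
Proof. induction l as [|i l IH]; simpl; [ring | rewrite IH; ring]. Qed.

Lemma rsum_minus {T} (l : list T) F G :
  rsum l (fun i => F i - G i)%R = (rsum l F - rsum l G)%R.
Proof. induction l as [|i l IH]; simpl; [ring | rewrite IH; ring]. Qed.

Lemma rsum_opp {T} (l : list T) F : rsum l (fun i => - F i)%R = (- rsum l F)%R.
Proof. induction l as [|i l IH]; simpl; [ring | rewrite IH; ring]. Qed.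

Lemma rsum_scal {T} (l : list T) (c : R) F :
  rsum l (fun i => c * F i)%R = (c * rsum l F)%R.
Proof. induction l as [|i l IH]; simpl; [ring | rewrite IH; ring]. Qed.

Lemma rsum_scal_r {T} (l : list T) (c : R) F :
  rsum l (fun i => F i * c)%R = (rsum l F * c)%R.
Proof. induction l as [|i l IH]; simpl; [ring | rewrite IH; ring]. Qed.

Lemma rsum_const {T} (l : list T) c : rsum l (fun _ => c) = (INR (length l) * c)%R.
Proof.
  induction l as [|i l IH]; simpl length; [simpl; ring|].
  rewrite S_INR; simpl; rewrite IH; ring.
Qed.

Lemma csum_const {T} (l : list T) c : csum l (fun _ => c) = INR (length l) * c.
Proof.
  induction l as [|i l IH]; simpl length; [simpl; ring|].
  rewrite S_INR, RtoC_plus; simpl csum; rewrite IH; ring.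
Qed.

Lemma rsum_le {T} (l : list T) F G :
  (forall i, In i l -> (F i <= G i)%R) -> (rsum l F <= rsum l G)%R.
Proof.
  induction l as [|i l IH]; intros H; simpl; [lra|].
  apply Rplus_le_compat; [apply H; left; auto | apply IH].
  intros j Hj; apply H; right; auto.
Qed.

Lemma rsum_ge0 {T} (l : list T) F :
  (forall i, In i l -> (0 <= F i)%R) -> (0 <= rsum l F)%R.
Proof.
  intros H. apply Rle_trans with (rsum l (fun _ => 0%R)).
  rewrite rsum_const; lra. apply rsum_le; auto.
Qed.

Lemma rsum_ge_term {T} (l : list T) F i :
  (forall j, In j l -> (0 <= F j)%R) -> In i l -> (F i <= rsum l F)%R.
Proof.
  induction l as [|j l IH]; intros H Hi; [destruct Hi|].
  simpl. destruct Hi as [->|Hi].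
  - assert (0 <= rsum l F)%R by (apply rsum_ge0; intros; apply H; right; auto). lra.
  - assert (F i <= rsum l F)%R by (apply IH; auto; intros; apply H; right; auto).
    assert (0 <= F j)%R by (apply H; left; auto). lra.
Qed.

Lemma Cmod_csum {T} (l : list T) F :
  (Cmod (csum l F) <= rsum l (fun i => Cmod (F i)))%R.
Proof.
  induction l as [|i l IH]; simpl; [rewrite Cmod_0; lra|].
  eapply Rle_trans; [apply Cmod_triangle|]. lra.
Qed.

Lemma Rabs_rsum {T} (l : list T) F :
  (Rabs (rsum l F) <= rsum l (fun i => Rabs (F i)))%R.
Proof.
  induction l as [|i l IH]; simpl; [rewrite Rabs_R0; lra|].
  eapply Rle_trans; [apply Rabs_triang|]. lra.
Qed.

Lemma csum_swap {T U} (l : list T) (l' : list U) F :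
  csum l (fun i => csum l' (fun j => F i j)) = csum l' (fun j => csum l (fun i => F i j)).
Proof.
  induction l as [|i l IH]; simpl.
  - symmetry; apply csum_0; auto.
  - rewrite IH, <- csum_plus; reflexivity.
Qed.

Lemma rsum_swap {T U} (l : list T) (l' : list U) F :
  rsum l (fun i => rsum l' (fun j => F i j)) = rsum l' (fun j => rsum l (fun i => F i j)).
Proof.
  induction l as [|i l IH]; simpl.
  - rewrite rsum_const; ring.
  - rewrite IH, <- rsum_plus; reflexivity.
Qed.

Lemma Re_csum {T} (l : list T) F : Re (csum l F) = rsum l (fun i => Re (F i)).
Proof. induction l as [|i l IH]; simpl; auto. f_equal; exact IH. Qed.

Lemma Im_csum {T} (l : list T) F : Im (csum l F) = rsum l (fun i => Im (F i)).
Proof. induction l as [|i l IH]; simpl; auto. f_equal; exact IH. Qed.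

Lemma RtoC_rsum {T} (l : list T) F : RtoC (rsum l F) = csum l (fun i => RtoC (F i)).
Proof. induction l as [|i l IH]; simpl; auto. rewrite RtoC_plus, IH; auto. Qed.

Lemma Cconj_csum {T} (l : list T) F : Cconj (csum l F) = csum l (fun i => Cconj (F i)).
Proof.
  induction l as [|i l IH]; simpl.
  - apply injective_projections; simpl; ring.
  - rewrite Cplus_conj, IH; auto.
Qed.

Lemma csum_mult {T U} (l : list T) (l' : list U) F G :
  csum l F * csum l' G = csum l (fun i => csum l' (fun j => F i * G j)).
Proof.
  rewrite <- csum_scal_r. apply csum_ext; intros i _. rewrite csum_scal; auto.
Qed.

Lemma csum_flat_map {T U} (f : T -> list U) (l : list T) F :
  csum (flat_map f l) F = csum l (fun i => csum (f i) F).
Proof. induction l as [|i l IH]; simpl; auto. rewrite csum_app, IH; auto. Qed.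

Lemma rsum_flat_map {T U} (f : T -> list U) (l : list T) F :
  rsum (flat_map f l) F = rsum l (fun i => rsum (f i) F).
Proof. induction l as [|i l IH]; simpl; auto. rewrite rsum_app, IH; auto. Qed.

Lemma csum_single {T} (l : list T) (i : T) (F : T -> C) :
  NoDup l -> In i l -> (forall j, In j l -> j <> i -> F j = 0) -> csum l F = F i.
Proof.
  induction l as [|j l IH]; intros Hn Hi H; [destruct Hi|].
  inversion Hn as [|? ? Hj Hl]; subst. simpl. destruct Hi as [->|Hi].
  - rewrite csum_0; [ring|]. intros k Hk. apply H; [right; auto|].
    intros ->; contradiction.
  - rewrite H; [|left; auto | intros ->; contradiction].
    rewrite IH; auto. ring. intros; apply H; auto; right; auto.
Qed.

(** * Partial sums and complex series dominated by geometric ones *)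

Definition csumn (N : nat) (u : nat -> C) : C := csum (seq 0 N) u.
Definition rsumn (N : nat) (u : nat -> R) : R := rsum (seq 0 N) u.

Lemma csumn_S N u : csumn (S N) u = csumn N u + u N.
Proof. unfold csumn. rewrite seq_S, csum_app; simpl. ring. Qed.

Lemma rsumn_S N u : rsumn (S N) u = (rsumn N u + u N)%R.
Proof. unfold rsumn. rewrite seq_S, rsum_app; simpl. ring. Qed.

Lemma csumn_split N K u : csumn (N + K) u = csumn N u + csumn K (fun k => u (N + k)%nat).
Proof.
  induction K as [|K IH].
  - rewrite Nat.add_0_r. unfold csumn at 3; simpl. ring.
  - rewrite Nat.add_succ_r, !csumn_S, IH. ring.
Qed.

Lemma rsumn_sum_n N u : rsumn (S N) u = sum_n u N.
Proof.
  induction N as [|N IH].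
  - unfold rsumn; simpl. rewrite sum_O. ring.
  - rewrite rsumn_S, IH, sum_Sn. reflexivity.
Qed.

Lemma csum_geom N (z : C) : (1 - z) * csumn N (fun n => z ^ n) = 1 - z ^ N.
Proof.
  induction N as [|N IH]; [unfold csumn; simpl; ring|].
  rewrite csumn_S, Cmult_plus_distr_l, IH. simpl. ring.
Qed.

Lemma rsum_geom_le N t : (0 <= t < 1)%R -> (rsumn N (fun n => t ^ n) <= / (1 - t))%R.
Proof.
  intros Ht.
  assert (H : (rsumn N (fun n => t ^ n) * (1 - t) = 1 - t ^ N)%R).
  { induction N as [|N IH]; [unfold rsumn; simpl; ring|].
    rewrite rsumn_S, Rmult_plus_distr_r, IH; simpl; ring. }
  assert (0 <= t ^ N)%R by (apply pow_le; lra).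
  apply Rmult_le_reg_r with (1 - t)%R; [lra|].
  rewrite H, Rinv_l by lra. lra.
Qed.

(** The form in which absolute convergence is carried through the proof. Rate and constant are
    explicit, so that tails, products and exchanges of sums are estimated from the same two
    numbers. *)
Definition geo (t M : R) (u : nat -> C) : Prop := forall k, (Cmod (u k) <= M * t ^ k)%R.

Lemma is_series_rsumn (u : nat -> R) (s : R) :
  is_lim_seq (fun N => rsumn N u) s -> is_series u s.
Proof.
  intros H. apply is_lim_seq_incr_1 in H.
  assert (H' : is_lim_seq (sum_n u) s); [|exact H'].
  eapply is_lim_seq_ext; [|exact H]. intros n; apply rsumn_sum_n.
Qed.

Lemma is_lim_rsumn (u : nat -> R) (s : R) :
  is_series u s -> is_lim_seq (fun N => rsumn N u) s.
Proof.
  intros H. apply is_lim_seq_incr_1.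
  eapply is_lim_seq_ext; [|exact H]. intros n; symmetry; apply rsumn_sum_n.
Qed.

Lemma im_le_Cmod c : (Rabs (Im c) <= Cmod c)%R.
Proof. eapply Rle_trans; [apply Rmax_r|apply Rmax_Cmod]. Qed.

Lemma Cmod_le_Re_Im c : (Cmod c <= Rabs (Re c) + Rabs (Im c))%R.
Proof.
  destruct c as [a b]; simpl. unfold Cmod; simpl.
  pose proof (Rabs_pos a); pose proof (Rabs_pos b).
  rewrite <- (sqrt_Rsqr (Rabs a + Rabs b)) by lra.
  apply sqrt_le_1_alt. unfold Rsqr.
  assert (E : forall x, (x * x = Rabs x * Rabs x)%R).
  { intros x; rewrite <- Rabs_mult; symmetry; apply Rabs_pos_eq.
    replace (x * x)%R with (Rsqr x) by reflexivity. apply Rle_0_sqr. }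
  rewrite !Rmult_1_r, (E a), (E b). nra.
Qed.

Lemma ex_series_pow t : (0 <= t < 1)%R -> ex_series (fun k => t ^ k)%R.
Proof. intros Ht. exists (/ (1 - t))%R. apply is_series_geom. rewrite Rabs_pos_eq; lra. Qed.

Lemma geo_ex_Cmod t M u : (0 <= t < 1)%R -> geo t M u -> ex_series (fun k => Cmod (u k)).
Proof.
  intros Ht H. apply (ex_series_le (K := R_AbsRing) (V := R_CompleteNormedModule) _ (fun k => scal M (t ^ k)%R)).
  - intros k. unfold norm; simpl. unfold abs; simpl.
    rewrite Rabs_pos_eq by apply Cmod_ge_0. apply H.
  - apply (ex_series_scal (K := R_AbsRing) (V := R_NormedModule) M (fun k => t ^ k)%R), ex_series_pow; auto.
Qed.

Lemma ex_Cmod_Re u : ex_series (fun k => Cmod (u k)) -> ex_series (fun k => Re (u k)).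
Proof. intros H. apply (ex_series_le (K := R_AbsRing) (V := R_CompleteNormedModule) _ _ (fun k => re_le_Cmod (u k)) H). Qed.

Lemma ex_Cmod_Im u : ex_series (fun k => Cmod (u k)) -> ex_series (fun k => Im (u k)).
Proof. intros H. apply (ex_series_le (K := R_AbsRing) (V := R_CompleteNormedModule) _ _ (fun k => im_le_Cmod (u k)) H). Qed.

(** Links the two sides of the proof: [Cseries] is defined through real and imaginary parts, whereas
    all estimates are made with [Cmod]. *)
Definition cconv (u : nat -> C) (s : C) : Prop :=
  forall eps, (0 < eps)%R -> exists N0, forall N, (N0 <= N)%nat -> (Cmod (u N - s) < eps)%R.

Lemma cconv_unique u s s' : cconv u s -> cconv u s' -> s = s'.
Proof.
  intros H H'. apply NNPP; intros Hn.
  assert (Hp : (0 < Cmod (s - s') / 2)%R).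
  { apply Rdiv_lt_0_compat; [|lra]. apply Cmod_gt_0, Cminus_eq_contra; auto. }
  destruct (H _ Hp) as [N HN], (H' _ Hp) as [N' HN'].
  specialize (HN (N + N')%nat ltac:(lia)). specialize (HN' (N + N')%nat ltac:(lia)).
  assert (Cmod (s - s') <= Cmod (u (N + N')%nat - s) + Cmod (u (N + N')%nat - s'))%R.
  { replace (s - s') with (- (u (N + N')%nat - s) + (u (N + N')%nat - s')) by ring.
    eapply Rle_trans; [apply Cmod_triangle|]. rewrite Cmod_opp; lra. }
  lra.
Qed.

Lemma cconv_Re_Im u s : cconv u s ->
  is_lim_seq (fun n => Re (u n)) (Re s) /\ is_lim_seq (fun n => Im (u n)) (Im s).
Proof.
  intros H; split; apply is_lim_seq_spec; intros eps;
    destruct (H eps (cond_pos eps)) as [N0 HN]; exists N0; intros n Hn;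
    (eapply Rle_lt_trans; [|apply (HN n Hn)]).
  - replace (Re (u n) - Re s)%R with (Re (u n - s)) by (unfold Cminus; rewrite re_plus, re_opp; ring). apply re_le_Cmod.
  - replace (Im (u n) - Im s)%R with (Im (u n - s)) by (unfold Cminus; rewrite im_plus, im_opp; ring). apply im_le_Cmod.
Qed.

Lemma Re_Im_cconv u s :
  is_lim_seq (fun n => Re (u n)) (Re s) -> is_lim_seq (fun n => Im (u n)) (Im s) ->
  cconv u s.
Proof.
  intros H1 H2 eps He. apply is_lim_seq_spec in H1. apply is_lim_seq_spec in H2.
  assert (He2 : (0 < eps / 2)%R) by lra.
  destruct (H1 (mkposreal _ He2)) as [N1 HN1], (H2 (mkposreal _ He2)) as [N2 HN2].
  exists (N1 + N2)%nat; intros N HN.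
  specialize (HN1 N ltac:(lia)); specialize (HN2 N ltac:(lia)); simpl in *.
  eapply Rle_lt_trans; [apply Cmod_le_Re_Im|].
  replace (Re (u N - s))%R with (Re (u N) - Re s)%R by (unfold Cminus; rewrite re_plus, re_opp; ring).
  replace (Im (u N - s))%R with (Im (u N) - Im s)%R by (unfold Cminus; rewrite im_plus, im_opp; ring). lra.
Qed.

(** The standard way to evaluate a [Cseries] below. Convergence of the partial sums makes both real
    series converge, so the default value of a divergent [Series] never appears. *)
Lemma Cseries_unique u s : cconv (fun N => csumn N u) s -> Cseries u = s.
Proof.
  intros H. apply cconv_Re_Im in H. destruct H as [H1 H2].
  unfold Cseries. destruct s as [s1 s2]; f_equal; apply is_series_unique, is_series_rsumn.
  - eapply is_lim_seq_ext; [|exact H1]. intros n. apply Re_csum.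
  - eapply is_lim_seq_ext; [|exact H2]. intros n. apply Im_csum.
Qed.

Lemma Cseries_conv u :
  ex_series (fun k => Cmod (u k)) -> cconv (fun N => csumn N u) (Cseries u).
Proof.
  intros H. apply Re_Im_cconv.
  - eapply is_lim_seq_ext. { intros n; symmetry; apply Re_csum. }
    apply is_lim_rsumn, Series_correct, ex_Cmod_Re, H.
  - eapply is_lim_seq_ext. { intros n; symmetry; apply Im_csum. }
    apply is_lim_rsumn, Series_correct, ex_Cmod_Im, H.
Qed.

Lemma cconv_bound u s B :
  cconv u s -> (exists N0, forall N, (N0 <= N)%nat -> (Cmod (u N) <= B)%R) -> (Cmod s <= B)%R.
Proof.
  intros H [N0 HB]. apply Rnot_lt_le; intros Hn.
  destruct (H (Cmod s - B)%R) as [N1 H1]; [lra|].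
  specialize (H1 (N0 + N1)%nat ltac:(lia)). specialize (HB (N0 + N1)%nat ltac:(lia)).
  pose proof (Cmod_triangle (- (u (N0 + N1)%nat - s)) (u (N0 + N1)%nat)) as T.
  replace (- (u (N0 + N1)%nat - s) + u (N0 + N1)%nat) with s in T by ring.
  rewrite Cmod_opp in T. lra.
Qed.

Lemma cconv_plus u v s t : cconv u s -> cconv v t -> cconv (fun n => u n + v n) (s + t).
Proof.
  intros H1 H2 eps He. destruct (H1 (eps / 2)%R) as [N1 HN1]; [lra|].
  destruct (H2 (eps / 2)%R) as [N2 HN2]; [lra|].
  exists (N1 + N2)%nat; intros N HN.
  specialize (HN1 N ltac:(lia)); specialize (HN2 N ltac:(lia)).
  replace (u N + v N - (s + t)) with ((u N - s) + (v N - t)) by ring.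
  eapply Rle_lt_trans; [apply Cmod_triangle|lra].
Qed.

Lemma cconv_scal c u s : cconv u s -> cconv (fun n => c * u n) (c * s).
Proof.
  intros H eps He. pose proof (Cmod_ge_0 c).
  destruct (H (eps / (Cmod c + 1))%R) as [N1 HN1]; [apply Rdiv_lt_0_compat; lra|].
  exists N1; intros N HN. specialize (HN1 N HN).
  replace (c * u N - c * s) with (c * (u N - s)) by ring. rewrite Cmod_mult.
  apply Rle_lt_trans with (Cmod c * (eps / (Cmod c + 1)))%R.
  - apply Rmult_le_compat_l; lra.
  - replace (Cmod c * (eps / (Cmod c + 1)))%R with (eps * (Cmod c / (Cmod c + 1)))%R by (field; lra).
    rewrite <- (Rmult_1_r eps) at 2. apply Rmult_lt_compat_l; auto.
    apply Rmult_lt_reg_r with (Cmod c + 1)%R; [lra|]. unfold Rdiv.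
    rewrite Rmult_assoc, Rinv_l; lra.
Qed.

Lemma cconv_ext u v s : (forall n, u n = v n) -> cconv u s -> cconv v s.
Proof. intros E H eps He. destruct (H eps He) as [N HN]. exists N; intros; rewrite <- E; auto. Qed.

Lemma cconv_csum {T} (l : list T) (u : T -> nat -> C) s :
  (forall i, In i l -> cconv (u i) (s i)) -> cconv (fun n => csum l (fun i => u i n)) (csum l s).
Proof.
  induction l as [|i l IH]; intros H; simpl.
  - intros eps He; exists O; intros. replace (0 - 0) with (RtoC 0) by ring. rewrite Cmod_0; auto.
  - apply cconv_plus; [apply H; left; auto | apply IH; intros; apply H; right; auto].
Qed.

Lemma Cseries_ext u v : (forall n, u n = v n) -> Cseries u = Cseries v.
Proof. intros E. unfold Cseries; f_equal; apply Series_ext; intros; rewrite E; auto. Qed.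

Lemma cconv_geo t M u :
  (0 <= t < 1)%R -> geo t M u -> cconv (fun N => csumn N u) (Cseries u).
Proof. intros Ht H. apply Cseries_conv, (geo_ex_Cmod t M); auto. Qed.

Lemma geo_M t M u : geo t M u -> (0 <= M)%R.
Proof.
  intros H. specialize (H O). rewrite pow_O, Rmult_1_r in H.
  eapply Rle_trans; [apply Cmod_ge_0|exact H].
Qed.

Lemma geo_csumn_le t M u N :
  (0 <= t < 1)%R -> geo t M u -> (Cmod (csumn N u) <= M / (1 - t))%R.
Proof.
  intros Ht H. eapply Rle_trans; [apply Cmod_csum|].
  apply Rle_trans with (rsum (seq 0 N) (fun k => M * t ^ k)%R).
  - apply rsum_le; intros; apply H.
  - rewrite rsum_scal. apply Rmult_le_compat_l; [eapply geo_M; eauto|].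
    apply rsum_geom_le; auto.
Qed.

Lemma Cseries_bound t M u :
  (0 <= t < 1)%R -> geo t M u -> (Cmod (Cseries u) <= M / (1 - t))%R.
Proof.
  intros Ht H. eapply cconv_bound; [eapply cconv_geo; eauto|].
  exists O; intros; apply geo_csumn_le; auto.
Qed.

Lemma geo_shift t M u N : (0 <= t)%R -> geo t M u -> geo t (M * t ^ N) (fun k => u (N + k)%nat).
Proof. intros Ht H k. rewrite Rmult_assoc, <- pow_add. apply H. Qed.

Lemma Cseries_split t M u N :
  (0 <= t < 1)%R -> geo t M u ->
  Cseries u = csumn N u + Cseries (fun k => u (N + k)%nat).
Proof.
  intros Ht H. apply Cseries_unique. intros eps He.
  destruct (cconv_geo t _ _ Ht (geo_shift t M u N (proj1 Ht) H) eps He) as [N0 HN0].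
  exists (N + N0)%nat; intros K HK.
  replace K with (N + (K - N))%nat by lia. rewrite csumn_split.
  specialize (HN0 (K - N)%nat ltac:(lia)).
  match goal with |- (Cmod ?e < _)%R =>
    replace e with (csumn (K - N) (fun k => u (N + k)%nat) - Cseries (fun k => u (N + k)%nat))
      by ring end. exact HN0.
Qed.

Lemma Cseries_tail t M u N :
  (0 <= t < 1)%R -> geo t M u ->
  (Cmod (Cseries u - csumn N u) <= M * t ^ N / (1 - t))%R.
Proof.
  intros Ht H. rewrite (Cseries_split t M u N) by auto.
  replace (csumn N u + Cseries (fun k => u (N + k)%nat) - csumn N u)
    with (Cseries (fun k => u (N + k)%nat)) by ring.
  apply Cseries_bound; auto. apply geo_shift; auto; lra.
Qed.

Lemma Cseries_plus t M u t' M' v :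
  (0 <= t < 1)%R -> geo t M u -> (0 <= t' < 1)%R -> geo t' M' v ->
  Cseries (fun n => u n + v n) = Cseries u + Cseries v.
Proof.
  intros Ht Hu Ht' Hv. apply Cseries_unique.
  eapply cconv_ext; [|apply (cconv_plus _ _ _ _ (cconv_geo _ _ _ Ht Hu) (cconv_geo _ _ _ Ht' Hv))].
  intros; unfold csumn; rewrite csum_plus; auto.
Qed.

Lemma Cseries_scal t M u c :
  (0 <= t < 1)%R -> geo t M u -> Cseries (fun n => c * u n) = c * Cseries u.
Proof.
  intros Ht Hu. apply Cseries_unique.
  eapply cconv_ext; [|apply (cconv_scal c _ _ (cconv_geo _ _ _ Ht Hu))].
  intros; unfold csumn; rewrite csum_scal; auto.
Qed.

Lemma Cseries_csum {T} (l : list T) t M (u : T -> nat -> C) :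
  (0 <= t < 1)%R -> (forall i, In i l -> geo t (M i) (u i)) ->
  Cseries (fun n => csum l (fun i => u i n)) = csum l (fun i => Cseries (u i)).
Proof.
  intros Ht Hu. apply Cseries_unique.
  eapply cconv_ext; [|apply (cconv_csum l (fun i N => csumn N (u i)))].
  - intros; unfold csumn; rewrite csum_swap; auto.
  - intros; eapply cconv_geo; eauto.
Qed.

Lemma Cseries_0 (u : nat -> C) : (forall n, u n = 0) -> Cseries u = 0.
Proof.
  intros H. apply Cseries_unique. intros eps He; exists O; intros.
  unfold csumn; rewrite csum_0 by auto.
  replace (0 - 0) with (RtoC 0) by ring. rewrite Cmod_0; auto.
Qed.

Lemma pow_small t eps : (0 <= t < 1)%R -> (0 < eps)%R ->
  exists N0, forall N, (N0 <= N)%nat -> (t ^ N < eps)%R.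
Proof.
  intros Ht He. destruct (pow_lt_1_zero t) with (y := eps) as [N0 HN0]; auto.
  rewrite Rabs_pos_eq; lra.
  exists N0; intros N HN. specialize (HN0 N HN). rewrite Rabs_pos_eq in HN0; auto.
  apply pow_le; lra.
Qed.

Lemma geo_small t M eps : (0 <= t < 1)%R -> (0 < eps)%R ->
  exists N0, forall N, (N0 <= N)%nat -> (M * t ^ N < eps)%R.
Proof.
  intros Ht He. pose proof (Rabs_pos M).
  destruct (pow_small t (eps / (Rabs M + 1)) Ht) as [N0 HN]; [apply Rdiv_lt_0_compat; lra|].
  exists N0; intros N HN'. specialize (HN N HN').
  assert (0 <= t ^ N)%R by (apply pow_le; lra).
  apply Rle_lt_trans with (Rabs M * t ^ N)%R.
  { apply Rmult_le_compat_r; auto. apply Rle_abs. }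
  apply (Rmult_lt_compat_r (Rabs M + 1)) in HN; [|lra].
  unfold Rdiv in HN. rewrite Rmult_assoc, Rinv_l in HN by lra. nra.
Qed.

(** The outer sum is cut at [N]. The finite part commutes with the inner series, and what remains is
    at most M t^N / ((1 - t) (1 - t')). *)
Lemma Cseries_fubini t t' M (f : nat -> nat -> C) :
  (0 <= t < 1)%R -> (0 <= t' < 1)%R ->
  (forall k l, (Cmod (f k l) <= M * t ^ k * t' ^ l)%R) ->
  Cseries (fun k => Cseries (fun l => f k l)) = Cseries (fun l => Cseries (fun k => f k l)).
Proof.
  intros Ht Ht' H.
  assert (Hrow : forall k, geo t' (M * t ^ k) (f k)) by (intros k l; apply H).
  assert (HM : (0 <= M)%R) by (pose proof (geo_M _ _ _ (Hrow O)); simpl in *; lra).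
  assert (Hcol : forall l, geo t (M * t' ^ l) (fun k => f k l)).
  { intros l k. replace (M * t' ^ l * t ^ k)%R with (M * t ^ k * t' ^ l)%R by ring. apply H. }
  apply Cseries_unique. intros eps He.
  destruct (geo_small t (M / (1 - t) / (1 - t')) eps Ht He) as [N0 HN0].
  exists N0; intros N HN.
  unfold csumn. rewrite <- (Cseries_csum (seq 0 N) t' (fun k => M * t ^ k)%R) by auto.
  assert (E : Cseries (fun l => Cseries (fun k => f k l)) =
    Cseries (fun l => csum (seq 0 N) (fun k => f k l)) +
    Cseries (fun l => Cseries (fun k => f (N + k)%nat l))).
  { rewrite <- (Cseries_plus t' (M / (1 - t)) _ t' (M / (1 - t))); auto.
    - apply Cseries_ext; intros l. apply (Cseries_split t (M * t' ^ l)); auto.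
    - intros l. eapply Rle_trans; [apply geo_csumn_le; [apply Ht | apply Hcol]|].
      right; field; lra.
    - intros l. eapply Rle_trans.
      + apply (Cseries_bound t (M * t' ^ l)); auto. intros k.
        eapply Rle_trans; [apply H|]. rewrite pow_add.
        assert (t ^ N <= 1)%R by (rewrite <- (pow1 N); apply pow_incr; lra).
        assert (0 <= t ^ k)%R by (apply pow_le; lra).
        assert (0 <= t ^ N)%R by (apply pow_le; lra).
        assert (0 <= M * t' ^ l)%R by (apply Rmult_le_pos; auto; apply pow_le; lra).
        replace (M * (t ^ N * t ^ k) * t' ^ l)%R with ((M * t' ^ l) * (t ^ N * t ^ k))%R by ring.
        apply Rmult_le_compat_l; auto. nra.
      + right; field; lra. }
  rewrite E.
  match goal with |- (Cmod (?a - (?b + ?c)) < _)%R =>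
    replace (a - (b + c)) with (- c) by ring end.
  rewrite Cmod_opp.
  eapply Rle_lt_trans; [|apply (HN0 N HN)].
  replace (M / (1 - t) / (1 - t') * t ^ N)%R with ((M * t ^ N / (1 - t)) / (1 - t'))%R by (field; lra).
  apply Cseries_bound; auto. intros l.
  eapply Rle_trans; [apply (Cseries_bound t (M * t ^ N * t' ^ l)); auto|].
  - intros k. eapply Rle_trans; [apply H|]. rewrite pow_add. right; ring.
  - right; field; lra.
Qed.

(** * Binomial and logarithmic series *)

(** The binomial coefficient of m + l over m, that is, the coefficient of x^l in (1 - x)^(-m-1). The
    quotient of factorials is kept because the entries of A are written with factorials. *)
Definition nb (m l : nat) : R := (INR (fact (m + l)) / (INR (fact m) * INR (fact l)))%R.

Lemma nb_0_r m : nb m 0 = 1%R.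
Proof. unfold nb. rewrite Nat.add_0_r; simpl. field. apply INR_fact_neq_0. Qed.

Lemma nb_0_l l : nb 0 l = 1%R.
Proof. unfold nb; simpl. field. apply INR_fact_neq_0. Qed.

Lemma nb_pos m l : (0 < nb m l)%R.
Proof.
  unfold nb. apply Rdiv_lt_0_compat; [|apply Rmult_lt_0_compat]; apply INR_fact_lt_0.
Qed.

Lemma nb_SS m l : nb (S m) (S l) = (nb (S m) l + nb m (S l))%R.
Proof.
  unfold nb. pose proof (INR_fact_neq_0 m); pose proof (INR_fact_neq_0 l).
  pose proof (INR_fact_neq_0 (m + l)).
  replace (S m + S l)%nat with (S (S (m + l))) by lia.
  replace (S m + l)%nat with (S (m + l)) by lia.
  replace (m + S l)%nat with (S (m + l)) by lia.
  rewrite !fact_simpl, !mult_INR, !S_INR, !plus_INR.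
  pose proof (pos_INR m); pose proof (pos_INR l). field. repeat split; try lra; auto.
Qed.

(** By Pascal's rule [nb_SS], multiplication by 1 - x lowers m by one and leaves a single boundary
    term. Both the bound [nb_sum_le] and the summation [neg_binomial] come from this identity. *)
Lemma nb_partial (m N : nat) (x : C) :
  (1 - x) * csumn (S N) (fun l => nb (S m) l * x ^ l)
  = csumn (S N) (fun l => nb m l * x ^ l) - nb (S m) N * x ^ (S N).
Proof.
  induction N as [|N IH].
  - unfold csumn; simpl. rewrite !nb_0_r. ring.
  - rewrite csumn_S, Cmult_plus_distr_l, IH, (csumn_S (S N)).
    rewrite nb_SS, RtoC_plus. simpl. ring.
Qed.

Lemma nb_sum_le (m N : nat) (y : R) : (0 <= y < 1)%R ->
  (rsumn N (fun l => nb m l * y ^ l) <= (/ (1 - y)) ^ (S m))%R.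
Proof.
  intros Hy. destruct N as [|N].
  { unfold rsumn; simpl rsum. apply pow_le. left; apply Rinv_0_lt_compat; lra. }
  induction m as [|m IH].
  - eapply Rle_trans; [|simpl; rewrite Rmult_1_r; apply (rsum_geom_le (S N) y Hy)].
    right. apply rsum_ext; intros. rewrite nb_0_l; ring.
  - pose proof (nb_partial m N (RtoC y)) as H. apply (f_equal Re) in H.
    assert (E : forall k, csumn (S N) (fun l => nb k l * RtoC y ^ l)
       = RtoC (rsumn (S N) (fun l => nb k l * y ^ l)%R)).
    { intros k. unfold rsumn; rewrite RtoC_rsum. apply csum_ext; intros.
      rewrite RtoC_mult, RtoC_pow; auto. }
    rewrite !E, <- RtoC_minus, <- RtoC_pow, <- !RtoC_mult, <- RtoC_minus, !re_RtoC in H.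
    assert (0 <= nb (S m) N * y ^ S N)%R.
    { apply Rmult_le_pos; [left; apply nb_pos | apply pow_le; lra]. }
    apply Rmult_le_reg_l with (1 - y)%R; [lra|]. rewrite H.
    change ((/ (1 - y)) ^ S (S m))%R with (/ (1 - y) * (/ (1 - y)) ^ S m)%R.
    rewrite <- Rmult_assoc, Rinv_r by lra. lra.
Qed.

Lemma nb_term_le (m l : nat) (y : R) : (0 <= y < 1)%R ->
  (nb m l * y ^ l <= (/ (1 - y)) ^ (S m))%R.
Proof.
  intros Hy. eapply Rle_trans; [|apply (nb_sum_le m (S l) y Hy)].
  apply (rsum_ge_term (seq 0 (S l)) (fun l => nb m l * y ^ l)%R l).
  - intros; apply Rmult_le_pos; [left; apply nb_pos | apply pow_le; lra].
  - apply in_seq; lia.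
Qed.

(** The polynomial growth of [nb m] costs a slightly larger ratio: y is the product of (1 + y)/2 and
    2y/(1 + y), both below 1, and the powers of the first factor absorb the binomial by
    [nb_term_le]. *)
Lemma nb_geo (m : nat) (y : R) : (0 <= y < 1)%R ->
  (0 <= 2 * y / (1 + y) < 1)%R /\
  forall l, (nb m l * y ^ l <= (2 / (1 - y)) ^ (S m) * (2 * y / (1 + y)) ^ l)%R.
Proof.
  intros Hy. split.
  - split; [apply Rmult_le_pos; [lra|left; apply Rinv_0_lt_compat; lra]|].
    apply Rmult_lt_reg_r with (1 + y)%R; [lra|]. unfold Rdiv; rewrite Rmult_assoc, Rinv_l by lra; lra.
  - intros l. replace (y ^ l)%R with (((1 + y) / 2) ^ l * (2 * y / (1 + y)) ^ l)%R.
    2:{ rewrite <- Rpow_mult_distr. f_equal. field; lra. }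
    rewrite <- Rmult_assoc. apply Rmult_le_compat_r.
    + apply pow_le, Rmult_le_pos; [lra|left; apply Rinv_0_lt_compat; lra].
    + replace (2 / (1 - y))%R with (/ (1 - (1 + y) / 2))%R by (field; lra).
      apply nb_term_le; lra.
Qed.

Lemma nb_geo_C (m : nat) (x : C) : (Cmod x < 1)%R ->
  exists t M, (0 <= t < 1)%R /\ geo t M (fun l => nb m l * x ^ l).
Proof.
  intros Hx. pose proof (Cmod_ge_0 x).
  destruct (nb_geo m (Cmod x)) as [Ht H1]; [lra|].
  do 2 eexists; split; [exact Ht|]. intros l.
  rewrite Cmod_mult, Cmod_R, Cmod_pow, Rabs_pos_eq by (left; apply nb_pos). apply H1.
Qed.

Lemma C1_minus_nz x : (Cmod x < 1)%R -> 1 - x <> 0.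
Proof.
  intros H E. assert (x = 1) as -> by (rewrite <- (Cplus_0_r x), <- E; ring).
  rewrite Cmod_1 in H; lra.
Qed.

Lemma neg_binomial (m : nat) (x : C) : (Cmod x < 1)%R ->
  Cseries (fun l => nb m l * x ^ l) = / (1 - x) ^ (S m).
Proof.
  intros Hx. pose proof (C1_minus_nz x Hx) as Hnz. apply Cseries_unique.
  induction m as [|m IH].
  - intros eps He. pose proof (Cmod_ge_0 x).
    destruct (geo_small (Cmod x) (/ Cmod (1 - x)) eps) as [N0 HN0]; auto.
    exists N0; intros N HN. specialize (HN0 N HN).
    assert (E : csumn N (fun l => nb 0 l * x ^ l) - / (1 - x) ^ 1 = - (x ^ N / (1 - x))).
    { pose proof (csum_geom N x) as G.
      replace (csumn N (fun l => nb 0 l * x ^ l)) with (csumn N (fun n => x ^ n)).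
      2:{ apply csum_ext; intros. rewrite nb_0_l; ring. }
      replace (csumn N (fun n => x ^ n)) with ((1 - x) * csumn N (fun n => x ^ n) / (1 - x)) by (field; auto).
      rewrite G. field; auto. }
    rewrite E, Cmod_opp, Cmod_div, Cmod_pow by auto.
    unfold Rdiv; rewrite Rmult_comm; exact HN0.
  - destruct (nb_geo_C (S m) x Hx) as (t & M & Ht & Hg).
    pose proof (cconv_geo t M _ Ht Hg) as Hc.
    (* The boundary term of [nb_partial] tends to 0, so (1 - x) times the sum for m + 1 is the sum
       for m, which the induction hypothesis knows. *)
    assert (Hl : cconv (fun N => csumn N (fun l => nb m l * x ^ l))
                  ((1 - x) * Cseries (fun l => nb (S m) l * x ^ l))).
    { intros eps He. destruct (cconv_scal (1 - x) _ _ Hc (eps / 2)%R ltac:(lra)) as [N1 H1].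
      destruct (geo_small t (M * Cmod x) (eps / 2) Ht ltac:(lra)) as [N2 H2].
      exists (S (N1 + N2)); intros [|N] HN; [lia|].
      specialize (H1 (S N) ltac:(lia)). specialize (H2 N ltac:(lia)).
      rewrite nb_partial in H1.
      match goal with |- (Cmod (?a - ?b) < _)%R =>
        replace (a - b) with (a - nb (S m) N * x ^ S N - b + (nb (S m) N * x ^ N) * x)
          by (simpl; ring) end.
      eapply Rle_lt_trans; [apply Cmod_triangle|].
      rewrite (Cmod_mult _ x). specialize (Hg N). simpl in Hg.
      pose proof (Cmod_ge_0 x). nra. }
    replace (/ (1 - x) ^ S (S m)) with (Cseries (fun l => nb (S m) l * x ^ l)); auto.
    pose proof (cconv_unique _ _ _ Hl IH) as E.
    change ((1 - x) ^ S (S m)) with ((1 - x) * (1 - x) ^ S m).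
    replace (Cseries (fun l => nb (S m) l * x ^ l))
      with ((1 - x) * Cseries (fun l => nb (S m) l * x ^ l) / (1 - x)) by (field; auto).
    rewrite E. field. split; auto. apply Cpow_nz; auto.
Qed.

Lemma nb_2 l : nb 2 l = ((INR l + 1) * (INR l + 2) / 2)%R.
Proof.
  unfold nb. replace (2 + l)%nat with (S (S l)) by lia.
  rewrite !fact_simpl, !mult_INR, !S_INR. simpl. field. apply INR_fact_neq_0.
Qed.

Lemma geom_C (x : C) : (Cmod x < 1)%R -> Cseries (fun n => x ^ n) = / (1 - x).
Proof.
  intros Hx. rewrite <- (Cpow_1_r (1 - x)), <- (neg_binomial 0 x Hx).
  apply Cseries_ext; intros. rewrite nb_0_l; ring.
Qed.

Lemma geo_pow (x : C) : geo (Cmod x) 1 (fun n => x ^ n).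
Proof. intros n. rewrite Cmod_pow; lra. Qed.

Lemma Re_Cseries u : Re (Cseries u) = Series (fun n => Re (u n)).
Proof. reflexivity. Qed.

(** Proved without a complex logarithm: along the segment t x with t in [0,1], the power series and
    -ln |1 - t x| have the same derivative Re (x / (1 - t x)), a geometric series, and both vanish
    at t = 0. *)
Lemma ln_Cmod_series (x : C) : (Cmod x < 1)%R ->
  Re (Cseries (fun n => x ^ S n / INR (S n))) = (- ln (Cmod (1 - x)))%R.
Proof.
  intros Hx. pose proof (Cmod_ge_0 x) as Hx0.
  (* The term [a 0] is 1 / 0, which is 0 by the convention on inverses, as the logarithmic series
     requires. *)
  set (a := fun n => (Re (x ^ n) / INR n)%R).
  assert (Ha : forall n, (Rabs (a n) <= Cmod x ^ n)%R).
  { intros [|n].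
    - unfold a. simpl. replace (1 / 0)%R with 0%R. rewrite Rabs_R0; lra.
      unfold Rdiv. rewrite Rinv_0. ring.
    - unfold a. rewrite <- Cmod_pow. unfold Rdiv. rewrite Rabs_mult.
      rewrite <- (Rmult_1_r (Cmod _)). apply Rmult_le_compat; try apply Rabs_pos.
      apply re_le_Cmod. rewrite Rabs_inv, Rabs_pos_eq by apply pos_INR.
      rewrite <- Rinv_1. apply Rinv_le_contravar; [lra|]. rewrite S_INR.
      pose proof (pos_INR n); lra. }
  (* The radius of convergence is at least 2 / (1 + |x|), which exceeds 1, so the endpoint t = 1 is
     interior. *)
  assert (HR : forall t, (0 <= t <= 1)%R -> Rbar_lt (Rabs t) (CV_radius a)).
  { intros t Ht. apply Rbar_lt_le_trans with (2 / (1 + Cmod x))%R.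
    - simpl. rewrite Rabs_pos_eq by lra. apply Rle_lt_trans with 1%R; [lra|].
      apply Rmult_lt_reg_r with (1 + Cmod x)%R; [lra|].
      unfold Rdiv; rewrite Rmult_assoc, Rinv_l; lra.
    - apply CV_radius_bounded. exists 1%R. intros n. rewrite Rabs_mult.
      apply Rle_trans with (Cmod x ^ n * Rabs ((2 / (1 + Cmod x)) ^ n))%R.
      + apply Rmult_le_compat_r; [apply Rabs_pos|apply Ha].
      + assert (0 < 2 / (1 + Cmod x))%R by (apply Rdiv_lt_0_compat; lra).
        rewrite Rabs_pos_eq by (apply pow_le; lra). rewrite <- Rpow_mult_distr.
        apply Rle_trans with (1 ^ n)%R; [|rewrite pow1; lra].
        apply pow_incr. split; [apply Rmult_le_pos; lra|].
        apply Rmult_le_reg_r with (1 + Cmod x)%R; [lra|]. unfold Rdiv.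
        rewrite !Rmult_assoc, Rinv_l; lra. }
  assert (Hpos : forall t, (0 <= t <= 1)%R ->
     (0 < (1 - t * Re x) * (1 - t * Re x) + (t * Im x) * (t * Im x))%R).
  { intros t Ht. pose proof (re_le_Cmod x) as H1. apply Rabs_le_between in H1.
    assert (0 < 1 - t * Re x)%R by nra. nra. }
  set (phi := fun t => (PSeries a t + / 2 * ln ((1 - t * Re x) * (1 - t * Re x) + (t * Im x) * (t * Im x)))%R).
  assert (Hd : forall t, (0 <= t <= 1)%R -> is_derive phi t 0%R).
  { intros t Ht. unfold phi.
    set (q := ((1 - t * Re x) * (1 - t * Re x) + (t * Im x) * (t * Im x))%R).
    replace 0%R with (Re (x / (1 - RtoC t * x)) + / 2 * (/ q * (- 2 * Re x * (1 - t * Re x) + 2 * t * Im x * Im x)))%R.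
    - apply (is_derive_plus (K := R_AbsRing) (V := R_NormedModule)).
      + replace (Re (x / (1 - RtoC t * x))) with (PSeries (PS_derive a) t).
        apply is_derive_PSeries, HR; auto.
        assert (Htx : (Cmod (RtoC t * x) < 1)%R).
        { rewrite Cmod_mult, Cmod_R, Rabs_pos_eq by lra. nra. }
        unfold Cdiv. rewrite <- (geom_C _ Htx).
        rewrite <- (Cseries_scal (Cmod (RtoC t * x)) 1); [|split; [apply Cmod_ge_0|auto]|apply geo_pow].
        rewrite Re_Cseries. unfold PSeries. apply Series_ext; intros n.
        unfold PS_derive, a.
        replace (x * (RtoC t * x) ^ n) with (RtoC (t ^ n) * x ^ S n).
        2:{ rewrite Cpow_mult_l, <- RtoC_pow. simpl; ring. }
        rewrite re_scal_l. field. apply not_0_INR; lia.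
      + apply is_derive_scal. unfold q.
        auto_derive; [apply Hpos; auto|]. field.
        apply Rgt_not_eq, Hpos; auto.
    - assert (Hq : q <> 0%R) by (apply Rgt_not_eq, Hpos; auto).
      replace (Re (x / (1 - RtoC t * x))) with ((Re x * (1 - t * Re x) - t * Im x * Im x) / q)%R.
      field; auto. unfold q in *. destruct x as [x1 x2]; simpl in *. field.
      intros H; apply Hq; rewrite <- H; ring. }
  assert (E : phi 1%R = phi 0%R).
  { destruct (MVT_gen phi 0 1 (fun _ => 0%R)) as [c [_ Hc]].
    - rewrite Rmin_left, Rmax_right by lra. intros t Ht; apply Hd; lra.
    - rewrite Rmin_left, Rmax_right by lra. intros t Ht.
      apply continuity_pt_filterlim, (ex_derive_continuous (K := R_AbsRing) (V := R_NormedModule)).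
      eexists; apply Hd; auto.
    - lra. }
  unfold phi in E. rewrite PSeries_0 in E.
  replace (a O) with 0%R in E by (unfold a; simpl; unfold Rdiv; rewrite Rinv_0; ring).
  replace ((1 - 0 * Re x) * (1 - 0 * Re x) + 0 * Im x * (0 * Im x))%R with 1%R in E by ring.
  rewrite ln_1 in E.
  replace ((1 - 1 * Re x) * (1 - 1 * Re x) + 1 * Im x * (1 * Im x))%R with (Cmod (1 - x) * Cmod (1 - x))%R in E.
  2:{ replace (Cmod (1 - x) * Cmod (1 - x))%R with (Cmod (1 - x) ^ 2)%R by ring.
      rewrite Cmod2_alt. unfold Cminus.
      rewrite re_plus, im_plus, re_opp, im_opp, re_RtoC, im_RtoC. ring. }
  assert (0 < Cmod (1 - x))%R by (apply Cmod_gt_0, C1_minus_nz; auto).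
  rewrite ln_mult in E by auto.
  assert (E2 : PSeries a 1 = Re (Cseries (fun n => x ^ S n / INR (S n)))).
  { rewrite PSeries_decr_1.
    - replace (a O) with 0%R by (unfold a; simpl; unfold Rdiv; rewrite Rinv_0; ring).
      rewrite Rplus_0_l, Rmult_1_l. rewrite Re_Cseries. unfold PSeries.
      apply Series_ext; intros n. rewrite pow1, Rmult_1_r. unfold PS_decr_1, a.
      unfold Cdiv. rewrite <- RtoC_inv, re_scal_r by (apply not_0_INR; lia). reflexivity.
    - apply CV_radius_inside, HR; lra. }
  rewrite <- E2. lra.
Qed.

(** * Positivity of the logarithmic energy *)

Lemma is_lim_rsum {T} (l : list T) (u : T -> nat -> R) (s : T -> R) :
  (forall i, In i l -> is_lim_seq (u i) (s i)) ->
  is_lim_seq (fun n => rsum l (fun i => u i n)) (rsum l s).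
Proof.
  induction l as [|i l IH]; intros H; simpl.
  - apply is_lim_seq_const.
  - apply (is_lim_seq_plus' (u i)); [apply H; left; auto | apply IH; intros; apply H; right; auto].
Qed.

(** A power of a Gram kernel is positive semidefinite. The induction takes one Gram factor off the
    power and absorbs its features [phi f] into the coefficients, which is why [c] is quantified
    inside. *)
Lemma psd_pow {T U} (l : list T) (fs : list U) (phi : U -> T -> R) (n : nat) :
  forall c : T -> R,
  (0 <= rsum l (fun p => rsum l (fun q =>
     c p * c q * (rsum fs (fun f => phi f p * phi f q)) ^ n)))%R.
Proof.
  induction n as [|n IH]; intros c.
  - replace (rsum l _) with (rsum l c * rsum l c)%R; [nra|].
    rewrite <- rsum_scal_r. apply rsum_ext; intros p _. rewrite <- rsum_scal.
    apply rsum_ext; intros q _. simpl; ring.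
  - rewrite (rsum_ext _ _ (fun p => rsum fs (fun f => rsum l (fun q =>
      (c p * phi f p) * (c q * phi f q) * (rsum fs (fun f => phi f p * phi f q)) ^ n)%R))).
    + rewrite rsum_swap. apply rsum_ge0; intros f _. apply IH.
    + intros p _. rewrite rsum_swap. apply rsum_ext; intros q _. simpl.
      set (M := (rsum fs (fun f => phi f p * phi f q) ^ n)%R).
      rewrite <- !Rmult_assoc, <- rsum_scal, <- rsum_scal_r.
      apply rsum_ext; intros f _. ring.
Qed.

Lemma neg_ln_series (M : R) : (-1 < M < 1)%R ->
  is_lim_seq (fun N => rsumn N (fun n => M ^ S n / INR (S n))%R) (- ln (1 - M))%R.
Proof.
  intros HM.
  assert (Hx : (Cmod (RtoC M) < 1)%R) by (rewrite Cmod_R; apply Rabs_def1; lra).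
  pose proof (ln_Cmod_series _ Hx) as H.
  rewrite <- RtoC_minus, Cmod_R, Rabs_pos_eq in H by lra. rewrite <- H.
  assert (Hg : geo (Cmod M) 1 (fun n => RtoC M ^ S n / INR (S n))).
  { intros n. rewrite Rmult_1_l. unfold Cdiv. rewrite Cmod_mult, Cmod_pow.
    assert (1 <= INR (S n))%R by (rewrite S_INR; pose proof (pos_INR n); lra).
    rewrite Cmod_inv, (Cmod_R (INR (S n))), Rabs_pos_eq; try lra.
    2:{ intros E; apply RtoC_inj in E; lra. }
    pose proof (Cmod_ge_0 M). assert (0 <= Cmod M ^ n)%R by (apply pow_le; lra).
    assert (/ INR (S n) <= 1)%R by (rewrite <- Rinv_1; apply Rinv_le_contravar; lra).
    assert (0 < / INR (S n))%R by (apply Rinv_0_lt_compat; lra).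
    simpl pow. replace (Cmod M ^ n)%R with (1 * Cmod M ^ n * 1)%R at 2 by ring.
    apply Rmult_le_compat; try nra. }
  pose proof (cconv_geo _ _ _ (conj (Cmod_ge_0 M) Hx) Hg) as Hc.
  apply cconv_Re_Im in Hc. destruct Hc as [Hc _].
  eapply is_lim_seq_ext; [|exact Hc]. intros N. unfold csumn; rewrite Re_csum.
  apply rsum_ext; intros n _.
  rewrite <- RtoC_pow, <- RtoC_div by (apply not_0_INR; lia). apply re_RtoC.
Qed.

(* With psi_p = |z_p|^2 + eps one has
   ln (|z_p - z_q|^2 + eps) = ln psi_p + ln psi_q - ln eps + ln (1 - M_pq), where M
   is a sum of three squares, hence positive; so is -ln (1 - M) = sum M^n / n. *)
Lemma log_kernel_neg {T} (l : list T) (c : T -> R) (z : T -> C) (eps : R) :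
  (0 < eps)%R -> rsum l c = 0%R ->
  (rsum l (fun p => rsum l (fun q =>
     c p * c q * ln (Cmod (z p - z q) ^ 2 + eps))) <= 0)%R.
Proof.
  intros He Hc.
  set (psi := fun p => (Cmod (z p) ^ 2 + eps)%R).
  assert (Hpsi : forall p, (0 < psi p)%R) by (intros p; unfold psi; pose proof (pow2_ge_0 (Cmod (z p))); lra).
  assert (Hs : (sqrt (2 * eps) * sqrt (2 * eps) = 2 * eps)%R) by (apply sqrt_sqrt; lra).
  revert Hs; generalize (sqrt (2 * eps)); intros sq Hs.
  set (phi := fun (f : nat) p => (match f with
     | O => Cmod (z p) ^ 2 / psi p
     | 1%nat => sq * Re (z p) / psi p
     | _ => sq * Im (z p) / psi p end)%R).
  set (M := fun p q => rsum [0%nat; 1%nat; 2%nat] (fun f => phi f p * phi f q)%R).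
  assert (HMe : forall p q, (M p q * (psi p * psi q) = Cmod (z p) ^ 2 * Cmod (z q) ^ 2 +
     2 * eps * (Re (z p) * Re (z q) + Im (z p) * Im (z q)))%R).
  { intros p q. unfold M, phi; simpl rsum. rewrite <- Hs. field.
    split; apply Rgt_not_eq, Hpsi. }
  assert (HM1 : forall p q, ((1 - M p q) * (psi p * psi q) = eps * (Cmod (z p - z q) ^ 2 + eps))%R).
  { intros p q. rewrite Rmult_minus_distr_r, HMe. unfold psi. rewrite !Cmod2_alt.
    unfold Cminus; rewrite re_plus, im_plus, re_opp, im_opp. ring. }
  (* The series for -ln (1 - M) also needs M > -1. Here (1 + M) psi_p psi_q equals 2 |z_p|^2 |z_q|^2
     + eps |z_p + z_q|^2 + eps^2. *)
  assert (HM2 : forall p q, (0 < (1 + M p q) * (psi p * psi q))%R).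
  { intros p q. rewrite Rmult_plus_distr_r, HMe. unfold psi. rewrite !Cmod2_alt.
    generalize (Re (z p)) (Im (z p)) (Re (z q)) (Im (z q)); intros a b d e.
    assert (0 <= (a + d) ^ 2)%R by apply pow2_ge_0. assert (0 <= (b + e) ^ 2)%R by apply pow2_ge_0.
    assert (0 <= (a ^ 2 + b ^ 2) * (d ^ 2 + e ^ 2))%R by (apply Rmult_le_pos; nra).
    assert (0 <= eps * ((a + d) ^ 2 + (b + e) ^ 2))%R by (apply Rmult_le_pos; lra). nra. }
  assert (HP : forall p q, (0 < psi p * psi q)%R) by (intros; apply Rmult_lt_0_compat; auto).
  assert (HMpos : forall p q, (0 < 1 - M p q)%R).
  { intros p q. apply Rmult_lt_reg_r with (psi p * psi q)%R; auto.
    rewrite Rmult_0_l, HM1. pose proof (pow2_ge_0 (Cmod (z p - z q))).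
    apply Rmult_lt_0_compat; lra. }
  assert (HMb : forall p q, (-1 < M p q < 1)%R).
  { intros p q. split; [|specialize (HMpos p q); lra].
    enough (0 < 1 + M p q)%R by lra.
    apply Rmult_lt_reg_r with (psi p * psi q)%R; auto. rewrite Rmult_0_l; auto. }
  assert (HL : forall p q, ln (Cmod (z p - z q) ^ 2 + eps)
     = (ln (psi p) + ln (psi q) - ln eps + ln (1 - M p q))%R).
  { intros p q. pose proof (pow2_ge_0 (Cmod (z p - z q))).
    enough (ln eps + ln (Cmod (z p - z q) ^ 2 + eps) = ln (1 - M p q) + (ln (psi p) + ln (psi q)))%R by lra.
    rewrite <- !ln_mult; auto; try lra. rewrite HM1; auto. }
  replace (rsum l _) with (- rsum l (fun p => rsum l (fun q => c p * c q * (- ln (1 - M p q)))))%R.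
  - enough (0 <= rsum l (fun p => rsum l (fun q => c p * c q * (- ln (1 - M p q)))))%R by lra.
    apply (is_lim_seq_le (fun _ => 0%R) (fun N => rsum l (fun p => rsum l (fun q =>
      c p * c q * rsumn N (fun n => M p q ^ S n / INR (S n)))))%R 0%R
      (rsum l (fun p => rsum l (fun q => c p * c q * (- ln (1 - M p q)))))%R).
    + intros N. unfold rsumn.
      rewrite (rsum_ext _ _ (fun p => rsum (seq 0 N) (fun n => rsum l (fun q =>
         / INR (S n) * (c p * c q * M p q ^ S n))))%R).
      * rewrite rsum_swap. apply rsum_ge0; intros n _.
        rewrite (rsum_ext _ _ (fun p => / INR (S n) * rsum l (fun q => c p * c q * M p q ^ S n))%R)
          by (intros; rewrite rsum_scal; auto).
        rewrite rsum_scal. apply Rmult_le_pos; [|apply (psd_pow l [0%nat; 1%nat; 2%nat] phi)].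
        left; apply Rinv_0_lt_compat, lt_0_INR; lia.
      * intros p _. rewrite rsum_swap. apply rsum_ext; intros q _. rewrite <- rsum_scal.
        apply rsum_ext; intros n _. unfold Rdiv; ring.
    + apply is_lim_seq_const.
    + apply is_lim_rsum; intros p _. apply is_lim_rsum; intros q _.
      apply (is_lim_seq_scal_l _ (c p * c q) (- ln (1 - M p q))%R), neg_ln_series, HMb.
  (* The summands ln psi_p, ln psi_q and ln eps each depend on at most one of the two points, so the
     vanishing total charge removes them. *)
  - transitivity (rsum l (fun p => c p * (ln (psi p) - ln eps)) * rsum l c
      + rsum l c * rsum l (fun q => c q * ln (psi q))
      + - rsum l (fun p => rsum l (fun q => c p * c q * (- ln (1 - M p q)))))%R.
    { rewrite Hc; ring. }
    rewrite <- !rsum_scal_r, <- rsum_opp, <- !rsum_plus. apply rsum_ext; intros p _.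
    rewrite <- !rsum_scal, <- rsum_opp, <- !rsum_plus. apply rsum_ext; intros q _.
    rewrite HL. ring.
Qed.

(** * Charges on disjoint circles and the Grunsky inequality *)

Definition ei (t : R) : C := (cos t, sin t).

Lemma ei_plus a b : ei (a + b) = ei a * ei b.
Proof. unfold ei. rewrite cos_plus, sin_plus. apply injective_projections; simpl; ring. Qed.

Lemma ei_0 : ei 0 = 1.
Proof. unfold ei. rewrite cos_0, sin_0. reflexivity. Qed.

Lemma Cmod_ei t : Cmod (ei t) = 1%R.
Proof.
  unfold Cmod, ei; simpl. transitivity (sqrt 1); [f_equal | apply sqrt_1].
  pose proof (sin2_cos2 t) as H. unfold Rsqr in H. lra.
Qed.

Lemma ei_nz t : ei t <> 0.
Proof. apply Cmod_gt_0. rewrite Cmod_ei; lra. Qed.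

Lemma ei_pow t n : ei t ^ n = ei (INR n * t).
Proof.
  induction n as [|n IH]; [simpl; rewrite Rmult_0_l, ei_0; auto|].
  rewrite S_INR, Rmult_plus_distr_r, Rmult_1_l, Rplus_comm, ei_plus, <- IH. reflexivity.
Qed.

Lemma ei_opp t : ei (- t) = / ei t.
Proof.
  assert (ei (- t) * ei t = 1) as H by (rewrite <- ei_plus, Rplus_opp_l; apply ei_0).
  rewrite <- (Cmult_1_l (/ ei t)), <- H. field. apply ei_nz.
Qed.

Lemma ei_2PI : ei (2 * PI) = 1.
Proof. unfold ei. rewrite cos_2PI, sin_2PI. reflexivity. Qed.

Lemma Cconj_ei t : Cconj (ei t) = ei (- t).
Proof. unfold ei, Cconj; simpl. rewrite cos_neg, sin_neg; auto. Qed.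

Lemma ei_neq_1 t : (0 < t < 2 * PI)%R -> ei t <> 1.
Proof.
  intros Ht E. apply (f_equal Re) in E. simpl in E.
  replace t with (2 * (t / 2))%R in E by field. rewrite cos_2a_sin in E.
  assert (0 < sin (t / 2))%R by (apply sin_gt_0; lra). nra.
Qed.

Definition zeta (N : nat) : C := ei (2 * PI / INR N).

Lemma Cmod_zeta N : Cmod (zeta N) = 1%R.
Proof. apply Cmod_ei. Qed.

Lemma zeta_sum_0 N m : (0 < m < N)%nat -> csumn N (fun p => (zeta N ^ m) ^ p) = 0.
Proof.
  intros Hm. pose proof (csum_geom N (zeta N ^ m)) as H.
  assert (HN : (0 < INR N)%R) by (apply lt_0_INR; lia).
  assert (E1 : (zeta N ^ m) ^ N = 1).
  { rewrite <- Cpow_mult_r, Nat.mul_comm, Cpow_mult_r. unfold zeta.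
    rewrite (ei_pow _ N). replace (INR N * (2 * PI / INR N))%R with (2 * PI)%R by (field; lra).
    rewrite ei_2PI. apply Cpow_1_l. }
  assert (E2 : 1 - zeta N ^ m <> 0).
  { apply Cminus_eq_contra. intros E; symmetry in E; revert E. unfold zeta. rewrite ei_pow.
    apply ei_neq_1. pose proof PI_RGT_0.
    assert (0 < INR m)%R by (apply lt_0_INR; lia). assert (INR m < INR N)%R by (apply lt_INR; lia).
    split.
    - apply Rmult_lt_0_compat; auto. apply Rdiv_lt_0_compat; lra.
    - apply Rmult_lt_reg_r with (INR N); auto.
      replace (INR m * (2 * PI / INR N) * INR N)%R with (INR m * (2 * PI))%R by (field; lra). nra. }
  rewrite E1 in H. replace (1 - 1) with (RtoC 0) in H by ring.
  apply (f_equal (Cmult (/ (1 - zeta N ^ m)))) in H.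
  rewrite Cmult_assoc, Cinv_l, Cmult_1_l in H by auto. rewrite H; ring.
Qed.

Lemma zeta_conj_pow N k : Cconj (zeta N) ^ k * zeta N ^ k = 1.
Proof.
  rewrite <- Cpow_mult_l. unfold zeta. rewrite Cconj_ei, <- ei_plus, Rplus_opp_l, ei_0.
  apply Cpow_1_l.
Qed.

Lemma zeta_sum_conj N k m : (k < N)%nat -> (m < N)%nat ->
  csumn N (fun p => (Cconj (zeta N) ^ k * zeta N ^ m) ^ p) = if Nat.eq_dec k m then INR N else 0.
Proof.
  intros Hk Hm. destruct (Nat.eq_dec k m) as [->|Hn].
  - unfold csumn. rewrite (csum_ext _ _ (fun _ => 1)).
    2:{ intros. rewrite zeta_conj_pow. apply Cpow_1_l. }
    rewrite csum_const, length_seq. ring.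
  - destruct (Nat.lt_total k m) as [H|[H|H]]; [|lia|].
    + rewrite <- (zeta_sum_0 N (m - k)) by lia. apply csum_ext; intros p _. f_equal.
      replace m with (k + (m - k))%nat at 1 by lia.
      rewrite Cpow_add_r, Cmult_assoc, zeta_conj_pow. ring.
    + transitivity (Cconj (csumn N (fun p => (zeta N ^ (k - m)) ^ p))).
      * unfold csumn. rewrite Cconj_csum. apply csum_ext; intros p _.
        rewrite !Cpow_conj. f_equal. replace k with ((k - m) + m)%nat at 1 by lia.
        rewrite Cpow_add_r, <- Cmult_assoc, zeta_conj_pow. ring.
      * rewrite zeta_sum_0 by lia. apply injective_projections; simpl; ring.
Qed.

(* Real point charges at the N-th roots of unity with Fourier modes x_1, ..., x_K
   and their conjugates. *)
Definition charge (K N : nat) (x : nat -> C) (p : nat) : R :=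
  rsum (seq 1 K) (fun k => 2 / INR N * Re (x k * (Cconj (zeta N) ^ k) ^ p))%R.

Definition mode (K N : nat) (x : nat -> C) (m : nat) : C :=
  csumn N (fun p => charge K N x p * (zeta N ^ m) ^ p).

Lemma charge_C K N x p : (0 < N)%nat -> RtoC (charge K N x p) =
  csum (seq 1 K) (fun k => / INR N * (x k * (Cconj (zeta N) ^ k) ^ p + Cconj (x k) * (zeta N ^ k) ^ p)).
Proof.
  intros HN. unfold charge. rewrite RtoC_rsum. apply csum_ext; intros k _.
  rewrite RtoC_mult, re_alt, Cmult_conj, !Cpow_conj, Cconj_conj.
  rewrite RtoC_div by (apply not_0_INR; lia). field.
  intros E; apply RtoC_inj in E; revert E; apply not_0_INR; lia.
Qed.

(** Orthogonality of roots of unity. The conjugate amplitudes that make the charges real show up as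
    modes N - k with 1 <= k <= K, hence the restriction m < N - K. The case m = 0 says that the
    total charge vanishes. *)
Lemma mode_eq K N x m : (2 * K < N)%nat -> (m < N - K)%nat ->
  mode K N x m = if (andb (1 <=? m) (m <=? K))%nat then x m else 0.
Proof.
  intros HN Hm. assert (HN0 : RtoC (INR N) <> 0).
  { intros E; apply RtoC_inj in E; revert E; apply not_0_INR; lia. }
  transitivity (csum (seq 1 K) (fun k => if Nat.eq_dec k m then x k else 0)).
  - unfold mode, csumn.
    rewrite (csum_ext _ _ (fun p => csum (seq 1 K) (fun k => / INR N *
      (x k * (Cconj (zeta N) ^ k * zeta N ^ m) ^ p + Cconj (x k) * (zeta N ^ (k + m)) ^ p)))).
    2:{ intros p _. rewrite charge_C, <- csum_scal_r by lia. apply csum_ext; intros k _.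
        rewrite Cpow_mult_l, Cpow_add_r, (Cpow_mult_l (zeta N ^ k)). ring. }
    rewrite csum_swap. apply csum_ext; intros k Hk. apply in_seq in Hk.
    rewrite csum_scal, csum_plus, !csum_scal.
    pose proof (zeta_sum_conj N k m ltac:(lia) ltac:(lia)) as H1.
    pose proof (zeta_sum_0 N (k + m) ltac:(lia)) as H2.
    change (csum (seq 0 N) (Cpow (Cconj (zeta N) ^ k * zeta N ^ m)) =
      (if Nat.eq_dec k m then RtoC (INR N) else 0)) in H1.
    change (csum (seq 0 N) (Cpow (zeta N ^ (k + m))) = 0) in H2. rewrite H1, H2.
    destruct (Nat.eq_dec k m); field; auto.
  - destruct (andb _ _) eqn:E.
    + apply Bool.andb_true_iff in E. destruct E as [E1 E2].
      apply Nat.leb_le in E1; apply Nat.leb_le in E2.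
      etransitivity; [apply (csum_single _ m)|].
      * apply seq_NoDup.
      * apply in_seq; lia.
      * intros j _ Hj; simpl; destruct (Nat.eq_dec j m); tauto.
      * simpl; destruct (Nat.eq_dec m m); tauto.
    + apply csum_0. intros j Hj. apply in_seq in Hj. destruct (Nat.eq_dec j m) as [->|]; auto.
      apply Bool.andb_false_iff in E. destruct E as [E|E]; apply Nat.leb_gt in E; lia.
Qed.

(** A bound, uniform in [N], for the sum of the absolute values of the charges and hence for every
    mode, aliased ones included. *)
Definition xnorm (K : nat) (x : nat -> C) : R := rsum (seq 1 K) (fun k => 2 * Cmod (x k))%R.

Lemma xnorm_ge0 K x : (0 <= xnorm K x)%R.
Proof. apply rsum_ge0; intros; pose proof (Cmod_ge_0 (x i)); lra. Qed.

Lemma charge_abs_sum K N x : (0 < N)%nat ->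
  (rsumn N (fun p => Rabs (charge K N x p)) <= xnorm K x)%R.
Proof.
  intros HN. assert (HN' : (0 < INR N)%R) by (apply lt_0_INR; auto).
  apply Rle_trans with (rsumn N (fun p => rsum (seq 1 K) (fun k => 2 / INR N * Cmod (x k))%R)).
  - apply rsum_le; intros p _. eapply Rle_trans; [apply Rabs_rsum|].
    apply rsum_le; intros k _. rewrite Rabs_mult, Rabs_pos_eq by (left; apply Rdiv_lt_0_compat; lra).
    apply Rmult_le_compat_l; [left; apply Rdiv_lt_0_compat; lra|].
    eapply Rle_trans; [apply re_le_Cmod|].
    rewrite Cmod_mult, !Cmod_pow, Cmod_conj, Cmod_zeta, !pow1; lra.
  - unfold rsumn. rewrite rsum_const, length_seq, <- rsum_scal. right.
    apply rsum_ext; intros; field; lra.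
Qed.

Lemma mode_bound K N x m : (0 < N)%nat -> (Cmod (mode K N x m) <= xnorm K x)%R.
Proof.
  intros HN. eapply Rle_trans; [|apply (charge_abs_sum K N x HN)].
  eapply Rle_trans; [apply Cmod_csum|]. apply rsum_le; intros p _.
  rewrite Cmod_mult, !Cmod_pow, Cmod_zeta, !pow1, Cmod_R; lra.
Qed.

Lemma charge_sum_0 K N x : (2 * K < N)%nat -> rsumn N (charge K N x) = 0%R.
Proof.
  intros HN. apply RtoC_inj. unfold rsumn; rewrite RtoC_rsum.
  transitivity (mode K N x 0).
  - apply csum_ext; intros. simpl (zeta N ^ 0). rewrite Cpow_1_l; ring.
  - rewrite mode_eq by lia. reflexivity.
Qed.

Lemma RtoC_neq0 (r : R) : r <> 0%R -> RtoC r <> 0.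
Proof. intros H E; apply RtoC_inj in E; auto. Qed.

Lemma zeta_pow_swap N m p : (zeta N ^ m) ^ p = (zeta N ^ p) ^ m.
Proof. rewrite <- !Cpow_mult_r, Nat.mul_comm; auto. Qed.

Lemma Cmod_zeta_pow N m : Cmod (zeta N ^ m) = 1%R.
Proof. rewrite Cmod_pow, Cmod_zeta, pow1; auto. Qed.

(** Summing the charges against a power series replaces its m-th power by [mode m]. Below N - K
    these are the prescribed amplitudes, so the error is a geometric tail starting at N - K. *)
Lemma charge_alias K N x (f : nat -> C) (S0 : C) tau M :
  (0 <= tau < 1)%R -> geo tau M (fun m => f m * S0 ^ m) -> (2 * K < N)%nat ->
  (Cmod (csumn N (fun p => charge K N x p * Cseries (fun m => f m * (S0 * zeta N ^ p) ^ m))%C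
     - csum (seq 1 K) (fun k => f k * S0 ^ k * x k)%C)
   <= M * xnorm K x * tau ^ (N - K) / (1 - tau))%R.
Proof.
  intros Ht Hg HN.
  assert (HM : (0 <= M)%R) by (eapply geo_M; eauto).
  set (u := fun m => f m * S0 ^ m * mode K N x m).
  assert (Hgp : forall p, geo tau M (fun m => f m * (S0 * zeta N ^ p) ^ m)).
  { intros p m. rewrite Cpow_mult_l, Cmult_assoc, Cmod_mult, Cmod_pow, Cmod_zeta_pow, pow1, Rmult_1_r.
    apply Hg. }
  assert (Hu : geo tau (M * xnorm K x) u).
  { intros m. unfold u. rewrite Cmod_mult.
    replace (M * xnorm K x * tau ^ m)%R with (M * tau ^ m * xnorm K x)%R by ring.
    apply Rmult_le_compat; try apply Cmod_ge_0; [apply Hg | apply mode_bound; lia]. }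
  assert (E1 : csumn N (fun p => charge K N x p * Cseries (fun m => f m * (S0 * zeta N ^ p) ^ m)) = Cseries u).
  { unfold csumn.
    rewrite (csum_ext _ _ (fun p => Cseries (fun m => charge K N x p * (f m * (S0 * zeta N ^ p) ^ m)))).
    2:{ intros p _. rewrite (Cseries_scal tau M); auto. }
    rewrite <- (Cseries_csum (seq 0 N) tau (fun p => Rabs (charge K N x p) * M)%R); auto.
    - apply Cseries_ext; intros m. unfold u, mode, csumn.
      rewrite <- csum_scal. apply csum_ext; intros p _.
      rewrite zeta_pow_swap, Cpow_mult_l. ring.
    - intros p _ m. rewrite Cmod_mult, Cmod_R, Rmult_assoc.
      apply Rmult_le_compat_l; [apply Rabs_pos | apply Hgp]. }
  assert (E2 : csum (seq 1 K) (fun k => f k * S0 ^ k * x k) = csumn (N - K) u).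
  { unfold csumn. replace (N - K)%nat with (1 + (K + (N - K - 1 - K)))%nat by lia.
    rewrite seq_app, csum_app, seq_app, csum_app.
    rewrite (csum_0 (seq 0 1)).
    2:{ intros i Hi; apply in_seq in Hi; unfold u; rewrite mode_eq by lia.
        replace i with 0%nat by lia. simpl; ring. }
    rewrite (csum_0 (seq (0 + 1 + K) _)).
    2:{ intros i Hi; apply in_seq in Hi; unfold u; rewrite mode_eq by lia.
        replace (i <=? K)%nat with false by (symmetry; apply Nat.leb_gt; lia).
        rewrite Bool.andb_false_r. ring. }
    rewrite Cplus_0_l, Cplus_0_r. apply csum_ext; intros i Hi; apply in_seq in Hi.
    unfold u; rewrite mode_eq by lia.
    replace (i <=? K)%nat with true by (symmetry; apply Nat.leb_le; lia).
    replace (1 <=? i)%nat with true by (symmetry; apply Nat.leb_le; lia). reflexivity. }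
  rewrite E1, E2. apply Cseries_tail; auto.
Qed.

Lemma ln_Cmod_sq (y : C) : (Cmod y < 1)%R ->
  ln (Cmod (1 - y) ^ 2) = (- 2 * Re (Cseries (fun n => y ^ S n / INR (S n))%C))%R.
Proof.
  intros Hy. rewrite ln_Cmod_series by auto.
  assert (0 < Cmod (1 - y))%R by (apply Cmod_gt_0, C1_minus_nz; auto).
  simpl. rewrite Rmult_1_r, ln_mult by auto. ring.
Qed.

Lemma INR_S_ge1 n : (1 <= INR (S n))%R.
Proof. rewrite S_INR; pose proof (pos_INR n); lra. Qed.

Lemma Cmod_log_term (y : C) n : (Cmod (y ^ S n / INR (S n)) <= Cmod y ^ S n)%R.
Proof.
  pose proof (INR_S_ge1 n). rewrite Cmod_div by (apply RtoC_neq0; lra).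
  rewrite Cmod_pow, Cmod_R, Rabs_pos_eq by lra.
  pose proof (pow_le (Cmod y) (S n) (Cmod_ge_0 y)).
  apply Rmult_le_reg_r with (INR (S n)); [lra|]. unfold Rdiv.
  rewrite Rmult_assoc, Rinv_l by lra. nra.
Qed.

Lemma charge_double_const K N x (y : nat -> R) (k : R) :
  (2 * K < N)%nat ->
  rsumn N (fun p => rsumn N (fun j => charge K N x p * y j * k)%R) = 0%R.
Proof.
  intros HN. transitivity (rsumn N (charge K N x) * rsumn N (fun j => y j * k))%R.
  - unfold rsumn. rewrite <- rsum_scal_r. apply rsum_ext; intros p _.
    rewrite <- rsum_scal. apply rsum_ext; intros; ring.
  - rewrite charge_sum_0 by auto. ring.
Qed.

(** On one circle the regularised kernel is, up to a constant, ln |1 - q zeta^(p-j)|^2 with some q <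
    1. Its expansion is diagonal in the modes, with weights q^k / k <= 1 / k, whatever [eps] is. *)
Lemma self_energy K x (S0 : C) eps : S0 <> 0 -> (0 < eps)%R ->
  forall eta, (0 < eta)%R -> exists N0, forall N, (N0 <= N)%nat ->
  (- rsumn N (fun p => rsumn N (fun j => charge K N x p * charge K N x j *
     ln (Cmod (S0 * zeta N ^ p - S0 * zeta N ^ j) ^ 2 + eps)))
   <= 2 * rsum (seq 1 K) (fun k => Cmod (x k) ^ 2 / INR k) + eta)%R.
Proof.
  intros HS He eta Heta.
  assert (HR : (0 < Cmod S0)%R) by (apply Cmod_gt_0; auto).
  (* With d chosen so and q the smaller root of q^2 + 1 = 2 (1 + d) q, one has |1 - q z|^2 = q (|1 -
     z|^2 + 2 d) for |z| = 1, and 2 d |S0|^2 = eps. *)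
  set (d := (eps / (2 * Cmod S0 ^ 2))%R).
  assert (Hd : (0 < d)%R) by (apply Rdiv_lt_0_compat; nra).
  set (r := sqrt (d * d + 2 * d)).
  assert (Hr : (r * r = d * d + 2 * d)%R) by (apply sqrt_sqrt; nra).
  assert (Hr0 : (0 <= r)%R) by apply sqrt_pos.
  set (q := (1 + d - r)%R).
  assert (Hq : (0 < q < 1)%R) by (unfold q; split; nra).
  assert (Hqq : (q * q + 1 = 2 * (1 + d) * q)%R) by (unfold q; nra).
  set (B := xnorm K x). pose proof (xnorm_ge0 K x) as HB; fold B in HB.
  destruct (geo_small q (2 * (B * B) / (1 - q)) eta ltac:(lra) Heta) as [N0 HN0].
  exists (N0 + 2 * K + 2)%nat; intros N HN.
  set (c := charge K N x).
  assert (Hy : forall p j, Cmod (q * (zeta N ^ p * Cconj (zeta N ^ j))) = q).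
  { intros. rewrite Cmod_mult, Cmod_mult, Cmod_conj, !Cmod_zeta_pow, Cmod_R, Rabs_pos_eq; lra. }
  assert (HL : forall p j, ln (Cmod (S0 * zeta N ^ p - S0 * zeta N ^ j) ^ 2 + eps) =
     (ln (Cmod S0 ^ 2 / q) + - 2 * Re (Cseries (fun n => (q * (zeta N ^ p * Cconj (zeta N ^ j))) ^ S n / INR (S n))%C))%R).
  { intros p j. rewrite <- ln_Cmod_sq by (rewrite Hy; lra).
    rewrite <- ln_mult.
    - f_equal. replace (S0 * zeta N ^ p - S0 * zeta N ^ j) with (S0 * (zeta N ^ p - zeta N ^ j)) by ring.
      rewrite Cmod_mult, Rpow_mult_distr.
      replace eps with (Cmod S0 ^ 2 * (2 * d))%R by (unfold d; field; lra).
      pose proof (Cmod_zeta_pow N p) as H1; pose proof (Cmod_zeta_pow N j) as H2.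
      apply (f_equal (fun r => r ^ 2)%R) in H1. apply (f_equal (fun r => r ^ 2)%R) in H2.
      rewrite Cmod2_alt in H1, H2. rewrite !Cmod2_alt.
      set (al := zeta N ^ p) in *; set (be := zeta N ^ j) in *.
      destruct al as [a1 a2], be as [b1 b2]. unfold Re, Im in *; simpl in *.
      apply Rmult_eq_reg_r with q; [|lra].
      replace (2 * d)%R with ((q * q + 1) / q - 2)%R by (rewrite Hqq; field; lra).
      assert (HA : (a1 * a1 + a2 * a2 = 1)%R) by lra.
      assert (HB' : (b1 * b1 + b2 * b2 = 1)%R) by lra.
      apply Rminus_diag_uniq.
      transitivity ((fst S0 * fst S0 + snd S0 * snd S0) *
        (q * ((a1 * a1 + a2 * a2 - 1) + (b1 * b1 + b2 * b2 - 1))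
         + q * q * (1 - (a1 * a1 + a2 * a2) * (b1 * b1 + b2 * b2))))%R.
      field; lra. rewrite HA, HB'; ring.
    - apply Rdiv_lt_0_compat; nra.
    - apply pow_lt, Cmod_gt_0, C1_minus_nz. rewrite Hy; lra. }
  (* The contribution of mode n + 1 to the energy. For n < N - K - 1 it involves the prescribed
     amplitudes only; beyond that there is aliasing, controlled by the factor q^n. *)
  set (u := fun n => RtoC (q ^ S n / INR (S n)) * (mode K N x (S n) * Cconj (mode K N x (S n)))).
  assert (Hur : forall n, u n = RtoC (q ^ S n / INR (S n) * Cmod (mode K N x (S n)) ^ 2)).
  { intros n. unfold u. rewrite <- Cmod2_conj, <- RtoC_mult. reflexivity. }
  assert (Hq1 : forall n, (0 <= q ^ S n / INR (S n) <= q ^ n)%R).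
  { intros n. pose proof (INR_S_ge1 n). assert (0 < q ^ n)%R by (apply pow_lt; lra).
    split; [apply Rmult_le_pos; [apply pow_le; lra | left; apply Rinv_0_lt_compat; lra]|].
    apply Rmult_le_reg_r with (INR (S n)); [lra|]. unfold Rdiv.
    rewrite Rmult_assoc, Rinv_l by lra. change (q ^ S n)%R with (q * q ^ n)%R.
    assert (q * q ^ n <= q ^ n)%R by nra.
    assert (q ^ n * 1 <= q ^ n * INR (S n))%R by (apply Rmult_le_compat_l; lra). lra. }
  assert (Hug : geo q (B * B) u).
  { intros n. rewrite Hur, Cmod_R.
    assert (Hm : (Cmod (mode K N x (S n)) ^ 2 <= B * B)%R).
    { simpl; rewrite Rmult_1_r. apply Rmult_le_compat; try apply Cmod_ge_0; apply mode_bound; lia. }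
    pose proof (pow2_ge_0 (Cmod (mode K N x (S n)))).
    specialize (Hq1 n). rewrite Rabs_pos_eq by (apply Rmult_le_pos; lra).
    rewrite (Rmult_comm (B * B)). apply Rmult_le_compat; lra. }
  assert (E : rsumn N (fun p => rsumn N (fun j => c p * c j *
     Re (Cseries (fun n => (q * (zeta N ^ p * Cconj (zeta N ^ j))) ^ S n / INR (S n))%C)))%R = Re (Cseries u)).
  { transitivity (Re (csumn N (fun p => csumn N (fun j => Cseries (fun n =>
       RtoC (c p * c j) * ((q * (zeta N ^ p * Cconj (zeta N ^ j))) ^ S n / INR (S n))))))).
    - unfold csumn, rsumn. rewrite Re_csum. apply rsum_ext; intros p _.
      rewrite Re_csum. apply rsum_ext; intros j _.
      rewrite (Cseries_scal q q), re_scal_l; auto; [lra|].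
      intros n. eapply Rle_trans; [apply Cmod_log_term|]. rewrite Hy. simpl; lra.
    - f_equal. unfold csumn.
      assert (Hg : forall p j, geo q (Rabs (c p * c j)) (fun n => RtoC (c p * c j) * ((q * (zeta N ^ p * Cconj (zeta N ^ j))) ^ S n / INR (S n)))).
      { intros p j n. rewrite Cmod_mult, Cmod_R. apply Rmult_le_compat_l; [apply Rabs_pos|].
        eapply Rle_trans; [apply Cmod_log_term|]. rewrite Hy. simpl.
        assert (0 < q ^ n)%R by (apply pow_lt; lra). nra. }
      rewrite (csum_ext _ _ (fun p => Cseries (fun n => csum (seq 0 N) (fun j =>
         RtoC (c p * c j) * ((q * (zeta N ^ p * Cconj (zeta N ^ j))) ^ S n / INR (S n)))))).
      2:{ intros p _. symmetry. apply (Cseries_csum _ q (fun j => Rabs (c p * c j))); [lra|auto]. }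
      rewrite <- (Cseries_csum (seq 0 N) q (fun p => rsum (seq 0 N) (fun j => Rabs (c p * c j)))); [|lra|].
      + apply Cseries_ext; intros n. unfold u, mode, csumn.
        rewrite Cconj_csum, csum_mult, <- csum_scal. apply csum_ext; intros p _.
        rewrite <- csum_scal. apply csum_ext; intros j _.
        rewrite Cmult_conj. fold c.
        replace (Cconj (c j)) with (RtoC (c j)) by (apply injective_projections; simpl; ring).
        rewrite (zeta_pow_swap N (S n) p), (zeta_pow_swap N (S n) j), !Cpow_mult_l, <- !Cpow_conj, RtoC_mult, RtoC_div, RtoC_pow
          by (apply not_0_INR; lia).
        field. apply RtoC_neq0, not_0_INR; lia.
      + intros p _ n. eapply Rle_trans; [apply Cmod_csum|].
        rewrite <- rsum_scal_r. apply rsum_le; intros j _. apply Hg. }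
  replace (- rsumn N _)%R with (2 * Re (Cseries u))%R.
  2:{ rewrite <- E. transitivity (- rsumn N (fun p => rsumn N (fun j => c p * c j * ln (Cmod S0 ^ 2 / q)))
        + 2 * rsumn N (fun p => rsumn N (fun j => c p * c j *
     Re (Cseries (fun n => (q * (zeta N ^ p * Cconj (zeta N ^ j))) ^ S n / INR (S n))%C))))%R.
      - pose proof (charge_double_const K N x c (ln (Cmod S0 ^ 2 / q)) ltac:(lia)) as H0.
        fold c in H0. rewrite H0. ring.
      - unfold rsumn. rewrite <- rsum_opp, <- rsum_scal, <- rsum_plus, <- rsum_opp.
        apply rsum_ext; intros p _. rewrite <- !rsum_opp, <- rsum_scal, <- rsum_plus.
        apply rsum_ext; intros j _. rewrite HL. ring. }
  pose proof (Cseries_tail q (B * B) u (N - K - 1) ltac:(lra) Hug) as HT.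
  pose proof (re_le_Cmod (Cseries u - csumn (N - K - 1) u)) as HRe.
  unfold Cminus in HRe at 1; rewrite re_plus, re_opp in HRe. apply Rabs_le_between in HRe.
  (* Replacing q^k by 1 removes the regularisation from the main term; only the upper bound is
     needed. *)
  assert (HM : (Re (csumn (N - K - 1) u) <= rsum (seq 1 K) (fun k => Cmod (x k) ^ 2 / INR k))%R).
  { unfold csumn. replace (N - K - 1)%nat with (K + (N - K - 1 - K))%nat by lia.
    rewrite seq_app, csum_app, (csum_0 (seq (0 + K) _)), Cplus_0_r.
    - rewrite Re_csum, <- seq_shift, rsum_map. apply rsum_le; intros n Hn. apply in_seq in Hn.
      rewrite Hur, re_RtoC, mode_eq by lia.
      replace (S n <=? K)%nat with true by (symmetry; apply Nat.leb_le; lia).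
      simpl (1 <=? S n)%nat. simpl andb. cbv iota.
      assert (q ^ S n <= 1)%R by (rewrite <- (pow1 (S n)); apply pow_incr; lra).
      pose proof (INR_S_ge1 n). pose proof (pow2_ge_0 (Cmod (x (S n)))).
      unfold Rdiv. rewrite (Rmult_comm (Cmod (x (S n)) ^ 2)). apply Rmult_le_compat_r; auto.
      rewrite <- (Rmult_1_l (/ INR (S n))) at 2. apply Rmult_le_compat_r; auto.
      left; apply Rinv_0_lt_compat; lra.
    - intros n Hn. apply in_seq in Hn. unfold u. rewrite mode_eq by lia.
      replace (S n <=? K)%nat with false by (symmetry; apply Nat.leb_gt; lia).
      rewrite Bool.andb_false_r. ring. }
  specialize (HN0 (N - K - 1)%nat ltac:(lia)).
  replace (2 * (B * B) / (1 - q) * q ^ (N - K - 1))%R with (2 * (B * B * q ^ (N - K - 1) / (1 - q)))%R in HN0 by (field; lra).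
  lra.
Qed.

(* The coefficient of - x_m y_l / 2 in the Fourier expansion of
   the interaction ln |D + u - v|^2 of two circles. *)
Definition cross_coef (S1 S2 D : C) (m l : nat) : C :=
  RtoC ((-1) ^ m * nb (m - 1) l / INR m) * (S1 ^ m * S2 ^ l / D ^ (m + l)).

Lemma log_mode_series (y : C) : (Cmod y < 1)%R ->
  Cseries (fun m => match m with O => 0 | S _ => y ^ m / INR m end)
  = Cseries (fun n => y ^ S n / INR (S n)).
Proof.
  intros Hy. rewrite (Cseries_split (Cmod y) 1 _ 1).
  - unfold csumn; simpl csum. ring_simplify. reflexivity.
  - split; [apply Cmod_ge_0|auto].
  - intros [|n]; [rewrite Cmod_0; simpl; lra|].
    eapply Rle_trans; [apply Cmod_log_term|]. lra.
Qed.

Lemma Cmod_minus_ge a b : (Cmod a - Cmod b <= Cmod (a - b))%R.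
Proof.
  pose proof (Cmod_triangle (a - b) b) as H. replace (a - b + b) with a in H by ring. lra.
Qed.

(** The negative binomial series of (D - v)^(-m-1) in v, summed against the charges at v = S2 zeta^j
    by [charge_alias]. *)
Lemma power_mode K x (S2 D : C) (m : nat) :
  (Cmod S2 < Cmod D)%R ->
  exists t M, (0 <= t < 1)%R /\ forall N, (2 * K < N)%nat ->
  (Cmod (csumn N (fun j => charge K N x j * / (D - S2 * zeta N ^ j) ^ S m)%C
    - csum (seq 1 K) (fun l => nb m l * S2 ^ l / D ^ (S m + l) * x l)%C) <= M * t ^ (N - K))%R.
Proof.
  intros HD. assert (HD0 : (0 < Cmod D)%R) by (pose proof (Cmod_ge_0 S2); lra).
  assert (HDn : D <> 0) by (apply Cmod_gt_0; auto).
  assert (Hq : (Cmod (S2 / D) < 1)%R).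
  { rewrite Cmod_div by auto. apply Rmult_lt_reg_r with (Cmod D); auto.
    unfold Rdiv; rewrite Rmult_assoc, Rinv_l; lra. }
  destruct (nb_geo_C m (S2 / D) Hq) as (t & M & Ht & Hg).
  exists t, (Cmod (/ D ^ S m) * (M * xnorm K x / (1 - t)))%R. split; auto. intros N HN.
  assert (Hg' : geo t M (fun l => nb m l / D ^ l * S2 ^ l)).
  { intros l. specialize (Hg l). cbv beta in Hg.
    replace (nb m l / D ^ l * S2 ^ l) with (nb m l * (S2 / D) ^ l); auto.
    unfold Cdiv. rewrite Cpow_mult_l, Cpow_inv by auto. ring. }
  pose proof (charge_alias K N x _ S2 t M Ht Hg' HN) as HA.
  match type of HA with (Cmod (?a - ?b) <= _)%R => set (a1 := a) in HA; set (b1 := b) in HA end.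
  match goal with |- (Cmod (?a - ?b) <= _)%R =>
    replace a with (/ D ^ S m * a1); [replace b with (/ D ^ S m * b1)|] end.
  - rewrite <- (Cmult_1_l (/ D ^ S m * a1 - _)).
    replace (1 * (/ D ^ S m * a1 - / D ^ S m * b1)) with (/ D ^ S m * (a1 - b1)) by ring.
    rewrite Cmod_mult, Rmult_assoc. apply Rmult_le_compat_l; [apply Cmod_ge_0|].
    eapply Rle_trans; [exact HA|]. right; field; lra.
  - unfold b1. rewrite <- csum_scal. apply csum_ext; intros l _. rewrite Cpow_add_r. field.
    split; apply Cpow_nz; auto.
  - unfold a1, csumn. rewrite <- csum_scal. apply csum_ext; intros j _.
    replace (Cseries _) with (/ (1 - (S2 * zeta N ^ j) / D) ^ S m).
    + assert (Hx : (Cmod (S2 * zeta N ^ j / D) < 1)%R).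
      { unfold Cdiv. rewrite !Cmod_mult, Cmod_zeta_pow, Rmult_1_r. rewrite <- Cmod_mult. exact Hq. }
      replace ((D - S2 * zeta N ^ j)) with (D * (1 - S2 * zeta N ^ j / D)) by (field; auto).
      rewrite Cpow_mult_l. field. split; apply Cpow_nz; auto. apply C1_minus_nz; auto.
    + rewrite <- neg_binomial.
      * apply Cseries_ext; intros l. unfold Cdiv. rewrite Cpow_mult_l, Cpow_inv by auto. ring.
      * unfold Cdiv. rewrite !Cmod_mult, Cmod_zeta_pow, Rmult_1_r. rewrite <- Cmod_mult. exact Hq.
Qed.

(** The logarithmic series of ln |E + v|^2 in v / E; its constant ln |E|^2 drops out because the
    total charge is zero. The rate [tau] is a parameter so that the bound holds uniformly for all
    [E] on the second circle. *)
Lemma cross_log K N x (S1 E : C) (tau : R) :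
  (0 <= tau < 1)%R -> (Cmod S1 <= tau * Cmod E)%R -> E <> 0 -> (2 * K < N)%nat ->
  (Rabs (rsumn N (fun p => charge K N x p * ln (Cmod (E + S1 * zeta N ^ p) ^ 2))
     + 2 * Re (csum (seq 1 K) (fun m => RtoC ((-1) ^ m / INR m) * S1 ^ m * x m * / E ^ m)%C))
   <= 2 * xnorm K x / (1 - tau) * tau ^ (N - K))%R.
Proof.
  intros Ht HS HE HN. assert (HEp : (0 < Cmod E)%R) by (apply Cmod_gt_0; auto).
  set (f := fun m => match m with O => RtoC 0 | S _ => RtoC ((-1) ^ m / INR m) * / E ^ m end).
  assert (Hq : (Cmod S1 / Cmod E <= tau)%R).
  { apply Rmult_le_reg_r with (Cmod E); auto. unfold Rdiv; rewrite Rmult_assoc, Rinv_l; lra. }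
  assert (Hy : forall p, (Cmod (- (S1 * zeta N ^ p / E)) <= tau)%R).
  { intros p. rewrite Cmod_opp. unfold Cdiv. rewrite !Cmod_mult, Cmod_zeta_pow, Cmod_inv, Rmult_1_r; auto. }
  assert (Hf : forall m v, f m * v ^ m = match m with O => 0 | S _ => (- (v / E)) ^ m / INR m end).
  { intros [|m] v; unfold f; [ring|]. pose proof (INR_S_ge1 m).
    replace (- (v / E)) with (RtoC (-1) * v * / E) by (unfold Cdiv; ring).
    rewrite !Cpow_mult_l, Cpow_inv, RtoC_div, RtoC_pow by (auto; lra). unfold Cdiv; ring. }
  assert (Hg : geo tau 1 (fun m => f m * S1 ^ m)).
  { intros m. rewrite Hf. destruct m as [|m]; [rewrite Cmod_0; simpl; lra|].
    eapply Rle_trans; [apply Cmod_log_term|]. rewrite Rmult_1_l. apply pow_incr.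
    split; [apply Cmod_ge_0|]. rewrite Cmod_opp, Cmod_div; auto. }
  pose proof (charge_alias K N x f S1 tau 1 Ht Hg HN) as HA.
  match type of HA with (Cmod (?a - ?b) <= _)%R => set (a1 := a) in HA; set (b1 := b) in HA end.
  replace (rsumn N _) with (- 2 * Re a1)%R.
  - replace (csum (seq 1 K) _) with b1.
    + replace (- 2 * Re a1 + 2 * Re b1)%R with (- 2 * Re (a1 - b1))%R.
      2:{ unfold Cminus; rewrite re_plus, re_opp; ring. }
      rewrite Rabs_mult, Rabs_left by lra.
      pose proof (re_le_Cmod (a1 - b1)).
      replace (2 * xnorm K x / (1 - tau) * tau ^ (N - K))%R
        with (2 * (1 * xnorm K x * tau ^ (N - K) / (1 - tau)))%R by (field; lra). lra.
    + apply csum_ext; intros [|m] Hm; apply in_seq in Hm; [lia|]. unfold f. ring.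
  - transitivity (rsumn N (fun p => charge K N x p * ln (Cmod E ^ 2)
        + charge K N x p * (- 2 * Re (Cseries (fun m => f m * (S1 * zeta N ^ p) ^ m)%C)))%R).
    + unfold a1, csumn, rsumn. rewrite rsum_plus, rsum_scal_r.
      change (rsum (seq 0 N) (charge K N x)) with (rsumn N (charge K N x)).
      rewrite charge_sum_0 by auto. rewrite Re_csum, <- rsum_scal, Rmult_0_l, Rplus_0_l.
      apply rsum_ext; intros p _. rewrite re_scal_l. ring.
    + apply rsum_ext; intros p _.
      rewrite (Cseries_ext _ _ (fun m => Hf m (S1 * zeta N ^ p))), log_mode_series
        by (eapply Rle_lt_trans; [apply Hy|lra]).
      rewrite <- ln_Cmod_sq by (eapply Rle_lt_trans; [apply Hy|lra]).
      rewrite <- Rmult_plus_distr_l, <- ln_mult.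
      * f_equal. f_equal. rewrite <- Rpow_mult_distr, <- Cmod_mult. f_equal. f_equal. field; auto.
      * apply pow_lt; auto.
      * apply pow_lt, Cmod_gt_0, C1_minus_nz. eapply Rle_lt_trans; [apply Hy|lra].
Qed.

Lemma eventually_list {T} (l : list T) (P : T -> nat -> Prop) :
  (forall i, In i l -> exists N0, forall N, (N0 <= N)%nat -> P i N) ->
  exists N0, forall N, (N0 <= N)%nat -> forall i, In i l -> P i N.
Proof.
  induction l as [|i l IH]; intros H.
  - exists O; intros ? _ ? [].
  - destruct (H i) as [N1 H1]; [left; auto|].
    destruct IH as [N2 H2]; [intros; apply H; right; auto|].
    exists (N1 + N2)%nat; intros N HN j [->|Hj]; [apply H1; lia | apply H2; auto; lia].
Qed.

(** The two circles are expanded one after the other: first in the points of the first circle, with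
    E_j = D - S2 zeta^j fixed, then the powers E_j^(-m) in the points of the second circle. The
    first expansion is uniform in j since |E_j| >= |D| - |S2| > |S1|. *)
Lemma cross_energy_0 K x y (S1 S2 D : C) : (Cmod S1 + Cmod S2 < Cmod D)%R ->
  forall eta, (0 < eta)%R -> exists N0, forall N, (N0 <= N)%nat ->
  (Rabs (rsumn N (fun p => rsumn N (fun j => charge K N x p * charge K N y j *
     ln (Cmod (D + S1 * zeta N ^ p - S2 * zeta N ^ j) ^ 2)))
   + 2 * Re (csum (seq 1 K) (fun m => csum (seq 1 K) (fun l => cross_coef S1 S2 D m l * x m * y l))%C))
   <= eta)%R.
Proof.
  intros HD eta Heta. pose proof (Cmod_ge_0 S1) as HS1. pose proof (Cmod_ge_0 S2) as HS2.
  set (tau := (Cmod S1 / (Cmod D - Cmod S2))%R).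
  assert (Ht : (0 <= tau < 1)%R).
  { unfold tau. split; [apply Rmult_le_pos; [lra|left; apply Rinv_0_lt_compat; lra]|].
    apply Rmult_lt_reg_r with (Cmod D - Cmod S2)%R; [lra|].
    unfold Rdiv; rewrite Rmult_assoc, Rinv_l; lra. }
  set (co := fun m => RtoC ((-1) ^ m / INR m) * S1 ^ m * x m).
  set (W := rsum (seq 1 K) (fun m => Cmod (co m))).
  assert (HW : (0 <= W)%R) by (apply rsum_ge0; intros; apply Cmod_ge_0).
  pose proof (xnorm_ge0 K x) as HX. pose proof (xnorm_ge0 K y) as HY.
  (* The tolerance for each power mean: after weighting by [co] the errors add up to at most W dl <=
     eta / 4. *)
  set (dl := (eta / (4 * (W + 1)))%R).
  assert (Hdl : (0 < dl)%R) by (apply Rdiv_lt_0_compat; lra).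
  assert (H2 : exists N0, forall N, (N0 <= N)%nat -> forall m, In m (seq 1 K) ->
     (2 * K < N)%nat /\ (Cmod (csumn N (fun j => charge K N y j * / (D - S2 * zeta N ^ j) ^ m)%C
    - csum (seq 1 K) (fun l => nb (m - 1) l * S2 ^ l / D ^ (m + l) * y l)%C) < dl)%R).
  { apply eventually_list. intros [|m] Hm; apply in_seq in Hm; [lia|].
    replace (S m - 1)%nat with m by lia.
    destruct (power_mode K y S2 D m) as (t & M & Ht' & HM); [lra|].
    destruct (geo_small t M dl Ht' Hdl) as [N1 HN1].
    exists (N1 + 2 * K + 1)%nat; intros N HN. split; [lia|].
    eapply Rle_lt_trans; [apply HM; lia|]. apply HN1; lia. }
  destruct H2 as [N2 HN2].
  destruct (geo_small tau (xnorm K y * (2 * xnorm K x / (1 - tau))) (eta / 4) Ht) as [N1 HN1]; [lra|].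
  exists (N1 + N2 + 2 * K + 1)%nat; intros N HN.
  set (E := fun j => D - S2 * zeta N ^ j).
  assert (HE : forall j, (Cmod D - Cmod S2 <= Cmod (E j))%R).
  { intros j. unfold E. pose proof (Cmod_minus_ge D (S2 * zeta N ^ j)) as H.
    rewrite Cmod_mult, Cmod_zeta_pow, Rmult_1_r in H. exact H. }
  set (main := fun j => (2 * Re (csum (seq 1 K) (fun m => co m * / E j ^ m)%C))%R).
  set (inner := fun j => rsumn N (fun p => charge K N x p * ln (Cmod (E j + S1 * zeta N ^ p) ^ 2))%R).
  assert (Hin : forall j, (Rabs (inner j + main j) <= 2 * xnorm K x / (1 - tau) * tau ^ (N - K))%R).
  { intros j. apply cross_log; auto; try lia.
    - specialize (HE j). unfold tau. apply Rle_trans with (Cmod S1 / (Cmod D - Cmod S2) * (Cmod D - Cmod S2))%R.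
      right; field; lra. apply Rmult_le_compat_l; auto. apply Ht.
    - apply Cmod_gt_0. specialize (HE j). lra. }
  set (Q := fun m => csumn N (fun j => charge K N y j * / (D - S2 * zeta N ^ j) ^ m)).
  set (Q0 := fun m => csum (seq 1 K) (fun l => nb (m - 1) l * S2 ^ l / D ^ (m + l) * y l)).
  replace (rsumn N _) with (rsumn N (fun j => charge K N y j * inner j))%R.
  2:{ unfold inner, rsumn. rewrite (rsum_swap (seq 0 N) (seq 0 N)). apply rsum_ext; intros j _.
      rewrite <- rsum_scal. apply rsum_ext; intros p _.
      replace (E j + S1 * zeta N ^ p) with (D + S1 * zeta N ^ p - S2 * zeta N ^ j) by (unfold E; ring).
      ring. }
  replace (csum (seq 1 K) _) with (csum (seq 1 K) (fun m => co m * Q0 m)).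
  2:{ apply csum_ext; intros m Hm. apply in_seq in Hm. unfold Q0. rewrite <- csum_scal.
      apply csum_ext; intros l _. unfold co, cross_coef.
      replace ((-1) ^ m * nb (m - 1) l / INR m)%R with ((-1) ^ m / INR m * nb (m - 1) l)%R
        by (field; apply not_0_INR; lia).
      rewrite RtoC_mult. unfold Cdiv; ring. }
  assert (Hm : rsumn N (fun j => charge K N y j * main j)%R = (2 * Re (csum (seq 1 K) (fun m => co m * Q m)%C))%R).
  { unfold main, Q, csumn, rsumn.
    rewrite (csum_ext (seq 1 K) _ (fun m => csum (seq 0 N) (fun j => charge K N y j * (co m * / E j ^ m)))).
    2:{ intros m _. rewrite <- csum_scal. apply csum_ext; intros j _. unfold E; ring. }
    rewrite csum_swap, Re_csum, <- rsum_scal. apply rsum_ext; intros j _.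
    rewrite csum_scal, re_scal_l. ring. }
  replace (rsumn N (fun j => charge K N y j * inner j))%R with
    (rsumn N (fun j => charge K N y j * (inner j + main j)) - 2 * Re (csum (seq 1 K) (fun m => co m * Q m)%C))%R.
  2:{ rewrite <- Hm. unfold rsumn. rewrite <- rsum_minus. apply rsum_ext; intros; ring. }
  assert (H1 : (Rabs (rsumn N (fun j => charge K N y j * (inner j + main j)))
     <= xnorm K y * (2 * xnorm K x / (1 - tau) * tau ^ (N - K)))%R).
  { eapply Rle_trans; [apply Rabs_rsum|].
    eapply Rle_trans; [|apply Rmult_le_compat_r; [|apply (charge_abs_sum K N y)]].
    - unfold rsumn. rewrite <- rsum_scal_r. apply rsum_le; intros j _. rewrite Rabs_mult.
      apply Rmult_le_compat_l; [apply Rabs_pos|apply Hin].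
    - apply Rmult_le_pos; [|apply pow_le; lra]. apply Rmult_le_pos; [lra|].
      left; apply Rinv_0_lt_compat; lra.
    - lia. }
  assert (H3 : (Cmod (csum (seq 1 K) (fun m => co m * Q m)%C - csum (seq 1 K) (fun m => co m * Q0 m)%C) <= W * dl)%R).
  { rewrite <- csum_minus. eapply Rle_trans; [apply Cmod_csum|]. unfold W.
    rewrite <- rsum_scal_r. apply rsum_le; intros m Hmm.
    replace (co m * Q m - co m * Q0 m) with (co m * (Q m - Q0 m)) by ring.
    rewrite Cmod_mult. apply Rmult_le_compat_l; [apply Cmod_ge_0|].
    left; apply (HN2 N ltac:(lia) m Hmm). }
  pose proof (re_le_Cmod (csum (seq 1 K) (fun m => co m * Q m) - csum (seq 1 K) (fun m => co m * Q0 m))) as H4.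
  unfold Cminus in H4 at 1; rewrite re_plus, re_opp in H4.
  specialize (HN1 (N - K)%nat ltac:(lia)).
  assert (H5 : (W * dl <= eta / 4)%R).
  { unfold dl. apply Rle_trans with ((W / (W + 1)) * (eta / 4))%R; [right; field; lra|].
    assert (W / (W + 1) <= 1)%R.
    { apply Rmult_le_reg_r with (W + 1)%R; [lra|]. unfold Rdiv; rewrite Rmult_assoc, Rinv_l; lra. }
    nra. }
  apply Rabs_le_between in H1. apply Rabs_le_between in H4. apply Rabs_le_between.
  lra.
Qed.

(** Different circles have a positive gap |D| - |S1| - |S2|, so adding [eps] inside the logarithm
    changes each interaction by at most eps over the square of the gap. *)
Lemma cross_energy K x y (S1 S2 D : C) eps : (Cmod S1 + Cmod S2 < Cmod D)%R -> (0 < eps)%R ->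
  forall eta, (0 < eta)%R -> exists N0, forall N, (N0 <= N)%nat ->
  (- rsumn N (fun p => rsumn N (fun j => charge K N x p * charge K N y j *
     ln (Cmod (D + S1 * zeta N ^ p - S2 * zeta N ^ j) ^ 2 + eps)))
   <= 2 * Re (csum (seq 1 K) (fun m => csum (seq 1 K) (fun l => cross_coef S1 S2 D m l * x m * y l))%C)
   + eps * (xnorm K x * xnorm K y / (Cmod D - Cmod S1 - Cmod S2) ^ 2) + eta)%R.
Proof.
  intros HD He eta Heta. destruct (cross_energy_0 K x y S1 S2 D HD eta Heta) as [N0 HN0].
  exists (S N0); intros N HN. specialize (HN0 N ltac:(lia)).
  apply Rabs_le_between in HN0.
  set (dm := (Cmod D - Cmod S1 - Cmod S2)%R).
  assert (Hdm : (0 < dm)%R) by (unfold dm; lra).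
  assert (HL : forall p j, let A := (Cmod (D + S1 * zeta N ^ p - S2 * zeta N ^ j) ^ 2)%R in
     (Rabs (ln (A + eps) - ln A) <= eps / dm ^ 2)%R).
  { intros p j A. assert (HA : (dm ^ 2 <= A)%R).
    { unfold A. apply pow_incr. split; [lra|].
      pose proof (Cmod_minus_ge (D + S1 * zeta N ^ p) (S2 * zeta N ^ j)) as T1.
      pose proof (Cmod_minus_ge D (- (S1 * zeta N ^ p))) as T2.
      replace (D - - (S1 * zeta N ^ p)) with (D + S1 * zeta N ^ p) in T2 by ring.
      rewrite Cmod_opp in T2. rewrite !Cmod_mult, !Cmod_zeta_pow, !Rmult_1_r in *. unfold dm; lra. }
    assert (0 < dm ^ 2)%R by (apply pow_lt; auto).
    replace (ln (A + eps) - ln A)%R with (ln (1 + eps / A)).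
    2:{ replace (A + eps)%R with (A * (1 + eps / A))%R by (field; lra).
        rewrite ln_mult; try lra. assert (0 < eps / A)%R by (apply Rdiv_lt_0_compat; lra). lra. }
    assert (0 < eps / A)%R by (apply Rdiv_lt_0_compat; lra).
    rewrite Rabs_pos_eq by (rewrite <- ln_1; left; apply ln_increasing; lra).
    apply Rle_trans with (eps / A)%R.
    - pose proof (exp_ineq1_le (eps / A)) as H1.
      rewrite <- (ln_exp (eps / A)) at 2.
      destruct (Req_dec (1 + eps / A) (exp (eps / A))) as [->|]; [lra|].
      left; apply ln_increasing; lra.
    - unfold Rdiv. apply Rmult_le_compat_l; [lra|]. apply Rinv_le_contravar; auto. }
  match goal with |- (- ?X <= _)%R => set (XX := X) end.
  match type of HN0 with (_ <= ?Y + _ <= _)%R => set (YY := Y) in HN0 end.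
  enough (Rabs (XX - YY) <= eps * (xnorm K x * xnorm K y / dm ^ 2))%R as HR
    by (apply Rabs_le_between in HR; lra).
  unfold XX, YY, rsumn. rewrite <- rsum_minus.
  eapply Rle_trans; [apply Rabs_rsum|].
  apply Rle_trans with (rsumn N (fun p => Rabs (charge K N x p)) * (rsumn N (fun j => Rabs (charge K N y j)) * (eps / dm ^ 2)))%R.
  - unfold rsumn. rewrite <- rsum_scal_r. apply rsum_le; intros p _.
    rewrite <- rsum_minus. eapply Rle_trans; [apply Rabs_rsum|].
    rewrite <- rsum_scal_r, <- rsum_scal. apply rsum_le; intros j _.
    rewrite <- Rmult_minus_distr_l, !Rabs_mult, !Rmult_assoc.
    apply Rmult_le_compat_l; [apply Rabs_pos|]. apply Rmult_le_compat_l; [apply Rabs_pos|]. apply HL.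
  - pose proof (charge_abs_sum K N x ltac:(lia)). pose proof (charge_abs_sum K N y ltac:(lia)).
    assert (0 < eps / dm ^ 2)%R by (apply Rdiv_lt_0_compat; auto; apply pow_lt; auto).
    assert (0 <= rsumn N (fun p => Rabs (charge K N x p)))%R by (apply rsum_ge0; intros; apply Rabs_pos).
    assert (0 <= rsumn N (fun p => Rabs (charge K N y p)))%R by (apply rsum_ge0; intros; apply Rabs_pos).
    replace (eps * (xnorm K x * xnorm K y / dm ^ 2))%R with (xnorm K x * (xnorm K y * (eps / dm ^ 2)))%R
      by (field; lra).
    apply Rmult_le_compat; auto. apply Rmult_le_pos; lra. apply Rmult_le_compat_r; lra.
Qed.

Lemma csum_list_prod {T U} (l : list T) (l' : list U) (F : T * U -> C) :
  csum (list_prod l l') F = csum l (fun i => csum l' (fun j => F (i, j))).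
Proof.
  induction l as [|i l IH]; simpl; auto. rewrite csum_app, csum_map, IH; auto.
Qed.

Lemma rsum_list_prod {T U} (l : list T) (l' : list U) (F : T * U -> R) :
  rsum (list_prod l l') F = rsum l (fun i => rsum l' (fun j => F (i, j))).
Proof.
  induction l as [|i l IH]; simpl; auto. rewrite rsum_app, rsum_map, IH; auto.
Qed.

Lemma rsum_single {T} (l : list T) (i : T) (F : T -> R) :
  NoDup l -> In i l -> (forall j, In j l -> j <> i -> F j = 0%R) -> rsum l F = F i.
Proof.
  intros Hn Hi H. apply RtoC_inj. rewrite RtoC_rsum.
  apply (csum_single l i (fun j => RtoC (F j))); auto.
  intros j Hj Hji; rewrite H; auto.
Qed.

Lemma ge0_of_ge0_plus_eps (A B : R) : (0 <= B)%R ->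
  (forall eta, (0 < eta)%R -> (0 <= A + eta * B)%R) -> (0 <= A)%R.
Proof.
  intros HB H. apply Rnot_lt_le; intros HA.
  specialize (H (- A / (2 * (B + 1)))%R ltac:(apply Rdiv_lt_0_compat; lra)).
  assert (B / (B + 1) <= 1)%R.
  { apply Rmult_le_reg_r with (B + 1)%R; [lra|]. unfold Rdiv; rewrite Rmult_assoc, Rinv_l; lra. }
  replace (- A / (2 * (B + 1)) * B)%R with ((- A / 2) * (B / (B + 1)))%R in H by (field; lra).
  nra.
Qed.

(** By [log_kernel_neg] the total energy of the neutral charges is nonnegative for every [N]. For
    large [N] the self and cross energies bound it above by twice the expression in the statement,
    up to an error proportional to the regularisation. *)
Lemma grunsky_quad (L : list Z) (w S0 : Z -> C) (x : Z -> nat -> C) (K : nat) :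
  NoDup L -> (forall a, In a L -> S0 a <> 0) ->
  (forall a b, In a L -> In b L -> a <> b -> (Cmod (S0 a) + Cmod (S0 b) < Cmod (w a - w b))%R) ->
  (0 <= rsum L (fun a => rsum (seq 1 K) (fun k => Cmod (x a k) ^ 2 / INR k))
      + Re (csum L (fun a => csum L (fun b => csum (seq 1 K) (fun m => csum (seq 1 K) (fun l =>
          (if Z.eq_dec a b then 0 else cross_coef (S0 a) (S0 b) (w a - w b) m l) * x a m * x b l))))%C))%R.
Proof.
  intros HL HS HD.
  set (mainf := fun a b => (if Z.eq_dec a b then 2 * rsum (seq 1 K) (fun k => Cmod (x a k) ^ 2 / INR k)
     else 2 * Re (csum (seq 1 K) (fun m => csum (seq 1 K) (fun l => cross_coef (S0 a) (S0 b) (w a - w b) m l * x a m * x b l))%C))%R).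
  set (cf := fun a b => (if Z.eq_dec a b then 0 else xnorm K (x a) * xnorm K (x b) / (Cmod (w a - w b) - Cmod (S0 a) - Cmod (S0 b)) ^ 2)%R).
  assert (Hcf : forall a b, In a L -> In b L -> (0 <= cf a b)%R).
  { intros a b Ha Hb. unfold cf. destruct (Z.eq_dec a b) as [|Hab]; [lra|].
    apply Rmult_le_pos; [apply Rmult_le_pos; apply xnorm_ge0|].
    left; apply Rinv_0_lt_compat, pow_lt. specialize (HD a b Ha Hb Hab); lra. }
  set (Main := rsum L (fun a => rsum L (fun b => mainf a b))).
  assert (Hmain : (Main = 2 * (rsum L (fun a => rsum (seq 1 K) (fun k => Cmod (x a k) ^ 2 / INR k))
      + Re (csum L (fun a => csum L (fun b => csum (seq 1 K) (fun m => csum (seq 1 K) (fun l =>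
          (if Z.eq_dec a b then 0 else cross_coef (S0 a) (S0 b) (w a - w b) m l) * x a m * x b l))))%C)))%R).
  { unfold Main. rewrite Re_csum, <- rsum_plus, <- rsum_scal. apply rsum_ext; intros a Ha.
    rewrite Re_csum.
    replace (rsum (seq 1 K) (fun k => Cmod (x a k) ^ 2 / INR k)%R) with
      (rsum L (fun b => if Z.eq_dec a b then rsum (seq 1 K) (fun k => Cmod (x a k) ^ 2 / INR k) else 0)%R).
    2:{ etransitivity; [apply (rsum_single L a); auto|].
        - intros j _ Hj. simpl. destruct (Z.eq_dec a j); [congruence|auto].
        - simpl. destruct (Z.eq_dec a a); [auto|congruence]. }
    rewrite <- rsum_plus, <- rsum_scal. apply rsum_ext; intros b Hb. unfold mainf.
    destruct (Z.eq_dec a b); [|ring].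
    rewrite csum_0; [simpl; ring|]. intros; apply csum_0; intros; ring. }
  enough (0 <= Main)%R by lra.
  apply ge0_of_ge0_plus_eps with (rsum L (fun a => rsum L (fun b => cf a b + 1)))%R.
  { apply rsum_ge0; intros a Ha; apply rsum_ge0; intros b Hb. specialize (Hcf a b Ha Hb); lra. }
  (* One number [eta] serves as the regularisation of the kernel and as the tolerance in each pair
     of circles, so the total error is linear in it. *)
  intros eta Heta.
  set (en := fun N a b => (- rsumn N (fun p => rsumn N (fun j => charge K N (x a) p * charge K N (x b) j *
     ln (Cmod ((w a + S0 a * zeta N ^ p) - (w b + S0 b * zeta N ^ j)) ^ 2 + eta))))%R).
  assert (Hev : exists N0, forall N, (N0 <= N)%nat -> forall ab, In ab (list_prod L L) ->
     (2 * K < N)%nat /\ (en N (fst ab) (snd ab) <= mainf (fst ab) (snd ab) + eta * (cf (fst ab) (snd ab)) + eta)%R).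
  { apply eventually_list. intros [a b] Hab. apply in_prod_iff in Hab. destruct Hab as [Ha Hb]. simpl.
    unfold en, mainf, cf. destruct (Z.eq_dec a b) as [<-|Hab].
    - destruct (self_energy K (x a) (S0 a) eta (HS a Ha) Heta eta Heta) as [N0 HN0].
      exists (N0 + 2 * K + 1)%nat; intros N HN; split; [lia|]. specialize (HN0 N ltac:(lia)).
      rewrite Rmult_0_r, Rplus_0_r. eapply Rle_trans; [|exact HN0]. right. f_equal.
      apply rsum_ext; intros p _; apply rsum_ext; intros j _.
      replace (w a + S0 a * zeta N ^ p - (w a + S0 a * zeta N ^ j)) with (S0 a * zeta N ^ p - S0 a * zeta N ^ j) by ring.
      reflexivity.
    - destruct (cross_energy K (x a) (x b) (S0 a) (S0 b) (w a - w b) eta (HD a b Ha Hb Hab) Heta eta Heta) as [N0 HN0].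
      exists (N0 + 2 * K + 1)%nat; intros N HN; split; [lia|]. specialize (HN0 N ltac:(lia)).
      eapply Rle_trans; [|exact HN0]. right. f_equal.
      apply rsum_ext; intros p _; apply rsum_ext; intros j _.
      replace (w a + S0 a * zeta N ^ p - (w b + S0 b * zeta N ^ j)) with (w a - w b + S0 a * zeta N ^ p - S0 b * zeta N ^ j) by ring.
      reflexivity. }
  destruct Hev as [N0 HN0].
  set (N := (N0 + 2 * K + 1)%nat).
  assert (HE : (0 <= rsum L (fun a => rsum L (fun b => en N a b)))%R).
  { pose proof (log_kernel_neg (list_prod L (seq 0 N)) (fun ap => charge K N (x (fst ap)) (snd ap))
      (fun ap => w (fst ap) + S0 (fst ap) * zeta N ^ snd ap) eta Heta) as H.
    assert (H0 : rsum (list_prod L (seq 0 N)) (fun ap => charge K N (x (fst ap)) (snd ap)) = 0%R).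
    { rewrite rsum_list_prod. simpl. transitivity (rsum L (fun _ => 0%R)); [|rewrite rsum_const; ring].
      apply rsum_ext; intros a _. apply (charge_sum_0 K N (x a)). unfold N; lia. }
    specialize (H H0). rewrite rsum_list_prod in H.
    enough (rsum L (fun a => rsum L (fun b => en N a b)) = - rsum L (fun a => rsum (seq 0 N) (fun p =>
      rsum (list_prod L (seq 0 N)) (fun q => charge K N (x a) p * charge K N (x (fst q)) (snd q) *
        ln (Cmod (w a + S0 a * zeta N ^ p - (w (fst q) + S0 (fst q) * zeta N ^ snd q)) ^ 2 + eta)))))%R as ->.
    { simpl in H. simpl. lra. }
    rewrite <- rsum_opp. apply rsum_ext; intros a _. unfold en. rewrite rsum_opp. f_equal.
    unfold rsumn. rewrite rsum_swap. apply rsum_ext; intros p _. rewrite rsum_list_prod. reflexivity. }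
  eapply Rle_trans; [exact HE|]. unfold Main. rewrite <- rsum_scal, <- rsum_plus.
  apply rsum_le; intros a Ha. rewrite <- rsum_scal, <- rsum_plus. apply rsum_le; intros b Hb.
  destruct (HN0 N ltac:(unfold N; lia) (a, b) ltac:(apply in_prod; auto)) as [_ H]. simpl in H. lra.
Qed.

(* Apply the form to [X - Y] and to [i (X + Y)], where [Y] is the conjugate of [X B],
   and add: the bilinear form of [X] and [Y] is the squared norm of [Y]. *)
Lemma contraction_of_quad {T} (J : list T) (B : T -> T -> C) :
  (forall i j, In i J -> In j J -> B i j = B j i) ->
  (forall X : T -> C, (0 <= rsum J (fun i => Cmod (X i) ^ 2)
     + Re (csum J (fun i => csum J (fun j => B i j * X i * X j))%C))%R) ->
  forall X : T -> C,
    (rsum J (fun j => Cmod (csum J (fun i => X i * B i j)%C) ^ 2)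
     <= rsum J (fun i => Cmod (X i) ^ 2))%R.
Proof.
  intros Hsym HQ X.
  set (Y := fun j => Cconj (csum J (fun i => X i * B i j))).
  set (bil := fun U V : T -> C => csum J (fun i => csum J (fun j => B i j * U i * V j))).
  assert (Hs : forall U V, bil U V = bil V U).
  { intros U V. unfold bil. rewrite csum_swap. apply csum_ext; intros i Hi; apply csum_ext; intros j Hj.
    rewrite Hsym by auto. ring. }
  assert (H1 : (0 <= rsum J (fun i => Cmod (X i - Y i) ^ 2) + Re (bil X X + bil Y Y - 2 * bil X Y))%R).
  { eapply Rle_trans; [apply (HQ (fun i => X i - Y i))|]. right. f_equal. f_equal.
    replace (2 * bil X Y) with (bil X Y + bil Y X) by (rewrite (Hs Y X); ring).
    unfold bil. rewrite <- !csum_plus, <- csum_minus. apply csum_ext; intros i _.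
    rewrite <- !csum_plus, <- csum_minus. apply csum_ext; intros j _. ring. }
  assert (H2 : (0 <= rsum J (fun i => Cmod (X i + Y i) ^ 2) - Re (bil X X + bil Y Y + 2 * bil X Y))%R).
  { eapply Rle_trans; [apply (HQ (fun i => Ci * (X i + Y i)))|]. right. unfold Rminus. f_equal.
    - apply rsum_ext; intros i _. rewrite Cmod_mult, Cmod_Ci, Rmult_1_l; auto.
    - rewrite <- re_opp. f_equal.
      replace (2 * bil X Y) with (bil X Y + bil Y X) by (rewrite (Hs Y X); ring).
      unfold bil. rewrite <- !csum_plus, <- csum_opp. apply csum_ext; intros i _.
      rewrite <- !csum_plus, <- csum_opp. apply csum_ext; intros j _.
      assert (HC : Ci * Ci = -1) by (apply injective_projections; simpl; ring).
      replace (B i j * (Ci * (X i + Y i)) * (Ci * (X j + Y j))) with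
        ((Ci * Ci) * (B i j * (X i + Y i) * (X j + Y j))) by ring. rewrite HC. ring. }
  assert (H3 : (rsum J (fun i => Cmod (X i - Y i) ^ 2) + rsum J (fun i => Cmod (X i + Y i) ^ 2)
     = 2 * rsum J (fun i => Cmod (X i) ^ 2) + 2 * rsum J (fun i => Cmod (Y i) ^ 2))%R).
  { rewrite <- !rsum_scal, <- !rsum_plus. apply rsum_ext; intros i _.
    rewrite !Cmod2_alt. unfold Cminus. rewrite !re_plus, !im_plus, !re_opp, !im_opp. ring. }
  assert (H4 : Re (bil X Y) = rsum J (fun i => Cmod (Y i) ^ 2)%R).
  { unfold bil. rewrite csum_swap, Re_csum. apply rsum_ext; intros j _.
    rewrite <- (re_RtoC (Cmod (Y j) ^ 2)), Cmod2_conj. f_equal.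
    transitivity (csum J (fun i => X i * B i j) * Y j).
    - rewrite <- csum_scal_r. apply csum_ext; intros; ring.
    - unfold Y at 3. rewrite Cconj_conj. ring. }
  assert (H5 : forall u v, Re (u + v - 2 * bil X Y) = (Re (u + v) - 2 * Re (bil X Y))%R).
  { intros. unfold Cminus. rewrite re_plus, re_opp, (re_scal_l 2). ring. }
  assert (H6 : forall u v, Re (u + v + 2 * bil X Y) = (Re (u + v) + 2 * Re (bil X Y))%R).
  { intros. rewrite re_plus, (re_scal_l 2). ring. }
  rewrite H5 in H1. rewrite H6 in H2.
  assert (H7 : rsum J (fun j => Cmod (csum J (fun i => X i * B i j)%C) ^ 2)%R = rsum J (fun i => Cmod (Y i) ^ 2)%R).
  { apply rsum_ext; intros j _. unfold Y. rewrite Cmod_conj; auto. }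
  rewrite H7. lra.
Qed.

(** * The contraction A and its Neumann series *)

Definition letters (g : nat) : list Z :=
  flat_map (fun n => [Z.of_nat n; (- Z.of_nat n)%Z]) (seq 1 g).

Lemma In_letters g a : In a (letters g) <-> is_letter g a.
Proof.
  unfold letters, is_letter. rewrite in_flat_map. split.
  - intros (n & Hn & Ha). apply in_seq in Hn. simpl in Ha. lia.
  - intros Ha. exists (Z.to_nat (Z.abs a)). split; [apply in_seq; lia|]. simpl. lia.
Qed.

Lemma NoDup_letters g : NoDup (letters g).
Proof.
  unfold letters. induction g as [|g IH]; [constructor|].
  rewrite seq_S, flat_map_app. simpl. apply NoDup_app; auto.
  - constructor; [simpl; lia|]. constructor; [simpl; tauto|constructor].
  - intros a Ha. apply in_flat_map in Ha. destruct Ha as (n & Hn & Ha). apply in_seq in Hn.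
    simpl in *. lia.
Qed.

Lemma csum_letters_opp g F : csum (letters g) (fun a => F (- a)%Z) = csum (letters g) F.
Proof.
  unfold letters. rewrite !csum_flat_map. apply csum_ext; intros n _. simpl.
  rewrite Z.opp_involutive. ring.
Qed.

Lemma rsum_letters_opp g F : rsum (letters g) (fun a => F (- a)%Z) = rsum (letters g) F.
Proof.
  unfold letters. rewrite !rsum_flat_map. apply rsum_ext; intros n _. simpl.
  rewrite Z.opp_involutive. ring.
Qed.

Definition trunc (g K : nat) : list index := list_prod (letters g) (seq 1 K).

(** The substitution x_m = sqrt m X_m, which turns the self energy into a sum of squares, turns the
    Fourier coefficients of the interaction into the entries in the definition of A. *)
Lemma cross_coef_A (S1 S2 D : C) m l : (1 <= m)%nat -> (1 <= l)%nat ->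
  RtoC (sqrt (INR m)) * RtoC (sqrt (INR l)) * cross_coef S1 S2 D m l =
  RtoC ((-1) ^ m * INR (fact (m + l - 1))
             / (sqrt (INR (m * l)) * INR (fact (m - 1)) * INR (fact (l - 1))))
       * (S1 ^ m * S2 ^ l / D ^ (m + l)).
Proof.
  intros Hm Hl. unfold cross_coef. rewrite Cmult_assoc, <- !RtoC_mult.
  match goal with |- RtoC ?a * ?X = RtoC ?b * ?X => enough (a = b) as -> by reflexivity end.
  destruct m as [|m]; [lia|]. destruct l as [|l]; [lia|].
  replace (S m - 1)%nat with m by lia. replace (S l - 1)%nat with l by lia.
  replace (S m + S l - 1)%nat with (m + S l)%nat by lia. unfold nb.
  pose proof (INR_fact_neq_0 m). pose proof (INR_fact_neq_0 l). pose proof (INR_fact_neq_0 (m + S l)).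
  assert (Hm' : (0 < INR (S m))%R) by (apply lt_0_INR; lia).
  assert (Hl' : (0 < INR (S l))%R) by (apply lt_0_INR; lia).
  rewrite (fact_simpl l), !mult_INR, sqrt_mult by lra.
  pose proof (sqrt_lt_R0 _ Hm') as Hs1. pose proof (sqrt_lt_R0 _ Hl') as Hs2.
  pose proof (sqrt_sqrt (INR (S m)) ltac:(lra)) as E1. pose proof (sqrt_sqrt (INR (S l)) ltac:(lra)) as E2.
  revert Hs1 Hs2 E1 E2. generalize (sqrt (INR (S m))) (sqrt (INR (S l))). intros r1 r2 Hs1 Hs2 <- <-.
  field. repeat split; auto; lra.
Qed.

(** The Grunsky inequality is applied to the discs enlarged by [t], giving a matrix [B] of norm at
    most 1. Up to the flip a -> -a of the row index, A arises from [B] by the weights t^(-m) and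
    t^(-l) on its two sides, each at most 1/t; this gives t^(-4) for squared norms. *)
Lemma A_row_contraction g w rho s t : in_Schottky_domain g w rho -> is_sqrt_choice g rho s ->
  (1 <= t)%R ->
  (forall a b, is_letter g a -> is_letter g b -> a <> b ->
     (Cmod (w a - w b) > t * radius rho a + t * radius rho b)%R) ->
  forall K (u : vec),
  (rsum (trunc g K) (fun j => Cmod (csum (trunc g K) (fun i => u i * A_mat w s i j)%C) ^ 2)
   <= (/ t) ^ 4 * rsum (trunc g K) (fun i => Cmod (u i) ^ 2))%R.
Proof.
  intros [Hrho _] Hs Ht Hd K u.
  set (S0 := fun a => RtoC t * s a).
  assert (Hsr : forall a, is_letter g a -> Cmod (s a) = radius rho a).
  { intros a Ha. destruct (Hs a Ha) as [E _]. unfold radius. rewrite <- E, Cmod_mult.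
    symmetry. apply sqrt_square, Cmod_ge_0. }
  assert (HS : forall a, is_letter g a -> Cmod (S0 a) = (t * radius rho a)%R).
  { intros a Ha. unfold S0. rewrite Cmod_mult, Cmod_R, Rabs_pos_eq, Hsr by (auto; lra). auto. }
  assert (Hsnz : forall a, is_letter g a -> s a <> 0).
  { intros a Ha E. destruct (Hs a Ha) as [E2 _]. rewrite E in E2.
    destruct (Hrho a Ha) as [H _]. apply H. rewrite <- E2. ring. }
  set (B := fun i j : index => let (a, m) := i in let (b, l) := j in
    if Z.eq_dec a b then RtoC 0 else RtoC (sqrt (INR m)) * RtoC (sqrt (INR l)) * cross_coef (S0 a) (S0 b) (w a - w b) m l).
  assert (Hin : forall a m, In (a, m) (trunc g K) -> is_letter g a /\ (1 <= m)%nat).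
  { intros a m H. apply in_prod_iff in H. destruct H as [H1 H2]. apply In_letters in H1.
    apply in_seq in H2. split; auto; lia. }
  assert (HC : forall X : index -> C, (rsum (trunc g K) (fun j => Cmod (csum (trunc g K) (fun i => X i * B i j)%C) ^ 2)
     <= rsum (trunc g K) (fun i => Cmod (X i) ^ 2))%R).
  { apply contraction_of_quad.
    (* Symmetry of [B]: exchanging the circles changes the sign of w a - w b, and the resulting
       (-1)^(m+l) turns the prefactor (-1)^l into (-1)^m. *)
    - intros [a m] [b l] Hi Hj. apply Hin in Hi. apply Hin in Hj. unfold B.
      destruct (Z.eq_dec a b) as [->|Hab]; destruct (Z.eq_dec b _) as [E|Hba]; try congruence.
      rewrite (Cmult_comm (RtoC (sqrt (INR l)))).
      rewrite cross_coef_A by tauto. rewrite (Cmult_comm (RtoC (sqrt (INR m)))), cross_coef_A by tauto.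
      rewrite (Nat.add_comm l m), (Nat.mul_comm l m).
      assert (Hw : w a - w b <> 0).
      { apply Cmod_gt_0. specialize (Hd a b (proj1 Hi) (proj1 Hj) Hab).
        assert (0 <= radius rho a)%R by apply sqrt_pos. assert (0 <= radius rho b)%R by apply sqrt_pos. nra. }
      assert (Hw' : w b - w a <> 0) by (intros E; apply Hw; replace (w a - w b) with (- (w b - w a)) by ring; rewrite E; ring).
      assert (Hsq : forall n, ((-1) ^ n * (-1) ^ n = 1)%R).
      { intros n. rewrite <- Rpow_mult_distr. replace (-1 * -1)%R with 1%R by ring. apply pow1. }
      pose proof (Hsq m) as Em. pose proof (Hsq l) as El.
      replace ((w b - w a) ^ (m + l)) with (RtoC ((-1) ^ m * (-1) ^ l) * (w a - w b) ^ (m + l)).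
      2:{ rewrite <- pow_add, RtoC_pow, <- Cpow_mult_l. f_equal. ring. }
      revert Em El. generalize ((-1) ^ m)%R ((-1) ^ l)%R. intros em el Em El.
      assert (HZ : (w a - w b) ^ (m + l) <> 0) by (apply Cpow_nz; auto).
      revert HZ. generalize ((w a - w b) ^ (m + l)) (S0 a ^ m) (S0 b ^ l). intros ZZ p q HZ.
      assert (Hc : RtoC (em * el) * RtoC (em * el) = 1).
      { rewrite <- RtoC_mult. f_equal. replace (em * el * (em * el))%R with ((em * em) * (el * el))%R by ring.
        rewrite Em, El; ring. }
      assert (Hcn : RtoC (em * el) <> 0) by (intros E; rewrite E in Hc; apply C1_nz; rewrite <- Hc; apply Cmult_0_l).
      replace (q * p / (RtoC (em * el) * ZZ)) with (RtoC (em * el) * (p * q / ZZ)).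
      2:{ revert Hc Hcn. generalize (RtoC (em * el)). intros c Hc Hcn.
          assert (Hci : / c = c) by (transitivity (c * c * / c); [rewrite Hc; ring | field; auto]).
          transitivity (/ c * (p * q / ZZ)); [rewrite Hci; reflexivity | field; auto]. }
      rewrite Cmult_assoc, <- RtoC_mult.
      match goal with |- RtoC ?a * ?X = RtoC ?b * ?X => enough (a = b) as -> by reflexivity end.
      replace (sqrt (INR (m * l)) * INR (fact (l - 1)) * INR (fact (m - 1)))%R with
        (sqrt (INR (m * l)) * INR (fact (m - 1)) * INR (fact (l - 1)))%R by ring.
      unfold Rdiv. rewrite <- (Rmult_1_r em) at 1. rewrite <- El. ring.
    - intros X.
      pose proof (grunsky_quad (letters g) w S0 (fun a m => RtoC (sqrt (INR m)) * X (a, m)) K (NoDup_letters g)) as HG.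
      eapply Rle_trans; [apply HG|].
      + intros a Ha. apply In_letters in Ha. unfold S0. apply Cmult_neq_0; auto. apply RtoC_neq0; lra.
      + intros a b Ha Hb Hab. apply In_letters in Ha. apply In_letters in Hb.
        rewrite !HS by auto. apply Hd; auto.
      + right. f_equal.
        * unfold trunc, index in *. rewrite rsum_list_prod. apply rsum_ext; intros a _. apply rsum_ext; intros k Hk.
          apply in_seq in Hk. assert (0 < INR k)%R by (apply lt_0_INR; lia).
          rewrite Cmod_mult, Rpow_mult_distr, Cmod_R, Rabs_pos_eq by apply sqrt_pos.
          rewrite pow2_sqrt by lra. field; lra.
        * f_equal. unfold trunc, index in *. rewrite csum_list_prod. apply csum_ext; intros a _.
          rewrite (csum_ext (seq 1 K) (fun j => csum (list_prod _ _) _) (fun m => csum (letters g) (fun b => csum (seq 1 K) (fun l => B (a, m) (b, l) * X (a, m) * X (b, l))))).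
          2:{ intros m _. rewrite csum_list_prod; auto. }
          rewrite (csum_swap (seq 1 K) (letters g)). apply csum_ext; intros b _. apply csum_ext; intros m _. apply csum_ext; intros l _.
          unfold B. destruct (Z.eq_dec a b); ring. }
  (* A row of A with letter a looks at the centre w_{-a}, whereas [B] looks at w_a; hence the flip.
     The excluded pairs a = -b then become the diagonal blocks of [B]. *)
  assert (HAB : forall a m b l, is_letter g a -> is_letter g b -> (1 <= m)%nat -> (1 <= l)%nat ->
     A_mat w s (a, m) (b, l) = RtoC ((/ t) ^ m) * B ((- a)%Z, m) (b, l) * RtoC ((/ t) ^ l)).
  { intros a m b l Ha Hb Hm Hl. unfold A_mat, B.
    destruct (Z.eq_dec a (- b)) as [Eab|Nab], (Z.eq_dec (- a) b) as [Eab2|Nab2]; try lia; [ring|].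
    rewrite cross_coef_A by auto. unfold S0. rewrite !Cpow_mult_l, !RtoC_pow, RtoC_inv by lra.
    rewrite !Cpow_inv by (apply RtoC_neq0; lra).
    destruct (Hs a Ha) as [_ ->]. unfold Cdiv.
    assert (Hp : forall n, RtoC t ^ n * / RtoC t ^ n = 1).
    { intros n. apply Cinv_r, Cpow_nz, RtoC_neq0; lra. }
    match goal with |- ?c * (?x * ?y * ?z) = _ =>
      transitivity ((RtoC t ^ m * / RtoC t ^ m) * (RtoC t ^ l * / RtoC t ^ l) * (c * (x * y * z))); [|ring] end.
    rewrite !Hp. ring. }
  assert (Hti : (0 < / t <= 1)%R).
  { split; [apply Rinv_0_lt_compat; lra|]. rewrite <- Rinv_1. apply Rinv_le_contravar; lra. }
  assert (Htp : forall m, (1 <= m)%nat -> (0 <= (/ t) ^ m <= / t)%R).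
  { intros m Hm. split; [apply pow_le; lra|]. destruct m as [|m]; [lia|].
    rewrite <- (Rmult_1_r (/ t)) at 2. simpl. apply Rmult_le_compat_l; [lra|].
    rewrite <- (pow1 m). apply pow_incr; lra. }
  set (X := fun i : index => RtoC ((/ t) ^ snd i) * u ((- fst i)%Z, snd i)).
  apply Rle_trans with ((/ t) ^ 2 * rsum (trunc g K) (fun j => Cmod (csum (trunc g K) (fun i => X i * B i j)%C) ^ 2))%R.
  - rewrite <- rsum_scal. apply rsum_le; intros [b l] Hj. apply Hin in Hj.
    replace (csum (trunc g K) (fun i => u i * A_mat w s i (b, l))) with (csum (trunc g K) (fun i => X i * B i (b, l)) * RtoC ((/ t) ^ l)).
    + rewrite Cmod_mult, Rpow_mult_distr, Rmult_comm. apply Rmult_le_compat_r; [apply pow2_ge_0|].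
      rewrite Cmod_R, Rabs_pos_eq by (apply Htp; tauto). apply pow_incr. apply Htp; tauto.
    + rewrite <- csum_scal_r. unfold trunc, index in *. rewrite !csum_list_prod.
      rewrite <- (csum_letters_opp g). apply csum_ext; intros a Ha. apply In_letters in Ha.
      apply csum_ext; intros m Hm. apply in_seq in Hm. rewrite HAB by (try tauto; lia).
      unfold X; simpl fst; simpl snd. rewrite Z.opp_involutive. ring.
  - replace ((/ t) ^ 4)%R with ((/ t) ^ 2 * (/ t) ^ 2)%R by ring. rewrite Rmult_assoc.
    apply Rmult_le_compat_l; [apply pow2_ge_0|]. eapply Rle_trans; [apply HC|].
    rewrite <- rsum_scal. unfold trunc, index in *. rewrite !rsum_list_prod.
    rewrite <- (rsum_letters_opp g). apply rsum_le; intros a Ha. apply rsum_le; intros m Hm. apply in_seq in Hm.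
    unfold X; simpl fst; simpl snd. rewrite Z.opp_involutive, Cmod_mult, Rpow_mult_distr.
    apply Rmult_le_compat_r; [apply pow2_ge_0|]. rewrite Cmod_R, Rabs_pos_eq by (apply Htp; lia).
    apply pow_incr, Htp; lia.
Qed.

(** * Sums over the indices (a,k), decaying vectors and contractive matrices *)

Lemma index_sum_letters g F :
  index_sum g F = Cseries (fun k => csum (letters g) (fun a => F (a, S k))).
Proof.
  unfold index_sum. apply Cseries_ext; intros k. unfold letters. rewrite csum_flat_map.
  induction g as [|g IH].
  - rewrite sum_n_m_zero by lia. reflexivity.
  - rewrite seq_S, csum_app, <- IH, sum_n_Sm by lia. simpl csum. unfold plus; simpl.
    replace (1 + g)%nat with (S g) by lia. ring.
Qed.

Lemma csum_trunc g K F :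
  csum (trunc g K) F = csumn K (fun k => csum (letters g) (fun a => F (a, S k))).
Proof.
  unfold trunc, index. rewrite csum_list_prod, csum_swap, <- seq_shift, csum_map. reflexivity.
Qed.

(** The counterpart of [geo] for vectors. The decay starts at k = 1 and is uniform in the letter. *)
Definition gbnd (g : nat) (t M : R) (u : vec) : Prop :=
  forall i, is_index g i -> (Cmod (u i) <= M * t ^ snd i)%R.

Lemma is_index_letters g a k : In a (letters g) -> is_index g (a, S k).
Proof. intros H. split; simpl; [apply In_letters; auto | lia]. Qed.

Definition len (g : nat) : R := INR (length (letters g)).

Lemma gbnd_geo g t M F : (0 <= t)%R -> gbnd g t M F ->
  geo t (len g * M * t) (fun k => csum (letters g) (fun a => F (a, S k))).
Proof.
  intros Ht H k. eapply Rle_trans; [apply Cmod_csum|].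
  eapply Rle_trans; [apply (rsum_le _ _ (fun _ => M * t ^ S k)%R)|].
  - intros a Ha. apply (H (a, S k)), is_index_letters; auto.
  - rewrite rsum_const. unfold len. simpl. right; ring.
Qed.

Lemma index_sum_ext g F G :
  (forall i, is_index g i -> F i = G i) -> index_sum g F = index_sum g G.
Proof.
  intros H. rewrite !index_sum_letters. apply Cseries_ext; intros k.
  apply csum_ext; intros a Ha. apply H, is_index_letters; auto.
Qed.

Lemma index_sum_conv g t M F : (0 <= t < 1)%R -> gbnd g t M F ->
  cconv (fun K => csum (trunc g K) F) (index_sum g F).
Proof.
  intros Ht H. rewrite index_sum_letters.
  eapply cconv_ext; [intros K; symmetry; apply csum_trunc|].
  eapply cconv_geo; [exact Ht|]. apply gbnd_geo; [lra|exact H].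
Qed.

Lemma index_sum_plus g t M F t' M' G : (0 <= t < 1)%R -> gbnd g t M F ->
  (0 <= t' < 1)%R -> gbnd g t' M' G ->
  index_sum g (fun i => F i + G i) = index_sum g F + index_sum g G.
Proof.
  intros Ht H Ht' H'. rewrite !index_sum_letters.
  rewrite <- (Cseries_plus t (len g * M * t) _ t' (len g * M' * t')); auto.
  - apply Cseries_ext; intros k. apply csum_plus.
  - apply gbnd_geo; auto; lra.
  - apply gbnd_geo; auto; lra.
Qed.

Lemma index_sum_scal g t M F c : (0 <= t < 1)%R -> gbnd g t M F ->
  index_sum g (fun i => c * F i) = c * index_sum g F.
Proof.
  intros Ht H. rewrite !index_sum_letters.
  rewrite <- (Cseries_scal t (len g * M * t)); auto.
  - apply Cseries_ext; intros k. apply csum_scal.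
  - apply gbnd_geo; auto; lra.
Qed.

Lemma index_sum_minus g t M F t' M' G : (0 <= t < 1)%R -> gbnd g t M F ->
  (0 <= t' < 1)%R -> gbnd g t' M' G ->
  index_sum g (fun i => F i - G i) = index_sum g F - index_sum g G.
Proof.
  intros Ht H Ht' H'.
  transitivity (index_sum g F + index_sum g (fun i => (-1) * G i)).
  - rewrite <- (index_sum_plus g t M F t' M'); auto.
    + apply index_sum_ext; intros; ring.
    + intros i Hi. rewrite Cmod_mult, Cmod_R, Rabs_left by lra. specialize (H' i Hi). lra.
  - rewrite (index_sum_scal g t' M'); auto. ring.
Qed.

Lemma index_sum_bound g t M F : (0 <= t < 1)%R -> gbnd g t M F ->
  (Cmod (index_sum g F) <= M * (len g * t / (1 - t)))%R.
Proof.
  intros Ht H. rewrite index_sum_letters.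
  eapply Rle_trans; [apply (Cseries_bound t (len g * M * t)); auto; apply gbnd_geo; auto; lra|].
  right; field; lra.
Qed.

Lemma index_sum_opp_index g F :
  index_sum g (fun i => F ((- fst i)%Z, snd i)) = index_sum g F.
Proof.
  rewrite !index_sum_letters. apply Cseries_ext; intros k. simpl.
  apply (csum_letters_opp g (fun a => F (a, S k))).
Qed.

Lemma len_ge0 g : (0 <= len g)%R.
Proof. apply pos_INR. Qed.

Lemma index_sum_fubini g t t' M (F : index -> index -> C) :
  (0 <= t < 1)%R -> (0 <= t' < 1)%R -> (0 <= M)%R ->
  (forall i j, is_index g i -> is_index g j -> (Cmod (F i j) <= M * t ^ snd i * t' ^ snd j)%R) ->
  index_sum g (fun i => index_sum g (fun j => F i j)) =
  index_sum g (fun j => index_sum g (fun i => F i j)).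
Proof.
  intros Ht Ht' HM H.
  assert (E : forall G : index -> index -> C, forall t t', (0 <= t < 1)%R -> (0 <= t' < 1)%R ->
    (forall i j, is_index g i -> is_index g j -> (Cmod (G i j) <= M * t ^ snd i * t' ^ snd j)%R) ->
    index_sum g (fun i => index_sum g (fun j => G i j)) =
    Cseries (fun k => Cseries (fun l => csum (letters g) (fun a => csum (letters g) (fun b => G (a, S k) (b, S l)))))).
  { clear. intros G t t' Ht Ht' H. rewrite index_sum_letters. apply Cseries_ext; intros k.
    rewrite (Cseries_csum (letters g) t' (fun _ => len g * (M * t ^ S k) * t')%R); auto.
    - apply csum_ext; intros a _. apply index_sum_letters.
    - intros a Ha. apply (gbnd_geo g t' (M * t ^ S k) (fun j => G (a, S k) j)); [lra|].
      intros j Hj. apply (H (a, S k) j); auto. apply is_index_letters; auto. }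
  rewrite (E F t t') by auto.
  rewrite (E (fun j i => F i j) t' t); auto.
  2:{ intros i j Hi Hj. eapply Rle_trans; [apply H; auto|]. right; ring. }
  rewrite (Cseries_fubini t t' (len g * len g * M)); auto.
  - apply Cseries_ext; intros l. apply Cseries_ext; intros k. apply csum_swap.
  - intros k l. eapply Rle_trans; [apply Cmod_csum|].
    eapply Rle_trans; [apply (rsum_le _ _ (fun _ => len g * (M * t ^ k * t' ^ l))%R)|].
    + intros a Ha. eapply Rle_trans; [apply Cmod_csum|].
      eapply Rle_trans; [apply (rsum_le _ _ (fun _ => M * t ^ k * t' ^ l)%R)|rewrite rsum_const; unfold len; lra].
      intros b Hb. eapply Rle_trans; [apply H; apply is_index_letters; auto|]. simpl.
      assert (0 <= t ^ k)%R by (apply pow_le; lra). assert (0 <= t' ^ l)%R by (apply pow_le; lra).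
      assert (t * t ^ k <= t ^ k)%R by nra. assert (t' * t' ^ l <= t' ^ l)%R by nra.
      replace (M * (t * t ^ k) * (t' * t' ^ l))%R with (M * ((t * t ^ k) * (t' * t' ^ l)))%R by ring.
      replace (M * t ^ k * t' ^ l)%R with (M * (t ^ k * t' ^ l))%R by ring.
      apply Rmult_le_compat_l; auto.
      apply Rmult_le_compat; auto; apply Rmult_le_pos; lra.
    + rewrite rsum_const. unfold len. right; ring.
Qed.

Lemma Cseries_index_sum g q t M (F : nat -> index -> C) :
  (0 <= q < 1)%R -> (0 <= t < 1)%R ->
  (forall n i, is_index g i -> (Cmod (F n i) <= M * q ^ n * t ^ snd i)%R) ->
  Cseries (fun n => index_sum g (F n)) = index_sum g (fun i => Cseries (fun n => F n i)).
Proof.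
  intros Hq Ht H.
  assert (HG : forall n, gbnd g t (M * q ^ n) (F n)) by (intros n i Hi; apply H; auto).
  rewrite index_sum_letters.
  rewrite (Cseries_ext _ (fun n => Cseries (fun k => csum (letters g) (fun a => F n (a, S k))))).
  2:{ intros n. apply index_sum_letters. }
  rewrite (Cseries_fubini q t (len g * M * t)); auto.
  - apply Cseries_ext; intros k.
    apply (Cseries_csum (letters g) q (fun _ => M * t ^ S k)%R); auto.
    intros a Ha n. eapply Rle_trans; [apply H, is_index_letters; auto|]. simpl; right; ring.
  - intros n k. eapply Rle_trans; [apply (gbnd_geo g t (M * q ^ n) (F n)); [lra|auto]|].
    right; ring.
Qed.

Lemma gbnd_summable g t M F : (0 <= t < 1)%R -> gbnd g t M F -> index_summable g F.
Proof.
  intros Ht H. unfold index_summable.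
  apply (ex_series_le (K := R_AbsRing) (V := R_CompleteNormedModule) _ (fun k => len g * M * t * t ^ k)%R).
  - intros k.
    replace (sum_n_m _ 1 g) with (rsum (letters g) (fun a => Cmod (F (a, S k)))).
    + unfold norm; simpl. unfold abs; simpl. rewrite Rabs_pos_eq by (apply rsum_ge0; intros; apply Cmod_ge_0).
      eapply Rle_trans; [apply (rsum_le _ _ (fun _ => M * t ^ S k)%R)|].
      * intros a Ha. apply (H (a, S k)), is_index_letters; auto.
      * rewrite rsum_const. unfold len. simpl. right; ring.
    + unfold letters. rewrite rsum_flat_map. clear. induction g as [|g IH].
      * rewrite sum_n_m_zero by lia. reflexivity.
      * rewrite seq_S, rsum_app, IH, sum_n_Sm by lia. simpl rsum. unfold plus; simpl.
        replace (1 + g)%nat with (S g) by lia. ring.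
  - apply (ex_series_scal (K := R_AbsRing) (V := R_NormedModule) (len g * M * t)%R (fun k => t ^ k)%R).
    apply ex_series_pow; auto.
Qed.

(** The entry bound makes sums over an index converge absolutely; the bound on truncations carries
    the operator norm, and t^4 is the square of the norm t^2. With finite truncations only,
    square-summable sequences need not be introduced. *)
Definition contractive (g : nat) (A : mat) (t : R) : Prop :=
  (0 < t < 1)%R /\
  (forall i j, is_index g i -> is_index g j -> (Cmod (A i j) <= t ^ snd i * t ^ snd j)%R) /\
  (forall K (u : vec),
    (rsum (trunc g K) (fun j => Cmod (csum (trunc g K) (fun i => u i * A i j)%C) ^ 2)
     <= t ^ 4 * rsum (trunc g K) (fun i => Cmod (u i) ^ 2))%R).

Lemma In_trunc g K i : In i (trunc g K) <-> is_index g i /\ (snd i <= K)%nat.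
Proof.
  destruct i as [a k]. unfold trunc, index in *. rewrite in_prod_iff, In_letters, in_seq.
  unfold is_index; simpl. intuition lia.
Qed.

Lemma NoDup_list_prod {T U} (l : list T) (l' : list U) :
  NoDup l -> NoDup l' -> NoDup (list_prod l l').
Proof.
  intros Hl Hl'. induction Hl as [|i l Hi Hl IH]; simpl; [constructor|].
  apply NoDup_app; auto.
  - apply NoDup_map_NoDup_ForallPairs; auto. intros x y _ _ E; congruence.
  - intros [x y] H1 H2. apply in_map_iff in H1. destruct H1 as (z & E & _).
    apply in_prod_iff in H2. destruct H2 as [H2 _]. congruence.
Qed.

Lemma NoDup_trunc g K : NoDup (trunc g K).
Proof.
  apply NoDup_list_prod; [apply NoDup_letters|apply seq_NoDup].
Qed.

Lemma cconv_Cmod u s : cconv u s -> is_lim_seq (fun n => Cmod (u n)) (Cmod s).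
Proof.
  intros H. apply is_lim_seq_spec. intros eps. destruct (H eps (cond_pos eps)) as [N HN].
  exists N; intros n Hn. eapply Rle_lt_trans; [|apply (HN n Hn)].
  pose proof (Cmod_minus_ge (u n) s). pose proof (Cmod_minus_ge s (u n)).
  replace (s - u n) with (- (u n - s)) in H1 by ring. rewrite Cmod_opp in H1.
  apply Rabs_le; lra.
Qed.

Lemma rsum_trunc_mono g K K' F : (K <= K')%nat -> (forall i, (0 <= F i)%R) ->
  (rsum (trunc g K) F <= rsum (trunc g K') F)%R.
Proof.
  intros HK HF. unfold trunc, index in *. rewrite !rsum_list_prod. apply rsum_le; intros a _.
  replace K' with (K + (K' - K))%nat by lia. rewrite seq_app, rsum_app.
  match goal with |- (_ <= _ + ?b)%R => enough (0 <= b)%R by lra end.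
  apply rsum_ge0; auto.
Qed.

(** The inequality for finite truncations passes to the limit in the inner sum while the outer
    truncation stays fixed. Applied to the rows of successive powers, it yields their geometric
    decay. *)
Lemma row_l2_step g A t B (u : vec) : contractive g A t -> (0 <= B)%R ->
  (forall K, (rsum (trunc g K) (fun i => Cmod (u i) ^ 2) <= B ^ 2)%R) ->
  (forall i, is_index g i -> (Cmod (u i) <= B)%R) /\
  (forall K, (rsum (trunc g K) (fun j => Cmod (index_sum g (fun i => u i * A i j)%C) ^ 2) <= (t ^ 2 * B) ^ 2)%R).
Proof.
  intros (Ht & HA & HC) HB Hu.
  assert (Hub : forall i, is_index g i -> (Cmod (u i) <= B)%R).
  { intros i Hi. specialize (Hu (snd i)).
    assert (Cmod (u i) ^ 2 <= B ^ 2)%R.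
    { eapply Rle_trans; [|exact Hu]. apply (rsum_ge_term _ (fun i => Cmod (u i) ^ 2)%R).
      intros; apply pow2_ge_0. apply In_trunc; auto. }
    pose proof (Cmod_ge_0 (u i)). apply Rnot_lt_le; intros Hlt. nra. }
  split; auto. intros K.
  assert (HL : is_lim_seq (fun K' => rsum (trunc g K) (fun j => Cmod (csum (trunc g K') (fun i => u i * A i j)%C) ^ 2)%R)
     (rsum (trunc g K) (fun j => Cmod (index_sum g (fun i => u i * A i j)%C) ^ 2)%R)).
  { apply (is_lim_rsum (trunc g K) (fun j K' => Cmod (csum (trunc g K') (fun i => u i * A i j)%C) ^ 2)%R).
    intros j Hj. apply In_trunc in Hj.
    assert (H1 : is_lim_seq (fun K' => Cmod (csum (trunc g K') (fun i => u i * A i j)%C)) (Cmod (index_sum g (fun i => u i * A i j)%C))).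
    { apply (cconv_Cmod (fun K' => csum (trunc g K') (fun i => u i * A i j))).
      apply (index_sum_conv g t B); [lra|]. intros i Hi. rewrite Cmod_mult.
      apply Rmult_le_compat; try apply Cmod_ge_0; auto.
      eapply Rle_trans; [apply HA; tauto|]. rewrite <- (Rmult_1_r (t ^ snd i)) at 2.
      apply Rmult_le_compat_l; [apply pow_le; lra|]. rewrite <- (pow1 (snd j)). apply pow_incr; lra. }
    simpl. eapply is_lim_seq_ext; [intros n; symmetry; rewrite Rmult_1_r; reflexivity|].
    rewrite Rmult_1_r. apply is_lim_seq_mult'; exact H1. }
  apply (is_lim_seq_le_loc _ (fun _ => (t ^ 2 * B) ^ 2)%R _ _) with (2 := HL) (3 := is_lim_seq_const _).
  (* From K' >= K on, the outer truncation may be enlarged to K', where [contractive] has the same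
     truncation on both sides. *)
  exists K; intros K' HK'.
  apply Rle_trans with (rsum (trunc g K') (fun j => Cmod (csum (trunc g K') (fun i => u i * A i j)%C) ^ 2))%R.
  - apply rsum_trunc_mono; [lia|]. intros; apply pow2_ge_0.
  - eapply Rle_trans; [apply HC|].
    replace ((t ^ 2 * B) ^ 2)%R with (t ^ 4 * B ^ 2)%R by ring.
    apply Rmult_le_compat_l; [apply pow_le; lra|apply Hu].
Qed.

Lemma mat_one_l2 g i : is_index g i ->
  forall K, (rsum (trunc g K) (fun j => Cmod (mat_one i j) ^ 2) <= 1 ^ 2)%R.
Proof.
  intros Hi K. destruct (classic (In i (trunc g K))) as [H|H].
  - right. etransitivity; [apply (rsum_single _ i)|].
    + apply NoDup_trunc.
    + exact H.
    + intros j _ Hj. simpl. unfold mat_one. destruct (index_eq_dec i j); [congruence|].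
      rewrite Cmod_0; ring.
    + simpl. unfold mat_one. destruct (index_eq_dec i i); [|congruence]. rewrite Cmod_1; ring.
  - rewrite (rsum_ext _ _ (fun _ => 0%R)); [rewrite rsum_const; lra|].
    intros j Hj. unfold mat_one. destruct (index_eq_dec i j); [congruence|]. rewrite Cmod_0; ring.
Qed.

Lemma mat_pow_l2 g A t i n : contractive g A t -> is_index g i ->
  forall K, (rsum (trunc g K) (fun j => Cmod (mat_pow g A n i j) ^ 2) <= ((t ^ 2) ^ n) ^ 2)%R.
Proof.
  intros HA Hi. induction n as [|n IH].
  - apply mat_one_l2; auto.
  - change ((t ^ 2) ^ S n)%R with (t ^ 2 * (t ^ 2) ^ n)%R.
    apply (row_l2_step g A t ((t ^ 2) ^ n) (mat_pow g A n i) HA).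
    + destruct HA as [Ht _]. apply pow_le, pow_le; lra.
    + apply IH.
Qed.

(** An entry is at most the square norm of its row. The decay in n comes from the operator norm and
    not from the sizes of the entries of A. *)
Lemma mat_pow_bound g A t i j n : contractive g A t -> is_index g i -> is_index g j ->
  (Cmod (mat_pow g A n i j) <= (t ^ 2) ^ n)%R.
Proof.
  intros HA Hi Hj. apply (row_l2_step g A t ((t ^ 2) ^ n) (mat_pow g A n i) HA); auto.
  - destruct HA as [Ht _]. apply pow_le, pow_le; lra.
  - apply mat_pow_l2; auto.
Qed.

Lemma contractive_q g A t : contractive g A t -> (0 <= t ^ 2 < 1)%R.
Proof. intros [Ht _]. simpl. nra. Qed.

Lemma contractive_col g A t i j : contractive g A t -> is_index g i -> is_index g j ->
  (Cmod (A i j) <= t ^ snd i)%R /\ (Cmod (A i j) <= t ^ snd j)%R.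
Proof.
  intros (Ht & HA & _) Hi Hj. pose proof (HA i j Hi Hj) as H.
  assert (H1 : forall n, (0 <= t ^ n <= 1)%R).
  { intros n; split; [apply pow_le; lra|]. rewrite <- (pow1 n). apply pow_incr; lra. }
  pose proof (H1 (snd i)). pose proof (H1 (snd j)). split; nra.
Qed.

Lemma contractive_neumann g A t : contractive g A t -> neumann_converges g A.
Proof.
  intros HA i j Hi Hj. pose proof (contractive_q _ _ _ HA) as Hq. split.
  - intros n. apply (gbnd_summable g t 1); [destruct HA; lra|]. intros k Hk.
    rewrite Cmod_mult, Rmult_1_l. rewrite <- (Rmult_1_l (t ^ snd k)).
    apply Rmult_le_compat; try apply Cmod_ge_0.
    + eapply Rle_trans; [apply (mat_pow_bound g A t i k n); auto|].
      rewrite <- (pow1 n). apply pow_incr; lra.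
    + apply (contractive_col g A t k j); auto.
  - apply (geo_ex_Cmod (t ^ 2) 1); auto. intros n. rewrite Rmult_1_l. apply mat_pow_bound; auto.
Qed.

(** The entries are bounded but need not decay in the indices, because of the identity term; in
    every sum containing the inverse the decay is supplied by the vectors beside it. *)
Lemma neumann_bound g A t i j : contractive g A t -> is_index g i -> is_index g j ->
  (Cmod (neumann_inverse g A i j) <= / (1 - t ^ 2))%R.
Proof.
  intros HA Hi Hj. eapply Rle_trans; [apply (Cseries_bound (t ^ 2) 1)|].
  - apply (contractive_q _ _ _ HA).
  - intros n. rewrite Rmult_1_l. apply mat_pow_bound; auto.
  - lra.
Qed.

Lemma Cseries_telescope (e : nat -> C) q M : (0 <= q < 1)%R -> geo q M e ->
  Cseries (fun n => e n - e (S n)) = e O.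
Proof.
  intros Hq He. apply Cseries_unique. intros eps Heps.
  destruct (geo_small q M eps Hq Heps) as [N0 HN0]. exists N0; intros N HN.
  assert (E : csumn N (fun n => e n - e (S n)) = e O - e N).
  { clear. induction N as [|N IH]; [unfold csumn; simpl; ring|]. rewrite csumn_S, IH; ring. }
  rewrite E. replace (e O - e N - e O) with (- e N) by ring. rewrite Cmod_opp.
  eapply Rle_lt_trans; [apply He|apply HN0; auto].
Qed.

Lemma Cmod_mult_le a b x y : (Cmod a <= x)%R -> (Cmod b <= y)%R -> (Cmod (a * b) <= x * y)%R.
Proof. intros. rewrite Cmod_mult. apply Rmult_le_compat; auto; apply Cmod_ge_0. Qed.

Lemma gbnd_M_pos g t M u : (0 < t)%R -> gbnd g t M u -> (exists i, is_index g i) -> (0 <= M)%R.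
Proof.
  intros Ht H [i Hi]. specialize (H i Hi). pose proof (Cmod_ge_0 (u i)).
  assert (0 < t ^ snd i)%R by (apply pow_lt; auto).
  apply Rnot_lt_le; intros Hn. nra.
Qed.

Lemma index_sum_single g i F : is_index g i ->
  (forall j, j <> i -> F j = RtoC 0) -> index_sum g F = F i.
Proof.
  intros Hi HF. rewrite index_sum_letters. apply Cseries_unique.
  intros eps Heps. exists (snd i). intros N HN. cbv beta. rewrite <- csum_trunc.
  rewrite (csum_single _ i); auto.
  - replace (F i - F i) with (RtoC 0) by ring. rewrite Cmod_0; auto.
  - apply NoDup_trunc.
  - apply In_trunc; auto.
Qed.

(** Applying A^n to Y = R + A Y gives A^n R = A^n Y - A^(n+1) Y. The sum over n telescopes to Y
    because A^n Y tends to 0 geometrically. *)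
Lemma neumann_column g A t M (Y Rv : vec) : contractive g A t -> gbnd g t M Y -> gbnd g t M Rv ->
  (forall i, is_index g i -> Y i = Rv i + index_sum g (fun j => A i j * Y j)) ->
  forall i, is_index g i -> index_sum g (fun j => neumann_inverse g A i j * Rv j) = Y i.
Proof.
  intros HA HY HR HE i Hi. pose proof (contractive_q _ _ _ HA) as Hq.
  pose proof HA as (Ht & HAb & _).
  assert (HM : (0 <= M)%R) by (apply (gbnd_M_pos g t M Y); eauto; lra).
  set (e := fun n => index_sum g (fun j => mat_pow g A n i j * Y j)).
  assert (Hpb : forall n u, gbnd g t M u -> gbnd g t (M * (t ^ 2) ^ n) (fun j => mat_pow g A n i j * u j)).
  { intros n u Hu j Hj. replace (M * (t ^ 2) ^ n * t ^ snd j)%R with ((t ^ 2) ^ n * (M * t ^ snd j))%R by ring.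
    apply Cmod_mult_le; [apply mat_pow_bound; auto | apply Hu; auto]. }
  assert (Hstep : forall n, index_sum g (fun j => mat_pow g A n i j * Rv j) = e n - e (S n)).
  { intros n. unfold e at 2. simpl mat_pow. unfold mat_mul.
    assert (Hb3 : forall j k, is_index g j -> is_index g k ->
       (Cmod (mat_pow g A n i k * A k j * Y j) <= M * t ^ snd j * t ^ snd k)%R).
    { intros j k Hj Hk. replace (M * t ^ snd j * t ^ snd k)%R with (1 * t ^ snd k * (M * t ^ snd j))%R by ring.
      apply Cmod_mult_le; [apply Cmod_mult_le|apply HY; auto].
      - eapply Rle_trans; [apply mat_pow_bound; eauto|]. rewrite <- (pow1 n). apply pow_incr; lra.
      - apply (contractive_col g A t k j); auto. }
    rewrite (index_sum_ext g (fun j => index_sum g (fun k => mat_pow g A n i k * A k j) * Y j)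
      (fun j => index_sum g (fun k => mat_pow g A n i k * A k j * Y j))).
    2:{ intros j Hj. rewrite Cmult_comm, <- (index_sum_scal g t 1); [|lra|].
        - apply index_sum_ext; intros; ring.
        - intros k Hk. apply Cmod_mult_le.
          + eapply Rle_trans; [apply mat_pow_bound; eauto|]. rewrite <- (pow1 n). apply pow_incr; lra.
          + apply (contractive_col g A t k j); auto. }
    rewrite (index_sum_fubini g t t M) by (auto; lra).
    unfold e. rewrite <- (index_sum_minus g t (M * (t ^ 2) ^ n) _ t (len g * t / (1 - t) * M * (t ^ 2) ^ n)); try lra; auto.
    - apply index_sum_ext; intros k Hk. rewrite (HE k Hk).
      replace (index_sum g (fun j => mat_pow g A n i k * A k j * Y j)) with
        (mat_pow g A n i k * index_sum g (fun j => A k j * Y j)); [ring|].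
      rewrite <- (index_sum_scal g t (M)); [|lra|].
      + apply index_sum_ext; intros; ring.
      + intros j Hj. rewrite <- (Rmult_1_l (M * _)%R). apply Cmod_mult_le; [|apply HY; auto].
        eapply Rle_trans; [apply (proj1 (contractive_col g A t k j HA Hk Hj))|].
        rewrite <- (pow1 (snd k)). apply pow_incr; lra.
    - intros k Hk. eapply Rle_trans; [apply (index_sum_bound g t (M * (t ^ 2) ^ n * t ^ snd k)); [lra|]|].
      + intros j Hj. replace (M * (t ^ 2) ^ n * t ^ snd k * t ^ snd j)%R with ((t ^ 2) ^ n * t ^ snd k * (M * t ^ snd j))%R by ring.
        apply Cmod_mult_le; [apply Cmod_mult_le|apply HY; auto].
        apply mat_pow_bound; auto. apply (contractive_col g A t k j); auto.
      + right; ring. }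
  transitivity (Cseries (fun n => index_sum g (fun j => mat_pow g A n i j * Rv j))).
  - rewrite (Cseries_index_sum g (t ^ 2) t M); auto; [|lra|].
    + apply index_sum_ext; intros j Hj. unfold neumann_inverse.
      rewrite Cmult_comm, <- (Cseries_scal (t ^ 2) 1); auto.
      * apply Cseries_ext; intros; ring.
      * intros n. rewrite Rmult_1_l. apply mat_pow_bound; auto.
    + intros n j Hj. apply (Hpb n Rv HR j Hj).
  - rewrite (Cseries_ext _ _ Hstep), (Cseries_telescope e (t ^ 2) (M * (len g * t / (1 - t)))); auto.
    + unfold e. rewrite (index_sum_single g i); auto.
      * simpl. unfold mat_one. destruct (index_eq_dec i i); [ring|congruence].
      * intros j Hj. simpl. unfold mat_one. destruct (index_eq_dec i j); [congruence|ring].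
    + intros n. eapply Rle_trans; [apply (index_sum_bound g t (M * (t ^ 2) ^ n)); [lra|apply Hpb; auto]|].
      right; ring.
Qed.

(** The transposed telescoping argument. Since [mat_pow] multiplies by A on the right, the identity
    L A^n = Y A^n - Y A^(n+1) is proved by induction on n for all columns at once, with [Hrec] as
    the step. *)
Lemma neumann_row g A t M (Y Lv : vec) : contractive g A t -> gbnd g t M Y -> gbnd g t M Lv ->
  (forall j, is_index g j -> Y j = Lv j + index_sum g (fun i => Y i * A i j)) ->
  forall j, is_index g j -> index_sum g (fun i => Lv i * neumann_inverse g A i j) = Y j.
Proof.
  intros HA HY HL HE j Hj. pose proof (contractive_q _ _ _ HA) as Hq.
  pose proof HA as (Ht & HAb & _).
  assert (HM : (0 <= M)%R) by (apply (gbnd_M_pos g t M Y); eauto; lra).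
  set (e := fun n j => index_sum g (fun i => Y i * mat_pow g A n i j)).
  assert (Hpb : forall n u j, is_index g j -> gbnd g t M u -> gbnd g t (M * (t ^ 2) ^ n) (fun i => u i * mat_pow g A n i j)).
  { intros n u k Hk Hu i Hi. replace (M * (t ^ 2) ^ n * t ^ snd i)%R with ((M * t ^ snd i) * (t ^ 2) ^ n)%R by ring.
    apply Cmod_mult_le; [apply Hu; auto | apply mat_pow_bound; auto]. }
  assert (Hrec : forall n u j, is_index g j -> gbnd g t M u ->
     index_sum g (fun i => u i * mat_pow g A (S n) i j) =
     index_sum g (fun k => index_sum g (fun i => u i * mat_pow g A n i k) * A k j)).
  { intros n u j' Hj' Hu. simpl mat_pow. unfold mat_mul.
    transitivity (index_sum g (fun i => index_sum g (fun k => u i * (mat_pow g A n i k * A k j')))).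
    - apply index_sum_ext; intros i Hi. rewrite (index_sum_scal g t 1); [auto|lra|].
      intros k Hk. apply Cmod_mult_le.
      + eapply Rle_trans; [apply mat_pow_bound; eauto|]. rewrite <- (pow1 n). apply pow_incr; lra.
      + apply (contractive_col g A t k j'); auto.
    - rewrite (index_sum_fubini g t t M); try lra.
      + apply index_sum_ext; intros k Hk. rewrite Cmult_comm.
        rewrite <- (index_sum_scal g t (M * (t ^ 2) ^ n)); [|lra|auto].
        apply index_sum_ext; intros; ring.
      + intros i k Hi Hk. rewrite Rmult_assoc.
        replace (M * (t ^ snd i * t ^ snd k))%R with ((M * t ^ snd i) * (1 * t ^ snd k))%R by ring.
        apply Cmod_mult_le; [apply Hu; auto|]. apply Cmod_mult_le.
        * eapply Rle_trans; [apply mat_pow_bound; eauto|]. rewrite <- (pow1 n). apply pow_incr; lra.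
        * apply (contractive_col g A t k j'); auto. }
  assert (Heb : forall n j, is_index g j -> (Cmod (e n j) <= M * (len g * t / (1 - t)) * (t ^ 2) ^ n)%R).
  { intros n k Hk. eapply Rle_trans; [apply (index_sum_bound g t (M * (t ^ 2) ^ n)); [lra|apply Hpb; auto]|].
    right; ring. }
  assert (Hone : forall u j, is_index g j -> index_sum g (fun i => u i * mat_pow g A 0 i j) = u j).
  { intros u k Hk. rewrite (index_sum_single g k); auto.
    - simpl. unfold mat_one. destruct (index_eq_dec k k); [ring|congruence].
    - intros i Hi. simpl. unfold mat_one. destruct (index_eq_dec i k); [congruence|ring]. }
  set (Cc := (M * (len g * t / (1 - t)))%R).
  assert (HC : (0 <= Cc)%R).
  { unfold Cc. apply Rmult_le_pos; auto. apply Rmult_le_pos; [apply Rmult_le_pos; [apply len_ge0|lra]|].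
    left; apply Rinv_0_lt_compat; lra. }
  assert (Hg : forall n j, is_index g j -> gbnd g t Cc (fun k => e n k * A k j)).
  { intros n k Hk i Hi. apply Cmod_mult_le; [|apply (contractive_col g A t i k); auto].
    eapply Rle_trans; [apply Heb; auto|]. fold Cc. rewrite <- (Rmult_1_r Cc) at 2.
    apply Rmult_le_compat_l; auto. rewrite <- (pow1 n). apply pow_incr; lra. }
  assert (Hstep : forall n j, is_index g j -> index_sum g (fun i => Lv i * mat_pow g A n i j) = e n j - e (S n) j).
  { induction n as [|n IH]; intros k Hk.
    - unfold e. rewrite (Hrec 0%nat Y k Hk HY), !Hone by auto.
      rewrite (HE k Hk) at 1.
      replace (index_sum g (fun k0 => index_sum g (fun i => Y i * mat_pow g A 0 i k0) * A k0 k))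
        with (index_sum g (fun i => Y i * A i k)); [ring|].
      apply index_sum_ext; intros i Hi. rewrite Hone by auto. auto.
    - rewrite (Hrec n Lv k Hk HL). unfold e. rewrite (Hrec n Y k Hk HY), (Hrec (S n) Y k Hk HY).
      rewrite <- (index_sum_minus g t Cc _ t Cc); try lra.
      + apply index_sum_ext; intros i Hi. rewrite IH by auto. unfold e. ring.
      + apply Hg; auto.
      + apply (Hg (S n)); auto. }
  transitivity (Cseries (fun n => index_sum g (fun i => Lv i * mat_pow g A n i j))).
  - rewrite (Cseries_index_sum g (t ^ 2) t M); auto; [|lra|].
    + apply index_sum_ext; intros i Hi. unfold neumann_inverse.
      rewrite <- (Cseries_scal (t ^ 2) 1); auto.
      intros n. rewrite Rmult_1_l. apply mat_pow_bound; auto.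
    + intros n i Hi. apply (Hpb n Lv j Hj HL i Hi).
  - rewrite (Cseries_ext _ _ (fun n => Hstep n j Hj)).
    rewrite (Cseries_telescope (fun n => e n j) (t ^ 2) Cc); auto.
    + apply Hone; auto.
    + intros n. apply Heb; auto.
Qed.

(** Associativity: [sandwich] multiplies by the row vector first, whereas the linear system
    determines the inverse times the column vector. *)
Lemma sandwich_conv g A t M (u v : vec) : contractive g A t -> gbnd g t M u -> gbnd g t M v ->
  sandwich_converges g u (neumann_inverse g A) v /\
  sandwich g u (neumann_inverse g A) v = index_sum g (fun i => u i * index_sum g (fun j => neumann_inverse g A i j * v j)).
Proof.
  intros HA Hu Hv. pose proof HA as (Ht & _ & _). pose proof (contractive_q _ _ _ HA) as Hq.
  set (c := (/ (1 - t ^ 2))%R). assert (Hc : (0 < c)%R) by (apply Rinv_0_lt_compat; lra).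
  assert (H1 : forall j, is_index g j -> gbnd g t (M * c) (fun i => u i * neumann_inverse g A i j)).
  { intros j Hj i Hi. replace (M * c * t ^ snd i)%R with (M * t ^ snd i * c)%R by ring.
    apply Cmod_mult_le; [apply Hu; auto|apply neumann_bound; auto]. }
  split; [split|].
  - intros j Hj. eapply gbnd_summable; [|apply H1; auto]. lra.
  - apply (gbnd_summable g t ((M * c) * (len g * t / (1 - t)) * M)); [lra|]. intros j Hj.
    rewrite Rmult_assoc. apply Cmod_mult_le; [|apply Hv; auto].
    apply index_sum_bound; [lra|auto].
  - destruct (classic (exists i, is_index g i)) as [He|He].
    2:{ unfold sandwich. rewrite !index_sum_letters. apply Cseries_ext; intros k. apply csum_ext.
        intros a Ha. exfalso; apply He. exists (a, S k). apply is_index_letters; auto. }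
    assert (HM : (0 <= M)%R) by (apply (gbnd_M_pos g t M u); auto; lra).
    unfold sandwich, vec_mat.
    transitivity (index_sum g (fun j => index_sum g (fun i => u i * neumann_inverse g A i j * v j))).
    + apply index_sum_ext; intros j Hj. rewrite Cmult_comm, <- (index_sum_scal g t (M * c)); [|lra|auto].
      apply index_sum_ext; intros; ring.
    + rewrite (index_sum_fubini g t t (M * c * M)); try lra.
      * apply index_sum_ext; intros i Hi. rewrite <- (index_sum_scal g t (c * M)); [|lra|].
        -- apply index_sum_ext; intros; ring.
        -- intros j Hj. rewrite Rmult_assoc. apply Cmod_mult_le; [apply neumann_bound; auto|apply Hv; auto].
      * apply Rmult_le_pos; auto. apply Rmult_le_pos; lra.
      * intros j i Hj Hi.
        replace (M * c * M * t ^ snd j * t ^ snd i)%R with (M * c * t ^ snd i * (M * t ^ snd j))%R by ring.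
        apply Cmod_mult_le; [apply H1; auto|apply Hv; auto].
Qed.

(** The entry bound comes from the operator bound: with rho replaced by t^2 rho the circles are
    still disjoint, the contraction with factor 1 applied to a unit vector bounds each entry of the
    new matrix by 1, and that entry is t^(m+l) times the old one. *)
Lemma A_contractive g w rho s t : in_Schottky_domain g w rho -> is_sqrt_choice g rho s ->
  (1 < t)%R ->
  (forall a b, is_letter g a -> is_letter g b -> a <> b ->
     (Cmod (w a - w b) > t * radius rho a + t * radius rho b)%R) ->
  contractive g (A_mat w s) (/ t).
Proof.
  intros Hw Hs Ht Hd.
  assert (Hti : (0 < / t < 1)%R).
  { split; [apply Rinv_0_lt_compat; lra|]. rewrite <- Rinv_1. apply Rinv_lt_contravar; lra. }
  split; [exact Hti|split].
  2:{ apply (A_row_contraction g w rho s t Hw Hs ltac:(lra) Hd). }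
  intros [a m] [b l] Hi Hj. simpl snd.
  set (rho' := fun a => RtoC (t * t) * rho a). set (s' := fun a => RtoC t * s a).
  assert (Hrad : forall a, radius rho' a = (t * radius rho a)%R).
  { intros c. unfold radius, rho'. rewrite Cmod_mult, Cmod_R, Rabs_pos_eq by nra.
    rewrite sqrt_mult by (try nra; apply Cmod_ge_0). rewrite sqrt_square by lra. auto. }
  assert (Hw' : in_Schottky_domain g w rho').
  { destruct Hw as [H1 H2]. split.
    - intros c Hc. destruct (H1 c Hc) as [H3 H4]. unfold rho'. split; [|rewrite H4; auto].
      apply Cmult_neq_0; auto. apply RtoC_neq0; nra.
    - intros c d Hc Hd' Hcd. rewrite !Hrad. apply Hd; auto. }
  assert (Hs' : is_sqrt_choice g rho' s').
  { intros c Hc. destruct (Hs c Hc) as [E1 E2]. unfold s', rho'. split; [|rewrite E2; auto].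
    rewrite RtoC_mult, <- E1. ring. }
  pose proof (A_row_contraction g w rho' s' 1 Hw' Hs' ltac:(lra)
    ltac:(intros c d Hc Hd' Hcd; rewrite !Rmult_1_l, !Hrad; apply Hd; auto) (m + l) (mat_one (a, m))) as HC.
  assert (Hin1 : In (a, m) (trunc g (m + l))) by (apply In_trunc; simpl; split; [auto|lia]).
  assert (Hin2 : In (b, l) (trunc g (m + l))) by (apply In_trunc; simpl; split; [auto|lia]).
  assert (H1 : (Cmod (A_mat w s' (a, m) (b, l)) <= 1)%R).
  { assert (H2 : (Cmod (A_mat w s' (a, m) (b, l)) ^ 2 <= 1)%R).
    { eapply Rle_trans; [|eapply Rle_trans; [exact HC|]].
      - eapply Rle_trans; [|apply (rsum_ge_term _ (fun j => Cmod (csum (trunc g (m + l)) (fun i => mat_one (a, m) i * A_mat w s' i j)%C) ^ 2)%R _ (fun j _ => pow2_ge_0 _) Hin2)].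
        right. f_equal. f_equal. symmetry. etransitivity; [apply (csum_single _ (a, m))|].
        + apply NoDup_trunc.
        + exact Hin1.
        + intros j _ Hj'. cbv beta. unfold mat_one. destruct (index_eq_dec (a, m) j); [congruence|ring].
        + cbv beta. unfold mat_one at 1. destruct (index_eq_dec (a, m) (a, m)); [|congruence]. apply Cmult_1_l.
      - rewrite Rinv_1, pow1, Rmult_1_l. eapply Rle_trans; [apply mat_one_l2; auto|]. lra. }
    pose proof (Cmod_ge_0 (A_mat w s' (a, m) (b, l))). apply Rnot_lt_le; intros; nra. }
  replace (A_mat w s (a, m) (b, l)) with (RtoC ((/ t) ^ m * (/ t) ^ l) * A_mat w s' (a, m) (b, l)).
  - assert (0 <= (/ t) ^ m * (/ t) ^ l)%R by (apply Rmult_le_pos; apply pow_le; lra).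
    rewrite Cmod_mult, Cmod_R, Rabs_pos_eq by auto.
    rewrite <- (Rmult_1_r ((/ t) ^ m * (/ t) ^ l)) at 2. apply Rmult_le_compat_l; auto.
  - unfold A_mat. destruct (Z.eq_dec a (- b)); [ring|]. unfold s'. rewrite !Cpow_mult_l.
    rewrite RtoC_mult, !RtoC_pow, RtoC_inv, !Cpow_inv by (try apply RtoC_neq0; lra).
    assert (Hp : forall n, RtoC t ^ n * / RtoC t ^ n = 1).
    { intros k. apply Cinv_r, Cpow_nz, RtoC_neq0; lra. }
    unfold Cdiv. match goal with |- _ = ?c * (?x * ?y * ?z) =>
      transitivity ((RtoC t ^ m * / RtoC t ^ m) * (RtoC t ^ l * / RtoC t ^ l) * (c * (x * y * z))); [ring|] end.
    rewrite !Hp. ring.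
Qed.

(** * Complex integrals and derivatives *)

Definition rcont (f : R -> C) (t : R) : Prop :=
  forall eps, (0 < eps)%R -> exists del, (0 < del)%R /\
    forall t', (Rabs (t' - t) < del)%R -> (Cmod (f t' - f t) < eps)%R.

Lemma rcont_continuous f t : rcont f t -> continuous (U := C_UniformSpace) f t.
Proof.
  intros H P [eps HP]. destruct (H eps (cond_pos eps)) as (del & Hd & Hdel).
  exists (mkposreal del Hd). intros t' Ht'. apply HP. specialize (Hdel t' Ht').
  split; (eapply Rle_lt_trans; [|exact Hdel]).
  - exact (re_le_Cmod (f t' - f t)).
  - exact (im_le_Cmod (f t' - f t)).
Qed.

Lemma continuous_rcont f t : continuous (U := C_UniformSpace) f t -> rcont f t.
Proof.
  intros H eps He. assert (He2 : (0 < eps / 2)%R) by lra.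
  destruct (H (fun z => ball (M := C_UniformSpace) (f t) (mkposreal _ He2) z)) as [del Hdel].
  { exists (mkposreal _ He2); auto. }
  exists del; split; [apply cond_pos|]. intros t' Ht'. destruct (Hdel t' Ht') as [H1 H2].
  eapply Rle_lt_trans; [apply Cmod_le_Re_Im|].
  change (Rabs (Re (f t' - f t)) < eps / 2)%R in H1. change (Rabs (Im (f t' - f t)) < eps / 2)%R in H2. lra.
Qed.

Lemma rcont_const c t : rcont (fun _ => c) t.
Proof.
  intros eps He; exists 1%R; split; [lra|]; intros.
  replace (c - c) with (RtoC 0) by ring. rewrite Cmod_0; auto.
Qed.

Lemma rcont_plus f g t : rcont f t -> rcont g t -> rcont (fun s => f s + g s) t.
Proof.
  intros H1 H2 eps He. destruct (H1 (eps / 2)%R) as (d1 & Hd1 & H1'); [lra|].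
  destruct (H2 (eps / 2)%R) as (d2 & Hd2 & H2'); [lra|].
  exists (Rmin d1 d2); split; [apply Rmin_pos; auto|]. intros t' Ht'.
  specialize (H1' t' (Rlt_le_trans _ _ _ Ht' (Rmin_l _ _))).
  specialize (H2' t' (Rlt_le_trans _ _ _ Ht' (Rmin_r _ _))).
  replace (f t' + g t' - (f t + g t)) with ((f t' - f t) + (g t' - g t)) by ring.
  eapply Rle_lt_trans; [apply Cmod_triangle|lra].
Qed.

Lemma rcont_mult f g t : rcont f t -> rcont g t -> rcont (fun s => f s * g s) t.
Proof.
  intros H1 H2 eps He. set (M := (Cmod (f t) + Cmod (g t) + 1)%R).
  pose proof (Cmod_ge_0 (f t)) as P1. pose proof (Cmod_ge_0 (g t)) as P2.
  assert (HM : (0 < M)%R) by (unfold M; lra).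
  set (e := Rmin 1 (eps / (2 * M))).
  assert (Hm : (0 < eps / (2 * M))%R) by (apply Rdiv_lt_0_compat; lra).
  assert (Hep : (0 < e)%R) by (apply Rmin_pos; lra).
  destruct (H1 e Hep) as (d1 & Hd1 & H1'). destruct (H2 e Hep) as (d2 & Hd2 & H2').
  exists (Rmin d1 d2); split; [apply Rmin_pos; auto|]. intros t' Ht'.
  specialize (H1' t' (Rlt_le_trans _ _ _ Ht' (Rmin_l _ _))).
  specialize (H2' t' (Rlt_le_trans _ _ _ Ht' (Rmin_r _ _))).
  replace (f t' * g t' - f t * g t) with ((f t' - f t) * (g t' - g t) + ((f t' - f t) * g t + f t * (g t' - g t))) by ring.
  assert (E1 : (e <= 1)%R) by apply Rmin_l. assert (E2 : (e <= eps / (2 * M))%R) by apply Rmin_r.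
  eapply Rle_lt_trans; [eapply Rle_trans; [apply Cmod_triangle|apply Rplus_le_compat_l, Cmod_triangle]|].
  rewrite !Cmod_mult. pose proof (Cmod_ge_0 (f t' - f t)). pose proof (Cmod_ge_0 (g t' - g t)).
  apply Rle_lt_trans with (e * 1 + (e * Cmod (g t) + Cmod (f t) * e))%R.
  - apply Rplus_le_compat; [apply Rmult_le_compat; lra|]. apply Rplus_le_compat.
    apply Rmult_le_compat_r; lra. apply Rmult_le_compat_l; lra.
  - replace (e * 1 + (e * Cmod (g t) + Cmod (f t) * e))%R with (e * M)%R by (unfold M; ring).
    apply Rle_lt_trans with (eps / (2 * M) * M)%R; [apply Rmult_le_compat_r; lra|].
    replace (eps / (2 * M) * M)%R with (eps / 2)%R by (field; lra). lra.
Qed.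

Definition ccont (f : C -> C) (z : C) : Prop :=
  forall eps, (0 < eps)%R -> exists del, (0 < del)%R /\
    forall z', (Cmod (z' - z) < del)%R -> (Cmod (f z' - f z) < eps)%R.

Lemma rcont_comp f g t : rcont g t -> ccont f (g t) -> rcont (fun s => f (g s)) t.
Proof.
  intros Hg Hf eps He. destruct (Hf eps He) as (d & Hd & H1). destruct (Hg d Hd) as (d' & Hd' & H2).
  exists d'; split; auto.
Qed.

Lemma rcont_ext f g t : (forall s, f s = g s) -> rcont f t -> rcont g t.
Proof.
  intros E H eps He. destruct (H eps He) as (d & Hd & H1). exists d; split; auto.
  intros. rewrite <- !E; auto.
Qed.

Definition Cint (f : R -> C) (a b : R) : C := RInt (V := C_R_CompleteNormedModule) f a b.

Lemma rcont_ex f a b : (a <= b)%R -> (forall t, (a <= t <= b)%R -> rcont f t) ->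
  ex_RInt (V := C_R_CompleteNormedModule) f a b.
Proof.
  intros Hab H. apply ex_RInt_continuous. rewrite Rmin_left, Rmax_right by auto.
  intros z Hz. apply (rcont_continuous f z), H; auto.
Qed.

Lemma is_RInt_C_parts (f : R -> C) a b (l : C) :
  is_RInt (V := C_R_NormedModule) f a b l <->
  is_RInt (fun t => Re (f t)) a b (Re l) /\ is_RInt (fun t => Im (f t)) a b (Im l).
Proof.
  split.
  - intros H. split.
    + apply (is_RInt_fct_extend_fst (U := R_NormedModule) (V := R_NormedModule) f a b l H).
    + apply (is_RInt_fct_extend_snd (U := R_NormedModule) (V := R_NormedModule) f a b l H).
  - intros [H1 H2]. destruct l as [l1 l2].
    apply (is_RInt_fct_extend_pair (U := R_NormedModule) (V := R_NormedModule) f a b l1 l2 H1 H2).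
Qed.

Lemma Cint_correct f a b : (a <= b)%R -> (forall t, (a <= t <= b)%R -> rcont f t) ->
  is_RInt (V := C_R_NormedModule) f a b (Cint f a b).
Proof. intros Hab H. apply (RInt_correct (V := C_R_CompleteNormedModule)), rcont_ex; auto. Qed.

Lemma Cint_unique f a b l : is_RInt (V := C_R_NormedModule) f a b l -> Cint f a b = l.
Proof. apply (is_RInt_unique (V := C_R_CompleteNormedModule)). Qed.

Lemma Cint_ext f g a b : (a <= b)%R -> (forall t, (a <= t <= b)%R -> f t = g t) -> Cint f a b = Cint g a b.
Proof.
  intros Hab H. apply (RInt_ext (V := C_R_CompleteNormedModule)).
  rewrite Rmin_left, Rmax_right by auto. intros; apply H; lra.
Qed.

Lemma Cint_plus f g a b : (a <= b)%R -> (forall t, (a <= t <= b)%R -> rcont f t) ->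
  (forall t, (a <= t <= b)%R -> rcont g t) ->
  Cint (fun t => f t + g t) a b = Cint f a b + Cint g a b.
Proof.
  intros Hab Hf Hg. apply (RInt_plus (V := C_R_CompleteNormedModule)); apply rcont_ex; auto.
Qed.

Lemma Cint_scal c f a b : (a <= b)%R -> (forall t, (a <= t <= b)%R -> rcont f t) ->
  Cint (fun t => c * f t) a b = c * Cint f a b.
Proof.
  intros Hab Hf. apply Cint_unique. pose proof (Cint_correct f a b Hab Hf) as H.
  apply is_RInt_C_parts in H. destruct H as [H1 H2]. apply is_RInt_C_parts. split.
  - rewrite re_mult. eapply is_RInt_ext; [intros; symmetry; apply re_mult|].
    apply (is_RInt_minus (V := R_NormedModule)); apply (is_RInt_scal (V := R_NormedModule)); auto.
  - rewrite im_mult. eapply is_RInt_ext; [intros; symmetry; apply im_mult|].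
    apply (is_RInt_plus (V := R_NormedModule)); apply (is_RInt_scal (V := R_NormedModule)); auto.
Qed.

Lemma rcont_opp f t : rcont f t -> rcont (fun s => - f s) t.
Proof.
  intros H. apply (rcont_ext (fun s => (-1) * f s)); [intros; ring|].
  apply rcont_mult; auto. apply rcont_const.
Qed.

Lemma rcont_minus f g t : rcont f t -> rcont g t -> rcont (fun s => f s - g s) t.
Proof. intros. apply rcont_plus; auto. apply rcont_opp; auto. Qed.

Lemma Cint_minus f g a b : (a <= b)%R -> (forall t, (a <= t <= b)%R -> rcont f t) ->
  (forall t, (a <= t <= b)%R -> rcont g t) ->
  Cint (fun t => f t - g t) a b = Cint f a b - Cint g a b.
Proof.
  intros Hab Hf Hg. transitivity (Cint (fun t => f t + (-1) * g t) a b).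
  - apply Cint_ext; auto. intros; ring.
  - rewrite Cint_plus, Cint_scal; auto. ring.
    intros; apply rcont_mult; auto. apply rcont_const.
Qed.

Lemma Cint_bound f a b M : (a <= b)%R -> (forall t, (a <= t <= b)%R -> rcont f t) ->
  (forall t, (a <= t <= b)%R -> (Cmod (f t) <= M)%R) -> (Cmod (Cint f a b) <= (b - a) * M)%R.
Proof.
  intros Hab Hf HM. pose proof (Cint_correct f a b Hab Hf) as H.
  assert (E : forall z : C, norm (V := C_R_NormedModule) z = Cmod z).
  { intros z. change (sqrt (Rabs (fst z) ^ 2 + Rabs (snd z) ^ 2) = Cmod z).
    rewrite !pow2_abs. reflexivity. }
  rewrite <- E. apply (norm_RInt_le_const (V := C_R_NormedModule) f a b); auto.
  intros. rewrite E; auto.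
Qed.

Lemma Cint_Chasles f a b c : (a <= b)%R -> (b <= c)%R -> (forall t, (a <= t <= c)%R -> rcont f t) ->
  Cint f a c = Cint f a b + Cint f b c.
Proof.
  intros Hab Hbc Hf. symmetry.
  apply (RInt_Chasles (V := C_R_CompleteNormedModule)); apply rcont_ex; auto; intros; apply Hf; lra.
Qed.

Lemma Cint_const c a b : Cint (fun _ => c) a b = RtoC (b - a) * c.
Proof.
  unfold Cint. rewrite (RInt_const (V := C_R_CompleteNormedModule)). apply scal_R_Cmult.
Qed.

Lemma Cint_shift f a b c : (a <= b)%R -> (forall t, (a + c <= t <= b + c)%R -> rcont f t) ->
  Cint (fun t => f (t + c)%R) a b = Cint f (a + c) (b + c).
Proof.
  intros Hab Hf.
  pose proof (RInt_comp_lin (V := C_R_CompleteNormedModule) f 1 c a b) as H.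
  rewrite !Rmult_1_l in H. unfold Cint. rewrite <- H by (apply rcont_ex; auto; lra).
  apply (RInt_ext (V := C_R_CompleteNormedModule)). intros x _.
  rewrite Rmult_1_l. symmetry. etransitivity; [apply (scal_R_Cmult 1)|]. apply Cmult_1_l.
Qed.

Lemma Cint_reflect f a b c : (a <= b)%R -> (forall t, (c - b <= t <= c - a)%R -> rcont f t) ->
  Cint (fun t => f (c - t)%R) a b = Cint f (c - b) (c - a).
Proof.
  intros Hab Hf.
  pose proof (RInt_comp_lin (V := C_R_CompleteNormedModule) f (-1) c a b) as H.
  replace (-1 * a + c)%R with (c - a)%R in H by ring. replace (-1 * b + c)%R with (c - b)%R in H by ring.
  assert (Hex : ex_RInt (V := C_R_CompleteNormedModule) f (c - b) (c - a)) by (apply rcont_ex; auto; lra).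
  specialize (H (ex_RInt_swap _ _ _ Hex)).
  assert (H2 : Cint f (c - b) (c - a) = opp (RInt (V := C_R_CompleteNormedModule) f (c - a) (c - b))).
  { symmetry. apply (opp_RInt_swap (V := C_R_CompleteNormedModule)), ex_RInt_swap, Hex. }
  rewrite H2.
  rewrite <- H. rewrite <- (RInt_opp (V := C_R_CompleteNormedModule)).
  - apply (RInt_ext (V := C_R_CompleteNormedModule)). intros x _.
    replace (-1 * x + c)%R with (c - x)%R by ring.
    change (f (c - x)%R = opp (scal (-1)%R (f (c - x)%R : C_R_ModuleSpace))).
    rewrite (scal_R_Cmult (-1)%R (f (c - x)%R)).
    change (f (c - x)%R = - (RtoC (-1) * f (c - x)%R)). ring.
  - apply (ex_RInt_scal (V := C_R_CompleteNormedModule)).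
    eapply (ex_RInt_ext (V := C_R_CompleteNormedModule)).
    2:{ apply (rcont_ex (fun y => f (-1 * y + c)%R)); auto. intros t Ht.
        intros eps He. destruct (Hf (-1 * t + c)%R ltac:(lra) eps He) as (d & Hd & H').
        exists d; split; auto. intros t' Ht'. apply H'.
        replace (-1 * t' + c - (-1 * t + c))%R with (- (t' - t))%R by ring. rewrite Rabs_Ropp; auto. }
    intros; reflexivity.
Qed.

Lemma Re_Cint f a b : (a <= b)%R -> (forall t, (a <= t <= b)%R -> rcont f t) ->
  is_RInt (fun t => Re (f t)) a b (Re (Cint f a b)).
Proof. intros Hab H. apply (is_RInt_C_parts f a b), Cint_correct; auto. Qed.

Lemma Cint_ge0 f a b : (a <= b)%R -> (forall t, (a <= t <= b)%R -> rcont f t) ->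
  (forall t, (a <= t <= b)%R -> (0 <= Re (f t))%R) -> (0 <= Re (Cint f a b))%R.
Proof.
  intros Hab Hf H. pose proof (Re_Cint f a b Hab Hf) as HR.
  rewrite <- (is_RInt_unique _ _ _ _ HR). apply RInt_ge_0; auto.
  - eexists; exact HR.
  - intros; apply H; lra.
Qed.

Lemma rcont_csumn (u : nat -> R -> C) K s :
  (forall n, rcont (u n) s) -> rcont (fun s => csumn K (fun n => u n s)) s.
Proof.
  intros Hu. induction K as [|K IH]; [apply (rcont_const 0)|].
  apply (rcont_ext (fun s => csumn K (fun n => u n s) + u K s)); [intros; symmetry; apply csumn_S|].
  apply rcont_plus; auto.
Qed.

Lemma rcont_Cseries (u : nat -> R -> C) t M s : (0 <= t < 1)%R ->
  (forall n, rcont (u n) s) -> (forall s, geo t M (fun n => u n s)) ->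
  rcont (fun s => Cseries (fun n => u n s)) s.
Proof.
  intros Ht Hu Hg eps He.
  destruct (geo_small t (M / (1 - t)) (eps / 3) Ht ltac:(lra)) as [N HN].
  specialize (HN N (Nat.le_refl N)).
  destruct (rcont_csumn u N s Hu (eps / 3)%R ltac:(lra)) as (d & Hd & H).
  exists d; split; auto. intros s' Hs'. specialize (H s' Hs').
  pose proof (Cseries_tail t M (fun n => u n s) N Ht (Hg s)) as H1.
  pose proof (Cseries_tail t M (fun n => u n s') N Ht (Hg s')) as H2.
  replace (M / (1 - t) * t ^ N)%R with (M * t ^ N / (1 - t))%R in HN by (field; lra).
  cbv beta in H.
  replace (Cseries (fun n => u n s') - Cseries (fun n => u n s)) with
    ((Cseries (fun n => u n s') - csumn N (fun n => u n s')) +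
     ((csumn N (fun n => u n s') - csumn N (fun n => u n s)) + - (Cseries (fun n => u n s) - csumn N (fun n => u n s)))) by ring.
  eapply Rle_lt_trans; [eapply Rle_trans; [apply Cmod_triangle|apply Rplus_le_compat_l, Cmod_triangle]|].
  rewrite Cmod_opp. lra.
Qed.

Lemma Cint_swap_series (u : nat -> R -> C) a b t M :
  (a <= b)%R -> (0 <= t < 1)%R ->
  (forall n s, rcont (u n) s) -> (forall s, geo t M (fun n => u n s)) ->
  Cint (fun s => Cseries (fun n => u n s)) a b = Cseries (fun n => Cint (u n) a b).
Proof.
  intros Hab Ht Hu Hg.
  assert (Hc : forall s, rcont (fun s => Cseries (fun n => u n s)) s) by (intros; eapply rcont_Cseries; eauto).
  symmetry. apply Cseries_unique. intros eps He.
  destruct (geo_small t (M / (1 - t) * (b - a)) eps Ht He) as [N0 HN0].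
  exists N0; intros N HN.
  assert (Hs : forall N s, rcont (fun s => csumn N (fun n => u n s)) s) by (intros; apply rcont_csumn; auto).
  assert (E : forall K, csumn K (fun n => Cint (u n) a b) = Cint (fun s => csumn K (fun n => u n s)) a b).
  { induction K as [|K IH].
    - unfold csumn; simpl. rewrite Cint_const. ring.
    - rewrite csumn_S, IH, <- Cint_plus; auto. apply Cint_ext; auto. intros; rewrite csumn_S; auto. }
  rewrite E, <- Cint_minus; auto.
  eapply Rle_lt_trans; [|apply (HN0 N HN)].
  eapply Rle_trans; [apply (Cint_bound _ a b (M * t ^ N / (1 - t)))|]; auto.
  - intros; apply rcont_minus; auto.
  - intros s Hs'. rewrite <- Cmod_opp.
    replace (- (csumn N (fun n => u n s) - Cseries (fun n => u n s))) with (Cseries (fun n => u n s) - csumn N (fun n => u n s)) by ring.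
    apply Cseries_tail; auto.
  - right; field; lra.
Qed.

(** * Complex differentiability, the exponential and integration along paths *)

Definition cderiv (f : C -> C) (z l : C) : Prop :=
  forall eps, (0 < eps)%R -> exists del, (0 < del)%R /\
    forall h, (Cmod h < del)%R -> (Cmod (f (z + h) - f z - l * h)%C <= eps * Cmod h)%R.

Definition holo (f : C -> C) (z : C) : Prop := exists l, cderiv f z l.

Lemma cderiv_ccont f z l : cderiv f z l -> ccont f z.
Proof.
  intros H eps He. destruct (H 1%R ltac:(lra)) as (d & Hd & H1).
  pose proof (Cmod_ge_0 l). set (M := (Cmod l + 1)%R).
  assert (HM : (0 < M)%R) by (unfold M; lra).
  exists (Rmin d (eps / M)). split.
  - apply Rmin_pos; auto. apply Rdiv_lt_0_compat; auto.
  - intros z' Hz'. set (h := z' - z) in *.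
    specialize (H1 h (Rlt_le_trans _ _ _ Hz' (Rmin_l _ _))).
    pose proof (Rlt_le_trans _ _ _ Hz' (Rmin_r _ _)) as H2.
    replace z' with (z + h) by (unfold h; ring).
    replace (f (z + h) - f z) with ((f (z + h) - f z - l * h) + l * h) by ring.
    eapply Rle_lt_trans; [apply Cmod_triangle|]. rewrite Cmod_mult.
    apply Rle_lt_trans with (M * Cmod h)%R; [unfold M; lra|].
    apply (Rmult_lt_compat_l M) in H2; auto.
    replace (M * (eps / M))%R with eps in H2 by (field; lra). lra.
Qed.

Lemma holo_ccont f z : holo f z -> ccont f z.
Proof. intros [l H]; eapply cderiv_ccont; eauto. Qed.

(** Squares, inverses and power series are differentiated through such second-order bounds. *)
Lemma cderiv_quadratic f z l K del : (0 < del)%R ->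
  (forall h, (Cmod h < del)%R -> (Cmod (f (z + h)%C - f z - l * h) <= K * (Cmod h * Cmod h))%R) ->
  cderiv f z l.
Proof.
  intros Hd H eps He. set (M := (Rabs K + 1)%R).
  assert (HM : (0 < M)%R) by (unfold M; pose proof (Rabs_pos K); lra).
  exists (Rmin del (eps / M)). split; [apply Rmin_pos; auto; apply Rdiv_lt_0_compat; auto|].
  intros h Hh. specialize (H h (Rlt_le_trans _ _ _ Hh (Rmin_l _ _))).
  pose proof (Rlt_le_trans _ _ _ Hh (Rmin_r _ _)) as H2.
  eapply Rle_trans; [exact H|]. rewrite <- Rmult_assoc. pose proof (Cmod_ge_0 h).
  apply Rmult_le_compat_r; auto.
  apply Rle_trans with (M * Cmod h)%R.
  - apply Rmult_le_compat_r; auto. unfold M. pose proof (Rle_abs K). lra.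
  - apply (Rmult_lt_compat_l M) in H2; auto.
    replace (M * (eps / M))%R with eps in H2 by (field; lra). lra.
Qed.

Lemma cderiv_ext_loc f g z l del : (0 < del)%R ->
  (forall z', (Cmod (z' - z) < del)%R -> f z' = g z') -> cderiv f z l -> cderiv g z l.
Proof.
  intros Hd E H eps He. destruct (H eps He) as (d & Hd' & H1).
  exists (Rmin del d). split; [apply Rmin_pos; auto|]. intros h Hh.
  rewrite <- !E.
  - apply H1. eapply Rlt_le_trans; [exact Hh|apply Rmin_r].
  - replace (z - z) with (RtoC 0) by ring. rewrite Cmod_0; auto.
  - replace (z + h - z) with h by ring. eapply Rlt_le_trans; [exact Hh|apply Rmin_l].
Qed.

Lemma holo_ext_loc f g z del : (0 < del)%R ->
  (forall z', (Cmod (z' - z) < del)%R -> f z' = g z') -> holo f z -> holo g z.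
Proof. intros Hd E [l H]; exists l; eapply cderiv_ext_loc; eauto. Qed.

Lemma cderiv_ext f g z l : (forall z', f z' = g z') -> cderiv f z l -> cderiv g z l.
Proof. intros E. apply (cderiv_ext_loc f g z l 1); auto; lra. Qed.

Lemma cderiv_eq f z l l' : l = l' -> cderiv f z l -> cderiv f z l'.
Proof. intros ->; auto. Qed.

Lemma cderiv_const c z : cderiv (fun _ => c) z 0.
Proof.
  intros eps He; exists 1%R; split; [lra|]. intros h _.
  replace (c - c - 0 * h) with (RtoC 0) by ring. rewrite Cmod_0.
  apply Rmult_le_pos; [lra|apply Cmod_ge_0].
Qed.

Lemma cderiv_id z : cderiv (fun z => z) z 1.
Proof.
  intros eps He; exists 1%R; split; [lra|]. intros h _.
  replace (z + h - z - 1 * h) with (RtoC 0) by ring. rewrite Cmod_0.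
  apply Rmult_le_pos; [lra|apply Cmod_ge_0].
Qed.

Lemma cderiv_plus f g z l m : cderiv f z l -> cderiv g z m -> cderiv (fun z => f z + g z) z (l + m).
Proof.
  intros H1 H2 eps He. destruct (H1 (eps / 2)%R) as (d1 & Hd1 & H1'); [lra|].
  destruct (H2 (eps / 2)%R) as (d2 & Hd2 & H2'); [lra|].
  exists (Rmin d1 d2); split; [apply Rmin_pos; auto|]. intros h Hh.
  specialize (H1' h (Rlt_le_trans _ _ _ Hh (Rmin_l _ _))).
  specialize (H2' h (Rlt_le_trans _ _ _ Hh (Rmin_r _ _))).
  replace (f (z + h) + g (z + h) - (f z + g z) - (l + m) * h) with
    ((f (z + h) - f z - l * h) + (g (z + h) - g z - m * h)) by ring.
  eapply Rle_trans; [apply Cmod_triangle|]. lra.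
Qed.

Lemma cderiv_comp f g z l m : cderiv f (g z) l -> cderiv g z m -> cderiv (fun z => f (g z)) z (l * m).
Proof.
  intros Hf Hg eps He.
  pose proof (Cmod_ge_0 l) as Hl. pose proof (Cmod_ge_0 m) as Hm.
  set (e1 := (eps / (2 * (Cmod m + 1)))%R).
  assert (He1 : (0 < e1)%R) by (apply Rdiv_lt_0_compat; lra).
  set (e2 := Rmin 1 (eps / (2 * (Cmod l + 1)))).
  assert (He2 : (0 < e2)%R) by (apply Rmin_pos; [lra|apply Rdiv_lt_0_compat; lra]).
  destruct (Hf e1 He1) as (d1 & Hd1 & H1). destruct (Hg e2 He2) as (d2 & Hd2 & H2).
  destruct (cderiv_ccont g z m Hg d1 Hd1) as (d3 & Hd3 & H3).
  exists (Rmin d2 d3); split; [apply Rmin_pos; auto|]. intros h Hh.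
  specialize (H2 h (Rlt_le_trans _ _ _ Hh (Rmin_l _ _))).
  specialize (H3 (z + h)). replace (z + h - z) with h in H3 by ring.
  specialize (H3 (Rlt_le_trans _ _ _ Hh (Rmin_r _ _))).
  set (k := g (z + h) - g z) in *. specialize (H1 k H3).
  replace (g z + k) with (g (z + h)) in H1 by (unfold k; ring).
  assert (Hk : (Cmod k <= (Cmod m + 1) * Cmod h)%R).
  { replace k with ((k - m * h) + m * h) by ring. eapply Rle_trans; [apply Cmod_triangle|].
    rewrite Cmod_mult. assert (e2 <= 1)%R by apply Rmin_l. pose proof (Cmod_ge_0 h). nra. }
  replace (f (g (z + h)) - f (g z) - l * m * h) with ((f (g (z + h)) - f (g z) - l * k) + l * (k - m * h)) by ring.
  eapply Rle_trans; [apply Cmod_triangle|]. rewrite Cmod_mult.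
  apply Rle_trans with (e1 * ((Cmod m + 1) * Cmod h) + Cmod l * (e2 * Cmod h))%R.
  - apply Rplus_le_compat.
    + eapply Rle_trans; [exact H1|]. apply Rmult_le_compat_l; lra.
    + apply Rmult_le_compat_l; auto.
  - replace (e1 * ((Cmod m + 1) * Cmod h))%R with (eps / 2 * Cmod h)%R by (unfold e1; field; lra).
    assert (Cmod l * e2 <= eps / 2)%R.
    { apply Rle_trans with ((Cmod l + 1) * (eps / (2 * (Cmod l + 1))))%R.
      - apply Rmult_le_compat; try lra. apply Rmin_r.
      - right; field; lra. }
    pose proof (Cmod_ge_0 h). nra.
Qed.

Lemma cderiv_sqr z : cderiv (fun z => z * z) z (2 * z).
Proof.
  apply (cderiv_quadratic _ _ _ 1 1); [lra|]. intros h _.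
  replace ((z + h) * (z + h) - z * z - 2 * z * h) with (h * h) by ring.
  rewrite Cmod_mult; lra.
Qed.

Lemma cderiv_scal c f z l : cderiv f z l -> cderiv (fun z => c * f z) z (c * l).
Proof.
  intros H. apply (cderiv_comp (fun y => c * y) f z c l); auto.
  intros eps He; exists 1%R; split; [lra|]. intros h _.
  replace (c * (f z + h) - c * f z - c * h) with (RtoC 0) by ring. rewrite Cmod_0.
  apply Rmult_le_pos; [lra|apply Cmod_ge_0].
Qed.

Lemma cderiv_opp f z l : cderiv f z l -> cderiv (fun z => - f z) z (- l).
Proof.
  intros H. apply (cderiv_eq _ _ ((-1) * l)); [ring|].
  apply (cderiv_ext (fun z => (-1) * f z)); [intros; ring|]. apply cderiv_scal; auto.
Qed.

Lemma cderiv_minus f g z l m : cderiv f z l -> cderiv g z m -> cderiv (fun z => f z - g z) z (l - m).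
Proof. intros. apply cderiv_plus; auto. apply cderiv_opp; auto. Qed.

Lemma cderiv_mult f g z l m : cderiv f z l -> cderiv g z m ->
  cderiv (fun z => f z * g z) z (l * g z + f z * m).
Proof.
  intros Hf Hg.
  (* Polarisation: f g = ((f + g)^2 - (f - g)^2) / 4 reduces the product rule to the chain rule for
     the square. *)
  apply (cderiv_eq _ _ (/ 4 * (2 * (f z + g z) * (l + m) - 2 * (f z - g z) * (l - m)))).
  - field.
  - apply (cderiv_ext (fun z => / 4 * ((f z + g z) * (f z + g z) - (f z - g z) * (f z - g z)))).
    + intros; field.
    + apply cderiv_scal, cderiv_minus.
      * apply (cderiv_comp (fun y => y * y) (fun z => f z + g z)); [apply cderiv_sqr|apply cderiv_plus; auto].
      * apply (cderiv_comp (fun y => y * y) (fun z => f z - g z)); [apply cderiv_sqr|apply cderiv_minus; auto].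
Qed.

Lemma cderiv_inv (z : C) : z <> 0 -> cderiv (fun z => / z) z (- / (z * z)).
Proof.
  intros Hz. assert (Hp : (0 < Cmod z)%R) by (apply Cmod_gt_0; auto).
  apply (cderiv_quadratic _ _ _ (2 / (Cmod z * Cmod z * Cmod z)) (Cmod z / 2)); [lra|].
  intros h Hh. pose proof (Cmod_minus_ge z (- h)) as H1. replace (z - - h) with (z + h) in H1 by ring.
  rewrite Cmod_opp in H1.
  assert (Hzh : z + h <> 0) by (apply Cmod_gt_0; lra).
  replace (/ (z + h) - / z - - / (z * z) * h) with (h * h * (/ (z + h) * / (z * z))) by (field; auto).
  rewrite !Cmod_mult, (Cmod_inv (z + h)), (Cmod_inv (z * z)), Cmod_mult by (auto; apply Cmult_neq_0; auto).
  rewrite Rmult_comm. apply Rmult_le_compat_r.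
  { apply Rmult_le_pos; apply Cmod_ge_0. }
  replace (2 / (Cmod z * Cmod z * Cmod z))%R with (/ (Cmod z / 2) * / (Cmod z * Cmod z))%R by (field; lra).
  apply Rmult_le_compat_r; [left; apply Rinv_0_lt_compat; nra|].
  apply Rinv_le_contravar; lra.
Qed.

Lemma cderiv_pow f z l n : cderiv f z l ->
  cderiv (fun z => f z ^ S n) z (INR (S n) * f z ^ n * l).
Proof.
  intros H. induction n as [|n IH].
  - apply (cderiv_eq _ _ l); [simpl; ring|]. apply (cderiv_ext f); auto. intros; simpl; ring.
  - apply (cderiv_eq _ _ (l * f z ^ S n + f z * (INR (S n) * f z ^ n * l))).
    + rewrite (S_INR (S n)), RtoC_plus. simpl; ring.
    + apply (cderiv_ext (fun z => f z * f z ^ S n)); [intros; reflexivity|].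
      apply cderiv_mult; auto.
Qed.

Lemma holo_pow_aux n z : holo (fun z => z ^ n) z.
Proof.
  destruct n as [|n]; [exists 0; apply (cderiv_const 1)|].
  eexists. apply (cderiv_pow (fun z => z)), cderiv_id.
Qed.

Lemma holo_plus f g z : holo f z -> holo g z -> holo (fun z => f z + g z) z.
Proof. intros [l H] [m H']; eexists; apply cderiv_plus; eauto. Qed.
Lemma holo_minus f g z : holo f z -> holo g z -> holo (fun z => f z - g z) z.
Proof. intros [l H] [m H']; eexists; apply cderiv_minus; eauto. Qed.
Lemma holo_mult f g z : holo f z -> holo g z -> holo (fun z => f z * g z) z.
Proof. intros [l H] [m H']; eexists; apply cderiv_mult; eauto. Qed.
Lemma holo_const c z : holo (fun _ => c) z.
Proof. eexists; apply cderiv_const. Qed.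
Lemma holo_comp f g z : holo f (g z) -> holo g z -> holo (fun z => f (g z)) z.
Proof. intros [l H] [m H']; eexists; apply cderiv_comp; eauto. Qed.
Lemma holo_shift f w u : holo f (w + u) -> holo (fun u => f (w + u)) u.
Proof.
  intros H. apply (holo_comp f (fun u => w + u)); auto.
  eexists; apply cderiv_plus; [apply cderiv_const|apply cderiv_id].
Qed.
Lemma holo_inv (z : C) : z <> 0 -> holo (fun z => / z) z.
Proof. intros; eexists; apply cderiv_inv; auto. Qed.
Lemma holo_pow n z : holo (fun z => z ^ n) z.
Proof. apply holo_pow_aux. Qed.

Lemma is_derive_eps (f : R -> R) x l : is_derive f x l -> forall eps, (0 < eps)%R ->
  exists del, (0 < del)%R /\ forall h, (Rabs h < del)%R -> (Rabs (f (x + h)%R - f x - l * h) <= eps * Rabs h)%R.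
Proof.
  intros H eps He. apply is_derive_Reals in H. destruct (H eps He) as [d Hd].
  exists d; split; [apply cond_pos|]. intros h Hh.
  destruct (Req_dec h 0) as [->|Hn].
  - rewrite Rplus_0_r, Rmult_0_r, Rabs_R0. replace (f x - f x - 0)%R with 0%R by ring. rewrite Rabs_R0; lra.
  - specialize (Hd h Hn Hh). replace (f (x + h) - f x - l * h)%R with (((f (x + h) - f x) / h - l) * h)%R by (field; auto).
    rewrite Rabs_mult. apply Rmult_le_compat_r; [apply Rabs_pos|lra].
Qed.

Definition cexp (z : C) : C := exp (Re z) * ei (Im z).

Lemma cexp_plus z h : cexp (z + h) = cexp z * cexp h.
Proof. unfold cexp. rewrite re_plus, im_plus, exp_plus, ei_plus, RtoC_mult. ring. Qed.

(** Only the derivative at 0 needs an estimate, obtained from the real derivatives of exp, cos and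
    sin at 0; the functional equation carries it to every point. *)
Lemma cderiv_cexp z : cderiv cexp z (cexp z).
Proof.
  assert (H0 : cderiv cexp 0 1).
  (* The three error terms are at most e, 4 e and e times |h|, hence the divisor 6; e <= 1 gives the
     bound 2 for |1 + x|. *)
  { intros eps He. set (e := (Rmin 1 (eps / 6))%R).
    assert (Hep : (0 < e)%R) by (apply Rmin_pos; lra).
    assert (Hc : is_derive cos 0 0%R) by (pose proof (is_derive_cos 0) as Hc0; rewrite sin_0, Ropp_0 in Hc0; exact Hc0).
    assert (Hsn : is_derive sin 0 1%R) by (pose proof (is_derive_sin 0) as Hc0; rewrite cos_0 in Hc0; exact Hc0).
    assert (Hx : is_derive exp 0 1%R) by (pose proof (is_derive_exp 0) as Hc0; rewrite exp_0 in Hc0; exact Hc0).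
    destruct (is_derive_eps _ _ _ Hc e Hep) as (d1 & Hd1 & H1).
    destruct (is_derive_eps _ _ _ Hsn e Hep) as (d2 & Hd2 & H2).
    destruct (is_derive_eps _ _ _ Hx e Hep) as (d3 & Hd3 & H3).
    exists (Rmin (Rmin d1 d2) (Rmin d3 e)). split; [apply Rmin_pos; apply Rmin_pos; assumption|].
    intros h Hh. pose proof (re_le_Cmod h) as Hr. pose proof (im_le_Cmod h) as Hi.
    assert (L1 := Rmin_l (Rmin d1 d2) (Rmin d3 e)). assert (L2 := Rmin_r (Rmin d1 d2) (Rmin d3 e)).
    assert (L3 := Rmin_l d1 d2). assert (L4 := Rmin_r d1 d2). assert (L5 := Rmin_l d3 e). assert (L6 := Rmin_r d3 e).
    destruct h as [x y]; simpl in Hr, Hi.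
    specialize (H1 y ltac:(lra)). specialize (H2 y ltac:(lra)). specialize (H3 x ltac:(lra)).
    rewrite Rplus_0_l, cos_0 in H1. rewrite Rplus_0_l, sin_0 in H2. rewrite Rplus_0_l, exp_0 in H3.
    unfold cexp. replace (RtoC 0 + (x, y)) with (x, y) by (apply injective_projections; simpl; ring).
    simpl (Re _). simpl (Im _). rewrite exp_0, ei_0.
    replace (exp x * ei y - 1 * 1 - 1 * (x, y)) with
      (RtoC (exp x - 1 - 1 * x) * ei y + (RtoC (1 + x) * (RtoC (cos y - 1 - 0 * y) + Ci * RtoC (sin y - 0 - 1 * y)) + RtoC (x * y) * Ci)).
    2:{ unfold ei. apply injective_projections; simpl; ring. }
    eapply Rle_trans; [eapply Rle_trans; [apply Cmod_triangle|apply Rplus_le_compat_l, Cmod_triangle]|].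
    rewrite !Cmod_mult, Cmod_ei, Cmod_Ci, !Cmod_R, !Rmult_1_r.
    assert (Hb : (Cmod (RtoC (cos y - 1 - 0 * y) + Ci * RtoC (sin y - 0 - 1 * y)) <= 2 * (e * Rabs y))%R).
    { eapply Rle_trans; [apply Cmod_triangle|]. rewrite Cmod_mult, Cmod_Ci, !Cmod_R. lra. }
    assert (He1 : (e <= 1)%R) by apply Rmin_l. assert (He6 : (e <= eps / 6)%R) by apply Rmin_r.
    assert (H1x : (Rabs (1 + x) <= 2)%R).
    { eapply Rle_trans; [apply Rabs_triang|]. rewrite Rabs_R1. lra. }
    rewrite Rabs_mult. set (hh := Cmod (x, y)) in *.
    pose proof (Rabs_pos x). pose proof (Rabs_pos y). pose proof (Rabs_pos (1 + x)).
    set (W := Cmod (RtoC (cos y - 1 - 0 * y) + Ci * RtoC (sin y - 0 - 1 * y))) in *.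
    assert (0 <= W)%R by apply Cmod_ge_0.
    assert (Rabs (1 + x) * W <= 2 * (2 * (e * hh)))%R.
    { apply Rmult_le_compat; auto. eapply Rle_trans; [exact Hb|]. nra. }
    assert (Rabs x * Rabs y <= e * hh)%R by (apply Rmult_le_compat; lra).
    assert (e * Rabs x <= e * hh)%R by nra.
    assert (e * hh <= eps / 6 * hh)%R by nra. nra. }
  apply (cderiv_ext (fun y => cexp z * cexp (y - z))).
  { intros y. rewrite <- cexp_plus. f_equal. ring. }
  apply (cderiv_eq _ _ (cexp z * (1 * 1))); [ring|].
  apply cderiv_scal. apply (cderiv_comp cexp (fun y => y - z)).
  - replace (z - z) with (RtoC 0) by ring. exact H0.
  - apply (cderiv_eq _ _ (1 - 0)); [ring|]. apply cderiv_minus; [apply cderiv_id|apply cderiv_const].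
Qed.

Definition rderiv (p : R -> C) (t : R) (v : C) : Prop :=
  is_derive (K := R_AbsRing) (V := C_R_NormedModule) p t v.

Lemma norm_C_R (z : C) : norm (V := C_R_NormedModule) z = Cmod z.
Proof.
  change (sqrt (Rabs (fst z) ^ 2 + Rabs (snd z) ^ 2) = Cmod z). rewrite !pow2_abs. reflexivity.
Qed.

Lemma rderiv_eps p t v : rderiv p t v <-> forall eps, (0 < eps)%R -> exists del, (0 < del)%R /\
  forall t', (Rabs (t' - t) < del)%R -> (Cmod (p t' - p t - RtoC (t' - t) * v)%C <= eps * Rabs (t' - t))%R.
Proof.
  assert (E : forall t', norm (V := C_R_NormedModule) (minus (minus (p t') (p t)) (scal (minus t' t) v))
     = Cmod (p t' - p t - RtoC (t' - t) * v)).
  { intros t'. rewrite norm_C_R. f_equal. rewrite scal_R_Cmult. reflexivity. }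
  split.
  - intros [_ H] eps He. specialize (H t (fun P HP => HP) (mkposreal eps He)).
    destruct H as [d Hd]. exists d; split; [apply cond_pos|]. intros t' Ht'.
    specialize (Hd t' Ht'). rewrite <- E. exact Hd.
  - intros H. split; [apply is_linear_scal_l|]. intros x Hx eps.
    assert (Hx' : t = x) by (apply (is_filter_lim_locally_unique (V := R_NormedModule)); exact Hx).
    subst x. destruct (H eps (cond_pos eps)) as (d & Hd & H1).
    exists (mkposreal d Hd). intros t' Ht'. specialize (H1 t' Ht'). rewrite <- E in H1. exact H1.
Qed.

Lemma rderiv_comp F p t v l : cderiv F (p t) l -> rderiv p t v -> rderiv (fun s => F (p s)) t (l * v).
Proof.
  intros Hf Hg. pose proof (proj1 (rderiv_eps _ _ _) Hg) as Hg'. apply rderiv_eps. intros eps He.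
  pose proof (Cmod_ge_0 l) as Hl. pose proof (Cmod_ge_0 v) as Hm.
  set (e1 := (eps / (2 * (Cmod v + 1)))%R).
  assert (He1 : (0 < e1)%R) by (apply Rdiv_lt_0_compat; lra).
  set (e2 := Rmin 1 (eps / (2 * (Cmod l + 1)))).
  assert (He2 : (0 < e2)%R) by (apply Rmin_pos; [lra|apply Rdiv_lt_0_compat; lra]).
  destruct (Hf e1 He1) as (d1 & Hd1 & H1). destruct (Hg' e2 He2) as (d2 & Hd2 & H2).
  set (d3 := (d1 / (Cmod v + 1))%R). assert (Hd3 : (0 < d3)%R) by (apply Rdiv_lt_0_compat; lra).
  exists (Rmin d2 d3); split; [apply Rmin_pos; auto|]. intros t' Ht'.
  specialize (H2 t' (Rlt_le_trans _ _ _ Ht' (Rmin_l _ _))).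
  pose proof (Rlt_le_trans _ _ _ Ht' (Rmin_r _ _)) as H3.
  set (h := (t' - t)%R) in *. set (k := p t' - p t) in *.
  assert (Hk : (Cmod k <= (Cmod v + 1) * Rabs h)%R).
  { replace k with ((k - RtoC h * v) + RtoC h * v) by ring. eapply Rle_trans; [apply Cmod_triangle|].
    rewrite Cmod_mult, Cmod_R. assert (e2 <= 1)%R by apply Rmin_l. pose proof (Rabs_pos h). nra. }
  assert (Hk1 : (Cmod k < d1)%R).
  { eapply Rle_lt_trans; [exact Hk|]. apply (Rmult_lt_compat_l (Cmod v + 1)) in H3; [|lra].
    replace ((Cmod v + 1) * d3)%R with d1 in H3 by (unfold d3; field; lra). exact H3. }
  specialize (H1 k Hk1). replace (p t + k) with (p t') in H1 by (unfold k; ring).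
  replace (F (p t') - F (p t) - RtoC h * (l * v)) with ((F (p t') - F (p t) - l * k) + l * (k - RtoC h * v)) by ring.
  eapply Rle_trans; [apply Cmod_triangle|]. rewrite Cmod_mult.
  apply Rle_trans with (e1 * ((Cmod v + 1) * Rabs h) + Cmod l * (e2 * Rabs h))%R.
  - apply Rplus_le_compat.
    + eapply Rle_trans; [exact H1|]. apply Rmult_le_compat_l; lra.
    + apply Rmult_le_compat_l; auto.
  - replace (e1 * ((Cmod v + 1) * Rabs h))%R with (eps / 2 * Rabs h)%R by (unfold e1; field; lra).
    assert (Cmod l * e2 <= eps / 2)%R.
    { apply Rle_trans with ((Cmod l + 1) * (eps / (2 * (Cmod l + 1))))%R.
      - apply Rmult_le_compat; try lra. apply Rmin_r.
      - right; field; lra. }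
    pose proof (Rabs_pos h). nra.
Qed.

Lemma rderiv_rcont p t v : rderiv p t v -> rcont p t.
Proof.
  intros H. apply continuous_rcont. apply (ex_derive_continuous (K := R_AbsRing) (V := C_R_NormedModule)).
  eexists; exact H.
Qed.

Lemma Cint_FTC F f a b : (a <= b)%R -> (forall t, (a <= t <= b)%R -> rderiv F t (f t)) ->
  (forall t, (a <= t <= b)%R -> rcont f t) -> Cint f a b = F b - F a.
Proof.
  intros Hab HF Hf. apply Cint_unique.
  apply (is_RInt_derive (V := C_R_CompleteNormedModule) F f a b); rewrite Rmin_left, Rmax_right by auto.
  - exact HF.
  - intros; apply (rcont_continuous f); auto.
Qed.

(** * Counterclockwise boundary integrals of rectangles and Goursat's theorem *)

Definition rect_int (g : C -> C) (a b c d : R) : C :=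
  Cint (fun x => g (x, c)) a b - Cint (fun x => g (x, d)) a b
  + Ci * (Cint (fun y => g (b, y)) c d - Cint (fun y => g (a, y)) c d).

Definition in_rect (a b c d : R) (z : C) : Prop :=
  (a <= Re z <= b)%R /\ (c <= Im z <= d)%R.

Lemma Cmod_horizontal x x' y : Cmod ((x', y) - (x, y)) = Rabs (x' - x).
Proof.
  rewrite <- Cmod_R. f_equal. apply injective_projections; simpl; ring.
Qed.

Lemma Cmod_vertical x y y' : Cmod ((x, y') - (x, y)) = Rabs (y' - y).
Proof.
  replace ((x, y') - (x, y)) with (Ci * RtoC (y' - y)) by (apply injective_projections; simpl; ring).
  rewrite Cmod_mult, Cmod_Ci, Cmod_R. ring.
Qed.

Lemma rcont_horizontal g x y : ccont g (x, y) -> rcont (fun x => g (x, y)) x.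
Proof.
  intros H. apply (rcont_comp g (fun x => (x, y) : C)); auto.
  intros eps He; exists eps; split; auto. intros t' Ht'. rewrite Cmod_horizontal; auto.
Qed.

Lemma rcont_vertical g x y : ccont g (x, y) -> rcont (fun y => g (x, y)) y.
Proof.
  intros H. apply (rcont_comp g (fun y => (x, y) : C)); auto.
  intros eps He; exists eps; split; auto. intros t' Ht'. rewrite Cmod_vertical; auto.
Qed.

Lemma rderiv_horizontal x y : rderiv (fun x => (x, y) : C) x 1.
Proof.
  apply rderiv_eps. intros eps He; exists 1%R; split; [lra|]. intros t' _.
  replace ((t', y) - (x, y) - RtoC (t' - x) * 1) with (RtoC 0) by (apply injective_projections; simpl; ring).
  rewrite Cmod_0. apply Rmult_le_pos; [lra|apply Rabs_pos].
Qed.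

Lemma rderiv_vertical x y : rderiv (fun y => (x, y) : C) y Ci.
Proof.
  apply rderiv_eps. intros eps He; exists 1%R; split; [lra|]. intros t' _.
  replace ((x, t') - (x, y) - RtoC (t' - y) * Ci) with (RtoC 0) by (apply injective_projections; simpl; ring).
  rewrite Cmod_0. apply Rmult_le_pos; [lra|apply Rabs_pos].
Qed.

Lemma rect_int_primitive K k a b c d : (a <= b)%R -> (c <= d)%R ->
  (forall z, cderiv K z (k z)) -> (forall z, ccont k z) -> rect_int k a b c d = 0.
Proof.
  intros Hab Hcd HK Hk.
  assert (HH : forall y, Cint (fun x => k (x, y)) a b = K (b, y) - K (a, y)).
  { intros y. apply (Cint_FTC (fun x => K (x, y))); auto.
    - intros t _. replace (k (t, y)) with (k (t, y) * 1) by ring.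
      apply (rderiv_comp K (fun x => (x, y) : C)); auto. apply rderiv_horizontal.
    - intros; apply rcont_horizontal; auto. }
  assert (HV : forall x, Ci * Cint (fun y => k (x, y)) c d = K (x, d) - K (x, c)).
  { intros x. rewrite <- Cint_scal; auto.
    2:{ intros; apply rcont_vertical; auto. }
    apply (Cint_FTC (fun y => K (x, y))); auto.
    - intros t _. rewrite Cmult_comm.
      apply (rderiv_comp K (fun y => (x, y) : C)); auto. apply rderiv_vertical.
    - intros; apply rcont_mult; [apply rcont_const|apply rcont_vertical; auto]. }
  unfold rect_int. rewrite !HH.
  replace (Ci * (Cint (fun y => k (b, y)) c d - Cint (fun y => k (a, y)) c d)) with
    (Ci * Cint (fun y => k (b, y)) c d - Ci * Cint (fun y => k (a, y)) c d) by ring.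
  rewrite !HV. ring.
Qed.

Lemma rect_int_plus g k a b c d : (a <= b)%R -> (c <= d)%R ->
  (forall z, in_rect a b c d z -> ccont g z) -> (forall z, in_rect a b c d z -> ccont k z) ->
  rect_int (fun z => g z + k z) a b c d = rect_int g a b c d + rect_int k a b c d.
Proof.
  intros Hab Hcd Hg Hk. unfold rect_int.
  rewrite !Cint_plus; auto; try ring;
    intros; (apply rcont_horizontal || apply rcont_vertical); (apply Hg || apply Hk); split; simpl; lra.
Qed.

Lemma rect_int_bound g a b c d M : (a <= b)%R -> (c <= d)%R ->
  (forall z, in_rect a b c d z -> ccont g z) ->
  (forall z, in_rect a b c d z -> (Cmod (g z) <= M)%R) ->
  (Cmod (rect_int g a b c d) <= 2 * ((b - a) + (d - c)) * M)%R.
Proof.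
  intros Hab Hcd Hg HM. unfold rect_int.
  assert (HH : forall y, (c <= y <= d)%R -> (Cmod (Cint (fun x => g (x, y)) a b) <= (b - a) * M)%R).
  { intros y Hy. apply Cint_bound; auto; intros; [apply rcont_horizontal, Hg|apply HM]; split; simpl; lra. }
  assert (HV : forall x, (a <= x <= b)%R -> (Cmod (Cint (fun y => g (x, y)) c d) <= (d - c) * M)%R).
  { intros x Hx. apply Cint_bound; auto; intros; [apply rcont_vertical, Hg|apply HM]; split; simpl; lra. }
  pose proof (HH c ltac:(lra)). pose proof (HH d ltac:(lra)).
  pose proof (HV a ltac:(lra)). pose proof (HV b ltac:(lra)).
  eapply Rle_trans; [apply Cmod_triangle|]. rewrite Cmod_mult, Cmod_Ci, Rmult_1_l.
  unfold Cminus.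
  eapply Rle_trans; [apply Rplus_le_compat; apply Cmod_triangle|]. rewrite !Cmod_opp. lra.
Qed.

Lemma rect_int_split g a m b c n d : (a <= m <= b)%R -> (c <= n <= d)%R ->
  (forall z, in_rect a b c d z -> ccont g z) ->
  rect_int g a b c d = (rect_int g a m c n + rect_int g m b c n) + (rect_int g a m n d + rect_int g m b n d).
Proof.
  intros Hm Hn Hg. unfold rect_int.
  assert (HH : forall y, (c <= y <= d)%R -> Cint (fun x => g (x, y)) a b = Cint (fun x => g (x, y)) a m + Cint (fun x => g (x, y)) m b).
  { intros y Hy. apply Cint_Chasles; try lra. intros; apply rcont_horizontal, Hg; split; simpl; lra. }
  assert (HV : forall x, (a <= x <= b)%R -> Cint (fun y => g (x, y)) c d = Cint (fun y => g (x, y)) c n + Cint (fun y => g (x, y)) n d).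
  { intros x Hx. apply Cint_Chasles; try lra. intros; apply rcont_vertical, Hg; split; simpl; lra. }
  rewrite (HH c), (HH d), (HV a), (HV b) by lra. ring.
Qed.

Section Goursat.

Let side (w : R) (n : nat) : R := (w / 2 ^ n)%R.

Lemma goursat_side_S w n : side w n = (side w (S n) + side w (S n))%R.
Proof. unfold side. simpl. field. apply pow_nonzero; lra. Qed.

Lemma goursat_side_pos w n : (0 <= w)%R -> (0 <= side w n)%R.
Proof.
  intros. unfold side. apply Rmult_le_pos; auto. left; apply Rinv_0_lt_compat, pow_lt; lra.
Qed.

Let big (g : C -> C) (w h eta : R) (n : nat) (p : R * R) : Prop :=
  (eta / 4 ^ n <= Cmod (rect_int g (fst p) (fst p + side w n) (snd p) (snd p + side h n)))%R.

(** The integral is the sum of those over the four quarters, so at least one of them carries a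
    quarter of the lower bound. *)
Lemma goursat_step g w h eta n p : (0 <= w)%R -> (0 <= h)%R ->
  (forall z, in_rect (fst p) (fst p + side w n) (snd p) (snd p + side h n) z -> ccont g z) ->
  big g w h eta n p ->
  exists q, (fst q = fst p \/ fst q = fst p + side w (S n))%R /\
    (snd q = snd p \/ snd q = snd p + side h (S n))%R /\ big g w h eta (S n) q.
Proof.
  intros Hw Hh Hg Hb. destruct p as [a c]; simpl fst in *; simpl snd in *.
  pose proof (goursat_side_S w n) as Ew. pose proof (goursat_side_S h n) as Eh.
  pose proof (goursat_side_pos w (S n) Hw). pose proof (goursat_side_pos h (S n) Hh).
  set (w' := side w (S n)) in *. set (h' := side h (S n)) in *.
  apply NNPP. intros Hno.
  assert (Hq : forall x y, (x = a \/ x = a + w')%R -> (y = c \/ y = c + h')%R ->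
    (Cmod (rect_int g x (x + w') y (y + h')) < eta / 4 ^ S n)%R).
  { intros x y Hx Hy. apply Rnot_le_lt. intros Hle. apply Hno. exists (x, y). simpl; repeat split; auto. }
  unfold big in Hb; simpl fst in Hb; simpl snd in Hb.
  rewrite (rect_int_split g a (a + w') _ c (c + h')) in Hb by (auto; rewrite ?Ew, ?Eh; lra).
  rewrite Ew, Eh in Hb.
  replace (a + (w' + w'))%R with (a + w' + w')%R in Hb by ring.
  replace (c + (h' + h'))%R with (c + h' + h')%R in Hb by ring.
  pose proof (Hq a c (or_introl eq_refl) (or_introl eq_refl)).
  pose proof (Hq (a + w')%R c (or_intror eq_refl) (or_introl eq_refl)).
  pose proof (Hq a (c + h')%R (or_introl eq_refl) (or_intror eq_refl)).
  pose proof (Hq (a + w')%R (c + h')%R (or_intror eq_refl) (or_intror eq_refl)).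
  replace (eta / 4 ^ n)%R with (4 * (eta / 4 ^ S n))%R in Hb by (simpl; field; apply pow_nonzero; lra).
  match type of Hb with (_ <= Cmod ((?x + ?y) + (?z + ?t)))%R =>
    pose proof (Cmod_triangle (x + y) (z + t)); pose proof (Cmod_triangle x y); pose proof (Cmod_triangle z t) end.
  lra.
Qed.

(** Bisection: a nonzero integral gives nested rectangles whose integrals are at least eta / 4^n.
    Near their common point g is affine up to an error too small for that. *)
Theorem goursat g a b c d : (a <= b)%R -> (c <= d)%R ->
  (forall z, in_rect a b c d z -> holo g z) -> rect_int g a b c d = 0.
Proof.
  intros Hab Hcd Hg. apply NNPP; intros Hne.
  assert (Hc : forall z, in_rect a b c d z -> ccont g z) by (intros; apply holo_ccont; auto).
  set (eta := Cmod (rect_int g a b c d)).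
  assert (Heta : (0 < eta)%R) by (apply Cmod_gt_0; auto).
  set (w := (b - a)%R). set (h := (d - c)%R).
  assert (Hw : (0 <= w)%R) by (unfold w; lra). assert (Hh : (0 <= h)%R) by (unfold h; lra).
  set (inside := fun n (p : R * R) => (a <= fst p /\ fst p + side w n <= b /\ c <= snd p /\ snd p + side h n <= d)%R).
  assert (Hstep : forall n p, inside n p /\ big g w h eta n p -> exists q,
     (inside (S n) q /\ big g w h eta (S n) q) /\
     (fst p <= fst q /\ fst q + side w (S n) <= fst p + side w n /\ snd p <= snd q /\ snd q + side h (S n) <= snd p + side h n)%R).
  { intros n p [Hi Hb]. destruct (goursat_step g w h eta n p Hw Hh) as (q & Hq1 & Hq2 & Hq); auto.
    - intros z [Hz1 Hz2]. apply Hc. unfold inside in Hi. split; lra.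
    - exists q. pose proof (goursat_side_S w n). pose proof (goursat_side_S h n).
      pose proof (goursat_side_pos w (S n) Hw). pose proof (goursat_side_pos h (S n) Hh).
      unfold inside in *. repeat split; auto; destruct Hq1, Hq2; lra. }
  assert (H0 : inside O (a, c) /\ big g w h eta O (a, c)).
  { unfold inside, big, side; simpl. replace (a + w / 1)%R with b by (unfold w; field).
    replace (c + h / 1)%R with d by (unfold h; field). split; [lra|].
    fold eta. lra. }
  (* A choice of the next rectangle, made for every pair [p]; it is meaningful on the sequence [sq]
     because [Hstep] applies there. *)
  set (nxt := fun n (p : R * R) => epsilon (inhabits p) (fun q =>
     (inside (S n) q /\ big g w h eta (S n) q) /\
     (fst p <= fst q /\ fst q + side w (S n) <= fst p + side w n /\ snd p <= snd q /\ snd q + side h (S n) <= snd p + side h n)%R)).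
  set (sq := nat_rect (fun _ => (R * R)%type) (a, c) nxt).
  assert (Hsq : forall n, inside n (sq n) /\ big g w h eta n (sq n)).
  { induction n as [|n IH]; [exact H0|].
    exact (proj1 (epsilon_spec (inhabits (sq n)) _ (Hstep n (sq n) IH))). }
  assert (Hmon : forall n, (fst (sq n) <= fst (sq (S n)) /\ fst (sq (S n)) + side w (S n) <= fst (sq n) + side w n
     /\ snd (sq n) <= snd (sq (S n)) /\ snd (sq (S n)) + side h (S n) <= snd (sq n) + side h n)%R).
  { intros n. exact (proj2 (epsilon_spec (inhabits (sq n)) _ (Hstep n (sq n) (Hsq n)))). }
  assert (Hnest : forall (u v : nat -> R), (forall n, u n <= u (S n))%R -> (forall n, v (S n) <= v n)%R ->
     (forall n, u n <= v n)%R -> exists X, forall n, (u n <= X <= v n)%R).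
  { intros u v Hu Hv Huv.
    assert (Hu' : forall n k, (u n <= u (n + k)%nat)%R).
    { intros n k. induction k as [|k IH]; [rewrite Nat.add_0_r; lra|]. rewrite Nat.add_succ_r. eapply Rle_trans; [exact IH|apply Hu]. }
    assert (Hv' : forall n k, (v (n + k)%nat <= v n)%R).
    { intros n k. induction k as [|k IH]; [rewrite Nat.add_0_r; lra|]. rewrite Nat.add_succ_r. eapply Rle_trans; [apply Hv|exact IH]. }
    assert (Huv' : forall n m, (u n <= v m)%R).
    { intros n m. eapply Rle_trans; [apply (Hu' n m)|]. eapply Rle_trans; [apply Huv|].
      rewrite Nat.add_comm. apply Hv'. }
    destruct (completeness (fun x => exists n, x = u n)) as [X [HX1 HX2]].
    - exists (v O). intros x [n ->]. apply Huv'.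
    - exists (u O); exists O; auto.
    - exists X. intros n. split; [apply HX1; exists n; auto|]. apply HX2. intros x [k ->]. apply Huv'. }
  destruct (Hnest (fun n => fst (sq n)) (fun n => fst (sq n) + side w n)%R) as [X HX].
  { apply Hmon. } { apply Hmon. } { intros n; pose proof (goursat_side_pos w n Hw); lra. }
  destruct (Hnest (fun n => snd (sq n)) (fun n => snd (sq n) + side h n)%R) as [Y HY].
  { apply Hmon. } { apply Hmon. } { intros n; pose proof (goursat_side_pos h n Hh); lra. }
  set (z0 := (X, Y) : C).
  assert (Hz0 : in_rect a b c d z0).
  { specialize (HX O). specialize (HY O). destruct (Hsq O) as [Hi _]. unfold inside in Hi.
    split; unfold z0; simpl in *; lra. }
  destruct (Hg z0 Hz0) as [l Hl].
  (* At level n the perimeter is at most 2 W 2^(-n) and the distance to [z0] at most W 2^(-n). The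
     tolerance eta / (4 W^2) therefore bounds the integral by (eta / 2) 4^(-n), a contradiction; the
     summand 1 keeps W positive for degenerate rectangles. *)
  set (W := (w + h + 1)%R).
  destruct (Hl (eta / (4 * (W * W)))%R) as (del & Hdel & Hd).
  { apply Rdiv_lt_0_compat; auto. unfold W; nra. }
  destruct (pow_small (/ 2) (del / W) ltac:(lra)) as [n Hn]; [apply Rdiv_lt_0_compat; unfold W; lra|].
  specialize (Hn n (Nat.le_refl n)). destruct (Hsq n) as [Hi Hb]. unfold big in Hb.
  specialize (HX n). specialize (HY n).
  set (a' := fst (sq n)) in *. set (c' := snd (sq n)) in *.
  assert (Hsw : side w n = (w * (/ 2) ^ n)%R) by (unfold side; rewrite pow_inv; reflexivity).
  assert (Hsh : side h n = (h * (/ 2) ^ n)%R) by (unfold side; rewrite pow_inv; reflexivity).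
  assert (Hp2 : (0 < (/ 2) ^ n)%R) by (apply pow_lt; lra).
  assert (HWp : (0 < W)%R) by (unfold W; lra).
  assert (HWn : (W * (/ 2) ^ n < del)%R).
  { apply (Rmult_lt_compat_l W) in Hn; auto. replace (W * (del / W))%R with del in Hn by (field; lra). exact Hn. }
  (* The affine part has a primitive and integrates to 0, so only the remainder contributes. *)
  set (r := fun z => g z - (g z0 + l * (z - z0))).
  assert (Haff : forall z, ccont (fun z => g z0 + l * (z - z0)) z).
  { intros z. apply (cderiv_ccont _ _ (0 + l * (1 - 0))). apply cderiv_plus; [apply cderiv_const|].
    apply cderiv_scal, cderiv_minus; [apply cderiv_id|apply cderiv_const]. }
  assert (Hin : forall z, in_rect a' (a' + side w n) c' (c' + side h n) z -> in_rect a b c d z).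
  { intros z [H1 H2]. unfold inside in Hi. fold a' c' in Hi. split; lra. }
  assert (Hrc : forall z, in_rect a' (a' + side w n) c' (c' + side h n) z -> ccont r z).
  { intros z Hz. specialize (Hg z (Hin z Hz)). apply holo_ccont. unfold r. apply holo_minus; auto.
    exists (0 + l * (1 - 0)). apply cderiv_plus; [apply cderiv_const|].
    apply cderiv_scal, cderiv_minus; [apply cderiv_id|apply cderiv_const]. }
  pose proof (goursat_side_pos w n Hw) as Hsw0. pose proof (goursat_side_pos h n Hh) as Hsh0.
  assert (E : rect_int g a' (a' + side w n) c' (c' + side h n) = rect_int r a' (a' + side w n) c' (c' + side h n)).
  { transitivity (rect_int (fun z => r z + (g z0 + l * (z - z0))) a' (a' + side w n) c' (c' + side h n)).
    - unfold rect_int, r. f_equal; [f_equal|f_equal; f_equal]; apply Cint_ext; try lra; intros; ring.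
    - rewrite rect_int_plus; auto; try lra.
      rewrite (rect_int_primitive (fun z => g z0 * z + l / 2 * ((z - z0) * (z - z0))) (fun z => g z0 + l * (z - z0))); auto; try lra.
      + ring.
      + intros z. apply (cderiv_eq _ _ (g z0 * 1 + l / 2 * ((2 * (z - z0)) * (1 - 0)))); [field|].
        apply cderiv_plus; [apply cderiv_scal, cderiv_id|]. apply cderiv_scal.
        apply (cderiv_comp (fun y => y * y) (fun z => z - z0)); [apply cderiv_sqr|].
        apply cderiv_minus; [apply cderiv_id|apply cderiv_const]. }
  rewrite E in Hb.
  assert (Hrb : forall z, in_rect a' (a' + side w n) c' (c' + side h n) z ->
    (Cmod (r z) <= eta / (4 * (W * W)) * (W * (/ 2) ^ n))%R).
  { intros z Hz. set (k := z - z0).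
    assert (Hk : (Cmod k <= W * (/ 2) ^ n)%R).
    { eapply Rle_trans; [apply Cmod_le_Re_Im|]. unfold k, Cminus. rewrite re_plus, im_plus, re_opp, im_opp.
      unfold z0. destruct Hz as [Hz1 Hz2]. simpl (Re (X, Y)). simpl (Im (X, Y)).
      assert (Rabs (Re z + - X) <= side w n)%R by (apply Rabs_le; lra).
      assert (Rabs (Im z + - Y) <= side h n)%R by (apply Rabs_le; lra). unfold W. nra. }
    specialize (Hd k (Rle_lt_trans _ _ _ Hk HWn)).
    replace (r z) with (g (z0 + k) - g z0 - l * k).
    - eapply Rle_trans; [exact Hd|]. apply Rmult_le_compat_l; auto.
      apply Rmult_le_pos; [lra|]. left; apply Rinv_0_lt_compat; nra.
    - unfold r, k. replace (z0 + (z - z0)) with z by ring. ring. }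
  pose proof (rect_int_bound r a' (a' + side w n) c' (c' + side h n) _ ltac:(lra) ltac:(lra) Hrc Hrb) as HB.
  assert (H4 : ((/ 2) ^ n * (/ 2) ^ n = / 4 ^ n)%R).
  { rewrite <- Rpow_mult_distr, <- pow_inv. f_equal. field. }
  assert (Hfin : (eta / 4 ^ n <= 2 * (W * (/ 2) ^ n) * (eta / (4 * (W * W)) * (W * (/ 2) ^ n)))%R).
  { eapply Rle_trans; [exact Hb|]. eapply Rle_trans; [exact HB|].
    apply Rmult_le_compat_r.
    - apply Rmult_le_pos; [|nra]. apply Rmult_le_pos; [lra|]. left; apply Rinv_0_lt_compat; nra.
    - unfold W; nra. }
  replace (2 * (W * (/ 2) ^ n) * (eta / (4 * (W * W)) * (W * (/ 2) ^ n)))%R with (eta / 2 * ((/ 2) ^ n * (/ 2) ^ n))%R in Hfin by (field; lra).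
  rewrite H4 in Hfin. assert (0 < / 4 ^ n)%R by (apply Rinv_0_lt_compat, pow_lt; lra).
  unfold Rdiv at 1 in Hfin. nra.
Qed.

End Goursat.

Lemma ei_cexp t : ei t = cexp (0%R, t).
Proof. unfold cexp; simpl. rewrite exp_0. ring. Qed.

(** * Means over circles and Laurent expansions *)

Lemma rderiv_ei t : rderiv ei t (ei t * Ci).
Proof.
  rewrite ei_cexp.
  apply (is_derive_ext (K := R_AbsRing) (V := C_R_NormedModule) (fun t => cexp (0%R, t))).
  { intros; symmetry; apply ei_cexp. }
  apply (rderiv_comp cexp (fun t => (0%R, t) : C)); [apply cderiv_cexp|apply rderiv_vertical].
Qed.

Definition circ (c : C) (t : R) : C := c * ei t.

Lemma rderiv_circ c t : rderiv (circ c) t (c * (ei t * Ci)).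
Proof.
  apply (rderiv_comp (fun z => c * z) ei); [|apply rderiv_ei].
  apply (cderiv_eq _ _ (c * 1)); [ring|]. apply cderiv_scal, cderiv_id.
Qed.

Lemma rcont_circ c t : rcont (circ c) t.
Proof. eapply rderiv_rcont, rderiv_circ. Qed.

Lemma Cmod_circ (r : R) t : (0 <= r)%R -> Cmod (circ r t) = r.
Proof. intros. unfold circ. rewrite Cmod_mult, Cmod_ei, Cmod_R, Rabs_pos_eq; lra. Qed.

Definition circ_cont (F : C -> C) (r : R) : Prop := forall u, Cmod u = r -> ccont F u.

(** Cauchy integrals in disguise: since du = i u dt, the integral of F(u) u^n du / (2 pi i) over the
    circle is the mean of F(u) u^(n+1). *)
Definition mean (F : C -> C) (r : R) : C :=
  / RtoC (2 * PI) * Cint (fun t => F (circ r t)) 0 (2 * PI).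

Lemma two_PI_pos : (0 < 2 * PI)%R.
Proof. pose proof PI_RGT_0; lra. Qed.

Lemma two_PI_nz : RtoC (2 * PI) <> 0.
Proof. apply RtoC_neq0. pose proof two_PI_pos; lra. Qed.

Lemma circ_rcont F r t : (0 <= r)%R -> circ_cont F r -> rcont (fun t => F (circ r t)) t.
Proof. intros Hr H. apply rcont_comp; [apply rcont_circ|]. apply H, Cmod_circ; auto. Qed.

Lemma mean_ext F G r : (0 <= r)%R -> (forall u, Cmod u = r -> F u = G u) -> mean F r = mean G r.
Proof.
  intros Hr H. unfold mean. f_equal. apply Cint_ext; [pose proof two_PI_pos; lra|].
  intros; apply H, Cmod_circ; auto.
Qed.

Lemma mean_plus F G r : (0 <= r)%R -> circ_cont F r -> circ_cont G r ->
  mean (fun u => F u + G u) r = mean F r + mean G r.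
Proof.
  intros Hr HF HG. unfold mean. rewrite Cint_plus; [ring|pose proof two_PI_pos; lra| |];
    intros; apply circ_rcont; auto.
Qed.

Lemma mean_minus F G r : (0 <= r)%R -> circ_cont F r -> circ_cont G r ->
  mean (fun u => F u - G u) r = mean F r - mean G r.
Proof.
  intros Hr HF HG. unfold mean. rewrite Cint_minus; [ring|pose proof two_PI_pos; lra| |];
    intros; apply circ_rcont; auto.
Qed.

Lemma mean_scal c F r : (0 <= r)%R -> circ_cont F r -> mean (fun u => c * F u) r = c * mean F r.
Proof.
  intros Hr HF. unfold mean. rewrite Cint_scal; [ring|pose proof two_PI_pos; lra|].
  intros; apply circ_rcont; auto.
Qed.

Lemma mean_const c r : mean (fun _ => c) r = c.
Proof. unfold mean. rewrite Cint_const, Rminus_0_r. field. apply two_PI_nz. Qed.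

Lemma mean_bound F r M : (0 <= r)%R -> circ_cont F r ->
  (forall u, Cmod u = r -> (Cmod (F u) <= M)%R) -> (Cmod (mean F r) <= M)%R.
Proof.
  intros Hr HF HM. unfold mean. pose proof two_PI_pos.
  rewrite Cmod_mult, Cmod_inv, Cmod_R, Rabs_pos_eq by (try apply two_PI_nz; lra).
  apply Rmult_le_reg_l with (2 * PI)%R; auto. rewrite <- Rmult_assoc, Rinv_r, Rmult_1_l by lra.
  replace (2 * PI * M)%R with ((2 * PI - 0) * M)%R by ring. apply Cint_bound; [lra| |].
  - intros; apply circ_rcont; auto.
  - intros; apply HM, Cmod_circ; auto.
Qed.

Lemma mean_series (u : nat -> C -> C) r t M : (0 <= r)%R -> (0 <= t < 1)%R ->
  (forall n, circ_cont (u n) r) -> (forall z, Cmod z = r -> geo t M (fun n => u n z)) ->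
  mean (fun z => Cseries (fun n => u n z)) r = Cseries (fun n => mean (u n) r).
Proof.
  intros Hr Ht Hu Hg. unfold mean. pose proof two_PI_pos.
  rewrite (Cint_swap_series (fun n s => u n (circ r s)) 0 (2 * PI) t M); auto; try lra.
  - rewrite <- (Cseries_scal t ((2 * PI - 0) * M)); auto.
    intros n. rewrite Rmult_assoc. apply Cint_bound; [lra| |].
    + intros; apply circ_rcont; auto.
    + intros s _. apply (Hg (circ r s)), Cmod_circ; auto.
  - intros; apply circ_rcont; auto.
  - intros s. apply Hg, Cmod_circ; auto.
Qed.

Lemma holo_circ F r : (forall u, Cmod u = r -> holo F u) -> circ_cont F r.
Proof. intros H u Hu; apply holo_ccont; auto. Qed.

Lemma Cmod_r_nz (r : R) u : (0 < r)%R -> Cmod u = r -> u <> 0.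
Proof. intros Hr Hu. apply Cmod_gt_0. lra. Qed.

Lemma holo_pow_inv n (u : C) : u <> 0 -> holo (fun u => / u ^ n) u.
Proof.
  intros Hu. apply (holo_comp (fun y => / y) (fun u => u ^ n)); [|apply holo_pow].
  apply holo_inv, Cpow_nz; auto.
Qed.

Lemma mean_pow n r : (0 <= r)%R -> mean (fun u => u ^ S n) r = 0.
Proof.
  intros Hr. unfold mean. pose proof two_PI_pos.
  rewrite (Cint_FTC (fun t => / (INR (S n) * Ci) * circ r t ^ S n)); try lra.
  - unfold circ. rewrite ei_2PI, ei_0. ring.
  - intros t _.
    assert (Hn : INR (S n) * Ci <> 0).
    { apply Cmult_neq_0; [|apply Ci_nz]. apply RtoC_neq0, not_0_INR; lia. }
    replace (circ r t ^ S n) with ((/ (INR (S n) * Ci) * (INR (S n) * circ r t ^ n * 1)) * (r * (ei t * Ci))).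
    + apply (rderiv_comp (fun z => / (INR (S n) * Ci) * z ^ S n) (circ r)); [|apply rderiv_circ].
      apply cderiv_scal. apply (cderiv_pow (fun z => z)), cderiv_id.
    + unfold circ. change ((r * ei t) ^ S n) with ((r * ei t) * (r * ei t) ^ n).
      field. split; [apply Ci_nz|apply RtoC_neq0, not_0_INR; lia].
  - intros t _. apply (rcont_comp (fun z => z ^ S n) (circ r)); [apply rcont_circ|].
    apply holo_ccont, holo_pow.
Qed.

Lemma Cint_periodic f c : (forall t, rcont f t) -> (forall t, f (t + 2 * PI)%R = f t) ->
  (0 <= c <= 2 * PI)%R -> Cint f c (2 * PI + c) = Cint f 0 (2 * PI).
Proof.
  intros Hf Hp Hc.
  rewrite (Cint_Chasles f c (2 * PI) (2 * PI + c)) by (auto; lra).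
  rewrite (Cint_Chasles f 0 c (2 * PI)) by (auto; lra).
  replace (Cint f (2 * PI) (2 * PI + c)) with (Cint f 0 c); [ring|].
  pose proof (Cint_shift f 0 c (2 * PI) ltac:(lra) ltac:(auto)) as H.
  rewrite Rplus_0_l in H. rewrite (Rplus_comm (2 * PI) c), <- H. apply Cint_ext; [lra|]. intros; symmetry; auto.
Qed.

Lemma ei_period t : ei (t + 2 * PI) = ei t.
Proof. rewrite ei_plus, ei_2PI. ring. Qed.

Lemma arg_exists z : Cmod z = 1%R -> exists t, (0 <= t <= 2 * PI)%R /\ z = ei t.
Proof.
  destruct z as [x y]. intros H.
  assert (H2 : (x * x + y * y = 1)%R).
  { pose proof (Cmod2_alt (x, y)) as E. rewrite H in E. simpl in E. lra. }
  assert (Hx : (-1 <= x <= 1)%R) by nra.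
  pose proof (acos_bound x) as Hb. pose proof PI_RGT_0.
  assert (Hs : (sin (acos x) * sin (acos x) = y * y)%R).
  { pose proof (sin2_cos2 (acos x)) as E. unfold Rsqr in E. rewrite cos_acos in E by auto. lra. }
  assert (Hs0 : (0 <= sin (acos x))%R) by (apply sin_ge_0; lra).
  destruct (Rle_lt_dec 0 y) as [Hy|Hy].
  - exists (acos x). split; [lra|]. unfold ei. rewrite cos_acos by auto. f_equal. nra.
  - exists (2 * PI - acos x)%R. split; [lra|]. unfold ei.
    replace (2 * PI - acos x)%R with (- acos x + 2 * INR 1 * PI)%R by (simpl; ring).
    rewrite cos_period, sin_period, cos_neg, sin_neg, cos_acos by auto. f_equal. nra.
Qed.

(** If rho = r^2 e^(i psi), the map u -> rho / u acts on the circle as t -> psi - t, and means are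
    invariant under reflections and rotations of the angle. This is how integrals are moved between
    C_a and C_{-a}. *)
Lemma mean_inversion F (r : R) rho : (0 < r)%R -> Cmod rho = (r * r)%R -> circ_cont F r ->
  mean (fun u => F (rho / u)) r = mean F r.
Proof.
  intros Hr Hrho HF. pose proof two_PI_pos.
  destruct (arg_exists (rho / (r * r))) as (psi & Hpsi & E).
  { rewrite Cmod_div, Hrho, Cmod_mult, !Cmod_R, Rabs_pos_eq by (try (apply Cmult_neq_0; apply RtoC_neq0); lra).
    field; lra. }
  assert (Hrn : RtoC r <> 0) by (apply RtoC_neq0; lra).
  assert (Erho : rho = r * r * ei psi) by (rewrite <- E; field; auto).
  unfold mean. f_equal.
  transitivity (Cint (fun t => F (circ r (psi - t)%R)) 0 (2 * PI)).
  { apply Cint_ext; [lra|]. intros t _. f_equal. unfold circ, Rminus. rewrite Erho, ei_plus, ei_opp.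
    field. split; auto. apply ei_nz. }
  assert (Hc : forall t, rcont (fun t => F (circ r t)) t) by (intros; apply circ_rcont; auto; lra).
  rewrite (Cint_reflect (fun t => F (circ r t)) 0 (2 * PI) psi) by (auto; lra).
  replace (psi - 0)%R with psi by ring.
  transitivity (Cint (fun t => F (circ r t)) psi (2 * PI + psi)).
  - pose proof (Cint_shift (fun t => F (circ r t)) (psi - 2 * PI) psi (2 * PI) ltac:(lra) ltac:(auto)) as HS.
    replace (psi - 2 * PI + 2 * PI)%R with psi in HS by ring. rewrite (Rplus_comm psi) in HS. rewrite <- HS.
    apply Cint_ext; [lra|]. intros t _. unfold circ. rewrite ei_period; auto.
  - apply (Cint_periodic (fun t => F (circ r t))); auto. intros; unfold circ; rewrite ei_period; auto.
Qed.

Lemma circ_cont_pow_inv n r : (0 < r)%R -> circ_cont (fun u => / u ^ n) r.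
Proof. intros Hr. apply holo_circ. intros u Hu. apply holo_pow_inv, (Cmod_r_nz r); auto. Qed.

Lemma circ_cont_pow n r : circ_cont (fun u => u ^ n) r.
Proof. apply holo_circ. intros; apply holo_pow. Qed.

Lemma mean_pow_inv n r : (0 < r)%R -> mean (fun u => / u ^ S n) r = 0.
Proof.
  intros Hr. assert (Hrn : RtoC r <> 0) by (apply RtoC_neq0; lra).
  rewrite <- (mean_inversion _ r (r * r)); auto.
  - transitivity (mean (fun u => / (r * r) ^ S n * u ^ S n) r).
    + apply mean_ext; [lra|]. intros u Hu. pose proof (Cmod_r_nz r u Hr Hu).
      unfold Cdiv. rewrite Cpow_mult_l, Cpow_inv by auto. field. split; apply Cpow_nz; auto.
      apply Cmult_neq_0; auto.
    + rewrite mean_scal, mean_pow by (try apply circ_cont_pow; lra). ring.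
  - rewrite Cmod_mult, Cmod_R, Rabs_pos_eq; lra.
  - apply circ_cont_pow_inv; auto.
Qed.

Lemma ccont_mult f g z : ccont f z -> ccont g z -> ccont (fun z => f z * g z) z.
Proof.
  intros H1 H2 eps He. set (M := (Cmod (f z) + Cmod (g z) + 1)%R).
  pose proof (Cmod_ge_0 (f z)) as P1. pose proof (Cmod_ge_0 (g z)) as P2.
  assert (HM : (0 < M)%R) by (unfold M; lra).
  set (e := Rmin 1 (eps / (2 * M))).
  assert (Hm : (0 < eps / (2 * M))%R) by (apply Rdiv_lt_0_compat; lra).
  assert (Hep : (0 < e)%R) by (apply Rmin_pos; lra).
  destruct (H1 e Hep) as (d1 & Hd1 & H1'). destruct (H2 e Hep) as (d2 & Hd2 & H2').
  exists (Rmin d1 d2); split; [apply Rmin_pos; auto|]. intros t' Ht'.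
  specialize (H1' t' (Rlt_le_trans _ _ _ Ht' (Rmin_l _ _))).
  specialize (H2' t' (Rlt_le_trans _ _ _ Ht' (Rmin_r _ _))).
  replace (f t' * g t' - f z * g z) with ((f t' - f z) * (g t' - g z) + ((f t' - f z) * g z + f z * (g t' - g z))) by ring.
  assert (E1 : (e <= 1)%R) by apply Rmin_l. assert (E2 : (e <= eps / (2 * M))%R) by apply Rmin_r.
  eapply Rle_lt_trans; [eapply Rle_trans; [apply Cmod_triangle|apply Rplus_le_compat_l, Cmod_triangle]|].
  rewrite !Cmod_mult. pose proof (Cmod_ge_0 (f t' - f z)). pose proof (Cmod_ge_0 (g t' - g z)).
  apply Rle_lt_trans with (e * 1 + (e * Cmod (g z) + Cmod (f z) * e))%R.
  - apply Rplus_le_compat; [apply Rmult_le_compat; lra|]. apply Rplus_le_compat.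
    apply Rmult_le_compat_r; lra. apply Rmult_le_compat_l; lra.
  - replace (e * 1 + (e * Cmod (g z) + Cmod (f z) * e))%R with (e * M)%R by (unfold M; ring).
    apply Rle_lt_trans with (eps / (2 * M) * M)%R; [apply Rmult_le_compat_r; lra|].
    replace (eps / (2 * M) * M)%R with (eps / 2)%R by (field; lra). lra.
Qed.

Lemma ccont_plus f g z : ccont f z -> ccont g z -> ccont (fun z => f z + g z) z.
Proof.
  intros H1 H2 eps He. destruct (H1 (eps / 2)%R) as (d1 & Hd1 & H1'); [lra|].
  destruct (H2 (eps / 2)%R) as (d2 & Hd2 & H2'); [lra|].
  exists (Rmin d1 d2); split; [apply Rmin_pos; auto|]. intros t' Ht'.
  specialize (H1' t' (Rlt_le_trans _ _ _ Ht' (Rmin_l _ _))).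
  specialize (H2' t' (Rlt_le_trans _ _ _ Ht' (Rmin_r _ _))).
  replace (f t' + g t' - (f z + g z)) with ((f t' - f z) + (g t' - g z)) by ring.
  eapply Rle_lt_trans; [apply Cmod_triangle|lra].
Qed.

Lemma ccont_conj f z : ccont f z -> ccont (fun z => Cconj (f z)) z.
Proof.
  intros H eps He. destruct (H eps He) as (d & Hd & H1). exists d; split; auto. intros z' Hz'.
  rewrite <- Cminus_conj, Cmod_conj; auto.
Qed.

Lemma circ_cont_mult F G r : circ_cont F r -> circ_cont G r -> circ_cont (fun u => F u * G u) r.
Proof. intros H1 H2 u Hu; apply ccont_mult; auto. Qed.
Lemma circ_cont_plus F G r : circ_cont F r -> circ_cont G r -> circ_cont (fun u => F u + G u) r.
Proof. intros H1 H2 u Hu; apply ccont_plus; auto. Qed.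
Lemma circ_cont_const c r : circ_cont (fun _ => c) r.
Proof. apply holo_circ; intros; apply holo_const. Qed.
Lemma circ_cont_scal c F r : circ_cont F r -> circ_cont (fun u => c * F u) r.
Proof. intros. apply circ_cont_mult; auto. apply circ_cont_const. Qed.
Lemma ccont_ext f g z : (forall z, f z = g z) -> ccont f z -> ccont g z.
Proof. intros E H eps He. destruct (H eps He) as (d & Hd & H1). exists d; split; auto. intros; rewrite <- !E; auto. Qed.
Lemma circ_cont_minus F G r : circ_cont F r -> circ_cont G r -> circ_cont (fun u => F u - G u) r.
Proof.
  intros H1 H2 u Hu. apply ccont_plus; auto.
  apply (ccont_ext (fun u => (-1) * G u)); [intros; ring|]. apply ccont_mult; auto. apply (circ_cont_const (-1) r); auto.
Qed.
Lemma circ_cont_conj F r : circ_cont F r -> circ_cont (fun u => Cconj (F u)) r.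
Proof. intros H u Hu; apply ccont_conj; auto. Qed.

Lemma mean_conj F r : (0 <= r)%R -> circ_cont F r -> mean (fun u => Cconj (F u)) r = Cconj (mean F r).
Proof.
  intros Hr HF. unfold mean. pose proof two_PI_pos.
  rewrite Cmult_conj, Cinv_conj by apply two_PI_nz.
  replace (Cconj (RtoC (2 * PI))) with (RtoC (2 * PI)) by (apply injective_projections; simpl; ring).
  f_equal. apply Cint_unique. apply is_RInt_C_parts.
  pose proof (Cint_correct (fun t => F (circ r t)) 0 (2 * PI) ltac:(lra) ltac:(intros; apply circ_rcont; auto)) as H1.
  apply is_RInt_C_parts in H1. destruct H1 as [H1 H2]. split.
  - rewrite re_conj. eapply is_RInt_ext; [|exact H1]. intros; symmetry; apply re_conj.
  - rewrite im_conj. eapply is_RInt_ext; [intros; symmetry; apply im_conj|]. apply (is_RInt_opp (V := R_NormedModule)); auto.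
Qed.

Lemma mean_ge0 F r : (0 <= r)%R -> circ_cont F r -> (forall u, Cmod u = r -> (0 <= Re (F u))%R) ->
  (0 <= Re (mean F r))%R.
Proof.
  intros Hr HF H. unfold mean. pose proof two_PI_pos.
  rewrite <- RtoC_inv by lra. rewrite re_scal_l. apply Rmult_le_pos; [left; apply Rinv_0_lt_compat; lra|].
  apply Cint_ge0; [lra| |]; intros; [apply circ_rcont; auto|apply H, Cmod_circ; auto].
Qed.

(** * Bessel's inequality on a circle and the decay of Fourier coefficients *)

Section Bessel.

Let phi (r : R) (n : nat) (u : C) : C := / r ^ n * u ^ n.
Let phib (r : R) (n : nat) (u : C) : C := r ^ n * / u ^ n.

Lemma phi_phib r n m : (0 < r)%R -> mean (fun u => phi r n u * phib r m u) r = if Nat.eq_dec n m then 1 else 0.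
Proof.
  intros Hr. assert (Hrn : RtoC r <> 0) by (apply RtoC_neq0; lra).
  assert (Hp : forall k, RtoC r ^ k <> 0) by (intros; apply Cpow_nz; auto).
  destruct (Nat.eq_dec n m) as [->|Hn].
  - rewrite <- (mean_const 1 r). apply mean_ext; [lra|]. intros u Hu. unfold phi, phib. field.
    split; auto. apply Cpow_nz, (Cmod_r_nz r); auto.
  - destruct (Nat.lt_total n m) as [H|[H|H]]; [|lia|].
    + transitivity (mean (fun u => r ^ S (m - n - 1) * / u ^ S (m - n - 1)) r).
      * apply mean_ext; [lra|]. intros u Hu. pose proof (Cmod_r_nz r u Hr Hu) as Hu0.
        assert (Hup : forall k, u ^ k <> 0) by (intros; apply Cpow_nz; auto). unfold phi, phib.
        replace m with (n + S (m - n - 1))%nat at 1 2 by lia. rewrite !Cpow_add_r. field. auto.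
      * rewrite mean_scal, mean_pow_inv; auto; try lra. ring. apply circ_cont_pow_inv; auto.
    + transitivity (mean (fun u => / r ^ S (n - m - 1) * u ^ S (n - m - 1)) r).
      * apply mean_ext; [lra|]. intros u Hu. pose proof (Cmod_r_nz r u Hr Hu) as Hu0.
        assert (Hup : forall k, u ^ k <> 0) by (intros; apply Cpow_nz; auto). unfold phi, phib.
        replace n with (m + S (n - m - 1))%nat at 1 2 by lia. rewrite !Cpow_add_r. field. auto.
      * rewrite mean_scal, mean_pow; auto; try lra. ring. apply circ_cont_pow.
Qed.

Lemma phi_cont r n : circ_cont (phi r n) r.
Proof. apply circ_cont_scal, circ_cont_pow. Qed.

Lemma phib_cont r n : (0 < r)%R -> circ_cont (phib r n) r.
Proof. intros. apply circ_cont_scal, circ_cont_pow_inv; auto. Qed.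

Lemma phi_conj r n u : (0 < r)%R -> Cmod u = r -> Cconj (phi r n u) = phib r n u.
Proof.
  intros Hr Hu. pose proof (Cmod_r_nz r u Hr Hu) as Hu0.
  assert (Hrn : RtoC r <> 0) by (apply RtoC_neq0; lra).
  assert (Hc : Cconj u = r * r * / u).
  { transitivity (u * Cconj u * / u); [field; auto|]. rewrite <- Cmod2_conj, Hu. f_equal.
    simpl. rewrite Rmult_1_r, RtoC_mult; auto. }
  unfold phi, phib. rewrite Cmult_conj, Cpow_conj, Hc, Cinv_conj, Cpow_conj by (apply Cpow_nz; auto).
  replace (Cconj (RtoC r)) with (RtoC r) by (apply injective_projections; simpl; ring).
  rewrite !Cpow_mult_l, Cpow_inv by auto. field. split; apply Cpow_nz; auto.
Qed.

Let energy (F : C -> C) (r : R) : R := Re (mean (fun u => F u * Cconj (F u)) r).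

Lemma energy_ge0 F r : (0 <= r)%R -> circ_cont F r -> (0 <= energy F r)%R.
Proof.
  intros Hr HF. apply mean_ge0; auto.
  - apply circ_cont_mult; auto. apply circ_cont_conj; auto.
  - intros u Hu. rewrite <- Cmod2_conj, re_RtoC. apply pow2_ge_0.
Qed.

(** [phi r n] has norm 1, and subtracting the orthogonal projection on it lowers the energy by the
    squared coefficient. *)
Lemma energy_step F r n : (0 < r)%R -> circ_cont F r ->
  let b := mean (fun u => F u * phib r n u) r in
  energy (fun u => F u - b * phi r n u) r = (energy F r - Cmod b ^ 2)%R.
Proof.
  intros Hr HF b. pose proof (phi_cont r n) as Hp. pose proof (phib_cont r n Hr) as Hpb.
  pose proof (circ_cont_conj F r HF) as HFc.
  assert (Hr' : (0 <= r)%R) by lra.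
  assert (E1 : mean (fun u => phi r n u * Cconj (F u)) r = Cconj b).
  { unfold b. rewrite <- mean_conj; auto; [|apply circ_cont_mult; auto].
    apply mean_ext; auto. intros u Hu. rewrite Cmult_conj, <- (phi_conj r n u), Cconj_conj; auto. ring. }
  assert (E : mean (fun u => (F u - b * phi r n u) * Cconj (F u - b * phi r n u)) r
     = mean (fun u => F u * Cconj (F u)) r - b * Cconj b).
  { transitivity (mean (fun u => (F u * Cconj (F u) - Cconj b * (F u * phib r n u)) -
       (b * (phi r n u * Cconj (F u)) - b * Cconj b * (phi r n u * phib r n u))) r).
    - apply mean_ext; auto. intros u Hu. rewrite Cminus_conj, Cmult_conj, phi_conj by auto. ring.
    - pose proof (circ_cont_mult _ _ r HF HFc). pose proof (circ_cont_mult _ _ r HF Hpb).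
      pose proof (circ_cont_mult _ _ r Hp HFc). pose proof (circ_cont_mult _ _ r Hp Hpb).
      rewrite !mean_minus; auto; try apply circ_cont_minus; try apply circ_cont_scal; auto.
      rewrite !mean_scal; auto. rewrite E1, phi_phib by auto. fold b.
      destruct (Nat.eq_dec n n); [ring|congruence]. }
  unfold energy. rewrite E, <- Cmod2_conj. unfold Cminus. rewrite re_plus, re_opp, re_RtoC. ring.
Qed.

(** The energy left after removing the first N modes is nonnegative, so the squares of the
    coefficients are summable. Only continuity on the circle is assumed, which lets the lemma apply
    to the difference quotient in the Laurent expansion. *)
Lemma fourier_small F r : (0 < r)%R -> circ_cont F r ->
  forall eps, (0 < eps)%R -> exists N0, forall n, (N0 <= n)%nat ->
    (Cmod (r ^ n * mean (fun u => F u * / u ^ n) r)%C < eps)%R.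
Proof.
  intros Hr HF. assert (Hr' : (0 <= r)%R) by lra.
  set (b := fun n => mean (fun u => F u * phib r n u) r).
  (* The residual after N projections; its coefficients of index at least N are still those of
     [F]. *)
  set (res := nat_rect (fun _ => C -> C) F (fun n G u => G u - b n * phi r n u)).
  assert (Hres : forall N, circ_cont (res N) r /\
     (forall m, (N <= m)%nat -> mean (fun u => res N u * phib r m u) r = b m) /\
     energy (res N) r = (energy F r - rsumn N (fun n => Cmod (b n) ^ 2))%R).
  { induction N as [|N (H1 & H2 & H3)].
    - simpl. repeat split; auto. unfold rsumn; simpl; ring.
    - assert (HN1 : circ_cont (res (S N)) r).
      { apply (circ_cont_minus (res N)); auto. apply circ_cont_scal, phi_cont. }
      split; [exact HN1|split].
      + intros m Hm. transitivity (mean (fun u => res N u * phib r m u - b N * (phi r N u * phib r m u)) r).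
        * apply mean_ext; auto. intros u _. simpl. ring.
        * rewrite mean_minus, mean_scal, phi_phib, H2; auto; try lia.
          -- destruct (Nat.eq_dec N m); [lia|]. ring.
          -- apply circ_cont_mult; [apply phi_cont|apply phib_cont; auto].
          -- apply circ_cont_mult; auto. apply phib_cont; auto.
          -- apply circ_cont_scal, circ_cont_mult; [apply phi_cont|apply phib_cont; auto].
      + rewrite rsumn_S. pose proof (energy_step (res N) r N Hr H1) as HE. cbv zeta in HE.
        rewrite H2 in HE by lia. transitivity (energy (fun u => res N u - b N * phi r N u) r); [reflexivity|].
        rewrite HE, H3. ring. }
  assert (Hsum : forall N, (rsumn N (fun n => Cmod (b n) ^ 2) <= energy F r)%R).
  { intros N. destruct (Hres N) as (H1 & _ & H3). pose proof (energy_ge0 (res N) r Hr' H1). lra. }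
  assert (Hser : ex_series (fun n => Cmod (b n) ^ 2)%R).
  { destruct (ex_finite_lim_seq_incr (fun N => rsumn N (fun n => Cmod (b n) ^ 2)%R) (energy F r)) as [l Hl].
    - intros n. rewrite rsumn_S. pose proof (pow2_ge_0 (Cmod (b n))). lra.
    - exact Hsum.
    - exists l. apply is_series_rsumn; auto. }
  pose proof (ex_series_lim_0 _ Hser) as Hlim. apply is_lim_seq_spec in Hlim.
  intros eps He. destruct (Hlim (mkposreal (eps * eps) ltac:(nra))) as [N0 HN0].
  exists N0. intros n Hn. specialize (HN0 n Hn).
  rewrite Rminus_0_r, Rabs_pos_eq in HN0 by apply pow2_ge_0. simpl in HN0.
  replace (r ^ n * mean (fun u => F u * / u ^ n) r) with (b n).
  - pose proof (Cmod_ge_0 (b n)). apply Rnot_le_lt; intros Hle. nra.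
  - unfold b, phib. rewrite <- mean_scal; auto.
    + apply mean_ext; auto; intros; ring.
    + apply circ_cont_mult; auto. apply circ_cont_pow_inv; auto.
Qed.

End Bessel.

(** The inversion u -> r^2 / u exchanges positive and negative powers on the circle. *)
Lemma fourier_small_neg F r : (0 < r)%R -> circ_cont F r ->
  forall eps, (0 < eps)%R -> exists N0, forall n, (N0 <= n)%nat ->
    (Cmod (/ r ^ n * mean (fun u => F u * u ^ n) r)%C < eps)%R.
Proof.
  intros Hr HF eps He.
  assert (Hrn : RtoC r <> 0) by (apply RtoC_neq0; lra).
  assert (Hrr : Cmod (RtoC r * RtoC r) = (r * r)%R) by (rewrite Cmod_mult, Cmod_R, Rabs_pos_eq; lra).
  assert (HG : circ_cont (fun u => F (r * r / u)) r).
  { intros u Hu. pose proof (Cmod_r_nz r u Hr Hu) as Hu0.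
    assert (Hv : Cmod (r * r / u) = r) by (rewrite Cmod_div, Hrr, Hu by auto; field; lra).
    intros e Hep. destruct (HF _ Hv e Hep) as (d & Hd & H1).
    destruct (holo_ccont (fun u => r * r * / u) u (holo_mult _ _ _ (holo_const _ _) (holo_inv u Hu0)) d Hd) as (d' & Hd' & H2).
    exists d'; split; [auto|]. intros z' Hz'. apply H1, H2, Hz'. }
  destruct (fourier_small _ r Hr HG eps He) as [N0 HN0]. exists N0; intros n Hn. specialize (HN0 n Hn).
  replace (/ r ^ n * mean (fun u => F u * u ^ n) r) with (r ^ n * mean (fun u => F (r * r / u) * / u ^ n) r); auto.
  rewrite <- (mean_inversion (fun u => F u * u ^ n) r (r * r)); auto.
  - transitivity (r ^ n * mean (fun u => / (r ^ n * r ^ n) * (F (r * r / u) * (r * r / u) ^ n)) r).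
    + f_equal. apply mean_ext; [lra|]. intros u Hu. pose proof (Cmod_r_nz r u Hr Hu) as Hu0.
      unfold Cdiv. rewrite !Cpow_mult_l, Cpow_inv by auto. field. split; apply Cpow_nz; auto.
    + rewrite mean_scal; [|lra|].
      * field. apply Cpow_nz; auto.
      * intros u Hu. pose proof (Cmod_r_nz r u Hr Hu) as Hu0. apply ccont_mult; [apply HG; auto|].
        apply holo_ccont. apply (holo_comp (fun y => y ^ n) (fun u => r * r / u)); [apply holo_pow|].
        apply holo_mult; [apply holo_const|apply holo_inv; auto].
  - apply circ_cont_mult; auto. apply circ_cont_pow.
Qed.

(** Under u = exp z the annulus becomes a rectangle of height 2 pi. The horizontal sides cancel by
    periodicity, and the vertical ones are the two means up to the factor 2 pi. *)
Lemma mean_radius F r1 r2 : (0 < r1 <= r2)%R ->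
  (forall u, (r1 <= Cmod u <= r2)%R -> holo F u) -> mean F r1 = mean F r2.
Proof.
  intros Hr HF. pose proof two_PI_pos.
  assert (Hcexp : forall s t, cexp (s, t) = exp s * ei t) by reflexivity.
  assert (HG : forall z, in_rect (ln r1) (ln r2) 0 (2 * PI) z -> holo (fun z => F (cexp z)) z).
  { intros [s t] [H1 H2]. simpl in H1, H2. apply holo_comp; [|eexists; apply cderiv_cexp].
    apply HF. rewrite Hcexp, Cmod_mult, Cmod_ei, Cmod_R, Rmult_1_r.
    rewrite Rabs_pos_eq by (left; apply exp_pos).
    assert (Hexp : forall x y, (x <= y)%R -> (exp x <= exp y)%R).
    { intros x y [Hxy| ->]; [left; apply exp_increasing; auto|lra]. }
    pose proof (Hexp _ _ (proj1 H1)) as L1. pose proof (Hexp _ _ (proj2 H1)) as L2.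
    rewrite exp_ln in L1, L2 by lra. lra. }
  assert (Hln : (ln r1 <= ln r2)%R).
  { destruct (proj2 Hr) as [H1|H1]; [left; apply ln_increasing; lra|rewrite H1; lra]. }
  pose proof (goursat _ (ln r1) (ln r2) 0 (2 * PI) Hln ltac:(lra) HG) as E.
  unfold rect_int in E.
  replace (Cint (fun x => F (cexp (x, 0%R))) (ln r1) (ln r2)) with
    (Cint (fun x => F (cexp (x, (2 * PI)%R))) (ln r1) (ln r2)) in E.
  2:{ apply Cint_ext; auto. intros; f_equal. rewrite !Hcexp, ei_2PI, ei_0; auto. }
  assert (Hr' : forall r, (0 < r)%R -> Cint (fun y => F (cexp (ln r, y))) 0 (2 * PI) = Cint (fun t => F (circ r t)) 0 (2 * PI)).
  { intros r H0. apply Cint_ext; [lra|]. intros. rewrite Hcexp, exp_ln; auto. }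
  rewrite !Hr' in E by lra. unfold mean. f_equal.
  match type of E with ?e = _ => match e with
    context [Ci * (?x - ?y)] => set (X := x) in E; set (Y := y) in E end end.
  enough (X - Y = 0) as E2 by (apply Ceq_minus in E2; symmetry; exact E2).
  transitivity (- Ci * (Ci * (X - Y))).
  - transitivity (- (Ci * Ci) * (X - Y)); [|ring].
    assert (HC : Ci * Ci = -1) by (apply injective_projections; simpl; ring). rewrite HC. ring.
  - transitivity (- Ci * 0); [|ring]. f_equal. rewrite <- E. ring.
Qed.

Lemma circ_bounded F r : (0 <= r)%R -> circ_cont F r ->
  exists M, (0 <= M)%R /\ forall u, Cmod u = r -> (Cmod (F u) <= M)%R.
Proof.
  intros Hr HF. pose proof two_PI_pos.
  destruct (continuity_ab_maj (fun t => Cmod (F (circ r t))) 0 (2 * PI)) as (x & Hx & _); [lra| |].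
  - intros t _. apply continuity_pt_filterlim. intros P [eps HP].
    destruct (circ_rcont F r t Hr HF eps (cond_pos eps)) as (d & Hd & H1).
    exists (mkposreal d Hd). intros t' Ht'. apply HP. specialize (H1 t' Ht').
    eapply Rle_lt_trans; [|exact H1].
    pose proof (Cmod_minus_ge (F (circ r t')) (F (circ r t))). pose proof (Cmod_minus_ge (F (circ r t)) (F (circ r t'))) as H2.
    replace (F (circ r t) - F (circ r t')) with (- (F (circ r t') - F (circ r t))) in H2 by ring.
    rewrite Cmod_opp in H2.
    change (Rabs (Cmod (F (circ r t')) - Cmod (F (circ r t))) <= Cmod (F (circ r t') - F (circ r t))%C)%R.
    apply Rabs_le; lra.
  - exists (Cmod (F (circ r x))). split; [apply Cmod_ge_0|]. intros u Hu.
    destruct Hr as [Hr|Hr].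
    + destruct (arg_exists (u / r)) as (t & Ht & E).
      { rewrite Cmod_div, Hu, Cmod_R, Rabs_pos_eq by (try apply RtoC_neq0; lra). field; lra. }
      replace u with (circ r t); [apply Hx; auto|]. unfold circ. rewrite <- E. field. apply RtoC_neq0; lra.
    + rewrite <- Hr in Hu. apply Cmod_eq_0 in Hu. subst u.
      replace (RtoC 0) with (circ r 0); [apply Hx; lra|]. unfold circ. rewrite <- Hr. ring.
Qed.

(* On the circle through u, F v = F u + G v (v - u) with G continuous, so the partial sums
   of the series at u telescope to F u up to far Fourier coefficients of G, which are
   small by Bessel's inequality. *)
Theorem laurent F r1 r2 : (0 < r1 < r2)%R ->
  (forall u, (r1 <= Cmod u <= r2)%R -> holo F u) ->
  exists a c M, geo (/ r2) M a /\ geo r1 M c /\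
    forall u, (r1 < Cmod u < r2)%R ->
      F u = Cseries (fun k => a k * u ^ k) + Cseries (fun k => c k * / u ^ S k).
Proof.
  intros Hr HF.
  assert (HFc : forall r, (r1 <= r <= r2)%R -> circ_cont F r) by (intros r H; apply holo_circ; intros u Hu; apply HF; lra).
  assert (Hha : forall k u, (r1 <= Cmod u <= r2)%R -> holo (fun u => F u * / u ^ k) u).
  { intros k u Hu. apply holo_mult; auto. apply holo_pow_inv, Cmod_gt_0; lra. }
  assert (Hhc : forall k u, (r1 <= Cmod u <= r2)%R -> holo (fun u => F u * u ^ k) u).
  { intros k u Hu. apply holo_mult; auto. apply holo_pow. }
  destruct (circ_bounded F r1 ltac:(lra) (HFc r1 ltac:(lra))) as (M1 & HM1 & HB1).
  destruct (circ_bounded F r2 ltac:(lra) (HFc r2 ltac:(lra))) as (M2 & HM2 & HB2).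
  (* Each family is taken on the extreme circle that gives its best bound and is then moved by
     [mean_radius] to the circle through the point of evaluation. *)
  set (a := fun k => mean (fun u => F u * / u ^ k) r2). set (c := fun k => mean (fun u => F u * u ^ S k) r1).
  assert (Ha : forall k r, (r1 <= r <= r2)%R -> a k = mean (fun u => F u * / u ^ k) r).
  { intros k r Hk. unfold a. symmetry.
    apply (mean_radius (fun u => F u * / u ^ k) r r2); [lra|]. intros; apply Hha; lra. }
  assert (Hc : forall k r, (r1 <= r <= r2)%R -> c k = mean (fun u => F u * u ^ S k) r).
  { intros k r Hk. unfold c.
    apply (mean_radius (fun u => F u * u ^ S k) r1 r); [lra|]. intros; apply Hhc; lra. }
  set (M := (M1 * r1 + M2)%R). assert (HM : (0 <= M)%R) by (unfold M; nra).
  assert (Hga : geo (/ r2) M a).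
  { intros k. eapply Rle_trans; [apply (mean_bound (fun u => F u * / u ^ k) r2 (M2 * (/ r2) ^ k)); [lra| |]|].
    - apply holo_circ; intros; apply Hha; lra.
    - intros u Hu. rewrite Cmod_mult, Cmod_inv, Cmod_pow, Hu, pow_inv by (apply Cpow_nz, (Cmod_r_nz r2); auto; lra).
      apply Rmult_le_compat_r; auto. left; apply Rinv_0_lt_compat, pow_lt; lra.
    - apply Rmult_le_compat_r; [apply pow_le; left; apply Rinv_0_lt_compat; lra|unfold M; nra]. }
  assert (Hgc : geo r1 M c).
  { intros k. eapply Rle_trans; [apply (mean_bound (fun u => F u * u ^ S k) r1 (M1 * r1 ^ S k)); [lra| |]|].
    - apply holo_circ; intros; apply Hhc; lra.
    - intros u Hu. rewrite Cmod_mult, Cmod_pow, Hu. apply Rmult_le_compat_r; auto. apply pow_le; lra.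
    - simpl. rewrite <- Rmult_assoc. apply Rmult_le_compat_r; [apply pow_le; lra|unfold M; lra]. }
  exists a, c, M. split; [exact Hga|split; [exact Hgc|]]. intros u0 Hu0.
  set (r := Cmod u0) in *. assert (Hrp : (0 < r)%R) by lra. assert (Hr0 : (0 <= r)%R) by lra.
  assert (Hu0n : u0 <> 0) by (apply Cmod_gt_0; auto).
  assert (Hup : forall k, u0 ^ k <> 0) by (intros; apply Cpow_nz; auto).
  destruct (HF u0 ltac:(fold r; lra)) as [l Hl].
  set (G := fun u => if Ceq_dec u u0 then l else (F u - F u0) / (u - u0)).
  assert (HFG : forall u, F u = F u0 + G u * (u - u0)).
  { intros u. unfold G. destruct (Ceq_dec u u0) as [->|Hn]; [ring|]. field. apply Cminus_eq_contra; auto. }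
  assert (HG : circ_cont G r).
  { intros u Hu. destruct (Ceq_dec u u0) as [->|Hn].
    - intros eps He. destruct (Hl (eps / 2)%R) as (d & Hd & H1); [lra|].
      exists d; split; auto. intros z' Hz'. unfold G.
      destruct (Ceq_dec u0 u0) as [_|]; [|congruence].
      destruct (Ceq_dec z' u0) as [->|Hz]; [replace (l - l) with (RtoC 0) by ring; rewrite Cmod_0; auto|].
      specialize (H1 _ Hz'). replace (u0 + (z' - u0)) with z' in H1 by ring.
      assert (Hz0 : z' - u0 <> 0) by (apply Cminus_eq_contra; auto).
      replace ((F z' - F u0) / (z' - u0) - l) with ((F z' - F u0 - l * (z' - u0)) / (z' - u0)) by (field; auto).
      rewrite Cmod_div by auto. assert (Hp : (0 < Cmod (z' - u0))%R) by (apply Cmod_gt_0; auto).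
      apply Rle_lt_trans with (eps / 2)%R; [|lra]. apply Rmult_le_reg_r with (Cmod (z' - u0)); auto.
      unfold Rdiv at 1. rewrite Rmult_assoc, Rinv_l by lra. lra.
    - apply holo_ccont.
      assert (Hp : (0 < Cmod (u - u0))%R) by (apply Cmod_gt_0, Cminus_eq_contra; auto).
      apply (holo_ext_loc (fun u => (F u - F u0) * / (u - u0)) _ u (Cmod (u - u0))); auto.
      + intros z' Hz'. unfold G. destruct (Ceq_dec z' u0) as [->|]; auto.
        replace (u0 - u) with (- (u - u0)) in Hz' by ring. rewrite Cmod_opp in Hz'. lra.
      + apply holo_mult; [apply holo_minus; [apply HF; lra|apply holo_const]|].
        apply (holo_comp (fun y => / y) (fun u => u - u0)); [apply holo_inv, Cminus_eq_contra; auto|].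
        apply holo_minus; [eexists; apply cderiv_id|apply holo_const]. }
  (* The Fourier coefficients of G, scaled by powers of u0. Apart from the first, the terms of both
     series are u0 times differences of consecutive [Pn] or [Qn]; the term a_0 contributes F u0. *)
  set (Pn := fun n => u0 ^ n * mean (fun u => G u * / u ^ n) r).
  set (Qn := fun n => / u0 ^ n * mean (fun u => G u * u ^ n) r).
  assert (Hri : (r1 <= r <= r2)%R) by lra.
  assert (HGi : forall n, circ_cont (fun u => G u * / u ^ n) r) by (intros; apply circ_cont_mult; auto; apply circ_cont_pow_inv; auto).
  assert (HGp : forall n, circ_cont (fun u => G u * u ^ n) r) by (intros; apply circ_cont_mult; auto; apply circ_cont_pow).
  assert (Ha0 : a O = F u0 + u0 * (Qn 1%nat - Pn O)).
  { rewrite (Ha O r Hri).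
    transitivity (mean (fun u => F u0 + (G u * u ^ 1 - u0 * (G u * / u ^ 0))) r).
    - apply mean_ext; auto. intros u Hu. rewrite (HFG u). simpl. field.
    - rewrite mean_plus, mean_minus, mean_scal, mean_const; auto; try apply circ_cont_scal; auto; try apply circ_cont_const.
      + unfold Qn, Pn. simpl. field. auto.
      + apply circ_cont_minus; auto. apply circ_cont_scal; auto. }
  assert (HaS : forall k, a (S k) * u0 ^ S k = u0 * (Pn k - Pn (S k))).
  { intros k. rewrite (Ha (S k) r Hri).
    transitivity (u0 ^ S k * mean (fun u => F u0 * / u ^ S k + (G u * / u ^ k - u0 * (G u * / u ^ S k))) r).
    - rewrite Cmult_comm. f_equal. apply mean_ext; auto. intros u Hu. pose proof (Cmod_r_nz r u Hrp Hu) as Hun.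
      rewrite (HFG u). simpl. field. split; auto. apply Cpow_nz; auto.
    - rewrite mean_plus, mean_minus, mean_scal, mean_scal, mean_pow_inv; auto; try apply circ_cont_scal; auto; try (apply circ_cont_pow_inv; auto).
      + unfold Pn. simpl. ring.
      + apply circ_cont_minus; auto. apply circ_cont_scal; auto. }
  assert (HcS : forall k, c k * / u0 ^ S k = u0 * (Qn (S (S k)) - Qn (S k))).
  { intros k. rewrite (Hc k r Hri).
    transitivity (/ u0 ^ S k * mean (fun u => F u0 * u ^ S k + (G u * u ^ S (S k) - u0 * (G u * u ^ S k))) r).
    - rewrite Cmult_comm. f_equal. apply mean_ext; auto. intros u Hu. rewrite (HFG u). simpl. ring.
    - rewrite mean_plus, mean_minus, mean_scal, mean_scal, mean_pow; auto; try apply circ_cont_scal; auto; try apply circ_cont_pow.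
      + unfold Qn. simpl. field. auto.
      + apply circ_cont_minus; auto. apply circ_cont_scal; auto. }
  assert (Hsum : forall N, csumn (S N) (fun k => a k * u0 ^ k) + csumn (S N) (fun k => c k * / u0 ^ S k)
     = F u0 + u0 * (Qn (S (S N)) - Pn N)).
  { induction N as [|N IH].
    - transitivity (a O + c O * / u0 ^ S O); [unfold csumn; simpl; ring|]. rewrite (HcS O), Ha0. ring.
    - rewrite (csumn_S (S N)), (csumn_S (S N) (fun k => c k * / u0 ^ S k)), HaS, HcS.
      transitivity ((csumn (S N) (fun k => a k * u0 ^ k) + csumn (S N) (fun k => c k * / u0 ^ S k)) +
        (u0 * (Pn N - Pn (S N)) + u0 * (Qn (S (S (S N))) - Qn (S (S N))))); [ring|]. rewrite IH. ring. }
  assert (Ht1 : (0 <= / r2 * r < 1)%R).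
  { split; [apply Rmult_le_pos; [left; apply Rinv_0_lt_compat|]; lra|].
    apply Rmult_lt_reg_l with r2; [lra|]. rewrite <- Rmult_assoc, Rinv_r; lra. }
  assert (Ht2 : (0 <= r1 * / r < 1)%R).
  { split; [apply Rmult_le_pos; [|left; apply Rinv_0_lt_compat]; lra|].
    apply Rmult_lt_reg_r with r; [lra|]. rewrite Rmult_assoc, Rinv_l; lra. }
  assert (Hg1 : geo (/ r2 * r) M (fun k => a k * u0 ^ k)).
  { intros k. rewrite Cmod_mult, Cmod_pow, Rpow_mult_distr, <- Rmult_assoc. apply Rmult_le_compat_r; [apply pow_le; auto|apply Hga]. }
  assert (Hg2 : geo (r1 * / r) (M * / r) (fun k => c k * / u0 ^ S k)).
  { intros k. rewrite Cmod_mult, Cmod_inv, Cmod_pow, Rpow_mult_distr by auto. fold r.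
    replace (M * / r * (r1 ^ k * (/ r) ^ k))%R with (M * r1 ^ k * / r ^ S k)%R.
    - apply Rmult_le_compat_r; [left; apply Rinv_0_lt_compat, pow_lt; auto|apply Hgc].
    - rewrite pow_inv. simpl. field. split; [|lra]. apply pow_nonzero; lra. }
  symmetry. eapply cconv_unique.
  - apply cconv_plus; [apply (cconv_geo _ _ _ Ht1 Hg1)|apply (cconv_geo _ _ _ Ht2 Hg2)].
  - intros eps He.
    destruct (fourier_small G r Hrp HG (eps / (2 * r))%R) as [N1 H1]; [apply Rdiv_lt_0_compat; lra|].
    destruct (fourier_small_neg G r Hrp HG (eps / (2 * r))%R) as [N2 H2]; [apply Rdiv_lt_0_compat; lra|].
    exists (S (N1 + N2)). intros [|N] HN; [lia|]. rewrite Hsum.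
    replace (F u0 + u0 * (Qn (S (S N)) - Pn N) - F u0) with (u0 * (Qn (S (S N)) - Pn N)) by ring.
    rewrite Cmod_mult. fold r. specialize (H1 N ltac:(lia)). specialize (H2 (S (S N)) ltac:(lia)).
    assert (E1 : Cmod (Pn N) = Cmod (r ^ N * mean (fun u => G u * / u ^ N) r)).
    { unfold Pn. rewrite !Cmod_mult, !Cmod_pow, Cmod_R, (Rabs_pos_eq r); auto. }
    assert (E2 : Cmod (Qn (S (S N))) = Cmod (/ r ^ S (S N) * mean (fun u => G u * u ^ S (S N)) r)).
    { unfold Qn. rewrite !Cmod_mult, !Cmod_inv, !Cmod_pow, Cmod_R, (Rabs_pos_eq r); auto.
      apply Cpow_nz, RtoC_neq0; lra. }
    rewrite <- E1 in H1. rewrite <- E2 in H2.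
    apply Rle_lt_trans with (r * (Cmod (Qn (S (S N))) + Cmod (Pn N)))%R.
    + apply Rmult_le_compat_l; auto. unfold Cminus. eapply Rle_trans; [apply Cmod_triangle|]. rewrite Cmod_opp; lra.
    + apply Rlt_le_trans with (r * (eps / (2 * r) + eps / (2 * r)))%R; [apply Rmult_lt_compat_l; lra|].
      right; field; lra.
Qed.

(** * Power series, Laurent tails and functions outside several discs *)

Definition pser (a : nat -> C) (u : C) : C := Cseries (fun k => a k * u ^ k).

(** The factor s on the left replaces the exponent k - 1 on the right, so that k = 0 is no
    exception; the same device gives s^2 in [pow_taylor_bound]. *)
Lemma pow_diff_bound (u h : C) (s : R) (k : nat) : (Cmod u <= s)%R -> (Cmod (u + h) <= s)%R ->
  (s * Cmod ((u + h) ^ k - u ^ k)%C <= INR k * Cmod h * s ^ k)%R.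
Proof.
  intros Hu Huh. pose proof (Cmod_ge_0 u) as H0. assert (Hs : (0 <= s)%R) by lra.
  induction k as [|k IH].
  - simpl. replace (1 - 1) with (RtoC 0) by ring. rewrite Cmod_0; lra.
  - replace ((u + h) ^ S k - u ^ S k) with (u * ((u + h) ^ k - u ^ k) + h * (u + h) ^ k) by (simpl; ring).
    assert (Hp : (Cmod ((u + h) ^ k)%C <= s ^ k)%R).
    { rewrite Cmod_pow. apply pow_incr. split; [apply Cmod_ge_0|auto]. }
    apply Rle_trans with (s * (Cmod u * Cmod ((u + h) ^ k - u ^ k)%C + Cmod h * Cmod ((u + h) ^ k)%C))%R.
    + apply Rmult_le_compat_l; auto. eapply Rle_trans; [apply Cmod_triangle|]. rewrite !Cmod_mult; lra.
    + rewrite S_INR. simpl pow. set (D := Cmod ((u + h) ^ k - u ^ k)) in *.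
      assert (0 <= D)%R by apply Cmod_ge_0. pose proof (Cmod_ge_0 h).
      assert (Cmod u * (s * D) <= s * (INR k * Cmod h * s ^ k))%R.
      { apply Rmult_le_compat; auto. apply Rmult_le_pos; auto. }
      assert (s * (Cmod h * Cmod ((u + h) ^ k)%C) <= s * (Cmod h * s ^ k))%R.
      { apply Rmult_le_compat_l; auto. apply Rmult_le_compat_l; auto. }
      lra.
Qed.

Definition dpow (u : C) (k : nat) : C := match k with O => 0 | S j => INR (S j) * u ^ j end.

Lemma pow_taylor_bound (u h : C) (s : R) (k : nat) : (Cmod u <= s)%R -> (Cmod (u + h) <= s)%R ->
  (s * s * Cmod ((u + h) ^ k - u ^ k - dpow u k * h)%C <= INR k * INR k * (Cmod h * Cmod h) * s ^ k)%R.
Proof.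
  intros Hu Huh. pose proof (Cmod_ge_0 u) as H0. assert (Hs : (0 <= s)%R) by lra.
  induction k as [|k IH].
  - simpl. replace (1 - 1 - 0 * h) with (RtoC 0) by ring. rewrite Cmod_0. pose proof (Cmod_ge_0 h). nra.
  - replace ((u + h) ^ S k - u ^ S k - dpow u (S k) * h) with
      (u * ((u + h) ^ k - u ^ k - dpow u k * h) + h * ((u + h) ^ k - u ^ k)).
    2:{ unfold dpow. destruct k as [|k]; [simpl; ring|]. rewrite (S_INR (S k)), RtoC_plus. simpl. ring. }
    pose proof (pow_diff_bound u h s k Hu Huh) as HD.
    set (D := Cmod ((u + h) ^ k - u ^ k)) in *. set (T := Cmod ((u + h) ^ k - u ^ k - dpow u k * h)) in *.
    assert (HD0 : (0 <= D)%R) by apply Cmod_ge_0. assert (HT0 : (0 <= T)%R) by apply Cmod_ge_0. pose proof (Cmod_ge_0 h) as Hh.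
    apply Rle_trans with (s * s * (Cmod u * T + Cmod h * D))%R.
    + apply Rmult_le_compat_l; [nra|]. eapply Rle_trans; [apply Cmod_triangle|]. rewrite !Cmod_mult. unfold T, D; lra.
    + assert (H1 : (Cmod u * (s * s * T) <= s * (INR k * INR k * (Cmod h * Cmod h) * s ^ k))%R).
      { apply Rmult_le_compat; auto. repeat apply Rmult_le_pos; auto. }
      assert (H2 : (s * (Cmod h * (s * D)) <= s * (Cmod h * (INR k * Cmod h * s ^ k)))%R).
      { apply Rmult_le_compat_l; auto. apply Rmult_le_compat_l; auto. }
      rewrite S_INR. simpl pow. pose proof (pos_INR k) as Hk. pose proof (pow_le s k Hs) as Hsk.
      assert (H3 : (0 <= (INR k + 1) * (Cmod h * Cmod h) * (s * s ^ k))%R) by (repeat apply Rmult_le_pos; try lra; auto).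
      nra.
Qed.

(** Since k^2 <= (k + 1)(k + 2) = 2 [nb 2 k], this is [nb_geo] for m = 2. *)
Lemma sq_geo y : (0 <= y < 1)%R -> exists t K, (0 <= t < 1)%R /\ (0 <= K)%R /\
  forall k, (INR k * INR k * y ^ k <= K * t ^ k)%R.
Proof.
  intros Hy. destruct (nb_geo 2 y Hy) as [Ht H].
  exists (2 * y / (1 + y))%R, (2 * (2 / (1 - y)) ^ 3)%R. split; auto.
  assert (HK : (0 <= (2 / (1 - y)) ^ 3)%R).
  { apply pow_le. apply Rmult_le_pos; [lra|left; apply Rinv_0_lt_compat; lra]. }
  split; [lra|]. intros k. specialize (H k). rewrite nb_2 in H.
  pose proof (pos_INR k). assert (0 <= y ^ k)%R by (apply pow_le; lra). nra.
Qed.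

Lemma geo_mul_pow (a : nat -> C) rho M u : (0 < rho)%R -> geo (/ rho) M a ->
  geo (Cmod u / rho) M (fun k => a k * u ^ k).
Proof.
  intros Hr Ha k. rewrite Cmod_mult, Cmod_pow. unfold Rdiv. rewrite Rpow_mult_distr, (Rmult_comm (Cmod u ^ k)), <- Rmult_assoc.
  apply Rmult_le_compat_r; [apply pow_le, Cmod_ge_0|apply Ha].
Qed.

Lemma ratio_lt u rho : (0 < rho)%R -> (Cmod u < rho)%R -> (0 <= Cmod u / rho < 1)%R.
Proof.
  intros Hr Hu. split; [apply Rmult_le_pos; [apply Cmod_ge_0|left; apply Rinv_0_lt_compat; auto]|].
  apply Rmult_lt_reg_r with rho; auto. unfold Rdiv; rewrite Rmult_assoc, Rinv_l; lra.
Qed.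

(** With s midway between |u| and rho, the second-order remainder of the k-th term is at most a
    constant times |h|^2 k^2 (s / rho)^k, which is summable by [sq_geo]. *)
Lemma cderiv_pser a rho M u : (0 < rho)%R -> geo (/ rho) M a -> (Cmod u < rho)%R ->
  cderiv (pser a) u (Cseries (fun k => INR (S k) * a (S k) * u ^ k)).
Proof.
  intros Hr Ha Hu. pose proof (Cmod_ge_0 u) as Hu0.
  assert (HM : (0 <= M)%R) by (eapply geo_M; eauto).
  set (s := ((Cmod u + rho) / 2)%R). assert (Hs : (Cmod u < s < rho)%R) by (unfold s; lra).
  destruct (sq_geo (s / rho)) as (t & K & Ht & HK & Hsq).
  { split; [apply Rmult_le_pos; [lra|left; apply Rinv_0_lt_compat; auto]|].
    apply Rmult_lt_reg_r with rho; auto. unfold Rdiv; rewrite Rmult_assoc, Rinv_l; lra. }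
  assert (Hdb : forall k, (Cmod (a k * dpow u k) <= M * K / s * t ^ k)%R).
  { intros [|k].
    - simpl. replace (a O * 0) with (RtoC 0) by ring. rewrite Cmod_0.
      rewrite Rmult_1_r. apply Rmult_le_pos; [nra|left; apply Rinv_0_lt_compat; lra].
    - unfold dpow. rewrite !Cmod_mult, Cmod_R, Rabs_pos_eq, Cmod_pow by apply pos_INR.
      specialize (Hsq (S k)). specialize (Ha (S k)).
      pose proof (INR_S_ge1 k) as H1. set (n := INR (S k)) in *.
      assert (Hn2 : (n <= n * n)%R) by nra.
      assert (E : (Cmod u ^ k <= s ^ k)%R) by (apply pow_incr; lra).
      assert (Hsk : (0 <= s ^ k)%R) by (apply pow_le; lra).
      assert (Hrk : (0 <= (/ rho) ^ S k)%R) by (apply pow_le; left; apply Rinv_0_lt_compat; auto).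
      apply Rle_trans with (M * (/ rho) ^ S k * (n * n * s ^ k))%R.
      + apply Rmult_le_compat; auto; try apply Cmod_ge_0.
        * apply Rmult_le_pos; [lra|]. apply pow_le; auto.
        * apply Rmult_le_compat; try lra. apply pow_le; auto.
      + replace (M * (/ rho) ^ S k * (n * n * s ^ k))%R with (M / s * (n * n * (s / rho) ^ S k))%R.
        * replace (M * K / s * t ^ S k)%R with (M / s * (K * t ^ S k))%R by (field; lra).
          apply Rmult_le_compat_l; auto. apply Rmult_le_pos; auto. left; apply Rinv_0_lt_compat; lra.
        * unfold Rdiv. rewrite Rpow_mult_distr. simpl. field. lra. }
  assert (Ed : Cseries (fun k => a k * dpow u k) = Cseries (fun k => INR (S k) * a (S k) * u ^ k)).
  { rewrite (Cseries_split t (M * K / s) _ 1 Ht Hdb). unfold csumn; simpl csum.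
    rewrite (Cseries_ext (fun k => a (1 + k)%nat * dpow u (1 + k)) (fun k => INR (S k) * a (S k) * u ^ k)).
    simpl. ring. intros k. change (a (S k) * (INR (S k) * u ^ k) = INR (S k) * a (S k) * u ^ k). ring. }
  rewrite <- Ed.
  apply (cderiv_quadratic _ _ _ (M * K / (s * s) / (1 - t)) (s - Cmod u)); [lra|].
  intros h Hh. assert (Huh : (Cmod (u + h) <= s)%R) by (eapply Rle_trans; [apply Cmod_triangle|lra]).
  pose proof (ratio_lt u rho Hr Hu) as Hq1. pose proof (ratio_lt (u + h) rho Hr ltac:(lra)) as Hq2.
  pose proof (geo_mul_pow a rho M u Hr Ha) as G1. pose proof (geo_mul_pow a rho M (u + h) Hr Ha) as G2.
  assert (E : pser a (u + h) - pser a u - Cseries (fun k => a k * dpow u k) * h =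
     Cseries (fun k => a k * ((u + h) ^ k - u ^ k - dpow u k * h))).
  { symmetry. apply Cseries_unique.
    pose proof (cconv_plus _ _ _ _ (cconv_geo _ _ _ Hq2 G2) (cconv_plus _ _ _ _
       (cconv_scal (-1) _ _ (cconv_geo _ _ _ Hq1 G1)) (cconv_scal (- h) _ _ (cconv_geo t _ _ Ht Hdb)))) as HC.
    unfold pser. match type of HC with cconv _ ?l => replace (Cseries (fun k => a k * (u + h) ^ k) - Cseries (fun k => a k * u ^ k) - Cseries (fun k => a k * dpow u k) * h) with l by ring end.
    eapply cconv_ext; [|exact HC]. intros n. unfold csumn. rewrite <- !csum_scal, <- !csum_plus.
    apply csum_ext; intros; ring. }
  rewrite E. eapply Rle_trans.
  - apply (Cseries_bound t (M * K / (s * s) * (Cmod h * Cmod h))); auto.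
    intros k. rewrite Cmod_mult. pose proof (pow_taylor_bound u h s k ltac:(lra) Huh) as HT.
    set (T := Cmod ((u + h) ^ k - u ^ k - dpow u k * h)) in *. assert (0 <= T)%R by apply Cmod_ge_0.
    apply Rle_trans with (M * (/ rho) ^ k * T)%R; [apply Rmult_le_compat_r; auto|].
    apply Rmult_le_reg_l with (s * s)%R; [nra|].
    replace (s * s * (M * K / (s * s) * (Cmod h * Cmod h) * t ^ k))%R with (M * (Cmod h * Cmod h) * (K * t ^ k))%R by (field; lra).
    assert (Hrk : (0 <= (/ rho) ^ k)%R) by (apply pow_le; left; apply Rinv_0_lt_compat; auto).
    apply Rle_trans with (M * (/ rho) ^ k * (INR k * INR k * (Cmod h * Cmod h) * s ^ k))%R.
    + replace (s * s * (M * (/ rho) ^ k * T))%R with (M * (/ rho) ^ k * (s * s * T))%R by ring.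
      apply Rmult_le_compat_l; auto. apply Rmult_le_pos; auto.
    + replace (M * (/ rho) ^ k * (INR k * INR k * (Cmod h * Cmod h) * s ^ k))%R with
        (M * (Cmod h * Cmod h) * (INR k * INR k * (s / rho) ^ k))%R.
      * apply Rmult_le_compat_l; auto. pose proof (Cmod_ge_0 h). repeat apply Rmult_le_pos; auto.
      * unfold Rdiv. rewrite Rpow_mult_distr. ring.
  - right. field. split; lra.
Qed.

(** A Laurent tail centred at 0. The index k belongs to the exponent -k-1, so [c 0] is the
    residue. *)
Definition nser (c : nat -> C) (v : C) : C := Cseries (fun k => c k * / v ^ S k).

Lemma nser_geo c rho M v : (0 < rho)%R -> geo rho M c -> (rho < Cmod v)%R ->
  (0 <= rho / Cmod v < 1)%R /\ geo (rho / Cmod v) (M / Cmod v) (fun k => c k * / v ^ S k).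
Proof.
  intros Hr Hc Hv. assert (Hvn : v <> 0) by (apply Cmod_gt_0; lra).
  split.
  - split; [apply Rmult_le_pos; [lra|left; apply Rinv_0_lt_compat; lra]|].
    apply Rmult_lt_reg_r with (Cmod v); [lra|]. unfold Rdiv; rewrite Rmult_assoc, Rinv_l; lra.
  - intros k. rewrite Cmod_mult, Cmod_inv, Cmod_pow by (apply Cpow_nz; auto).
    replace (M / Cmod v * (rho / Cmod v) ^ k)%R with (M * rho ^ k * / Cmod v ^ S k)%R.
    + apply Rmult_le_compat_r; [left; apply Rinv_0_lt_compat, pow_lt; lra|apply Hc].
    + unfold Rdiv. rewrite Rpow_mult_distr, pow_inv. simpl. field. split; [apply pow_nonzero|]; lra.
Qed.

Lemma geo_inv_radius c rho M : (0 < rho)%R -> geo rho M c -> geo (/ / rho) M c.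
Proof. intros Hr Hc k. rewrite Rinv_inv. apply Hc. Qed.

Lemma nser_pser c rho M v : (0 < rho)%R -> geo rho M c -> (rho < Cmod v)%R ->
  nser c v = / v * pser c (/ v).
Proof.
  intros Hr Hc Hv. assert (Hvn : v <> 0) by (apply Cmod_gt_0; lra).
  unfold nser, pser. rewrite <- (Cseries_scal (Cmod (/ v) / / rho) M).
  - apply Cseries_ext; intros k. rewrite Cpow_inv by auto. simpl. field. split; auto. apply Cpow_nz; auto.
  - apply ratio_lt; [apply Rinv_0_lt_compat; auto|]. rewrite Cmod_inv by auto. apply Rinv_lt_contravar; auto. nra.
  - apply geo_mul_pow; [apply Rinv_0_lt_compat; auto|]. apply geo_inv_radius; auto.
Qed.

Lemma Cmod_near z z' r : (Cmod (z' - z) < Cmod z - r)%R -> (r < Cmod z')%R.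
Proof.
  intros H. pose proof (Cmod_minus_ge z (z - z')) as H1.
  replace (z - (z - z')) with z' in H1 by ring. replace (z - z') with (- (z' - z)) in H1 by ring.
  rewrite Cmod_opp in H1. lra.
Qed.

Lemma Cmod_near_lt z z' r : (Cmod (z' - z) < r - Cmod z)%R -> (Cmod z' < r)%R.
Proof.
  intros H. pose proof (Cmod_triangle (z' - z) z) as H1. replace (z' - z + z) with z' in H1 by ring. lra.
Qed.

Lemma holo_nser c rho M v : (0 < rho)%R -> geo rho M c -> (rho < Cmod v)%R -> holo (nser c) v.
Proof.
  intros Hr Hc Hv. assert (Hvn : v <> 0) by (apply Cmod_gt_0; lra).
  apply (holo_ext_loc (fun v => / v * pser c (/ v)) _ v (Cmod v - rho)); [lra| |].
  - intros z' Hz'. symmetry. apply (nser_pser c rho M); auto. eapply Cmod_near; eauto.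
  - apply holo_mult; [apply holo_inv; auto|].
    apply (holo_comp (pser c) (fun v => / v)); [|apply holo_inv; auto].
    eexists. apply (cderiv_pser c (/ rho) M); [apply Rinv_0_lt_compat; auto|apply geo_inv_radius; auto|].
    rewrite Cmod_inv by auto. apply Rinv_lt_contravar; auto. nra.
Qed.

Lemma nser_bound c rho M v : (0 < rho)%R -> geo rho M c -> (2 * rho < Cmod v)%R ->
  (Cmod (nser c v) <= 2 * M / Cmod v)%R.
Proof.
  intros Hr Hc Hv. destruct (nser_geo c rho M v Hr Hc ltac:(lra)) as [H1 H2].
  assert (HM : (0 <= M)%R) by (eapply geo_M; eauto).
  eapply Rle_trans; [apply (Cseries_bound _ _ _ H1 H2)|].
  assert (rho / Cmod v <= / 2)%R.
  { apply Rmult_le_reg_r with (Cmod v); [lra|]. unfold Rdiv; rewrite Rmult_assoc, Rinv_l; lra. }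
  replace (2 * M / Cmod v)%R with (M / Cmod v * / (/ 2))%R by (field; lra). unfold Rdiv at 1.
  apply Rmult_le_compat_l; [apply Rmult_le_pos; auto; left; apply Rinv_0_lt_compat; lra|].
  apply Rinv_le_contravar; lra.
Qed.

Lemma holo_sub f w y : holo f (y - w) -> holo (fun y => f (y - w)) y.
Proof.
  intros H. apply (holo_comp f (fun y => y - w)); auto.
  apply holo_minus; [eexists; apply cderiv_id|apply holo_const].
Qed.

(** Inside radius r2 the new function is the regular part of the Laurent expansion, outside it is F
    minus the tail. The two agree on the annulus, so the hole is filled holomorphically. *)
Lemma remove_hole F w r1 r2 : (0 < r1 < r2)%R ->
  (forall y, (r1 <= Cmod (y - w) <= r2)%R -> holo F y) ->
  exists c M F1, geo r1 M c /\
    (forall y, (r1 < Cmod (y - w))%R -> F y = F1 y + nser c (y - w)) /\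
    (forall y, (r1 < Cmod (y - w))%R -> holo F y -> holo F1 y) /\
    (forall y, (Cmod (y - w) < r2)%R -> holo F1 y).
Proof.
  intros Hr HF.
  destruct (laurent (fun u => F (w + u)) r1 r2 Hr) as (a & c & M & Ha & Hc & HL).
  { intros u Hu. apply holo_shift, HF. replace (w + u - w) with u by ring. auto. }
  set (F1 := fun y => if Rlt_dec (Cmod (y - w)) r2 then pser a (y - w) else F y - nser c (y - w)).
  assert (HF1 : forall y, (r1 < Cmod (y - w))%R -> F1 y = F y - nser c (y - w)).
  { intros y Hy. unfold F1. destruct (Rlt_dec (Cmod (y - w)) r2) as [H|H]; auto.
    specialize (HL (y - w) (conj Hy H)). replace (w + (y - w)) with y in HL by ring.
    rewrite HL. unfold pser, nser. ring. }
  assert (Hin : forall y, (Cmod (y - w) < r2)%R -> holo F1 y).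
  { intros y Hy. apply (holo_ext_loc (fun y => pser a (y - w)) _ y (r2 - Cmod (y - w))); [lra| |].
    - intros z' Hz'. unfold F1. destruct (Rlt_dec (Cmod (z' - w)) r2) as [|H]; auto.
      exfalso; apply H. apply (Cmod_near_lt (y - w)). replace (z' - w - (y - w)) with (z' - y) by ring. auto.
    - apply holo_sub. eexists. apply (cderiv_pser a r2 M); auto; lra. }
  exists c, M, F1. split; [exact Hc|split; [|split]].
  - intros y Hy. rewrite HF1 by auto. ring.
  - intros y Hy HFy.
    apply (holo_ext_loc (fun y => F y - nser c (y - w)) _ y (Cmod (y - w) - r1)); [lra| |].
    + intros z' Hz'. symmetry; apply HF1. apply (Cmod_near (y - w)).
      replace (z' - w - (y - w)) with (z' - y) by ring. auto.
    + apply holo_minus; auto. apply holo_sub. apply (holo_nser c r1 M); auto; lra.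
  - exact Hin.
Qed.

(** The holes are filled one at a time. The discs of radius r2 are disjoint, so filling one does not
    affect the annuli around the others. *)
Lemma split_singular_parts (w : Z -> C) (r1 r2 : Z -> R) (L : list Z) : NoDup L ->
  (forall a, In a L -> (0 < r1 a < r2 a)%R) ->
  (forall a b, In a L -> In b L -> a <> b -> (r2 a + r2 b < Cmod (w a - w b))%R) ->
  forall F, (forall y, (forall a, In a L -> (r1 a <= Cmod (y - w a))%R) -> holo F y) ->
  exists (c : Z -> nat -> C) (M : Z -> R) (E : C -> C),
    (forall a, In a L -> geo (r1 a) (M a) (c a)) /\ (forall y, holo E y) /\
    (forall y, (forall a, In a L -> (r1 a < Cmod (y - w a))%R) ->
       F y = E y + csum L (fun a => nser (c a) (y - w a))).
Proof.
  induction L as [|a L IH]; intros Hnd Hr Hd F HF.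
  - exists (fun _ _ => 0), (fun _ => 0%R), F. split; [intros a []|split].
    + intros y; apply HF; intros a [].
    + intros; simpl; ring.
  - inversion Hnd as [|? ? Ha HL]; subst.
    assert (Hsep : forall b y, In b L -> (Cmod (y - w a) <= r2 a)%R -> (r2 b < Cmod (y - w b))%R).
    { intros b y Hb Hy. assert (Hab : a <> b) by congruence.
      specialize (Hd a b (or_introl eq_refl) (or_intror Hb) Hab).
      pose proof (Cmod_minus_ge (w a - w b) (- (y - w a))) as H1.
      replace (w a - w b - - (y - w a)) with (y - w b) in H1 by ring. rewrite Cmod_opp in H1. lra. }
    destruct (remove_hole F (w a) (r1 a) (r2 a)) as (c & M & F1 & Hc & HFF & HF1 & HF2).
    + apply Hr; left; auto.
    + intros y Hy. apply HF. intros b [<-|Hb]; [lra|]. specialize (Hsep b y Hb ltac:(lra)).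
      specialize (Hr b (or_intror Hb)). lra.
    + destruct (IH HL) with (F := F1) as (c' & M' & E & Hc' & HE & HFE).
      * intros; apply Hr; right; auto.
      * intros b b' Hb Hb' Hne. apply Hd; auto; right; auto.
      * intros y Hy. destruct (Rlt_le_dec (Cmod (y - w a)) (r2 a)) as [H|H]; [apply HF2; auto|].
        specialize (Hr a (or_introl eq_refl)).
        apply HF1; [lra|]. apply HF. intros b [<-|Hb]; [lra|apply Hy; auto].
      * exists (fun b => if Z.eq_dec b a then c else c' b), (fun b => if Z.eq_dec b a then M else M' b), E.
        split; [|split; [exact HE|]].
        -- intros b [<-|Hb]; [destruct (Z.eq_dec a a); [auto|congruence]|].
           destruct (Z.eq_dec b a) as [->|_]; [contradiction|]. apply Hc'; auto.
        -- intros y Hy. rewrite HFF by (apply Hy; left; auto).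
           rewrite HFE by (intros; apply Hy; right; auto). simpl csum.
           destruct (Z.eq_dec a a) as [_|]; [|congruence].
           rewrite (csum_ext L (fun b => nser (if Z.eq_dec b a then c else c' b) (y - w b)) (fun b => nser (c' b) (y - w b))).
           ring. intros b Hb. destruct (Z.eq_dec b a) as [->|_]; [contradiction|auto].
Qed.

(** Mean value property: the mean over a small circle around y is close to E y, and it equals the
    mean over a huge circle, where E is small. *)
Lemma liouville E : (forall y, holo E y) ->
  (forall eps, (0 < eps)%R -> exists R0, forall y, (R0 < Cmod y)%R -> (Cmod (E y) <= eps)%R) ->
  forall y, E y = 0.
Proof.
  intros HE Hinf y. apply NNPP; intros Hn.
  (* The two approximations give |E y| <= 2 eps, which contradicts this choice. *)
  set (eps := (Cmod (E y) / 3)%R). assert (He : (0 < eps)%R) by (apply Rdiv_lt_0_compat; [apply Cmod_gt_0; auto|lra]).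
  destruct (Hinf eps He) as [R0 HR0].
  destruct (holo_ccont _ _ (HE y) eps He) as (d & Hd & H1).
  set (F := fun u => E (y + u)).
  assert (HF : forall u, holo F u) by (intros; apply holo_shift, HE).
  assert (HFc : forall r, circ_cont F r) by (intros; apply holo_circ; auto).
  set (r := (d / 2)%R). set (RR := (r + Rabs R0 + Cmod y + 1)%R).
  pose proof (Cmod_ge_0 y). pose proof (Rabs_pos R0). assert (Hr : (0 < r)%R) by (unfold r; lra).
  assert (Em : mean F r = mean F RR) by (apply mean_radius; [unfold RR; lra|auto]).
  assert (B1 : (Cmod (mean F RR) <= eps)%R).
  { apply mean_bound; auto; [unfold RR; lra|]. intros u Hu. apply HR0.
    pose proof (Cmod_minus_ge u (- y)) as H2. replace (u - - y) with (y + u) in H2 by ring.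
    rewrite Cmod_opp, Hu in H2. pose proof (Rle_abs R0). unfold RR in H2. lra. }
  assert (B2 : (Cmod (mean F r - E y) <= eps)%R).
  { rewrite <- (mean_const (E y) r), <- mean_minus by (auto; try lra; apply circ_cont_const).
    apply mean_bound; [lra|apply circ_cont_minus; auto; apply circ_cont_const|].
    intros u Hu. left. apply H1. replace (y + u - y) with u by ring. rewrite Hu. unfold r; lra. }
  rewrite Em in B2. pose proof (Cmod_minus_ge (E y) (- (mean F RR - E y))) as H2.
  replace (E y - - (mean F RR - E y)) with (mean F RR) in H2 by ring. rewrite Cmod_opp in H2.
  unfold eps in *. lra.
Qed.

(* Removing the singular parts in all the holes leaves an entire function that tends to 0
   at infinity. *)
Theorem exterior_expansion (w : Z -> C) (r1 r2 : Z -> R) (L : list Z) (F : C -> C) : NoDup L ->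
  (forall a, In a L -> (0 < r1 a < r2 a)%R) ->
  (forall a b, In a L -> In b L -> a <> b -> (r2 a + r2 b < Cmod (w a - w b))%R) ->
  (forall y, (forall a, In a L -> (r1 a <= Cmod (y - w a))%R) -> holo F y) ->
  (forall eps, (0 < eps)%R -> exists R0, forall y, (R0 < Cmod y)%R -> (Cmod (F y) <= eps)%R) ->
  exists (c : Z -> nat -> C) (M : Z -> R),
    (forall a, In a L -> geo (r1 a) (M a) (c a)) /\
    (forall y, (forall a, In a L -> (r1 a < Cmod (y - w a))%R) ->
       F y = csum L (fun a => nser (c a) (y - w a))).
Proof.
  intros HL Hr Hd HF Hinf.
  destruct (split_singular_parts w r1 r2 L HL Hr Hd F HF) as (c & M & E & Hc & HE & HFE).
  exists c, M. split; auto. intros y Hy. rewrite HFE by auto.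
  rewrite (liouville E HE); [ring|]. clear y Hy.
  assert (HN : forall L', incl L' L -> forall eps, (0 < eps)%R -> exists R0, forall y, (R0 < Cmod y)%R ->
    (Cmod (csum L' (fun a => nser (c a) (y - w a))) <= eps)%R).
  { induction L' as [|a L' IH]; intros Hi eps He.
    - exists 0%R. intros; simpl. rewrite Cmod_0; lra.
    - destruct (IH ltac:(intros b Hb; apply Hi; right; auto) (eps / 2)%R ltac:(lra)) as [R1 HR1].
      assert (Ha : In a L) by (apply Hi; left; auto). pose proof (Hr a Ha) as Hra.
      pose proof (Hc a Ha) as Hca. assert (HM : (0 <= M a)%R) by (eapply geo_M; eauto).
      exists (Rmax R1 (Cmod (w a) + 2 * r1 a + 4 * M a / eps + 1)). intros y Hy.
      specialize (HR1 y (Rle_lt_trans _ _ _ (Rmax_l _ _) Hy)).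
      pose proof (Rle_lt_trans _ _ _ (Rmax_r _ _) Hy) as Hy2.
      pose proof (Cmod_minus_ge y (w a)) as H1.
      assert (H4 : (0 <= 4 * M a / eps)%R) by (apply Rmult_le_pos; [lra|left; apply Rinv_0_lt_compat; auto]).
      pose proof (nser_bound (c a) (r1 a) (M a) (y - w a) ltac:(lra) Hca ltac:(lra)) as HB.
      simpl. eapply Rle_trans; [apply Cmod_triangle|].
      assert (2 * M a / Cmod (y - w a) <= eps / 2)%R; [|lra].
      apply Rmult_le_reg_r with (Cmod (y - w a)); [lra|]. unfold Rdiv at 1. rewrite Rmult_assoc, Rinv_l by lra.
      replace (2 * M a * 1)%R with (eps / 2 * (4 * M a / eps))%R by (field; lra).
      apply Rmult_le_compat_l; lra. }
  intros eps He.
  destruct (Hinf (eps / 2)%R ltac:(lra)) as [R1 HR1]. destruct (HN L (incl_refl L) (eps / 2)%R ltac:(lra)) as [R2 HR2].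
  assert (HR3 : exists R3, forall y, (R3 < Cmod y)%R -> forall a, In a L -> (r1 a < Cmod (y - w a))%R).
  { clear -Hr. induction L as [|a L IH].
    - exists 0%R. intros y _ a [].
    - destruct IH as [R3 H3]; [intros; apply Hr; right; auto|].
      exists (Rmax R3 (Cmod (w a) + r1 a)). intros y Hy b [<-|Hb].
      + pose proof (Rle_lt_trans _ _ _ (Rmax_r _ _) Hy). pose proof (Cmod_minus_ge y (w a)). lra.
      + apply H3; auto. eapply Rle_lt_trans; [apply Rmax_l|exact Hy]. }
  destruct HR3 as [R3 HR3]. exists (Rmax R1 (Rmax R2 R3)). intros y Hy.
  pose proof (Rle_lt_trans _ _ _ (Rmax_l _ _) Hy) as Hy1. pose proof (Rle_lt_trans _ _ _ (Rmax_r _ _) Hy) as Hy23.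
  pose proof (Rle_lt_trans _ _ _ (Rmax_l _ _) Hy23) as Hy2. pose proof (Rle_lt_trans _ _ _ (Rmax_r _ _) Hy23) as Hy3.
  specialize (HFE y (HR3 y Hy3)). specialize (HR1 y Hy1). specialize (HR2 y Hy2).
  replace (E y) with (F y + - csum L (fun a => nser (c a) (y - w a))) by (rewrite HFE; ring).
  eapply Rle_trans; [apply Cmod_triangle|]. rewrite Cmod_opp. lra.
Qed.

(** * The Schottky group and its regular set *)

Definition closed_D (g : nat) (w rho : Z -> C) (p : Chat) : Prop :=
  match p with
  | Fin z => forall a, is_letter g a -> (radius rho a <= Cmod (z - w a))%R
  | Infty => True
  end.

Lemma in_D_closed g w rho p : in_D g w rho p -> closed_D g w rho p.
Proof. destruct p as [z|]; simpl; auto. intros H a Ha. specialize (H a Ha). lra. Qed.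

Lemma letter_opp g a : is_letter g a -> is_letter g (- a).
Proof. unfold is_letter; lia. Qed.

Lemma radius_pos g w rho a : in_Schottky_domain g w rho -> is_letter g a -> (0 < radius rho a)%R.
Proof. intros [H _] Ha. apply sqrt_lt_R0, Cmod_gt_0, H; auto. Qed.

Lemma radius_opp g w rho a : in_Schottky_domain g w rho -> is_letter g a -> radius rho (- a) = radius rho a.
Proof. intros [H _] Ha. unfold radius. destruct (H a Ha) as [_ ->]. auto. Qed.

Lemma radius_sqr rho a : (radius rho a * radius rho a)%R = Cmod (rho a).
Proof. apply sqrt_sqrt, Cmod_ge_0. Qed.

Lemma gen_inverse g w rho a p : in_Schottky_domain g w rho -> is_letter g a ->
  schottky_gen w rho (- a) (schottky_gen w rho a p) = p.
Proof.
  intros Hw Ha. destruct (proj1 Hw a Ha) as [H1 H2]. destruct p as [z|]; simpl.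
  - destruct (Ceq_dec z (w a)) as [->|Hz]; simpl; [rewrite Z.opp_involutive; auto|].
    assert (Hz' : z - w a <> 0) by (apply Cminus_eq_contra; auto).
    destruct (Ceq_dec _ _) as [E|E].
    + exfalso. assert (rho a / (z - w a) = 0).
      { transitivity (w (- a)%Z + rho a / (z - w a) - w (- a)%Z); [ring|]. rewrite E; ring. }
      assert (E2 : rho a = rho a / (z - w a) * (z - w a)) by (field; auto).
      apply H1. rewrite E2, H. ring.
    + rewrite Z.opp_involutive, H2. f_equal.
      replace (w (- a)%Z + rho a / (z - w a) - w (- a)%Z) with (rho a / (z - w a)) by ring.
      field. split; auto.
  - destruct (Ceq_dec _ _) as [_|E]; [auto|congruence].
Qed.

Lemma gen_dist g w rho a z : in_Schottky_domain g w rho -> is_letter g a -> z <> w a ->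
  exists z', schottky_gen w rho a (Fin z) = Fin z' /\
    (Cmod (z' - w (- a)%Z) * Cmod (z - w a) = radius rho a * radius rho a)%R.
Proof.
  intros Hw Ha Hz. simpl. destruct (Ceq_dec z (w a)) as [|_]; [congruence|].
  eexists; split; [reflexivity|].
  assert (Hz' : z - w a <> 0) by (apply Cminus_eq_contra; auto).
  replace (w (- a)%Z + rho a / (z - w a) - w (- a)%Z) with (rho a / (z - w a)) by ring.
  rewrite Cmod_div, radius_sqr by auto. field. apply Rgt_not_eq, Cmod_gt_0; auto.
Qed.

Lemma gen_closed g w rho a p : in_Schottky_domain g w rho -> is_letter g a ->
  (forall z, p = Fin z -> (radius rho a <= Cmod (z - w a))%R) ->
  exists z', schottky_gen w rho a p = Fin z' /\ (Cmod (z' - w (- a)%Z) <= radius rho a)%R /\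
   ((forall z, p = Fin z -> (radius rho a < Cmod (z - w a))%R) -> (Cmod (z' - w (- a)%Z) < radius rho a)%R).
Proof.
  intros Hw Ha Hp. pose proof (radius_pos _ _ _ _ Hw Ha) as Hr. destruct p as [z|].
  - specialize (Hp z eq_refl).
    destruct (gen_dist g w rho a z Hw Ha) as (z' & E & Hd).
    + intros ->. replace (w a - w a) with (RtoC 0) in Hp by ring. rewrite Cmod_0 in Hp. lra.
    + exists z'; split; auto. pose proof (Cmod_ge_0 (z' - w (- a)%Z)). split.
      * apply Rnot_lt_le; intros Hlt. nra.
      * intros Hs. specialize (Hs z eq_refl). apply Rnot_le_lt; intros Hle. nra.
  - exists (w (- a)%Z). simpl. replace (w (- a)%Z - w (- a)%Z) with (RtoC 0) by ring. rewrite Cmod_0.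
    repeat split; auto; lra.
Qed.

Definition eval_word (w rho : Z -> C) (l : list Z) (p : Chat) : Chat :=
  fold_right (schottky_gen w rho) p l.

Fixpoint reduced (l : list Z) : Prop :=
  match l with
  | nil => True
  | a :: l' => match l' with nil => True | b :: _ => a <> (- b)%Z end /\ reduced l'
  end.

(** Ping-pong: a generator maps the outside of C_a into the disc of C_{-a}. In a reduced word the
    next letter is not the inverse, so its circle has that disc outside, and strictness appears from
    the second letter on. *)
Lemma word_image g w rho l a p : in_Schottky_domain g w rho ->
  Forall (is_letter g) (a :: l) -> reduced (a :: l) -> closed_D g w rho p ->
  exists z, eval_word w rho (a :: l) p = Fin z /\ (Cmod (z - w (- a)%Z) <= radius rho a)%R /\
    (in_D g w rho p \/ l <> nil -> (Cmod (z - w (- a)%Z) < radius rho a)%R).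
Proof.
  intros Hw. revert a. induction l as [|b l IH]; intros a Hl Hr Hp; inversion Hl as [|? ? Ha Hl']; subst.
  - destruct (gen_closed g w rho a p Hw Ha) as (z & E & H1 & H2).
    + intros z ->. apply Hp; auto.
    + exists z. split; [exact E|split; auto]. intros [Hd|Hn]; [|congruence]. apply H2. intros y ->.
      apply Hd; auto.
  - destruct Hr as [Hab Hr]. destruct (IH b Hl' Hr Hp) as (z1 & E1 & H1 & _).
    inversion Hl' as [|? ? Hb _]; subst.
    assert (Hz1 : (radius rho a < Cmod (z1 - w a))%R).
    { pose proof (proj2 Hw a (- b)%Z Ha (letter_opp _ _ Hb) Hab) as Hd.
      rewrite (radius_opp _ _ _ _ Hw Hb) in Hd.
      pose proof (Cmod_minus_ge (w a - w (- b)%Z) (z1 - w (- b)%Z)) as H2.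
      replace (w a - w (- b)%Z - (z1 - w (- b)%Z)) with (- (z1 - w a)) in H2 by ring.
      rewrite Cmod_opp in H2. lra. }
    destruct (gen_closed g w rho a (Fin z1) Hw Ha) as (z & E & H2 & H3).
    + intros z [= <-]. lra.
    + exists z. split.
      * change (eval_word w rho (a :: b :: l) p) with (schottky_gen w rho a (eval_word w rho (b :: l) p)).
        rewrite E1. exact E.
      * split; auto. intros _. apply H3. intros y [= <-]; auto.
Qed.

(** When the new letter is the inverse of the first one, the pair is cancelled by [gen_inverse] and
    the tail of a reduced word remains. *)
Lemma group_word g w rho f : in_Schottky_domain g w rho -> schottky_group g w rho f ->
  exists l, Forall (is_letter g) l /\ reduced l /\ forall p, f p = eval_word w rho l p.
Proof.
  intros Hw Hf. induction Hf as [|a f Ha Hf (l & H1 & H2 & H3)].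
  - exists nil. repeat split; auto.
  - destruct l as [|b l].
    + exists [a]. split; [constructor; auto|split; [simpl; auto|]]. intros p. simpl. rewrite H3; auto.
    + destruct (Z.eq_dec a (- b)) as [->|Hn].
      * exists l. inversion H1 as [|? ? Hb Hl]; subst. split; [exact Hl|]. split; [apply H2|].
        intros p. rewrite H3. simpl. apply (gen_inverse g); auto.
      * exists (a :: b :: l). split; [constructor; auto|]. split; [exact (conj Hn H2)|]. intros p. simpl. rewrite H3; auto.
Qed.

Lemma group_comp g w rho f h : schottky_group g w rho f -> schottky_group g w rho h ->
  schottky_group g w rho (fun p => f (h p)).
Proof.
  intros Hf Hh. induction Hf as [|a f Ha Hf IH]; auto.
  apply (schottky_comp g w rho a (fun p => f (h p))); auto.
Qed.

Lemma group_gen g w rho a : is_letter g a -> schottky_group g w rho (schottky_gen w rho a).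
Proof. intros Ha. apply (schottky_comp g w rho a (fun p => p)); auto. apply schottky_id. Qed.

Lemma group_inverse g w rho f : in_Schottky_domain g w rho -> schottky_group g w rho f ->
  exists h, schottky_group g w rho h /\ (forall p, h (f p) = p).
Proof.
  intros Hw Hf. induction Hf as [|a f Ha Hf (h & Hh & E)].
  - exists (fun p => p). split; auto. apply schottky_id.
  - exists (fun p => h (schottky_gen w rho (- a) p)). split.
    + apply group_comp; auto. apply group_gen, letter_opp; auto.
    + intros p. rewrite (gen_inverse g) by auto. apply E.
Qed.

(** A nonempty reduced word sends p into some disc C_{-a}, strictly inside it unless the word is one
    letter and p lies on a boundary circle. Hence only the identity and single generators bring p
    back to the closed region. *)
Lemma closed_D_return g w rho f p : in_Schottky_domain g w rho -> schottky_group g w rho f ->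
  closed_D g w rho p -> closed_D g w rho (f p) ->
  (forall q, f q = q) \/ (~ in_D g w rho p /\ exists a, is_letter g a /\ forall q, f q = schottky_gen w rho a q).
Proof.
  intros Hw Hf Hp Hfp. destruct (group_word g w rho f Hw Hf) as (l & H1 & H2 & H3).
  destruct l as [|a l]; [left; exact H3|right].
  destruct (word_image g w rho l a p Hw H1 H2 Hp) as (z & E & H4 & H5).
  inversion H1 as [|? ? Ha Hl]; subst. rewrite H3, E in Hfp. simpl in Hfp.
  specialize (Hfp (- a)%Z (letter_opp _ _ Ha)). rewrite (radius_opp _ _ _ _ Hw Ha) in Hfp.
  split.
  - intros Hd. specialize (H5 (or_introl Hd)). lra.
  - exists a; split; auto. destruct l as [|b l]; [intros q; rewrite H3; reflexivity|].
    assert (H6 : b :: l <> nil) by discriminate. specialize (H5 (or_intror H6)). lra.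
Qed.

Lemma equivalent_closed_D g w rho x q : in_Schottky_domain g w rho -> in_D g w rho x ->
  closed_D g w rho q -> equivalent g w rho x q -> x = q.
Proof.
  intros Hw Hx Hq (f & Hf & E). subst q.
  destruct (closed_D_return g w rho f x Hw Hf (in_D_closed _ _ _ _ Hx) Hq) as [H|[H _]]; [auto|contradiction].
Qed.

Lemma equivalent_sym g w rho p q : in_Schottky_domain g w rho ->
  equivalent g w rho p q -> equivalent g w rho q p.
Proof.
  intros Hw (f & Hf & E). destruct (group_inverse g w rho f Hw Hf) as (h & Hh & Ei).
  exists h; split; auto. rewrite <- E; auto.
Qed.

Lemma equivalent_gen g w rho p q a : in_Schottky_domain g w rho -> is_letter g a ->
  equivalent g w rho p q -> equivalent g w rho p (schottky_gen w rho a q).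
Proof.
  intros Hw Ha (f & Hf & E). exists (fun p => schottky_gen w rho a (f p)). split.
  - apply schottky_comp; auto.
  - rewrite E; auto.
Qed.

Definition gen_opt (w rho : Z -> C) (o : option Z) (p : Chat) : Chat :=
  match o with None => p | Some a => schottky_gen w rho a p end.

Definition opt_letters (g : nat) : list (option Z) := None :: map Some (letters g).

Lemma In_opt_letters g o : In o (opt_letters g) <-> match o with None => True | Some a => is_letter g a end.
Proof.
  unfold opt_letters. destruct o as [a|]; simpl.
  - rewrite in_map_iff, <- In_letters. split.
    + intros [H|(b & [= ->] & H)]; [discriminate|auto].
    + intros H. right. exists a; auto.
  - tauto.
Qed.

Lemma pigeonhole {T} (l : list T) (R : nat -> T -> Prop) :
  (forall n, exists c, In c l /\ R n c) -> exists n m c, n <> m /\ R n c /\ R m c.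
Proof.
  intros H. set (code := fun n => proj1_sig (constructive_indefinite_description _ (H n))).
  assert (Hc : forall n, In (code n) l /\ R n (code n)).
  { intros n. exact (proj2_sig (constructive_indefinite_description _ (H n))). }
  apply NNPP. intros Hno.
  assert (Hnd : NoDup (map code (seq 0 (S (length l))))).
  { apply NoDup_map_NoDup_ForallPairs; [|apply seq_NoDup].
    intros n m _ _ E. apply NNPP; intros Hnm. apply Hno. exists n, m, (code n).
    split; auto. split; [apply Hc|]. rewrite E. apply Hc. }
  assert (Hincl : incl (map code (seq 0 (S (length l)))) l).
  { intros c Hin. apply in_map_iff in Hin. destruct Hin as (n & <- & _). apply Hc. }
  pose proof (NoDup_incl_length Hnd Hincl) as Hlen. rewrite length_map, length_seq in Hlen. lia.
Qed.

(* If p were a limit point, infinitely many images of one point would lie in the cover, and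
   by [closed_D_return] only finitely many elements of the group allow that. *)
Lemma regular_of_covered g w rho p : in_Schottky_domain g w rho ->
  locally_hat p (fun q => closed_D g w rho q \/ exists a, is_letter g a /\ closed_D g w rho (schottky_gen w rho a q)) ->
  regular_set g w rho p.
Proof.
  intros Hw HU (z & f & Hf & Hdist & Hlim). specialize (Hlim _ HU). destruct Hlim as [N HN].
  assert (Hcode : forall n, (N <= n)%nat -> exists o, In o (opt_letters g) /\ closed_D g w rho (gen_opt w rho o (f n z))).
  { intros n Hn. destruct (HN n Hn) as [H|(a & Ha & H)].
    - exists None. split; [apply In_opt_letters; exact I|exact H].
    - exists (Some a). split; [apply In_opt_letters; exact Ha|exact H]. }
  assert (Hgo : forall o, In o (opt_letters g) -> schottky_group g w rho (gen_opt w rho o)).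
  { intros [a|] Ho; apply In_opt_letters in Ho; [apply group_gen; auto|apply schottky_id]. }
  destruct (Hcode N (Nat.le_refl N)) as (o0 & Ho0 & Hz1).
  (* A base element with K z in the closed region. Any other f_n, corrected by at most one
     generator, also sends z there, and their quotient is governed by [closed_D_return]. *)
  set (K := fun q => gen_opt w rho o0 (f N q)).
  assert (HK : schottky_group g w rho K) by (apply (group_comp g w rho (gen_opt w rho o0)); auto).
  destruct (group_inverse g w rho K Hw HK) as (Ki & HKi & EKi).
  destruct (group_inverse g w rho Ki Hw HKi) as (K' & HK' & EK').
  set (neg := fun o : option Z => match o with None => None | Some a => Some (- a)%Z end).
  (* Each f_(N+n) is K followed by at most two generators, so a pair of optional letters encodes it.
     There are finitely many codes, so two of the f_n coincide as maps. *)
  destruct (pigeonhole (list_prod (opt_letters g) (opt_letters g))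
    (fun n c => forall q, f (N + n)%nat q = gen_opt w rho (neg (fst c)) (gen_opt w rho (snd c) (K q)))) as (n & m & c & Hnm & H1 & H2).
  - intros n. destruct (Hcode (N + n)%nat ltac:(lia)) as (o & Ho & Hcl).
    set (e := fun q => gen_opt w rho o (f (N + n)%nat (Ki q))).
    assert (He : schottky_group g w rho e).
    { apply (group_comp g w rho (fun q => gen_opt w rho o (f (N + n)%nat q))); auto.
      apply (group_comp g w rho (gen_opt w rho o)); auto. }
    assert (Heq : forall q, e (K q) = gen_opt w rho o (f (N + n)%nat q)) by (intros q; unfold e; rewrite EKi; auto).
    assert (Hinv : forall q, f (N + n)%nat q = gen_opt w rho (neg o) (e (K q))).
    { intros q. rewrite Heq. apply In_opt_letters in Ho. destruct o as [a|]; simpl; auto.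
      symmetry. apply (gen_inverse g); auto. }
    destruct (closed_D_return g w rho e (K z) Hw He Hz1) as [Hid|(_ & a & Ha & Hgen)].
    + rewrite Heq. exact Hcl.
    + exists (o, None). split; [apply in_prod; auto; apply In_opt_letters; exact I|].
      intros q. rewrite Hinv, Hid. reflexivity.
    + exists (o, Some a). split; [apply in_prod; auto; apply In_opt_letters; exact Ha|].
      intros q. rewrite Hinv, Hgen. reflexivity.
  - destruct (Hdist (N + n)%nat (N + m)%nat ltac:(lia)) as [q Hq]. apply Hq. rewrite H1, H2. auto.
Qed.

Lemma exists_factor (l : list (R * R)) : (forall AB, In AB l -> (0 <= snd AB < fst AB)%R) ->
  exists t, (1 < t)%R /\ forall AB, In AB l -> (t * snd AB < fst AB)%R.
Proof.
  induction l as [|[A B] l IH]; intros H.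
  - exists 2%R. split; [lra|]. intros ? [].
  - destruct IH as (t & Ht & Hl); [intros; apply H; right; auto|].
    pose proof (H (A, B) (or_introl eq_refl)) as HAB. simpl in HAB.
    (* [t2] times B is the midpoint of A and B. *)
    set (t2 := ((A + B) / (2 * B))%R).
    destruct (Req_dec B 0) as [->|HB].
    + exists t; split; auto. intros AB [<-|H2]; [simpl; lra|auto].
    + assert (Ht2 : (1 < t2)%R).
      { unfold t2. apply Rmult_lt_reg_r with (2 * B)%R; [lra|]. unfold Rdiv; rewrite Rmult_assoc, Rinv_l; lra. }
      exists (Rmin t t2). split; [apply Rmin_glb_lt; auto|].
      intros AB [<-|H2].
      * simpl. apply Rle_lt_trans with (t2 * B)%R; [apply Rmult_le_compat_r; [lra|apply Rmin_r]|].
        unfold t2. replace ((A + B) / (2 * B) * B)%R with ((A + B) / 2)%R by (field; auto). lra.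
      * specialize (Hl AB H2). specialize (H AB (or_intror H2)).
        apply Rle_lt_trans with (t * snd AB)%R; auto. apply Rmult_le_compat_r; [lra|apply Rmin_l].
Qed.

(** The room common to all estimates: the circles stay disjoint, and x stays outside them, after
    enlargement by t. The last clause is vacuous for x at infinity. *)
Definition spread (g : nat) (w rho : Z -> C) (x : Chat) (t : R) : Prop :=
  (1 < t)%R /\
  (forall a b, is_letter g a -> is_letter g b -> a <> b ->
     (t * radius rho a + t * radius rho b < Cmod (w a - w b))%R) /\
  (forall z a, x = Fin z -> is_letter g a -> (t * radius rho a < Cmod (z - w a))%R).

Lemma exists_spread g w rho x : in_Schottky_domain g w rho -> in_D g w rho x ->
  exists t, spread g w rho x t.
Proof.
  intros Hw Hx.
  set (l1 := flat_map (fun a => flat_map (fun b => if Z.eq_dec a b then [] else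
     [(Cmod (w a - w b), radius rho a + radius rho b)%R]) (letters g)) (letters g)).
  set (l2 := match x with Infty => [] | Fin z => map (fun a => (Cmod (z - w a), radius rho a)) (letters g) end).
  destruct (exists_factor (l1 ++ l2)) as (t & Ht & H).
  - intros AB HAB. apply in_app_iff in HAB. destruct HAB as [HAB|HAB].
    + apply in_flat_map in HAB. destruct HAB as (a & Ha & HAB). apply in_flat_map in HAB.
      destruct HAB as (b & Hb & HAB). apply In_letters in Ha. apply In_letters in Hb.
      destruct (Z.eq_dec a b) as [|Hn]; [destruct HAB|]. destruct HAB as [<-|[]]. simpl.
      pose proof (radius_pos _ _ _ _ Hw Ha). pose proof (radius_pos _ _ _ _ Hw Hb).
      pose proof (proj2 Hw a b Ha Hb Hn). lra.
    + unfold l2 in HAB. destruct x as [z|]; [|destruct HAB]. apply in_map_iff in HAB.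
      destruct HAB as (a & <- & Ha). apply In_letters in Ha. simpl.
      pose proof (radius_pos _ _ _ _ Hw Ha). specialize (Hx a Ha). lra.
  - exists t. split; [auto|split].
    + intros a b Ha Hb Hn. specialize (H (Cmod (w a - w b), radius rho a + radius rho b)%R). simpl in H.
      rewrite <- Rmult_plus_distr_l. apply H. apply in_app_iff; left.
      apply in_flat_map. exists a; split; [apply In_letters; auto|].
      apply in_flat_map. exists b; split; [apply In_letters; auto|].
      destruct (Z.eq_dec a b); [contradiction|left; auto].
    + intros z a -> Ha. apply (H (Cmod (z - w a), radius rho a)). apply in_app_iff; right.
      unfold l2. apply in_map_iff. exists a; split; auto. apply In_letters; auto.
Qed.

(** A neighbourhood of the finite part of the closed region, reaching inside each circle by the
    factor t. Laurent expansion around C_a needs holomorphy on an annulus and not only on one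
    side. *)
Definition collar_D (g : nat) (w rho : Z -> C) (t : R) (y : C) : Prop :=
  forall a, is_letter g a -> (radius rho a / t < Cmod (y - w a))%R.

(** A point of the collar inside C_a is sent by gamma_a between C_{-a} and its enlargement by t.
    There it lies in D and differs from x, which is outside the enlarged circles. *)
Lemma collar_D_cover g w rho x t y : in_Schottky_domain g w rho -> spread g w rho x t ->
  collar_D g w rho t y ->
  closed_D g w rho (Fin y) \/ exists a, is_letter g a /\
    closed_D g w rho (schottky_gen w rho a (Fin y)) /\ x <> schottky_gen w rho a (Fin y).
Proof.
  intros Hw (Ht & Hd & Hx) Hy.
  destruct (classic (closed_D g w rho (Fin y))) as [H|H]; [auto|right].
  simpl in H. apply not_all_ex_not in H. destruct H as [a H]. apply imply_to_and in H. destruct H as [Ha H].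
  apply Rnot_le_lt in H. exists a; split; auto.
  pose proof (radius_pos _ _ _ _ Hw Ha) as Hr. specialize (Hy a Ha).
  assert (Hyw : (0 < Cmod (y - w a))%R).
  { eapply Rle_lt_trans; [|exact Hy]. apply Rmult_le_pos; [lra|left; apply Rinv_0_lt_compat; lra]. }
  destruct (gen_dist g w rho a y Hw Ha) as (y' & E & Hdist).
  { intros ->. replace (w a - w a) with (RtoC 0) in Hyw by ring. rewrite Cmod_0 in Hyw. lra. }
  rewrite E. set (R0 := radius rho a) in *.
  assert (H1 : (R0 < Cmod (y' - w (- a)%Z))%R) by (apply Rnot_le_lt; intros Hle; pose proof (Cmod_ge_0 (y' - w (- a)%Z)); nra).
  assert (H2 : (Cmod (y' - w (- a)%Z) < t * R0)%R).
  { apply Rmult_lt_reg_r with (Cmod (y - w a)); auto. rewrite Hdist.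
    replace (R0 * R0)%R with (t * R0 * (R0 / t))%R by (field; lra).
    apply Rmult_lt_compat_l; [nra|auto]. }
  split.
  - simpl. intros b Hb. destruct (Z.eq_dec b (- a)) as [->|Hn].
    + rewrite (radius_opp _ _ _ _ Hw Ha). fold R0. lra.
    + specialize (Hd b (- a)%Z Hb (letter_opp _ _ Ha) Hn). rewrite (radius_opp _ _ _ _ Hw Ha) in Hd. fold R0 in Hd.
      pose proof (Cmod_minus_ge (w b - w (- a)%Z) (y' - w (- a)%Z)) as H3.
      replace (w b - w (- a)%Z - (y' - w (- a)%Z)) with (- (y' - w b)) in H3 by ring. rewrite Cmod_opp in H3.
      pose proof (radius_pos _ _ _ _ Hw Hb). nra.
  - intros E'. specialize (Hx y' (- a)%Z E' (letter_opp _ _ Ha)).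
    rewrite (radius_opp _ _ _ _ Hw Ha) in Hx. fold R0 in Hx. lra.
Qed.

Lemma collar_D_not_equivalent g w rho x t y : in_Schottky_domain g w rho -> spread g w rho x t ->
  in_D g w rho x -> collar_D g w rho t y -> x <> Fin y -> ~ equivalent g w rho x (Fin y).
Proof.
  intros Hw Hs Hx Hy Hn He. destruct (collar_D_cover g w rho x t y Hw Hs Hy) as [H|(a & Ha & H1 & H2)].
  - apply Hn. apply (equivalent_closed_D g w rho); auto.
  - apply H2. apply (equivalent_closed_D g w rho); auto. apply equivalent_gen; auto.
Qed.

Lemma collar_D_open g w rho t y : in_Schottky_domain g w rho -> collar_D g w rho t y ->
  exists d, (0 < d)%R /\ forall y', (Cmod (y' - y) < d)%R -> collar_D g w rho t y'.
Proof.
  intros Hw Hy.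
  assert (H : forall L, (forall a, In a L -> is_letter g a) -> exists d, (0 < d)%R /\ forall y', (Cmod (y' - y) < d)%R ->
    forall a, In a L -> (radius rho a / t < Cmod (y' - w a))%R).
  { induction L as [|a L IH]; intros HL.
    - exists 1%R; split; [lra|]. intros ? _ ? [].
    - destruct IH as (d & Hd & H); [intros; apply HL; right; auto|].
      specialize (Hy a (HL a (or_introl eq_refl))).
      exists (Rmin d (Cmod (y - w a) - radius rho a / t)). split; [apply Rmin_pos; lra|].
      intros y' Hy' b [<-|Hb].
      + apply (Cmod_near (y - w a)). replace (y' - w a - (y - w a)) with (y' - y) by ring.
        eapply Rlt_le_trans; [exact Hy'|apply Rmin_r].
      + apply H; auto. eapply Rlt_le_trans; [exact Hy'|apply Rmin_l]. }
  destruct (H (letters g)) as (d & Hd & H'); [intros; apply In_letters; auto|].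
  exists d; split; auto. intros y' Hy' a Ha. apply H'; auto. apply In_letters; auto.
Qed.

Lemma ball_Cmod (z z' : C) (d : posreal) : (Cmod (z' - z) < d)%R -> ball (M := C_UniformSpace) z d z'.
Proof.
  intros H. split; (eapply Rle_lt_trans; [|exact H]).
  - exact (re_le_Cmod (z' - z)).
  - exact (im_le_Cmod (z' - z)).
Qed.

Lemma locally_of_Cmod (z : C) (P : C -> Prop) (d : R) : (0 < d)%R ->
  (forall z', (Cmod (z' - z) < d)%R -> P z') -> locally (T := C_UniformSpace) z P.
Proof.
  intros Hd H. assert (Hd2 : (0 < d / 2)%R) by lra. exists (mkposreal _ Hd2).
  intros z' [H1 H2]. apply H. eapply Rle_lt_trans; [apply Cmod_le_Re_Im|].
  change (Rabs (Re (z' - z)) < d / 2)%R in H1. change (Rabs (Im (z' - z)) < d / 2)%R in H2. lra.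
Qed.

Lemma collar_D_regular g w rho x t y : in_Schottky_domain g w rho -> spread g w rho x t ->
  collar_D g w rho t y -> regular_set g w rho (Fin y).
Proof.
  intros Hw Hs Hy. apply regular_of_covered; auto.
  destruct (collar_D_open g w rho t y Hw Hy) as (d & Hd & H).
  apply (locally_of_Cmod y _ d Hd). intros y' Hy'. simpl.
  destruct (collar_D_cover g w rho x t y' Hw Hs (H y' Hy')) as [H1|(a & Ha & H1 & _)]; [left; exact H1|].
  right; exists a; auto.
Qed.

Lemma bounded_centres g (w rho : Z -> C) : exists B, (0 < B)%R /\ forall a, is_letter g a -> (Cmod (w a) + radius rho a < B)%R.
Proof.
  exists (rsum (letters g) (fun a => Cmod (w a) + radius rho a) + 1)%R. split.
  - enough (0 <= rsum (letters g) (fun a => Cmod (w a) + radius rho a))%R by lra.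
    apply rsum_ge0. intros. pose proof (Cmod_ge_0 (w i)). assert (0 <= radius rho i)%R by apply sqrt_pos. lra.
  - intros a Ha. enough (Cmod (w a) + radius rho a <= rsum (letters g) (fun a => Cmod (w a) + radius rho a))%R by lra.
    apply (rsum_ge_term (letters g) (fun a => Cmod (w a) + radius rho a)%R); [|apply In_letters; auto].
    intros j _. pose proof (Cmod_ge_0 (w j)). assert (0 <= radius rho j)%R by apply sqrt_pos. lra.
Qed.

Lemma infinity_regular g w rho : in_Schottky_domain g w rho -> regular_set g w rho Infty.
Proof.
  intros Hw. apply regular_of_covered; auto.
  destruct (bounded_centres g w rho) as (B & HB & H).
  apply (locally_of_Cmod 0 _ (/ B)); [apply Rinv_0_lt_compat; auto|]. intros u Hu. left. simpl.
  destruct (Ceq_dec u 0) as [|Hn]; simpl; auto. intros a Ha.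
  replace (u - 0) with u in Hu by ring.
  assert (Hup : (0 < Cmod u)%R) by (apply Cmod_gt_0; auto).
  pose proof (Cmod_minus_ge (/ u) (w a)) as H1. rewrite Cmod_inv in H1 by auto.
  specialize (H a Ha). assert (B < / Cmod u)%R; [|lra].
  rewrite <- (Rinv_inv B). apply Rinv_lt_contravar; auto. apply Rmult_lt_0_compat; auto. apply Rinv_0_lt_compat; auto.
Qed.

(** * The bidifferential near the fundamental region *)

Lemma cderiv_is_derive f z l : cderiv f z l -> is_derive (K := C_AbsRing) (V := C_NormedModule) f z l.
Proof.
  intros H. split; [apply is_linear_scal_l|]. intros x Hx eps.
  assert (Hx' : z = x) by (apply (is_filter_lim_locally_unique (V := AbsRing_NormedModule C_AbsRing)); exact Hx).
  subst x. destruct (H eps (cond_pos eps)) as (d & Hd & H1).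
  exists (mkposreal d Hd). intros y Hy. set (z' := y : C).
  specialize (H1 (z' - z) Hy). assert (E : z + (z' - z) = z') by ring.
  rewrite E, (Cmult_comm l) in H1. exact H1.
Qed.

(** The derivative in the second variable is the value of the differential at the vector (0, 1). *)
Lemma C_differentiable2_slice h (p q : C) : C_differentiable2 h (p, q) -> holo (fun v => h (p, v)) q.
Proof.
  intros (l & Hl & H). set (e1 := (RtoC 0, RtoC 1) : prod_NormedModule C_AbsRing C_NormedModule C_NormedModule).
  exists (l e1 : C).
  intros eps He. specialize (H (p, q) (fun P HP => HP) (mkposreal eps He)).
  destruct H as [d Hd]. exists d; split; [apply cond_pos|]. intros k Hk.
  specialize (Hd (p, q + k)).
  assert (Hb : ball (M := prod_UniformSpace C_UniformSpace C_UniformSpace) (p, q) d (p, q + k)).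
  { split; [apply ball_center|]. apply ball_Cmod. simpl. replace (q + k - q) with k by ring. exact Hk. }
  specialize (Hd Hb). simpl pos in Hd.
  assert (E1 : minus (p, q + k) (p, q) = scal (V := prod_NormedModule C_AbsRing C_NormedModule C_NormedModule) k e1).
  { apply injective_projections; simpl.
    - change (p - p = k * 0). ring.
    - change (q + k - q = k * 1). ring. }
  assert (E2 : l (minus (p, q + k) (p, q)) = (l e1 : C) * k).
  { rewrite E1, (linear_scal _ Hl). apply Cmult_comm. }
  assert (E3 : norm (V := prod_NormedModule C_AbsRing C_NormedModule C_NormedModule) (minus (p, q + k) (p, q)) = Cmod k).
  { change (sqrt (Cmod (p - p) ^ 2 + Cmod (q + k - q)%C ^ 2) = Cmod k).
    replace (p - p) with (RtoC 0) by ring. replace (q + k - q) with k by ring. rewrite Cmod_0.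
    replace (0 ^ 2 + Cmod k ^ 2)%R with (Cmod k ^ 2)%R by ring. apply sqrt_pow2, Cmod_ge_0. }
  rewrite <- E3. eapply Rle_trans; [|exact Hd]. right.
  change (Cmod (h (p, q + k) - h (p, q) - (l e1 : C) * k) = Cmod (h (p, q + k) - h (p, q) - l (minus (p, q + k) (p, q)))).
  rewrite E2. auto.
Qed.

Lemma param_pt_coord p : param (chart_at p) (pt_coord p) = p.
Proof. destruct p as [z|]; simpl; auto. unfold pt_coord; simpl. destruct (Ceq_dec 0 0); [auto|congruence]. Qed.

Lemma jac_pt_coord p : jac (chart_at p) (pt_coord p) = 1.
Proof. destruct p as [z|]; simpl; auto. unfold pt_coord; simpl. destruct (Ceq_dec 0 0); [auto|congruence]. Qed.

(** The principal part of omega(x, y). With x = 1/t one has dx / (x - y)^2 = - dt / (1 - t y)^2,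
    hence the coefficient -1 at infinity. *)
Definition pole (x : Chat) (y : C) : C :=
  match x with Fin z => / ((z - y) * (z - y)) | Infty => -1 end.

Definition pole_prim (x : Chat) (y : C) : C :=
  match x with Fin z => / (z - y) | Infty => - y end.

Lemma cderiv_pole_prim x y : x <> Fin y -> cderiv (pole_prim x) y (pole x y).
Proof.
  destruct x as [z|]; intros Hn; simpl.
  - assert (Hz : z - y <> 0) by (apply Cminus_eq_contra; congruence).
    apply (cderiv_eq _ _ (- / ((z - y) * (z - y)) * (0 - 1))); [ring|].
    apply (cderiv_comp (fun u => / u) (fun y => z - y)); [apply cderiv_inv; auto|].
    apply cderiv_minus; [apply cderiv_const|apply cderiv_id].
  - apply (cderiv_eq _ _ (- (1))); [ring|]. apply (cderiv_opp (fun y => y)), cderiv_id.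
Qed.

Lemma holo_pole x y : x <> Fin y -> holo (pole x) y.
Proof.
  destruct x as [z|]; intros Hn; simpl; [|apply (holo_const (-1))].
  assert (Hz : z - y <> 0) by (apply Cminus_eq_contra; congruence).
  apply (holo_comp (fun u => / u) (fun y => (z - y) * (z - y))); [apply holo_inv, Cmult_neq_0; auto|].
  assert (H : holo (fun y => z - y) y) by (apply holo_minus; [apply holo_const|eexists; apply cderiv_id]).
  apply holo_mult; auto.
Qed.

Lemma holo_bounded f z : holo f z -> exists d M, (0 < d)%R /\ (0 < M)%R /\ forall z', (Cmod (z' - z) < d)%R -> (Cmod (f z') <= M)%R.
Proof.
  intros H. destruct (holo_ccont f z H 1%R ltac:(lra)) as (d & Hd & H1).
  pose proof (Cmod_ge_0 (f z)). exists d, (Cmod (f z) + 1)%R. split; [auto|split; [lra|]].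
  intros z' Hz'. specialize (H1 z' Hz'). pose proof (Cmod_minus_ge (f z') (f z)). lra.
Qed.

Lemma omega_holo g w rho omega x t y : in_Schottky_domain g w rho -> is_canonical_bidiff g w rho omega ->
  in_D g w rho x -> regular_set g w rho x -> spread g w rho x t -> collar_D g w rho t y -> x <> Fin y ->
  holo (fun y => omega x (Fin y)) y.
Proof.
  intros Hw Ho Hx Hxr Hs Hy Hn.
  pose proof (bidiff_holomorphic g w rho omega Ho x (Fin y) Hxr (collar_D_regular g w rho x t y Hw Hs Hy)
    (collar_D_not_equivalent g w rho x t y Hw Hs Hx Hy Hn)) as H.
  apply C_differentiable2_slice in H.
  apply (holo_ext_loc (fun v => bicoef omega (chart_at x) ChartZ (pt_coord x, v)) _ y 1); [lra| |exact H].
  intros v _. unfold bicoef. simpl fst; simpl snd. rewrite param_pt_coord, jac_pt_coord. simpl. ring.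
Qed.

Lemma in_D_regular g w rho x t : in_Schottky_domain g w rho -> spread g w rho x t -> in_D g w rho x -> regular_set g w rho x.
Proof.
  intros Hw Hs Hx. destruct x as [z|]; [|apply infinity_regular; auto].
  apply (collar_D_regular g w rho (Fin z) t z); auto. intros a Ha.
  specialize (Hx a Ha). pose proof (radius_pos _ _ _ _ Hw Ha). destruct Hs as [Ht _].
  apply Rle_lt_trans with (radius rho a); [|auto].
  apply Rmult_le_reg_r with t; [lra|]. unfold Rdiv. rewrite Rmult_assoc, Rinv_l; nra.
Qed.

(** In the coordinate v = 1/y the form f(y) dy is - f(y) dv / v^2, so holomorphy at infinity means f
    = O(y^(-2)). For x at infinity the point y = infinity is on the diagonal, and the singular part
    accounts for the constant -1. *)
Lemma omega_decay g w rho omega x t : in_Schottky_domain g w rho -> is_canonical_bidiff g w rho omega ->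
  in_D g w rho x -> spread g w rho x t ->
  exists R0 M, (0 < M)%R /\ forall y, (R0 < Cmod y)%R ->
    (Cmod (omega x (Fin y) - match x with Fin _ => 0 | Infty => -1 end) <= M / (Cmod y * Cmod y))%R.
Proof.
  intros Hw Ho Hx Hs. pose proof (in_D_regular g w rho x t Hw Hs Hx) as Hxr.
  destruct x as [z|].
  - pose proof (bidiff_holomorphic g w rho omega Ho (Fin z) Infty Hxr (infinity_regular g w rho Hw)) as H.
    assert (Hne : ~ equivalent g w rho (Fin z) Infty).
    { intros He. apply (equivalent_closed_D g w rho (Fin z) Infty Hw Hx I) in He. discriminate. }
    specialize (H Hne). apply C_differentiable2_slice, holo_bounded in H. destruct H as (d & M & Hd & HM & HB).
    exists (/ d)%R, M. split; auto. intros y Hy.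
    assert (Hdp : (0 < / d)%R) by (apply Rinv_0_lt_compat; auto).
    assert (Hyn : y <> 0) by (apply Cmod_gt_0; lra).
    assert (Hyi : / y <> 0) by (intros E; apply C1_nz; rewrite <- (Cinv_r y Hyn), E; ring).
    assert (Hv : (Cmod (/ y - pt_coord Infty) < d)%R).
    { change (pt_coord Infty) with (RtoC 0). replace (/ y - 0) with (/ y) by ring.
      rewrite Cmod_inv, <- (Rinv_inv d) by auto. apply Rinv_lt_contravar; auto.
      apply Rmult_lt_0_compat; lra. }
    specialize (HB (/ y) Hv).
    unfold bicoef in HB. simpl in HB. destruct (Ceq_dec (/ y) 0) as [|_]; [contradiction|].
    change (pt_coord (Fin z)) with z in HB.
    replace (/ / y) with y in HB by (field; auto).
    replace (omega (Fin z) (Fin y) * 1 * - / (/ y * / y)) with (- (omega (Fin z) (Fin y) * (y * y))) in HB by (field; auto).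
    rewrite Cmod_opp, !Cmod_mult in HB. replace (omega (Fin z) (Fin y) - 0) with (omega (Fin z) (Fin y)) by ring.
    assert (0 < Cmod y)%R by lra.
    apply Rmult_le_reg_r with (Cmod y * Cmod y)%R; [nra|].
    unfold Rdiv. rewrite (Rmult_assoc M), Rinv_l by nra. lra.
  - destruct (bidiff_diagonal g w rho omega Ho Infty Hxr) as (h & Hh).
    destruct Hh as [d0 Hd0].
    assert (H0 : C_differentiable2 h (RtoC 0, RtoC 0)).
    { apply (Hd0 (RtoC 0, RtoC 0)). split; apply ball_center. }
    apply C_differentiable2_slice, holo_bounded in H0. destruct H0 as (d & M & Hd & HM & HB).
    set (d1 := Rmin d d0). assert (Hd1 : (0 < d1)%R) by (apply Rmin_pos; auto; apply cond_pos).
    exists (/ d1)%R, M. split; auto. intros y Hy.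
    assert (Hdp : (0 < / d1)%R) by (apply Rinv_0_lt_compat; auto).
    assert (Hyn : y <> 0) by (apply Cmod_gt_0; lra).
    assert (Hyi : / y <> 0) by (intros E; apply C1_nz; rewrite <- (Cinv_r y Hyn), E; ring).
    assert (Hv : (Cmod (/ y - 0) < d1)%R).
    { replace (/ y - 0) with (/ y) by ring. rewrite Cmod_inv, <- (Rinv_inv d1) by auto. apply Rinv_lt_contravar; auto.
      apply Rmult_lt_0_compat; lra. }
    assert (Hvd : (Cmod (/ y - 0) < d)%R) by (eapply Rlt_le_trans; [exact Hv|apply Rmin_l]).
    assert (Hvd0 : (Cmod (/ y - 0) < d0)%R) by (eapply Rlt_le_trans; [exact Hv|apply Rmin_r]).
    specialize (HB (/ y) Hvd).
    assert (Hball : ball (M := prod_UniformSpace C_UniformSpace C_UniformSpace) (RtoC 0, RtoC 0) d0 (RtoC 0, / y)).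
    { split; [apply ball_center|]. apply ball_Cmod; exact Hvd0. }
    destruct (Hd0 (RtoC 0, / y) Hball) as [_ Heq].
    assert (Hne : fst (RtoC 0, / y) <> snd (RtoC 0, / y)) by (simpl; congruence).
    specialize (Heq Hne). unfold bicoef in Heq. simpl in Heq.
    destruct (Ceq_dec 0 0) as [_|]; [|congruence]. destruct (Ceq_dec (/ y) 0) as [|_]; [contradiction|].
    replace (/ / y) with y in Heq by (field; auto).
    assert (E : omega Infty (Fin y) - -1 = - (h (RtoC 0, / y) * / (y * y))).
    { assert (E1 : omega Infty (Fin y) = (omega Infty (Fin y) * 1 * - / (/ y * / y)) * - / (y * y)) by (field; auto).
      rewrite E1, Heq. field. auto. }
    rewrite E, Cmod_opp, Cmod_mult, Cmod_inv, Cmod_mult by (apply Cmult_neq_0; auto).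
    apply Rmult_le_compat_r; auto. left; apply Rinv_0_lt_compat.
    assert (0 < Cmod y)%R by lra. nra.
Qed.

(** Removing the double pole leaves a function holomorphic on the whole collar, whose value at y = x
    is read off the regular part [h] of the diagonal expansion. It vanishes at infinity, as
    [exterior_expansion] requires. *)
Lemma omega_regular_part g w rho omega x t : in_Schottky_domain g w rho -> is_canonical_bidiff g w rho omega ->
  in_D g w rho x -> spread g w rho x t ->
  exists F : C -> C,
    (forall y, collar_D g w rho t y -> holo F y) /\
    (forall y, x <> Fin y -> omega x (Fin y) = F y + pole x y) /\
    (forall eps, (0 < eps)%R -> exists R0, forall y, (R0 < Cmod y)%R -> (Cmod (F y) <= eps)%R).
Proof.
  intros Hw Ho Hx Hs. pose proof (in_D_regular g w rho x t Hw Hs Hx) as Hxr.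
  destruct (omega_decay g w rho omega x t Hw Ho Hx Hs) as (R0 & M & HM & Hdec).
  assert (Hsmall : forall eps, (0 < eps)%R -> exists R1, (R0 <= R1)%R /\ forall y, (R1 < Cmod y)%R -> (M / (Cmod y * Cmod y) <= eps)%R).
  { intros eps He. exists (Rmax R0 (Rmax 1 (M / eps))). split; [apply Rmax_l|]. intros y Hy.
    pose proof (Rle_lt_trans _ _ _ (Rmax_r _ _) Hy) as Hy1.
    pose proof (Rle_lt_trans _ _ _ (Rmax_l _ _) Hy1) as Hy2. pose proof (Rle_lt_trans _ _ _ (Rmax_r _ _) Hy1) as Hy3.
    apply Rmult_le_reg_r with (Cmod y * Cmod y)%R; [nra|]. unfold Rdiv at 1. rewrite Rmult_assoc, Rinv_l by nra.
    apply (Rmult_lt_compat_l eps) in Hy3; auto. replace (eps * (M / eps))%R with M in Hy3 by (field; lra).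
    assert (eps * Cmod y * 1 <= eps * Cmod y * Cmod y)%R; [|lra]. apply Rmult_le_compat_l; nra. }
  destruct x as [z|].
  - destruct (bidiff_diagonal g w rho omega Ho (Fin z) Hxr) as (h & d0 & Hd0).
    change (pt_coord (Fin z)) with z in Hd0. change (chart_at (Fin z)) with ChartZ in Hd0.
    set (F := fun y => if Ceq_dec y z then h (z, z) else omega (Fin z) (Fin y) - pole (Fin z) y).
    assert (HF : forall y, Fin z <> Fin y -> omega (Fin z) (Fin y) = F y + pole (Fin z) y).
    { intros y Hn. unfold F. destruct (Ceq_dec y z) as [->|_]; [congruence|]. ring. }
    exists F. split; [|split; [exact HF|]].
    + intros y Hy. destruct (Ceq_dec y z) as [->|Hn].
      * assert (H0 : C_differentiable2 h (z, z)).
        { apply (Hd0 (z, z)). split; apply ball_center. }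
        apply C_differentiable2_slice in H0.
        apply (holo_ext_loc (fun v => h (z, v)) _ z d0); [apply cond_pos| |exact H0].
        intros v Hv. unfold F. destruct (Ceq_dec v z) as [->|Hn]; auto.
        assert (Hball : ball (M := prod_UniformSpace C_UniformSpace C_UniformSpace) (z, z) d0 (z, v)).
        { split; [apply ball_center|]. apply ball_Cmod; exact Hv. }
        destruct (Hd0 (z, v) Hball) as [_ Heq].
        assert (Hne : fst (z, v) <> snd (z, v)) by (simpl; congruence).
        specialize (Heq Hne). unfold bicoef in Heq. simpl in Heq. simpl.
        replace (omega (Fin z) (Fin v)) with (omega (Fin z) (Fin v) * 1 * 1) by ring. rewrite Heq. ring.
      * assert (Hp : (0 < Cmod (y - z))%R) by (apply Cmod_gt_0, Cminus_eq_contra; auto).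
        apply (holo_ext_loc (fun y => omega (Fin z) (Fin y) - pole (Fin z) y) _ y (Cmod (y - z))); auto.
        -- intros y' Hy'. unfold F. destruct (Ceq_dec y' z) as [->|_]; auto.
           replace (z - y) with (- (y - z)) in Hy' by ring. rewrite Cmod_opp in Hy'. lra.
        -- apply holo_minus; [|apply holo_pole; congruence].
           apply (omega_holo g w rho omega (Fin z) t y); auto. congruence.
    + intros eps He. destruct (Hsmall (eps / 2)%R ltac:(lra)) as (R1 & HR1 & H1).
      exists (Rmax R1 (Cmod z + Rmax 1 (2 / eps))). intros y Hy.
      pose proof (Rle_lt_trans _ _ _ (Rmax_l _ _) Hy) as Hy1. pose proof (Rle_lt_trans _ _ _ (Rmax_r _ _) Hy) as Hy2.
      pose proof (Rmax_l 1 (2 / eps)) as HA. pose proof (Rmax_r 1 (2 / eps)) as HB.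
      pose proof (Cmod_minus_ge y z) as H2.
      assert (Hyz : (Rmax 1 (2 / eps) < Cmod (z - y))%R).
      { replace (z - y) with (- (y - z)) by ring. rewrite Cmod_opp. lra. }
      assert (Hn : Fin z <> Fin y).
      { intros [= E]. rewrite E in Hyz. replace (y - y) with (RtoC 0) in Hyz by ring. rewrite Cmod_0 in Hyz. lra. }
      assert (Hzy : z - y <> 0) by (apply Cminus_eq_contra; congruence).
      replace (F y) with (omega (Fin z) (Fin y) - 0 + - pole (Fin z) y) by (rewrite (HF y Hn); ring).
      eapply Rle_trans; [apply Cmod_triangle|]. rewrite Cmod_opp.
      specialize (Hdec y ltac:(lra)). specialize (H1 y Hy1).
      enough (Cmod (pole (Fin z) y) <= eps / 2)%R by lra.
      simpl. rewrite Cmod_inv, Cmod_mult by (apply Cmult_neq_0; auto).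
      set (m := Cmod (z - y)) in *. apply Rmult_le_reg_r with (m * m)%R; [nra|]. rewrite Rinv_l by nra.
      assert (H3 : (eps * (2 / eps) <= eps * m)%R) by (apply Rmult_le_compat_l; lra).
      replace (eps * (2 / eps))%R with 2%R in H3 by (field; lra). nra.
  - exists (fun y => omega Infty (Fin y) - -1). split; [|split].
    + intros y Hy. apply holo_minus; [|apply holo_const]. apply (omega_holo g w rho omega Infty t y); auto. discriminate.
    + intros y _. simpl. ring.
    + intros eps He. destruct (Hsmall eps He) as (R1 & HR1 & H1). exists R1. intros y Hy.
      eapply Rle_trans; [apply Hdec; lra|apply H1; auto].
Qed.

(** [bidiff_invariant] concerns the first variable, so symmetry is used before and after it. The
    circles lie in the collar, which makes their points regular and not equivalent to x. *)
Lemma omega_invariant g w rho omega x a y : in_Schottky_domain g w rho -> is_canonical_bidiff g w rho omega ->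
  in_D g w rho x -> is_letter g a -> Cmod (y - w a) = radius rho a ->
  omega x (Fin (w (- a)%Z + rho a / (y - w a))) * (- rho a / ((y - w a) * (y - w a))) = omega x (Fin y).
Proof.
  intros Hw Ho Hx Ha Hy. pose proof (radius_pos _ _ _ _ Hw Ha) as Hr.
  destruct (exists_spread g w rho x Hw Hx) as (t & Hs). pose proof Hs as (Ht & Hd & Hxt).
  assert (Hyn : y - w a <> 0) by (apply Cmod_gt_0; lra).
  assert (Hclosed : forall b v, is_letter g b -> Cmod (v - w b) = radius rho b -> closed_D g w rho (Fin v)).
  { intros b v Hb Hv c Hc. destruct (Z.eq_dec c b) as [->|Hn]; [lra|].
    pose proof (proj2 Hw c b Hc Hb Hn) as H1. pose proof (Cmod_minus_ge (w c - w b) (v - w b)) as H2.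
    replace (w c - w b - (v - w b)) with (- (v - w c)) in H2 by ring. rewrite Cmod_opp in H2. lra. }
  assert (Hcollar : forall b v, is_letter g b -> Cmod (v - w b) = radius rho b -> collar_D g w rho t v).
  { intros b v Hb Hv c Hc. specialize (Hclosed b v Hb Hv c Hc). pose proof (radius_pos _ _ _ _ Hw Hc).
    eapply Rlt_le_trans; [|exact Hclosed]. apply Rmult_lt_reg_r with t; [lra|]. unfold Rdiv.
    rewrite Rmult_assoc, Rinv_l by lra. nra. }
  assert (Hne : forall b v, is_letter g b -> Cmod (v - w b) = radius rho b -> ~ equivalent g w rho x (Fin v)).
  { intros b v Hb Hv He. pose proof (equivalent_closed_D g w rho x (Fin v) Hw Hx (Hclosed b v Hb Hv) He) as E.
    subst x. specialize (Hx b Hb). lra. }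
  set (y' := w (- a)%Z + rho a / (y - w a)).
  assert (Hy' : Cmod (y' - w (- a)%Z) = radius rho (- a)).
  { unfold y'. replace (w (- a)%Z + rho a / (y - w a) - w (- a)%Z) with (rho a / (y - w a)) by ring.
    rewrite Cmod_div, Hy, <- radius_sqr, (radius_opp _ _ _ _ Hw Ha) by auto. field; lra. }
  assert (Ha' := letter_opp _ _ Ha).
  pose proof (in_D_regular g w rho x t Hw Hs Hx) as Hxr.
  pose proof (collar_D_regular g w rho x t y Hw Hs (Hcollar a y Ha Hy)) as Hyr.
  pose proof (collar_D_regular g w rho x t y' Hw Hs (Hcollar (- a)%Z y' Ha' Hy')) as Hyr'.
  assert (Hgen : schottky_gen w rho a (Fin y) = Fin y').
  { simpl. destruct (Ceq_dec y (w a)) as [E|_]; auto. exfalso; apply Hyn. rewrite E; ring. }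
  rewrite (bidiff_sym g w rho omega Ho x (Fin y')) by (auto; apply (Hne (- a)%Z); auto).
  rewrite (bidiff_sym g w rho omega Ho x (Fin y)) by (auto; apply (Hne a); auto).
  rewrite <- Hgen. apply (bidiff_invariant g w rho omega Ho); auto.
  - apply group_gen; auto.
  - intros He. apply (Hne a y Ha Hy). apply equivalent_sym; auto.
  - unfold is_derive_hat. rewrite Hgen. apply cderiv_is_derive.
    apply (cderiv_ext_loc (fun u => w (- a)%Z + rho a * / (u - w a)) _ _ _ (radius rho a)); auto.
    + intros u Hu. change (pt_coord (Fin y)) with y in Hu. simpl.
      destruct (Ceq_dec u (w a)) as [->|_]; [|reflexivity].
      replace (w a - y) with (- (y - w a)) in Hu by ring. rewrite Cmod_opp in Hu. lra.
    + change (pt_coord (Fin y)) with y.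
      apply (cderiv_eq _ _ (0 + rho a * (- / ((y - w a) * (y - w a)) * (1 - 0)))); [field; auto|].
      apply cderiv_plus; [apply cderiv_const|]. apply cderiv_scal.
      apply (cderiv_comp (fun u => / u) (fun u => u - w a)); [apply cderiv_inv; auto|].
      apply cderiv_minus; [apply cderiv_id|apply cderiv_const].
Qed.

(** * Moments over the circles *)

Lemma Cseries_delta (u : nat -> C) m : (forall k, k <> m -> u k = 0) -> Cseries u = u m.
Proof.
  intros H. apply Cseries_unique. intros eps He. exists (S m). intros N HN.
  assert (E : csumn N u = u m).
  { apply (csum_single (seq 0 N) m u); [apply seq_NoDup|apply in_seq; lia|]. intros; auto. }
  rewrite E. replace (u m - u m) with (RtoC 0) by ring. rewrite Cmod_0; auto.
Qed.

Lemma mean_monomial k m r : (0 < r)%R -> mean (fun u => u ^ k * / u ^ m) r = if Nat.eq_dec k m then 1 else 0.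
Proof.
  intros Hr. destruct (Nat.eq_dec k m) as [->|Hn].
  - rewrite <- (mean_const 1 r) at 1. apply mean_ext; [lra|]. intros u Hu.
    pose proof (Cmod_r_nz r u Hr Hu). field. apply Cpow_nz; auto.
  - destruct (Nat.lt_ge_cases k m) as [Hlt|Hge].
    + rewrite <- (mean_pow_inv (m - k - 1) r Hr). apply mean_ext; [lra|]. intros u Hu.
      pose proof (Cmod_r_nz r u Hr Hu). replace m with (k + S (m - k - 1))%nat at 1 by lia.
      rewrite Cpow_add_r. field. split; apply Cpow_nz; auto.
    + rewrite <- (mean_pow (k - m - 1) r ltac:(lra)). apply mean_ext; [lra|]. intros u Hu.
      pose proof (Cmod_r_nz r u Hr Hu). replace k with (m + S (k - m - 1))%nat at 1 by lia.
      rewrite Cpow_add_r. field. apply Cpow_nz; auto.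
Qed.

Lemma mean_csum {T} (l : list T) (F : T -> C -> C) r : (0 <= r)%R -> (forall i, In i l -> circ_cont (F i) r) ->
  circ_cont (fun u => csum l (fun i => F i u)) r /\
  mean (fun u => csum l (fun i => F i u)) r = csum l (fun i => mean (F i) r).
Proof.
  intros Hr. induction l as [|i l IH]; intros H; simpl.
  - split; [apply circ_cont_const|apply mean_const].
  - destruct IH as [H1 H2]; [intros; apply H; right; auto|].
    assert (Hi : circ_cont (F i) r) by (apply H; left; auto).
    split; [apply circ_cont_plus; auto|]. rewrite mean_plus, H2; auto.
Qed.

Lemma mean_series_weight (v : nat -> C -> C) (W : C -> C) r t M : (0 <= r)%R -> (0 <= t < 1)%R ->
  (forall n, circ_cont (v n) r) -> circ_cont W r -> (forall z, Cmod z = r -> geo t M (fun n => v n z)) ->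
  mean (fun z => Cseries (fun n => v n z) * W z) r = Cseries (fun n => mean (fun z => v n z * W z) r).
Proof.
  intros Hr Ht Hv HW Hg. destruct (circ_bounded W r Hr HW) as (K & HK & HWK).
  rewrite <- (mean_series (fun n z => v n z * W z) r t (M * K)); auto.
  - apply mean_ext; auto. intros u Hu. rewrite Cmult_comm, <- (Cseries_scal t M); auto.
    apply Cseries_ext; intros; ring.
  - intros n. apply circ_cont_mult; auto.
  - intros z Hz n. replace (M * K * t ^ n)%R with (M * t ^ n * K)%R by ring.
    apply Cmod_mult_le; [apply Hg; auto|apply HWK; auto].
Qed.

Lemma mean_pser a rho M r m : (0 < r < rho)%R -> geo (/ rho) M a ->
  mean (fun u => pser a u * / u ^ m) r = a m.
Proof.
  intros Hr Ha. unfold pser.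
  rewrite (mean_series_weight (fun n u => a n * u ^ n) _ r (r / rho) M); try lra.
  - rewrite (Cseries_delta _ m).
    + rewrite (mean_ext _ (fun u => a m * (u ^ m * / u ^ m))) by (try lra; intros; ring).
      rewrite mean_scal, mean_monomial by first [lra | apply circ_cont_mult; [apply circ_cont_pow|apply circ_cont_pow_inv; lra]].
      destruct (Nat.eq_dec m m); [ring|congruence].
    + intros k Hk. rewrite (mean_ext _ (fun u => a k * (u ^ k * / u ^ m))) by (try lra; intros; ring).
      rewrite mean_scal, mean_monomial by first [lra | apply circ_cont_mult; [apply circ_cont_pow|apply circ_cont_pow_inv; lra]].
      destruct (Nat.eq_dec k m); [congruence|ring].
  - split; [apply Rmult_le_pos; [lra|left; apply Rinv_0_lt_compat; lra]|].
    apply Rmult_lt_reg_r with rho; [lra|]. unfold Rdiv; rewrite Rmult_assoc, Rinv_l; lra.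
  - intros n. apply circ_cont_scal, circ_cont_pow.
  - apply circ_cont_pow_inv; lra.
  - intros u Hu k. rewrite Cmod_mult, Cmod_pow, Hu. unfold Rdiv. rewrite Rpow_mult_distr.
    replace (M * (r ^ k * (/ rho) ^ k))%R with (M * (/ rho) ^ k * r ^ k)%R by ring.
    apply Rmult_le_compat_r; [apply pow_le; lra|apply Ha].
Qed.

Lemma mean_pser_pos a rho M r p : (0 < r < rho)%R -> geo (/ rho) M a ->
  mean (fun u => pser a u * u ^ S p) r = 0.
Proof.
  intros Hr Ha. unfold pser.
  rewrite (mean_series_weight (fun n u => a n * u ^ n) _ r (r / rho) M); try lra.
  - apply Cseries_0. intros k. rewrite (mean_ext _ (fun u => a k * u ^ S (k + p))); try lra.
    + rewrite mean_scal, mean_pow by (try lra; apply circ_cont_pow). ring.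
    + intros u _. replace (S (k + p)) with (k + S p)%nat by lia. rewrite Cpow_add_r. ring.
  - split; [apply Rmult_le_pos; [lra|left; apply Rinv_0_lt_compat; lra]|].
    apply Rmult_lt_reg_r with rho; [lra|]. unfold Rdiv; rewrite Rmult_assoc, Rinv_l; lra.
  - intros n. apply circ_cont_scal, circ_cont_pow.
  - apply circ_cont_pow.
  - intros u Hu k. rewrite Cmod_mult, Cmod_pow, Hu. unfold Rdiv. rewrite Rpow_mult_distr.
    replace (M * (r ^ k * (/ rho) ^ k))%R with (M * (/ rho) ^ k * r ^ k)%R by ring.
    apply Rmult_le_compat_r; [apply pow_le; lra|apply Ha].
Qed.

(** The coefficient of u^k in (D + u)^(-l-1); as in [nser], the index l is one less than the
    exponent. *)
Definition taylor_inv (D : C) (l k : nat) : C := RtoC ((-1) ^ k * nb l k) * / D ^ (S l + k).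

Lemma taylor_inv_pser D l r : (0 < r < Cmod D)%R ->
  exists rho M, (r < rho)%R /\ geo (/ rho) M (taylor_inv D l) /\
    forall u, Cmod u = r -> / (D + u) ^ S l = pser (taylor_inv D l) u.
Proof.
  intros Hr. assert (HD : D <> 0) by (apply Cmod_gt_0; lra).
  set (rho := ((r + Cmod D) / 2)%R). assert (Hrho : (r < rho < Cmod D)%R) by (unfold rho; lra).
  assert (Hy : (0 <= rho / Cmod D < 1)%R).
  { split; [apply Rmult_le_pos; [lra|left; apply Rinv_0_lt_compat; lra]|].
    apply Rmult_lt_reg_r with (Cmod D); [lra|]. unfold Rdiv; rewrite Rmult_assoc, Rinv_l; lra. }
  destruct (nb_geo l _ Hy) as [Hq Hnb]. set (q := (2 * (rho / Cmod D) / (1 + rho / Cmod D))%R) in *.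
  set (K := ((2 / (1 - rho / Cmod D)) ^ S l)%R) in *.
  exists rho, (K / Cmod D ^ S l)%R. split; [lra|split].
  - intros k. unfold taylor_inv. rewrite Cmod_mult, Cmod_R, Cmod_inv, Cmod_pow by (apply Cpow_nz; auto).
    rewrite Rabs_mult, pow_1_abs, Rmult_1_l.
    rewrite Rabs_pos_eq by (left; apply nb_pos). rewrite pow_add, pow_inv.
    assert (HDp : (0 < Cmod D ^ S l)%R) by (apply pow_lt; lra).
    assert (HDk : (0 < Cmod D ^ k)%R) by (apply pow_lt; lra).
    assert (Hrk : (0 < rho ^ k)%R) by (apply pow_lt; lra).
    specialize (Hnb k). unfold Rdiv in Hnb at 1. rewrite Rpow_mult_distr, pow_inv in Hnb.
    assert (HK : (0 < K)%R) by (apply pow_lt, Rdiv_lt_0_compat; lra).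
    assert (Hqk : (q ^ k <= 1)%R) by (rewrite <- (pow1 k); apply pow_incr; lra).
    apply Rmult_le_reg_r with (rho ^ k * Cmod D ^ S l)%R; [apply Rmult_lt_0_compat; auto|].
    replace (nb l k * / (Cmod D ^ S l * Cmod D ^ k) * (rho ^ k * Cmod D ^ S l))%R
      with (nb l k * (rho ^ k * / Cmod D ^ k))%R by (field; split; lra).
    replace (K / Cmod D ^ S l * / rho ^ k * (rho ^ k * Cmod D ^ S l))%R with K by (field; split; lra).
    eapply Rle_trans; [exact Hnb|]. rewrite <- (Rmult_1_r K) at 2. apply Rmult_le_compat_l; lra.
  - intros u Hu. assert (Hx : (Cmod (- u / D) < 1)%R).
    { rewrite Cmod_div, Cmod_opp, Hu by auto. apply Rmult_lt_reg_r with (Cmod D); [lra|].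
      unfold Rdiv; rewrite Rmult_assoc, Rinv_l; lra. }
    destruct (nb_geo_C l _ Hx) as (t & M & Ht & Hg).
    replace (/ (D + u) ^ S l) with (/ D ^ S l * / (1 - - u / D) ^ S l).
    2:{ assert (E : D + u = D * (1 - - u / D)) by (field; auto). rewrite E, Cpow_mult_l.
        field. split; apply Cpow_nz; auto. apply C1_minus_nz; auto. }
    rewrite <- neg_binomial, <- (Cseries_scal t M) by auto. unfold pser. apply Cseries_ext. intros k.
    unfold taylor_inv. rewrite Cpow_add_r, RtoC_mult, RtoC_pow.
    replace (- u / D) with (RtoC (-1) * u * / D) by (unfold Cdiv; ring).
    rewrite !Cpow_mult_l, Cpow_inv by auto. field. split; apply Cpow_nz; auto.
Qed.

Lemma taylor_inv_nz D u r : (0 < r < Cmod D)%R -> Cmod u = r -> D + u <> 0.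
Proof.
  intros Hr Hu E. assert (E' : D = - u) by (rewrite <- (Cplus_0_r D), <- (Cplus_opp_r u), Cplus_assoc, E; ring).
  rewrite E', Cmod_opp in Hr. lra.
Qed.

Lemma mean_inv_shift D l r m : (0 < r < Cmod D)%R ->
  mean (fun u => / (D + u) ^ S l * / u ^ m) r = taylor_inv D l m.
Proof.
  intros Hr. destruct (taylor_inv_pser D l r Hr) as (rho & M & Hrho & Hg & E).
  rewrite <- (mean_pser (taylor_inv D l) rho M r m) by (auto; lra).
  apply mean_ext; [lra|]. intros u Hu. rewrite E; auto.
Qed.

Lemma mean_inv_shift_pos D l r p : (0 < r < Cmod D)%R ->
  mean (fun u => / (D + u) ^ S l * u ^ S p) r = 0.
Proof.
  intros Hr. destruct (taylor_inv_pser D l r Hr) as (rho & M & Hrho & Hg & E).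
  rewrite <- (mean_pser_pos (taylor_inv D l) rho M r p) by (auto; lra).
  apply mean_ext; [lra|]. intros u Hu. rewrite E; auto.
Qed.

Lemma mean_nser c rho rho' M D r W : (0 < rho < rho')%R -> (0 <= r)%R -> geo rho M c ->
  (forall u, Cmod u = r -> (rho' <= Cmod (D + u))%R) -> circ_cont W r ->
  circ_cont (fun u => nser c (D + u)) r /\
  mean (fun u => nser c (D + u) * W u) r = Cseries (fun l => c l * mean (fun u => / (D + u) ^ S l * W u) r).
Proof.
  intros Hrho Hr Hc HD HW. assert (Hn : forall u, Cmod u = r -> D + u <> 0).
  { intros u Hu. apply Cmod_gt_0. specialize (HD u Hu). lra. }
  assert (Hsh : forall u, holo (fun u => D + u) u).
  { intros u. apply holo_plus; [apply holo_const|eexists; apply cderiv_id]. }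
  assert (Hi : forall l, circ_cont (fun u => / (D + u) ^ S l) r).
  { intros l. apply holo_circ. intros u Hu. apply (holo_comp (fun v => / v ^ S l) (fun u => D + u)); auto.
    apply holo_pow_inv; auto. }
  split.
  - apply holo_circ. intros u Hu. apply (holo_comp (nser c) (fun u => D + u)); auto.
    apply (holo_nser c rho M); [lra|auto|]. specialize (HD u Hu). lra.
  - unfold nser. rewrite (mean_series_weight (fun l u => c l * / (D + u) ^ S l) W r (rho / rho') (M / rho')); auto.
    + apply Cseries_ext. intros l.
      rewrite <- mean_scal; auto; [|apply circ_cont_mult; auto]. apply mean_ext; auto. intros; ring.
    + split; [apply Rmult_le_pos; [lra|left; apply Rinv_0_lt_compat; lra]|].
      apply Rmult_lt_reg_r with rho'; [lra|]. unfold Rdiv; rewrite Rmult_assoc, Rinv_l; lra.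
    + intros l. apply circ_cont_scal; auto.
    + intros u Hu k. specialize (HD u Hu).
      rewrite Cmod_mult, Cmod_inv, Cmod_pow by (apply Cpow_nz; auto).
      replace (M / rho' * (rho / rho') ^ k)%R with (M * rho ^ k * / rho' ^ S k)%R.
      2:{ unfold Rdiv. rewrite Rpow_mult_distr, pow_inv. simpl. field. split; [apply pow_nonzero|]; lra. }
      apply Rmult_le_compat; [apply Cmod_ge_0| |apply Hc|].
      * left; apply Rinv_0_lt_compat, pow_lt; lra.
      * apply Rinv_le_contravar; [apply pow_lt; lra|]. apply pow_incr; lra.
Qed.

Lemma mean_nser_self c rho M r k : (0 < rho < r)%R -> geo rho M c ->
  mean (fun u => nser c u * u ^ S k) r = c k.
Proof.
  intros Hr Hc.
  destruct (mean_nser c rho r M 0 r (fun u => u ^ S k) Hr ltac:(lra) Hc) as [_ E].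
  - intros u Hu. rewrite Cplus_0_l. lra.
  - apply circ_cont_pow.
  - rewrite (mean_ext _ (fun u => nser c (0 + u) * u ^ S k)) by (try lra; intros; rewrite Cplus_0_l; auto).
    rewrite E, (Cseries_delta _ k).
    + rewrite (mean_ext _ (fun u => u ^ S k * / u ^ S k)), mean_monomial by (try lra; intros; rewrite Cplus_0_l; ring).
      destruct (Nat.eq_dec _ _); [ring|congruence].
    + intros l Hl.
      rewrite (mean_ext _ (fun u => u ^ S k * / u ^ S l)), mean_monomial by (try lra; intros; rewrite Cplus_0_l; ring).
      destruct (Nat.eq_dec _ _); [congruence|ring].
Qed.

Lemma mean_nser_self_neg c rho M r m : (0 < rho < r)%R -> geo rho M c ->
  mean (fun u => nser c u * / u ^ m) r = 0.
Proof.
  intros Hr Hc.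
  destruct (mean_nser c rho r M 0 r (fun u => / u ^ m) Hr ltac:(lra) Hc) as [_ E].
  - intros u Hu. rewrite Cplus_0_l. lra.
  - apply circ_cont_pow_inv; lra.
  - rewrite (mean_ext _ (fun u => nser c (0 + u) * / u ^ m)) by (try lra; intros; rewrite Cplus_0_l; auto).
    rewrite E. apply Cseries_0. intros l.
    rewrite (mean_ext _ (fun u => / u ^ S (l + m))), mean_pow_inv; try lra; [ring|].
    intros u Hu. rewrite Cplus_0_l. pose proof (Cmod_r_nz r u ltac:(lra) Hu).
    replace (S (l + m)) with (S l + m)%nat by lia. rewrite Cpow_add_r. field. split; apply Cpow_nz; auto.
Qed.

Definition expansion (g : nat) (w rho : Z -> C) (omega : Chat -> Chat -> C) (x : Chat) (t : R)
    (c : Z -> nat -> C) (M : Z -> R) : Prop :=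
  (forall a, is_letter g a -> geo (radius rho a / t) (M a) (c a)) /\
  (forall y, collar_D g w rho t y -> x <> Fin y ->
     omega x (Fin y) = csum (letters g) (fun a => nser (c a) (y - w a)) + pole x y).

Lemma div_lt_self r t : (0 < r)%R -> (1 < t)%R -> (0 < r / t < r)%R.
Proof.
  intros Hr Ht. split; [apply Rdiv_lt_0_compat; lra|].
  apply Rmult_lt_reg_r with t; [lra|]. unfold Rdiv. rewrite Rmult_assoc, Rinv_l by lra. nra.
Qed.

Lemma spread_smaller g w rho x t t1 : in_Schottky_domain g w rho -> spread g w rho x t -> (1 < t1 <= t)%R -> spread g w rho x t1.
Proof.
  intros Hw (Ht & H1 & H2) Hle. split; [lra|split].
  - intros a b Ha Hb Hn. specialize (H1 a b Ha Hb Hn).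
    pose proof (radius_pos _ _ _ _ Hw Ha); pose proof (radius_pos _ _ _ _ Hw Hb). nra.
  - intros z a E Ha. specialize (H2 z a E Ha). pose proof (radius_pos _ _ _ _ Hw Ha). nra.
Qed.

(** Because t1 < t, the closed annulus between radius / t1 and the radius of each circle lies in the
    collar for t, where the regular part is holomorphic. *)
Lemma omega_expansion g w rho omega x t t1 : in_Schottky_domain g w rho -> is_canonical_bidiff g w rho omega ->
  in_D g w rho x -> spread g w rho x t -> (1 < t1 < t)%R ->
  exists c M, expansion g w rho omega x t1 c M.
Proof.
  intros Hw Ho Hx Hs Ht1. pose proof Hs as (Ht & Hd & _).
  destruct (omega_regular_part g w rho omega x t Hw Ho Hx Hs) as (F & HF & HFx & HF0).
  destruct (exterior_expansion w (fun a => radius rho a / t1)%R (radius rho) (letters g) F) as (c & M & Hc & HE); auto.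
  - apply NoDup_letters.
  - intros a Ha. apply In_letters in Ha. apply div_lt_self; [apply (radius_pos g w); auto|lra].
  - intros a b Ha Hb Hn. apply In_letters in Ha, Hb. specialize (Hd a b Ha Hb Hn).
    pose proof (radius_pos _ _ _ _ Hw Ha); pose proof (radius_pos _ _ _ _ Hw Hb). nra.
  - intros y Hy. apply HF. intros a Ha. eapply Rlt_le_trans; [|apply Hy, In_letters; auto].
    apply Rmult_lt_compat_l; [apply (radius_pos g w); auto|]. apply Rinv_lt_contravar; nra.
  - exists c, M. split; [intros; apply Hc, In_letters; auto|].
    intros y Hy Hn. rewrite HFx, HE; auto. intros a Ha. apply Hy, In_letters; auto.
Qed.

(** The Taylor coefficients of [pole x] at v. For finite x = z one writes 1 / (z - v - u)^2 = 1 /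
    ((v - z) + u)^2. *)
Definition pole_taylor (x : Chat) (v : C) (m : nat) : C :=
  match x with
  | Fin z => taylor_inv (v - z) 1 m
  | Infty => if Nat.eq_dec m 0 then -1 else 0
  end.

Lemma pole_moment x v r m : (0 < r)%R -> (forall z, x = Fin z -> (r < Cmod (z - v))%R) ->
  mean (fun u => pole x (v + u) * / u ^ m) r = pole_taylor x v m.
Proof.
  intros Hr Hx. destruct x as [z|]; simpl.
  - specialize (Hx z eq_refl). replace (z - v) with (- (v - z)) in Hx by ring. rewrite Cmod_opp in Hx.
    rewrite <- (mean_inv_shift (v - z) 1 r m) by lra. apply mean_ext; [lra|]. intros u Hu. do 2 f_equal. simpl. ring.
  - rewrite mean_scal by (try lra; apply circ_cont_pow_inv; auto).
    rewrite (mean_ext _ (fun u => u ^ 0 * / u ^ m)), mean_monomial by (try lra; intros; simpl; ring).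
    destruct (Nat.eq_dec 0 m), (Nat.eq_dec m 0); try congruence; ring.
Qed.

Lemma pole_moment_pos x v r p : (0 < r)%R -> (forall z, x = Fin z -> (r < Cmod (z - v))%R) ->
  mean (fun u => pole x (v + u) * u ^ S p) r = 0.
Proof.
  intros Hr Hx. destruct x as [z|]; simpl pole.
  - specialize (Hx z eq_refl). replace (z - v) with (- (v - z)) in Hx by ring. rewrite Cmod_opp in Hx.
    rewrite <- (mean_inv_shift_pos (v - z) 1 r p) by lra. apply mean_ext; [lra|]. intros u Hu. do 2 f_equal. simpl. ring.
  - rewrite mean_scal, mean_pow by (try lra; apply circ_cont_pow). ring.
Qed.

Lemma circle_collar g w rho x t a u : in_Schottky_domain g w rho -> spread g w rho x t -> is_letter g a ->
  Cmod u = radius rho a ->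
  collar_D g w rho t (w a + u) /\ x <> Fin (w a + u) /\
  forall b, is_letter g b -> b <> a -> (t * radius rho b <= Cmod (w a - w b + u))%R.
Proof.
  intros Hw (Ht & Hd & Hx) Ha Hu. pose proof (radius_pos _ _ _ _ Hw Ha) as Hr.
  assert (Hb : forall b, is_letter g b -> b <> a -> (t * radius rho b <= Cmod (w a - w b + u))%R).
  { intros b Hb Hn. specialize (Hd a b Ha Hb ltac:(congruence)). pose proof (Cmod_minus_ge (w a - w b) (- u)) as H.
    rewrite Cmod_opp in H. replace (w a - w b - - u) with (w a - w b + u) in H by ring. nra. }
  split; [|split; auto].
  - intros b Hb'. pose proof (radius_pos _ _ _ _ Hw Hb') as Hrb. pose proof (div_lt_self _ t Hrb Ht).
    destruct (Z.eq_dec b a) as [->|Hn].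
    + replace (w a + u - w a) with u by ring. lra.
    + specialize (Hb b Hb' Hn). replace (w a + u - w b) with (w a - w b + u) by ring. nra.
  - intros E. specialize (Hx _ a E Ha). replace (w a + u - w a) with u in Hx by ring. nra.
Qed.

(** Termwise integration of the expansion over C_a against a weight. The tail at a itself is kept
    apart, since positive and negative powers as weights treat it in opposite ways. *)
Lemma circle_moment g w rho omega x t c M a W : in_Schottky_domain g w rho -> is_canonical_bidiff g w rho omega ->
  in_D g w rho x -> spread g w rho x t ->
  expansion g w rho omega x t c M -> is_letter g a -> circ_cont W (radius rho a) ->
  circ_cont (fun u => omega x (Fin (w a + u))) (radius rho a) /\
  mean (fun u => omega x (Fin (w a + u)) * W u) (radius rho a) =
    mean (fun u => nser (c a) u * W u) (radius rho a)
    + csum (letters g) (fun b => if Z.eq_dec b a then 0 else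
        Cseries (fun l => c b l * mean (fun u => / (w a - w b + u) ^ S l * W u) (radius rho a)))
    + mean (fun u => pole x (w a + u) * W u) (radius rho a).
Proof.
  intros Hw Ho Hx Hs (Hc & HE) Ha HW. pose proof Hs as (Ht & _ & _). pose proof (radius_pos _ _ _ _ Hw Ha) as Hr.
  assert (Hcirc := fun u Hu => circle_collar g w rho x t a u Hw Hs Ha Hu).
  assert (Hsh : forall v u, holo (fun u => v + u) u).
  { intros v u. apply holo_plus; [apply holo_const|eexists; apply cderiv_id]. }
  assert (Hpole : circ_cont (fun u => pole x (w a + u)) (radius rho a)).
  { apply holo_circ. intros u Hu. apply (holo_comp (pole x) (fun u => w a + u)); auto. apply holo_pole, Hcirc; auto. }
  assert (Hself : circ_cont (nser (c a)) (radius rho a)).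
  { apply holo_circ. intros u Hu. pose proof (div_lt_self _ t Hr Ht). apply (holo_nser _ (radius rho a / t) (M a)); auto; lra. }
  assert (Hb : forall b, is_letter g b -> b <> a ->
     circ_cont (fun u => nser (c b) (w a - w b + u)) (radius rho a) /\
     mean (fun u => nser (c b) (w a - w b + u) * W u) (radius rho a) =
     Cseries (fun l => c b l * mean (fun u => / (w a - w b + u) ^ S l * W u) (radius rho a))).
  { intros b Hb Hn. pose proof (radius_pos _ _ _ _ Hw Hb) as Hrb. pose proof (div_lt_self _ t Hrb Ht).
    apply (mean_nser (c b) (radius rho b / t) (t * radius rho b) (M b)); auto; try lra; [nra|].
    intros u Hu. apply Hcirc; auto. }
  set (P := fun b u => if Z.eq_dec b a then nser (c a) u else nser (c b) (w a - w b + u)).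
  assert (HP : forall b, In b (letters g) -> circ_cont (P b) (radius rho a)).
  { intros b Hb'. apply In_letters in Hb'. unfold P. destruct (Z.eq_dec b a); [exact Hself|apply Hb; auto]. }
  assert (HPW : forall b, In b (letters g) -> circ_cont (fun u => P b u * W u) (radius rho a)).
  { intros; apply circ_cont_mult; auto. }
  assert (HEc : forall u, Cmod u = radius rho a -> omega x (Fin (w a + u)) = csum (letters g) (fun b => P b u) + pole x (w a + u)).
  { intros u Hu. destruct (Hcirc u Hu) as (H1 & H2 & _). rewrite HE; auto. f_equal. apply csum_ext; intros b _.
    unfold P. destruct (Z.eq_dec b a) as [->|]; f_equal; ring. }
  destruct (mean_csum (letters g) P (radius rho a) ltac:(lra) HP) as [HPc _].
  destruct (mean_csum (letters g) (fun b u => P b u * W u) (radius rho a) ltac:(lra) HPW) as [HPWc HPWm].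
  split.
  - apply holo_circ. intros u Hu. destruct (Hcirc u Hu) as (H1 & H2 & _).
    apply (holo_comp (fun y => omega x (Fin y)) (fun u => w a + u)); auto.
    apply (omega_holo g w rho omega x t); auto. apply (in_D_regular g w rho x t); auto.
  - rewrite (mean_ext _ (fun u => csum (letters g) (fun b => P b u * W u) + pole x (w a + u) * W u)).
    + rewrite mean_plus, HPWm; auto; [|lra|apply circ_cont_mult; auto]. f_equal.
      pose proof (csum_single (letters g) a (fun b => if Z.eq_dec b a then mean (fun u => nser (c a) u * W u) (radius rho a) else 0)) as Hsg.
      cbv beta in Hsg. destruct (Z.eq_dec a a) as [_|]; [|congruence]. rewrite <- Hsg.
      2: apply NoDup_letters. 2: apply In_letters; auto.
      2:{ intros b _ Hn. destruct (Z.eq_dec b a); [contradiction|auto]. }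
      rewrite <- csum_plus. apply csum_ext. intros b Hb'. apply In_letters in Hb'. unfold P.
      destruct (Z.eq_dec b a) as [->|Hn]; [ring|]. rewrite (proj2 (Hb b Hb' Hn)). ring.
    + lra.
    + intros u Hu. rewrite HEc, csum_scal_r; auto. ring.
Qed.

Lemma spread_far g w rho x t a z : in_Schottky_domain g w rho -> spread g w rho x t -> is_letter g a ->
  x = Fin z -> (radius rho a < Cmod (z - w a))%R.
Proof.
  intros Hw (Ht & _ & Hx) Ha E. specialize (Hx z a E Ha). pose proof (radius_pos _ _ _ _ Hw Ha). nra.
Qed.

Lemma spread_apart g w rho x t a b : in_Schottky_domain g w rho -> spread g w rho x t -> is_letter g a ->
  is_letter g b -> b <> a -> (0 < radius rho a < Cmod (w a - w b))%R.
Proof.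
  intros Hw (Ht & Hd & _) Ha Hb Hn. specialize (Hd a b Ha Hb ltac:(congruence)).
  pose proof (radius_pos _ _ _ _ Hw Ha). pose proof (radius_pos _ _ _ _ Hw Hb). nra.
Qed.

(** Against a positive power, every part holomorphic inside C_a has mean zero; only the tail at a
    remains. *)
Lemma moment_pos g w rho omega x t c M a k : in_Schottky_domain g w rho -> is_canonical_bidiff g w rho omega ->
  in_D g w rho x -> spread g w rho x t -> expansion g w rho omega x t c M -> is_letter g a ->
  mean (fun u => omega x (Fin (w a + u)) * u ^ S k) (radius rho a) = c a k.
Proof.
  intros Hw Ho Hx Hs HE Ha. pose proof (radius_pos _ _ _ _ Hw Ha) as Hr. pose proof Hs as (Ht & _ & _).
  pose proof (div_lt_self _ t Hr Ht) as Hrt.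
  rewrite (proj2 (circle_moment g w rho omega x t c M a (fun u => u ^ S k) Hw Ho Hx Hs HE Ha (circ_cont_pow _ _))).
  rewrite (mean_nser_self (c a) (radius rho a / t) (M a)), pole_moment_pos; auto.
  - rewrite csum_0; [ring|]. intros b Hb. apply In_letters in Hb. destruct (Z.eq_dec b a) as [|Hn]; auto.
    apply Cseries_0. intros l. rewrite mean_inv_shift_pos; [ring|]. apply (spread_apart g w rho x t); auto.
  - intros z E. apply (spread_far g w rho x t); auto.
  - apply HE; auto.
Qed.

(** The m-th Taylor coefficient at w_a of omega(x, .) minus its own tail at a: the other tails and
    the pole are holomorphic inside C_a. *)
Definition taylor_moment g w (c : Z -> nat -> C) x (a : Z) (m : nat) : C :=
  csum (letters g) (fun b => if Z.eq_dec b a then 0 else Cseries (fun l => c b l * taylor_inv (w a - w b) l m))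
  + pole_taylor x (w a) m.

(** Dividing by u^m makes the mean of the tail at a vanish, and extracts the Taylor coefficients of
    the other parts. *)
Lemma moment_neg g w rho omega x t c M a m : in_Schottky_domain g w rho -> is_canonical_bidiff g w rho omega ->
  in_D g w rho x -> spread g w rho x t -> expansion g w rho omega x t c M -> is_letter g a ->
  mean (fun u => omega x (Fin (w a + u)) * / u ^ m) (radius rho a) = taylor_moment g w c x a m.
Proof.
  intros Hw Ho Hx Hs HE Ha. pose proof (radius_pos _ _ _ _ Hw Ha) as Hr. pose proof Hs as (Ht & _ & _).
  pose proof (div_lt_self _ t Hr Ht) as Hrt.
  rewrite (proj2 (circle_moment g w rho omega x t c M a (fun u => / u ^ m) Hw Ho Hx Hs HE Ha (circ_cont_pow_inv _ _ Hr))).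
  rewrite (mean_nser_self_neg (c a) (radius rho a / t) (M a)), pole_moment; auto.
  - unfold taylor_moment. rewrite Cplus_0_l. f_equal. apply csum_ext. intros b Hb. apply In_letters in Hb.
    destruct (Z.eq_dec b a) as [|Hn]; auto. apply Cseries_ext. intros l.
    rewrite mean_inv_shift; auto. apply (spread_apart g w rho x t); auto.
  - intros z E. apply (spread_far g w rho x t); auto.
  - apply HE; auto.
Qed.

(** With v = rho_a / u, invariance gives f(w_a + u) u^(k+2) = - rho_a^(k+1) f(w_{-a} + v) v^(-k) on
    C_a. Taking means, [mean_inversion] turns a tail coefficient at w_a into a Taylor coefficient at
    w_{-a}. *)
Lemma coef_rec g w rho omega x t c M a k : in_Schottky_domain g w rho -> is_canonical_bidiff g w rho omega ->
  in_D g w rho x -> spread g w rho x t -> expansion g w rho omega x t c M -> is_letter g a ->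
  c a (S k) = - rho a ^ S k * taylor_moment g w c x (- a) k.
Proof.
  intros Hw Ho Hx Hs HE Ha. pose proof (radius_pos _ _ _ _ Hw Ha) as Hr.
  pose proof (letter_opp _ _ Ha) as Ha'. pose proof (radius_opp _ _ _ _ Hw Ha) as Hro.
  rewrite <- (moment_neg g w rho omega x t c M (- a) k), <- (moment_pos g w rho omega x t c M a (S k)) by auto.
  pose proof (circ_cont_pow_inv k (radius rho (- a)) ltac:(lra)) as HW.
  destruct (circle_moment g w rho omega x t c M (- a) (fun u => / u ^ k) Hw Ho Hx Hs HE Ha' HW) as [Hcc _].
  rewrite Hro in *.
  assert (HW' := circ_cont_mult _ _ _ Hcc HW). rewrite <- mean_scal by (auto; lra).
  rewrite <- (mean_inversion (fun u => - rho a ^ S k * (omega x (Fin (w (- a)%Z + u)) * / u ^ k)) (radius rho a) (rho a));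
    auto; [|rewrite radius_sqr; auto|apply circ_cont_scal; auto].
  apply mean_ext; [lra|]. intros u Hu. pose proof (Cmod_r_nz _ u Hr Hu) as Hun.
  rewrite <- (omega_invariant g w rho omega x a (w a + u)); auto.
  - replace (w a + u - w a) with u by ring. destruct (proj1 Hw a Ha) as [Hrn _].
    unfold Cdiv. rewrite !Cpow_mult_l, Cpow_inv by auto. simpl. field.
    repeat split; auto; apply Cpow_nz; auto.
  - rewrite <- Hu. f_equal. ring.
Qed.

(** For the residue the same substitution yields - f(w_{-a} + v) v, which relates two residues. The
    periods over C_a with a > 0 therefore determine those with a < 0. *)
Lemma coef_zero_opp g w rho omega x t c M a : in_Schottky_domain g w rho -> is_canonical_bidiff g w rho omega ->
  in_D g w rho x -> spread g w rho x t -> expansion g w rho omega x t c M -> is_letter g a ->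
  c a O = - c (- a)%Z O.
Proof.
  intros Hw Ho Hx Hs HE Ha. pose proof (radius_pos _ _ _ _ Hw Ha) as Hr.
  pose proof (letter_opp _ _ Ha) as Ha'. pose proof (radius_opp _ _ _ _ Hw Ha) as Hro.
  rewrite <- (moment_pos g w rho omega x t c M a O), <- (moment_pos g w rho omega x t c M (- a) O) by auto.
  destruct (circle_moment g w rho omega x t c M (- a) (fun u => u ^ 1) Hw Ho Hx Hs HE Ha' (circ_cont_pow _ _)) as [Hcc _].
  rewrite Hro in *.
  assert (HW' := circ_cont_mult _ _ _ Hcc (circ_cont_pow 1 (radius rho a))).
  replace (- mean (fun u => omega x (Fin (w (- a)%Z + u)) * u ^ 1) (radius rho a)) with
    ((-1) * mean (fun u => omega x (Fin (w (- a)%Z + u)) * u ^ 1) (radius rho a)) by ring.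
  rewrite <- mean_scal by (auto; lra).
  rewrite <- (mean_inversion (fun u => (-1) * (omega x (Fin (w (- a)%Z + u)) * u ^ 1)) (radius rho a) (rho a));
    auto; [|rewrite radius_sqr; auto|apply circ_cont_scal; auto].
  apply mean_ext; [lra|]. intros u Hu. pose proof (Cmod_r_nz _ u Hr Hu) as Hun.
  rewrite <- (omega_invariant g w rho omega x a (w a + u)); auto.
  - replace (w a + u - w a) with u by ring. simpl. field. auto.
  - rewrite <- Hu. f_equal. ring.
Qed.

(** Up to the factor 2 pi i the residue is the period over [alpha_a], which is normalised to 0. This
    makes the tails integrable without logarithms. *)
Lemma coef_zero g w rho omega x t c M a : in_Schottky_domain g w rho -> is_canonical_bidiff g w rho omega ->
  in_D g w rho x -> spread g w rho x t -> expansion g w rho omega x t c M -> is_letter g a ->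
  c a O = 0.
Proof.
  intros Hw Ho Hx Hs HE.
  assert (Hp : forall a, (1 <= a <= Z.of_nat g)%Z -> c a O = 0).
  { clear a. intros a Ha. assert (Hl : is_letter g a) by (unfold is_letter; lia).
    pose proof (radius_pos _ _ _ _ Hw Hl) as Hr.
    rewrite <- (moment_pos g w rho omega x t c M a O) by auto. unfold mean.
    pose proof (bidiff_alpha g w rho omega Ho x a Hx Ha) as HI.
    apply Cint_unique in HI.
    assert (E : Cint (path_integrand (omega x) (circle w rho a)) 0 (2 * PI) =
      Ci * Cint (fun s => omega x (Fin (w a + circ (radius rho a) s)) * circ (radius rho a) s ^ 1) 0 (2 * PI)).
    { pose proof two_PI_pos. rewrite <- Cint_scal; [|lra|].
      - apply Cint_ext; [lra|]. intros s _. unfold path_integrand, circle, circ, ei. simpl.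
        replace ((- sin s)%R, cos s) with (Ci * (cos s, sin s)) by (apply injective_projections; simpl; ring). ring.
      - intros s _. apply (circ_rcont (fun u => omega x (Fin (w a + u)) * u ^ 1)); [lra|].
        apply circ_cont_mult; [|apply circ_cont_pow].
        apply (circle_moment g w rho omega x t c M a (fun u => u ^ 1) Hw Ho Hx Hs HE Hl (circ_cont_pow _ _)). }
    rewrite HI in E.
    replace (Cint _ 0 (2 * PI)) with (RtoC 0); [ring|].
    apply (f_equal (fun z => - Ci * z)) in E. rewrite Cmult_assoc in E.
    replace (- Ci * Ci) with (RtoC 1) in E by (apply injective_projections; simpl; ring).
    rewrite Cmult_1_l in E. rewrite <- E. ring. }
  intros Ha. destruct (Z.le_gt_cases 1 a) as [H1|H1].
  - apply Hp. unfold is_letter in Ha. lia.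
  - rewrite (coef_zero_opp g w rho omega x t c M) by auto. rewrite Hp; [ring|]. unfold is_letter in Ha. lia.
Qed.

(** * The linear system for the Laurent coefficients *)

Lemma sqrt_S_pos k : (0 < sqrt (INR (S k)))%R.
Proof. apply sqrt_lt_R0, lt_0_INR; lia. Qed.

Lemma sqrt_S_nz k : RtoC (sqrt (INR (S k))) <> 0.
Proof. apply RtoC_neq0. pose proof (sqrt_S_pos k). lra. Qed.

Lemma sqrt_S_sqr k : RtoC (sqrt (INR (S k))) * RtoC (sqrt (INR (S k))) = RtoC (INR (S k)).
Proof. rewrite <- RtoC_mult, sqrt_sqrt; auto. apply pos_INR. Qed.

Lemma sqrt_choice_nz g w rho s a : in_Schottky_domain g w rho -> is_sqrt_choice g rho s -> is_letter g a -> s a <> 0.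
Proof.
  intros Hw Hs Ha E. destruct (Hs a Ha) as [H _]. destruct (proj1 Hw a Ha) as [H1 _]. apply H1. rewrite <- H, E. ring.
Qed.

Lemma sqrt_choice_Cmod g rho s a : is_sqrt_choice g rho s -> is_letter g a -> Cmod (s a) = radius rho a.
Proof.
  intros Hs Ha. unfold radius. destruct (Hs a Ha) as [<- _]. rewrite Cmod_mult.
  symmetry. apply sqrt_square, Cmod_ge_0.
Qed.

(** The row (a, k+1) takes the k-th Taylor coefficient at w_{-a}, the column (b, l+1) stands for the
    power (y - w_b)^(-l-2); hence the shifted arguments [S l] and [k]. The scaling matches that of
    [sol]. *)
Lemma A_taylor w s a b k l : a <> (- b)%Z ->
  A_mat w s (a, S k) (b, S l) =
  - (s a ^ S k / RtoC (sqrt (INR (S k)))) * (RtoC (sqrt (INR (S l))) * s b ^ S l) * taylor_inv (w (- a)%Z - w b) (S l) k.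
Proof.
  intros Hn. unfold A_mat. destruct (Z.eq_dec a (- b)); [contradiction|]. unfold taylor_inv.
  replace (S (S l) + k)%nat with (S k + S l)%nat by lia.
  replace (S k - 1)%nat with k by lia. replace (S l - 1)%nat with l by lia.
  replace (S k + S l - 1)%nat with (S l + k)%nat by lia. unfold nb.
  pose proof (sqrt_S_pos k) as Hs1. pose proof (sqrt_S_pos l) as Hs2.
  match goal with |- RtoC ?A * (?X * ?Y / ?Z) = - (?X / RtoC ?r1) * (RtoC ?r2 * ?Y) * (RtoC ?B * / ?Z) =>
    transitivity (RtoC (- / r1 * r2 * B) * (X * Y / Z));
    [|rewrite !RtoC_mult, RtoC_opp, RtoC_inv by lra; unfold Cdiv; ring] end.
  f_equal. f_equal.
  pose proof (INR_fact_neq_0 k). pose proof (INR_fact_neq_0 l). pose proof (INR_fact_neq_0 (S l + k)).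
  assert (Hm' : (0 < INR (S k))%R) by (apply lt_0_INR; lia).
  assert (Hl' : (0 < INR (S l))%R) by (apply lt_0_INR; lia).
  rewrite (fact_simpl l), !mult_INR, sqrt_mult by lra.
  pose proof (sqrt_sqrt (INR (S l)) ltac:(lra)) as E2.
  revert Hs1 Hs2 E2. generalize (sqrt (INR (S k))) (sqrt (INR (S l))). intros r1 r2 Hs1 Hs2 <-.
  simpl pow. field. repeat split; auto; lra.
Qed.

(** For finite x the binomial of 1 + k over k is k + 1, one square root of which goes into the
    scaling. At infinity both sides vanish unless k = 0. *)
Lemma R_taylor g rho w s x a k : is_sqrt_choice g rho s -> is_letter g a ->
  (forall z, x = Fin z -> z <> w (- a)%Z) ->
  R_vec w s x (a, S k) = s a ^ S k / RtoC (sqrt (INR (S k))) * pole_taylor x (w (- a)%Z) k.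
Proof.
  intros Hs Ha Hx. unfold R_vec. simpl fst; simpl snd. rewrite <- (proj2 (Hs a Ha)).
  pose proof (sqrt_S_nz k) as Hq. destruct x as [z|]; unfold L_form, pole_taylor.
  - assert (Hz : z - w (- a)%Z <> 0) by (apply Cminus_eq_contra; auto).
    unfold taylor_inv. replace (S k + 1)%nat with (2 + k)%nat by lia.
    replace (w (- a)%Z - z) with (RtoC (-1) * (z - w (- a)%Z)) by ring. rewrite Cpow_mult_l.
    replace (nb 1 k) with (INR (S k)).
    2:{ unfold nb. change (1 + k)%nat with (S k). rewrite fact_simpl, mult_INR. simpl (INR (fact 1)).
        field. apply INR_fact_neq_0. }
    rewrite RtoC_mult, <- sqrt_S_sqr, RtoC_pow, !(Cpow_add_r _ 2 k).
    assert (Hm1 : RtoC (-1) ^ k <> 0) by (apply Cpow_nz, RtoC_neq0; lra).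
    assert (Hm2 : RtoC (-1) ^ 2 = 1) by (simpl; ring). rewrite Hm2.
    field. split; [|split]; auto; apply Cpow_nz; auto.
  - destruct k as [|k].
    + change (INR 1) with 1%R. rewrite sqrt_1. simpl. field.
    + destruct (Nat.eq_dec (S (S k)) 1), (Nat.eq_dec (S k) 0); try lia; ring.
Qed.

(* The vector Y = (I - A)^(-1) R, read off the Laurent coefficients of omega(x, .). *)
Definition sol (s : Z -> C) (c : Z -> nat -> C) : vec :=
  fun i => - (c (fst i) (snd i) / (RtoC (sqrt (INR (snd i))) * s (fst i) ^ snd i)).

Lemma sol_coef g w rho s c a k : in_Schottky_domain g w rho -> is_sqrt_choice g rho s -> is_letter g a ->
  c a (S k) = - (RtoC (sqrt (INR (S k))) * s a ^ S k) * sol s c (a, S k).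
Proof.
  intros Hw Hs Ha. unfold sol. simpl fst; simpl snd. field. split.
  - apply Cpow_nz, (sqrt_choice_nz g w rho); auto.
  - apply sqrt_S_nz.
Qed.

Lemma gbnd_le g t M M' u : (0 <= t)%R -> (M <= M')%R -> gbnd g t M u -> gbnd g t M' u.
Proof.
  intros Ht HM H i Hi. eapply Rle_trans; [apply H; auto|]. apply Rmult_le_compat_r; auto. apply pow_le; auto.
Qed.

(** The bound (radius / t)^k for the Laurent coefficients loses its radius against |s_a|^k, and
    t^(-k) remains. *)
Lemma gbnd_sol g w rho omega s x t c M : in_Schottky_domain g w rho -> is_sqrt_choice g rho s -> (1 < t)%R ->
  expansion g w rho omega x t c M -> gbnd g (/ t) (rsum (letters g) M) (sol s c).
Proof.
  intros Hw Hs Ht (Hc & _) [a k] [Ha Hk]. simpl in Ha, Hk. unfold sol. simpl fst; simpl snd.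
  pose proof (radius_pos _ _ _ _ Hw Ha) as Hr. destruct k as [|k]; [lia|].
  assert (HM : (M a <= rsum (letters g) M)%R).
  { apply rsum_ge_term; [|apply In_letters; auto]. intros b Hb. apply In_letters in Hb. eapply geo_M. apply Hc; auto. }
  assert (Hsn : s a ^ S k <> 0) by (apply Cpow_nz, (sqrt_choice_nz g w rho); auto).
  rewrite Cmod_opp, Cmod_div by (apply Cmult_neq_0; auto; apply sqrt_S_nz).
  rewrite Cmod_mult, Cmod_pow, (sqrt_choice_Cmod g rho s a Hs Ha), Cmod_R, Rabs_pos_eq by (left; apply sqrt_S_pos).
  specialize (Hc a Ha (S k)). unfold Rdiv in Hc. rewrite Rpow_mult_distr in Hc.
  assert (Hrk : (0 < radius rho a ^ S k)%R) by (apply pow_lt; auto).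
  assert (Htk : (0 < (/ t) ^ S k)%R) by (apply pow_lt, Rinv_0_lt_compat; lra).
  assert (H1 : (1 <= sqrt (INR (S k)))%R).
  { rewrite <- sqrt_1. apply sqrt_le_1_alt. rewrite S_INR. pose proof (pos_INR k). lra. }
  apply Rmult_le_reg_r with (sqrt (INR (S k)) * radius rho a ^ S k)%R; [nra|].
  unfold Rdiv. rewrite Rmult_assoc, Rinv_l, Rmult_1_r by nra.
  eapply Rle_trans; [exact Hc|].
  set (N := rsum (letters g) M) in *. assert (0 <= M a)%R.
  { pose proof (Cmod_ge_0 (c a (S k))). apply Rnot_lt_le; intros Hneg.
    assert (M a * (radius rho a ^ S k * (/ t) ^ S k) < 0)%R; [|lra].
    rewrite <- (Rmult_0_l (radius rho a ^ S k * (/ t) ^ S k)). apply Rmult_lt_compat_r; auto. apply Rmult_lt_0_compat; auto. }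
  replace (N * (/ t) ^ S k * (sqrt (INR (S k)) * radius rho a ^ S k))%R with
    ((N * sqrt (INR (S k))) * (radius rho a ^ S k * (/ t) ^ S k))%R by ring.
  apply Rmult_le_compat_r; [left; apply Rmult_lt_0_compat; auto|]. nra.
Qed.

(** Reconciles Laurent tails, indexed from 0 with vanishing residue, with the matrix indices, which
    start at 1. *)
Lemma Cseries_shift0 t M (u v : nat -> C) kappa : (0 < t < 1)%R -> geo t M v ->
  u O = 0 -> (forall l, u (S l) = kappa * v l) -> Cseries u = kappa * Cseries v.
Proof.
  intros Ht Hv H0 HS. assert (HM := geo_M _ _ _ Hv).
  assert (Hu : geo t (Cmod kappa * M / t) u).
  { intros [|l].
    - rewrite H0, Cmod_0. simpl. rewrite Rmult_1_r. apply Rmult_le_pos; [|left; apply Rinv_0_lt_compat; lra].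
      apply Rmult_le_pos; auto. apply Cmod_ge_0.
    - rewrite HS, Cmod_mult. replace (Cmod kappa * M / t * t ^ S l)%R with (Cmod kappa * (M * t ^ l))%R by (simpl; field; lra).
      apply Rmult_le_compat_l; [apply Cmod_ge_0|apply Hv]. }
  rewrite (Cseries_split t _ u 1) by (eauto; lra). unfold csumn; simpl. rewrite H0.
  rewrite (Cseries_ext (fun k => u (S k)) (fun l => kappa * v l)) by auto.
  rewrite (Cseries_scal t M) by (auto; lra). ring.
Qed.

(** Dividing [coef_rec] by - sqrt (k+1) s_a^(k+1) leaves the Taylor coefficient at w_{-a} times
    s_a^(k+1) / sqrt (k+1). The pole contributes R by [R_taylor], the other tails contribute A Y by
    [A_taylor], and the missing tail at -a is the zero block of A. *)
Lemma sol_equation g w rho omega s x t c M : in_Schottky_domain g w rho -> is_canonical_bidiff g w rho omega ->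
  is_sqrt_choice g rho s -> in_D g w rho x -> spread g w rho x t -> expansion g w rho omega x t c M ->
  contractive g (A_mat w s) (/ t) ->
  forall i, is_index g i -> sol s c i = R_vec w s x i + index_sum g (fun j => A_mat w s i j * sol s c j).
Proof.
  intros Hw Ho Hs Hx Hsp HE HA [a k] [Ha Hk]. simpl in Ha, Hk. destruct k as [|k]; [lia|]. clear Hk.
  pose proof Hsp as (Ht & _ & _). pose proof (letter_opp _ _ Ha) as Ha'.
  assert (Hti : (0 < / t < 1)%R) by (destruct HA; auto).
  pose proof (gbnd_sol g w rho omega s x t c M Hw Hs Ht HE) as Hb. set (M0 := rsum (letters g) M) in *.
  assert (Hsn : s a <> 0) by (apply (sqrt_choice_nz g w rho); auto).
  assert (HAY : forall b l, is_letter g b -> (Cmod (A_mat w s (a, S k) (b, S l) * sol s c (b, S l))%C <= M0 * / t * (/ t) ^ l)%R).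
  { intros b l Hbl. rewrite Cmod_mult. replace (M0 * / t * (/ t) ^ l)%R with (1 * (M0 * (/ t) ^ S l))%R by (simpl; ring).
    apply Rmult_le_compat; try apply Cmod_ge_0.
    - assert (Hi : is_index g (a, S k)) by (split; simpl; [auto|lia]).
      assert (Hj : is_index g (b, S l)) by (split; simpl; [auto|lia]).
      destruct (contractive_col g _ _ _ _ HA Hi Hj) as [H1 _]. eapply Rle_trans; [exact H1|]. simpl snd.
      rewrite <- (pow1 (S k)). apply pow_incr; lra.
    - apply (Hb (b, S l)). split; simpl; [auto|lia]. }
  rewrite (R_taylor g rho) by (auto; intros z E Hz; pose proof (spread_far g w rho x t (- a) z Hw Hsp Ha' E) as H;
    rewrite Hz in H; replace (w (- a)%Z - w (- a)%Z) with (RtoC 0) in H by ring; rewrite Cmod_0 in H;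
    pose proof (radius_pos _ _ _ _ Hw Ha'); lra).
  rewrite index_sum_letters, (Cseries_csum (letters g) (/ t) (fun _ => (M0 * / t)%R)
    (fun b l => A_mat w s (a, S k) (b, S l) * sol s c (b, S l))) by
    (try lra; intros b Hbl; apply In_letters in Hbl; intros l; apply HAY; auto).
  unfold sol at 1. simpl fst; simpl snd. rewrite (coef_rec g w rho omega x t c M a k) by auto. unfold taylor_moment.
  destruct (Hs a Ha) as [<- _].
  set (P := pole_taylor x (w (- a)%Z) k).
  (* What is left of rho_a^(k+1) after division by the scaling, since rho_a = s_a^2. *)
  set (kap := s a ^ S k / RtoC (sqrt (INR (S k)))).
  assert (E : csum (letters g) (fun b => Cseries (fun l => A_mat w s (a, S k) (b, S l) * sol s c (b, S l))) =
    kap * csum (letters g) (fun b => if Z.eq_dec b (- a) then 0 else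
       Cseries (fun l => c b l * taylor_inv (w (- a)%Z - w b) l k))).
  { rewrite <- csum_scal. apply csum_ext. intros b Hbl. apply In_letters in Hbl.
    destruct (Z.eq_dec b (- a)) as [Eb|Hn].
    - rewrite Cseries_0; [ring|]. intros l. unfold A_mat. destruct (Z.eq_dec a (- b)); [ring|lia].
    - assert (Hkap : kap <> 0).
      { unfold kap. intros E. apply (Cpow_nz (s a) (S k) Hsn). pose proof (sqrt_S_nz k).
        replace (s a ^ S k) with (s a ^ S k / RtoC (sqrt (INR (S k))) * RtoC (sqrt (INR (S k)))) by (field; auto).
        rewrite E. ring. }
      rewrite (Cseries_shift0 (/ t) (M0 * / t) (fun l => c b l * taylor_inv (w (- a)%Z - w b) l k) (fun l => A_mat w s (a, S k) (b, S l) * sol s c (b, S l)) (/ kap)); auto.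
      + field; auto.
      + intros l. apply HAY; auto.
      + rewrite (coef_zero g w rho omega x t c M b) by auto. ring.
      + intros l. rewrite A_taylor by lia. fold kap. rewrite (sol_coef g w rho s c b l) by auto. field; auto. }
  rewrite E. set (H := csum _ _). unfold kap. pose proof (sqrt_S_nz k) as Hq.
  rewrite Cpow_mult_l. field. split; auto. apply Cpow_nz; auto.
Qed.

Definition opp_index (i : index) : index := ((- fst i)%Z, snd i).

Lemma is_index_opp g i : is_index g i -> is_index g (opp_index i).
Proof. intros [H1 H2]. split; simpl; auto. apply letter_opp; auto. Qed.

Lemma gbnd_opp g t M u : gbnd g t M u -> gbnd g t M (fun i => u (opp_index i)).
Proof. intros H i Hi. apply (H (opp_index i)), is_index_opp; auto. Qed.

(* The bound is that of the two other terms of [sol_equation]. *)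
Lemma gbnd_R g w rho omega s x t c M : in_Schottky_domain g w rho -> is_canonical_bidiff g w rho omega ->
  is_sqrt_choice g rho s -> in_D g w rho x -> spread g w rho x t -> expansion g w rho omega x t c M ->
  contractive g (A_mat w s) (/ t) -> exists M', gbnd g (/ t) M' (R_vec w s x).
Proof.
  intros Hw Ho Hs Hx Hsp HE HA. pose proof Hsp as (Ht & _ & _).
  pose proof (gbnd_sol g w rho omega s x t c M Hw Hs Ht HE) as Hb. set (M0 := rsum (letters g) M) in *.
  pose proof HA as (Hti & HAb & _).
  eexists. intros i Hi.
  pose proof (sol_equation g w rho omega s x t c M Hw Ho Hs Hx Hsp HE HA i Hi) as E.
  replace (R_vec w s x i) with (sol s c i + - index_sum g (fun j => A_mat w s i j * sol s c j)) by (rewrite E; ring).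
  eapply Rle_trans; [apply Cmod_triangle|]. rewrite Cmod_opp.
  assert (HAy : gbnd g (/ t) ((/ t) ^ snd i * M0) (fun j => A_mat w s i j * sol s c j)).
  { intros j Hj. rewrite Rmult_assoc. apply Cmod_mult_le; [|apply Hb; auto].
    apply (contractive_col g _ _ _ _ HA Hi Hj). }
  pose proof (index_sum_bound g (/ t) _ _ ltac:(lra) HAy) as H1. specialize (Hb i Hi).
  replace ((/ t) ^ snd i * M0 * (len g * / t / (1 - / t)))%R with ((M0 * (len g * / t / (1 - / t))) * (/ t) ^ snd i)%R in H1 by ring.
  eapply Rle_trans; [apply Rplus_le_compat; [exact Hb|exact H1]|]. rewrite <- Rmult_plus_distr_r. apply Rle_refl.
Qed.

Lemma d_term_bound g w rho s t a v k : in_Schottky_domain g w rho -> is_sqrt_choice g rho s -> is_letter g a ->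
  (1 < t)%R -> (t * radius rho a <= Cmod (v - w a))%R ->
  (Cmod (s a ^ S k / RtoC (sqrt (INR (S k))) * / (v - w a) ^ S k) <= (/ t) ^ S k)%R.
Proof.
  intros Hw Hs Ha Ht Hv. pose proof (radius_pos _ _ _ _ Hw Ha) as Hr.
  assert (Hvn : v - w a <> 0) by (apply Cmod_gt_0; nra).
  rewrite Cmod_mult, Cmod_div, Cmod_inv by (try apply Cpow_nz; auto; apply sqrt_S_nz).
  rewrite !Cmod_pow, (sqrt_choice_Cmod g rho s a Hs Ha), Cmod_R, Rabs_pos_eq by (left; apply sqrt_S_pos).
  assert (H1 : (1 <= sqrt (INR (S k)))%R).
  { rewrite <- sqrt_1. apply sqrt_le_1_alt. rewrite S_INR. pose proof (pos_INR k). lra. }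
  assert (Hrk : (0 < radius rho a ^ S k)%R) by (apply pow_lt; auto).
  assert (Htk : (0 < t ^ S k)%R) by (apply pow_lt; lra).
  assert (Hle : (t ^ S k * radius rho a ^ S k <= Cmod (v - w a) ^ S k)%R).
  { rewrite <- Rpow_mult_distr. apply pow_incr. nra. }
  set (p := (radius rho a ^ S k)%R) in *. set (q := (Cmod (v - w a) ^ S k)%R) in *. set (r := sqrt (INR (S k))) in *.
  rewrite pow_inv. set (T := (t ^ S k)%R) in *. assert (0 < q)%R by nra.
  clearbody p q r T. apply Rmult_le_reg_r with (T * q * r)%R; [repeat apply Rmult_lt_0_compat; lra|].
  replace (p / r * / q * (T * q * r))%R with (T * p)%R by (field; lra).
  replace (/ T * (T * q * r))%R with (q * r)%R by (field; lra). nra.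
Qed.

Lemma gbnd_d g w rho s x t b : in_Schottky_domain g w rho -> is_sqrt_choice g rho s -> spread g w rho x t ->
  (1 <= b <= Z.of_nat g)%Z -> gbnd g (/ t) 2 (d_vec w s b).
Proof.
  intros Hw Hs (Ht & Hd & _) Hb [a k] [Ha Hk]. simpl in Ha, Hk. destruct k as [|k]; [lia|]. simpl snd.
  assert (Hb1 : is_letter g b) by (unfold is_letter; lia). pose proof (letter_opp _ _ Hb1) as Hb2.
  pose proof (radius_pos _ _ _ _ Hw Ha) as Hr.
  assert (Htk : (0 < (/ t) ^ S k)%R) by (apply pow_lt, Rinv_0_lt_compat; lra).
  assert (Hfar : forall e, is_letter g e -> e <> a -> (t * radius rho a <= Cmod (w e - w a))%R).
  { intros e He Hn. specialize (Hd e a He Ha Hn). pose proof (radius_pos _ _ _ _ Hw He). nra. }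
  unfold d_vec. destruct (Z.eq_dec (Z.abs a) b) as [Eb|Hn].
  (* When |a| = b the letter -b sgn(a) is -a, so this branch of [d_vec] is the generic difference
     without its singular term at w_a. *)
  - set (e := (- (b * Z.sgn a))%Z).
    assert (He : e = (- a)%Z) by (unfold e; rewrite <- Eb; lia).
    rewrite He. pose proof (letter_opp _ _ Ha) as Ha'.
    unfold Cdiv at 1. rewrite <- !Cmult_assoc, Cmod_mult, Cmult_assoc. change (s a ^ S k * / RtoC (sqrt (INR (S k)))) with (s a ^ S k / RtoC (sqrt (INR (S k)))).
    assert (Hsg : (Cmod (RtoC (IZR (Z.sgn a))) = 1)%R).
    { rewrite Cmod_R, <- abs_IZR. replace (Z.abs (Z.sgn a)) with 1%Z; auto. unfold is_letter in Ha. lia. }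
    rewrite Hsg, Rmult_1_l. pose proof (d_term_bound g w rho s t a (w (- a)%Z) k Hw Hs Ha Ht (Hfar _ Ha' ltac:(unfold is_letter in Ha; lia))). lra.
  - replace (s a ^ S k / RtoC (sqrt (INR (S k))) * (/ (w (- b)%Z - w a) ^ S k - / (w b - w a) ^ S k)) with
      (s a ^ S k / RtoC (sqrt (INR (S k))) * / (w (- b)%Z - w a) ^ S k + - (s a ^ S k / RtoC (sqrt (INR (S k))) * / (w b - w a) ^ S k)) by ring.
    eapply Rle_trans; [apply Cmod_triangle|]. rewrite Cmod_opp.
    pose proof (d_term_bound g w rho s t a (w b) k Hw Hs Ha Ht (Hfar _ Hb1 ltac:(lia))).
    pose proof (d_term_bound g w rho s t a (w (- b)%Z) k Hw Hs Ha Ht (Hfar _ Hb2 ltac:(lia))). lra.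
Qed.

(** The factorial coefficient is symmetric in k and l up to its sign, and the sign (-1)^(k+l) from
    reversing w_{-a} - w_b turns (-1)^l into (-1)^k. *)
Lemma A_mat_opp g rho w s i j : is_sqrt_choice g rho s -> is_index g i -> is_index g j ->
  (forall a b, is_letter g a -> is_letter g b -> a <> b -> w a <> w b) ->
  A_mat w s (opp_index j) (opp_index i) = A_mat w s i j.
Proof.
  intros Hs [Ha Hk] [Hb Hl] Hw. destruct i as [a k], j as [b l]. unfold opp_index, A_mat. simpl in *.
  destruct (Z.eq_dec (- b) (- - a)), (Z.eq_dec a (- b)); try lia; auto.
  rewrite (proj2 (Hs a Ha)), (proj2 (Hs b Hb)), Z.opp_involutive.
  assert (HD : w (- a)%Z - w b <> 0) by (apply Cminus_eq_contra, Hw; auto; [apply letter_opp; auto|lia]).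
  replace (l + k)%nat with (k + l)%nat by lia. rewrite (Nat.mul_comm l k).
  replace (w b - w (- a)%Z) with (RtoC (-1) * (w (- a)%Z - w b)) by ring. rewrite Cpow_mult_l.
  assert (Hp : RtoC ((-1) ^ l) = RtoC ((-1) ^ k) * RtoC (-1) ^ (k + l)).
  { rewrite Cpow_add_r, <- !RtoC_pow, <- !RtoC_mult. f_equal. rewrite <- Rmult_assoc, <- Rpow_mult_distr.
    replace (-1 * -1)%R with 1%R by ring. rewrite pow1. ring. }
  replace (sqrt (INR (k * l)) * INR (fact (l - 1)) * INR (fact (k - 1)))%R with
    (sqrt (INR (k * l)) * INR (fact (k - 1)) * INR (fact (l - 1)))%R by ring.
  assert (Hm : RtoC (-1) ^ (k + l) <> 0) by (apply Cpow_nz, RtoC_neq0; lra).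
  unfold Rdiv. rewrite !(RtoC_mult (_ * _) (/ _)), !(RtoC_mult (_ ^ _)), Hp.
  field. split; auto. apply Cpow_nz; auto.
Qed.

(** Both expressions reduce to the pairing of d with Y. For the second one L, dbar and A are related
    to R, d and A by a -> -a and transposition, so Y with opposite letters solves the row system
    with right side L. *)
Lemma sandwich_values g w rho omega s x b : in_Schottky_domain g w rho -> is_canonical_bidiff g w rho omega ->
  is_sqrt_choice g rho s -> in_D g w rho x -> (1 <= b <= Z.of_nat g)%Z ->
  exists t c M, spread g w rho x t /\ expansion g w rho omega x t c M /\
    contractive g (A_mat w s) (/ t) /\
    sandwich_converges g (d_vec w s b) (neumann_inverse g (A_mat w s)) (R_vec w s x) /\
    sandwich_converges g (L_vec w s x) (neumann_inverse g (A_mat w s)) (dbar_vec w s b) /\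
    sandwich g (d_vec w s b) (neumann_inverse g (A_mat w s)) (R_vec w s x) = index_sum g (fun i => d_vec w s b i * sol s c i) /\
    sandwich g (L_vec w s x) (neumann_inverse g (A_mat w s)) (dbar_vec w s b) = index_sum g (fun i => d_vec w s b i * sol s c i).
Proof.
  intros Hw Ho Hs Hx Hb.
  destruct (exists_spread g w rho x Hw Hx) as (t0 & Hs0). pose proof Hs0 as (Ht0 & _ & _).
  (* The expansion holds only for factors strictly below that of the spread, hence the midpoint of 1
     and [t0]. *)
  set (t := ((1 + t0) / 2)%R). assert (Ht : (1 < t < t0)%R) by (unfold t; lra).
  pose proof (spread_smaller g w rho x t0 t Hw Hs0 ltac:(lra)) as Hsp. pose proof Hsp as (_ & Hd & _).
  destruct (omega_expansion g w rho omega x t0 t Hw Ho Hx Hs0 Ht) as (c & M & HE).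
  assert (HA : contractive g (A_mat w s) (/ t)).
  { apply (A_contractive g w rho s t Hw Hs ltac:(lra)). intros; apply Rlt_gt, Hd; auto. }
  destruct (gbnd_R g w rho omega s x t c M Hw Ho Hs Hx Hsp HE HA) as (MR & HR).
  pose proof (gbnd_d g w rho s x t b Hw Hs Hsp Hb) as Hdb.
  pose proof (gbnd_sol g w rho omega s x t c M Hw Hs ltac:(lra) HE) as HY.
  set (K := Rmax (rsum (letters g) M) (Rmax MR 2)).
  assert (Hti : (0 <= / t)%R) by (left; apply Rinv_0_lt_compat; lra).
  apply (gbnd_le _ _ _ K) in HY; auto; [|apply Rmax_l].
  apply (gbnd_le _ _ _ K) in HR; auto; [|eapply Rle_trans; [apply Rmax_l|apply Rmax_r]].
  apply (gbnd_le _ _ _ K) in Hdb; auto; [|eapply Rle_trans; [apply Rmax_r|apply Rmax_r]].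
  assert (HLR : forall i, is_index g i -> L_vec w s x i = R_vec w s x (opp_index i)).
  { intros i Hi. unfold L_vec, R_vec, opp_index. simpl. rewrite Z.opp_involutive. auto. }
  assert (HL : gbnd g (/ t) K (L_vec w s x)).
  { intros i Hi. rewrite HLR by auto. apply (gbnd_opp g _ _ _ HR); auto. }
  pose proof (gbnd_opp g _ _ _ Hdb) as Hdo. change (fun i => d_vec w s b (opp_index i)) with (dbar_vec w s b) in Hdo.
  pose proof (sol_equation g w rho omega s x t c M Hw Ho Hs Hx Hsp HE HA) as HEq.
  destruct (sandwich_conv g _ (/ t) K _ _ HA Hdb HR) as [C1 V1].
  destruct (sandwich_conv g _ (/ t) K _ _ HA HL Hdo) as [C2 _].
  exists t, c, M. split; [auto|split; [auto|split; [auto|split; [auto|split; [auto|split]]]]].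
  - rewrite V1. apply index_sum_ext. intros i Hi. f_equal.
    apply (neumann_column g _ (/ t) K (sol s c)); auto.
  - unfold sandwich, vec_mat.
    transitivity (index_sum g (fun i => d_vec w s b (opp_index i) * sol s c (opp_index i)));
      [|apply (index_sum_opp_index g (fun i => d_vec w s b i * sol s c i))].
    apply index_sum_ext. intros j Hj. rewrite Cmult_comm. f_equal.
    apply (neumann_row g (A_mat w s) (/ t) K (fun i => sol s c (opp_index i))); auto.
    + apply gbnd_opp; auto.
    + intros i Hi. rewrite HEq, HLR by (auto; apply is_index_opp; auto). f_equal.
      transitivity (index_sum g (fun k => A_mat w s (opp_index i) (opp_index k) * sol s c (opp_index k)));
        [symmetry; apply (index_sum_opp_index g (fun k => A_mat w s (opp_index i) k * sol s c k))|].
      apply index_sum_ext. intros k Hk.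
      rewrite (A_mat_opp g rho w s k i); auto; [ring|].
      intros a e Ha He Hn E. specialize (Hd a e Ha He Hn). rewrite E in Hd.
      replace (w e - w e) with (RtoC 0) in Hd by ring. rewrite Cmod_0 in Hd.
      pose proof (radius_pos _ _ _ _ Hw Ha). pose proof (radius_pos _ _ _ _ Hw He). nra.
Qed.

(** * The period along beta *)

(** Coefficients of minus the termwise primitive of a tail: c_(k+1) v^(-k-2) has the primitive -
    c_(k+1) v^(-k-1) / (k+1). The coefficient [c 0], which would give a logarithm, is omitted. *)
Definition cprim (c : nat -> C) (k : nat) : C := c (S k) / INR (S k).

Lemma INR_S_nz k : RtoC (INR (S k)) <> 0.
Proof. apply RtoC_neq0, not_0_INR; lia. Qed.

Lemma Cmod_div_INR z k : (Cmod (z / INR (S k)) <= Cmod z)%R.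
Proof.
  rewrite Cmod_div by apply INR_S_nz. pose proof (INR_S_ge1 k). rewrite Cmod_R, Rabs_pos_eq by lra.
  pose proof (Cmod_ge_0 z). apply Rmult_le_reg_r with (INR (S k)); [lra|].
  unfold Rdiv. rewrite Rmult_assoc, Rinv_l by lra. nra.
Qed.

Lemma geo_cprim c rho M : geo rho M c -> geo rho (M * rho) (cprim c).
Proof.
  intros Hc k. eapply Rle_trans; [apply Cmod_div_INR|]. eapply Rle_trans; [apply Hc|]. simpl. lra.
Qed.

(** In the variable 1/v the tail is a power series without constant term, the sequence [a], so the
    derivative follows from [cderiv_pser] and the chain rule. The vanishing residue accounts for the
    term that [cprim] omits. *)
Lemma cderiv_nser_prim c rho M v : (0 < rho)%R -> geo rho M c -> c O = 0 -> (rho < Cmod v)%R ->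
  cderiv (nser (cprim c)) v (- nser c v).
Proof.
  intros Hr Hc H0 Hv. assert (Hvn : v <> 0) by (apply Cmod_gt_0; lra).
  set (a := fun k => match k with O => RtoC 0 | S j => cprim c j end).
  assert (Ha : geo rho M a).
  { intros [|j]; simpl a.
    - rewrite Cmod_0. simpl. pose proof (geo_M _ _ _ Hc). lra.
    - eapply Rle_trans; [apply geo_cprim; eauto|]. simpl. lra. }
  apply (cderiv_ext_loc (fun v => pser a (/ v)) _ v _ (Cmod v - rho)); [lra| |].
  - intros v' Hv'. apply Cmod_near in Hv'.
    destruct (nser_geo (cprim c) rho _ v' Hr (geo_cprim _ _ _ Hc) Hv') as [Ht Hg].
    assert (Hvn' : v' <> 0) by (apply Cmod_gt_0; lra).
    unfold pser, nser. rewrite (Cseries_shift0 (rho / Cmod v') (M * rho / Cmod v') (fun k => a k * (/ v') ^ k) (fun k => cprim c k * / v' ^ S k) 1); [ring| |exact Hg|simpl; ring|].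
    + split; [apply Rdiv_lt_0_compat; lra|lra].
    + intros l. rewrite Cpow_inv by auto. simpl a. ring.
  - assert (Hi : (Cmod (/ v) < / rho)%R) by (rewrite Cmod_inv by auto; apply Rinv_lt_contravar; auto; nra).
    pose proof (cderiv_pser a (/ rho) M (/ v) ltac:(apply Rinv_0_lt_compat; auto) (geo_inv_radius a rho M Hr Ha) Hi) as Hd.
    pose proof (cderiv_comp _ (fun v => / v) v _ _ Hd (cderiv_inv v Hvn)) as Hcm.
    destruct (nser_geo c rho M v Hr Hc Hv) as [Ht Hg].
    assert (E : nser c v = / (v * v) * Cseries (fun k => INR (S k) * a (S k) * (/ v) ^ k));
      [|eapply cderiv_eq; [|exact Hcm]; rewrite E; ring].
    unfold nser. rewrite (Cseries_split _ _ _ 1 Ht Hg). unfold csumn. simpl csum. rewrite H0.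
    rewrite (Cseries_ext (fun k => c (1 + k)%nat * / v ^ S (1 + k)) (fun k => / (v * v) * (INR (S k) * a (S k) * (/ v) ^ k))).
    2:{ intros k. rewrite Cpow_inv by auto. unfold a, cprim. simpl Cpow. simpl Nat.add. field. repeat split; first [assumption | apply INR_S_nz | apply Cpow_nz; assumption]. }
    assert (Hra : (0 <= rho / Cmod v < 1)%R) by auto.
    rewrite (Cseries_scal (rho / Cmod v) (M * rho)); auto; [ring|].
    intros k. unfold a, cprim. replace (INR (S k) * (c (S k) / INR (S k)) * (/ v) ^ k) with (c (S k) * (/ v) ^ k) by (field; apply INR_S_nz).
    rewrite Cmod_mult, Cmod_pow, Cmod_inv by auto. unfold Rdiv. rewrite Rpow_mult_distr.
    replace (M * rho * (rho ^ k * (/ Cmod v) ^ k))%R with (M * rho ^ S k * (/ Cmod v) ^ k)%R by (simpl; ring).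
    apply Rmult_le_compat_r; [apply pow_le; left; apply Rinv_0_lt_compat; lra|apply Hc].
Qed.

Lemma cderiv_csum {T} (l : list T) (F : T -> C -> C) (D : T -> C) z :
  (forall i, In i l -> cderiv (F i) z (D i)) -> cderiv (fun z => csum l (fun i => F i z)) z (csum l D).
Proof.
  induction l as [|i l IH]; intros H; simpl; [apply (cderiv_const 0)|].
  apply cderiv_plus; [apply H; left; auto|apply IH; intros; apply H; right; auto].
Qed.

(** The primitive Phi of omega(x, .). The tails enter with a minus sign because [cprim] leaves it
    out. *)
Definition omega_prim (g : nat) (w : Z -> C) (c : Z -> nat -> C) (x : Chat) (y : C) : C :=
  pole_prim x y - csum (letters g) (fun a => nser (cprim (c a)) (y - w a)).

Lemma cderiv_omega_prim g w rho omega x t c M y : in_Schottky_domain g w rho -> is_canonical_bidiff g w rho omega ->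
  in_D g w rho x -> spread g w rho x t -> expansion g w rho omega x t c M ->
  collar_D g w rho t y -> x <> Fin y -> cderiv (omega_prim g w c x) y (omega x (Fin y)).
Proof.
  intros Hw Ho Hx Hs HE Hy Hn. pose proof HE as (Hc & HF). rewrite HF by auto. pose proof Hs as (Ht & _ & _).
  apply (cderiv_eq _ _ (pole x y - csum (letters g) (fun a => - nser (c a) (y - w a)))); [rewrite csum_opp; ring|].
  apply cderiv_minus; [apply cderiv_pole_prim; auto|].
  apply (cderiv_csum (letters g) (fun a y => nser (cprim (c a)) (y - w a)) (fun a => - nser (c a) (y - w a))).
  intros a Ha. apply In_letters in Ha.
  apply (cderiv_eq _ _ (- nser (c a) (y - w a) * (1 - 0))); [ring|].
  apply (cderiv_comp (nser (cprim (c a))) (fun y => y - w a)).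
  - apply (cderiv_nser_prim (c a) (radius rho a / t) (M a)); auto.
    + apply Rdiv_lt_0_compat; [apply (radius_pos g w); auto|lra].
    + apply (coef_zero g w rho omega x t c M); auto.
  - apply cderiv_minus; [apply cderiv_id|apply cderiv_const].
Qed.

(** The parts of Phi holomorphic inside C_a have as mean their value at the centre; the tail at a
    contains only negative powers and has mean zero. *)
Lemma mean_omega_prim g w rho omega x t c M a : in_Schottky_domain g w rho -> is_canonical_bidiff g w rho omega ->
  in_D g w rho x -> spread g w rho x t -> expansion g w rho omega x t c M -> is_letter g a ->
  circ_cont (fun u => omega_prim g w c x (w a + u)) (radius rho a) /\
  mean (fun u => omega_prim g w c x (w a + u)) (radius rho a) =
  pole_prim x (w a) - csum (letters g) (fun e => if Z.eq_dec e a then 0 else nser (cprim (c e)) (w a - w e)).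
Proof.
  intros Hw Ho Hx Hs HE Ha. pose proof HE as (Hc & _). pose proof Hs as (Ht & _ & _).
  pose proof (radius_pos _ _ _ _ Hw Ha) as Hr.
  assert (Hcirc := fun u Hu => circle_collar g w rho x t a u Hw Hs Ha Hu).
  assert (Hsh : forall v u, holo (fun u => v + u) u).
  { intros v u. apply holo_plus; [apply holo_const|eexists; apply cderiv_id]. }
  set (P := fun e u => nser (cprim (c e)) (w a - w e + u)).
  assert (HP : forall e, is_letter g e -> circ_cont (P e) (radius rho a) /\
     mean (P e) (radius rho a) = if Z.eq_dec e a then 0 else nser (cprim (c e)) (w a - w e)).
  { intros e He. pose proof (radius_pos _ _ _ _ Hw He) as Hre. pose proof (div_lt_self _ t Hre Ht) as Hrt.
    pose proof (geo_cprim _ _ _ (Hc e He)) as Hg.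
    destruct (Z.eq_dec e a) as [->|Hn]; unfold P.
    - assert (H1 : forall u, Cmod u = radius rho a -> (radius rho a <= Cmod (w a - w a + u))%R).
      { intros u Hu. replace (w a - w a + u) with u by ring. lra. }
      destruct (mean_nser _ _ (radius rho a) _ (w a - w a) (radius rho a) (fun _ => 1) Hrt ltac:(lra) Hg H1
        (circ_cont_const 1 _)) as [H2 _]. split; auto.
      rewrite <- (mean_nser_self_neg _ _ _ (radius rho a) O Hrt Hg).
      apply mean_ext; [lra|]. intros u _. replace (w a - w a + u) with u by ring. simpl. field.
    - assert (Hte : (0 < radius rho e / t < t * radius rho e)%R) by (split; [lra|nra]).
      destruct (mean_nser _ (radius rho e / t) (t * radius rho e) _ (w a - w e) (radius rho a) (fun _ => 1) Hte ltac:(lra) Hg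
        ltac:(intros u Hu; apply Hcirc; auto) (circ_cont_const 1 _)) as [H2 H3]. split; auto.
      rewrite (mean_ext _ (fun u => nser (cprim (c e)) (w a - w e + u) * 1)) by (try lra; intros; ring). rewrite H3.
      apply Cseries_ext. intros l. f_equal.
      rewrite (mean_ext _ (fun u => / (w a - w e + u) ^ S l * / u ^ 0)); [|lra|].
      2:{ intros u Hu. simpl (u ^ 0). replace (/ 1) with (RtoC 1) by field. reflexivity. }
      rewrite mean_inv_shift by (apply (spread_apart g w rho x t); auto). unfold taylor_inv.
      rewrite nb_0_r, Nat.add_0_r. simpl pow. rewrite Rmult_1_l. ring. }
  assert (Hpp : circ_cont (fun u => pole_prim x (w a + u)) (radius rho a)).
  { apply holo_circ. intros u Hu. apply (holo_comp (pole_prim x) (fun u => w a + u)); auto.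
    eexists. apply cderiv_pole_prim, Hcirc; auto. }
  assert (Hpm : mean (fun u => pole_prim x (w a + u)) (radius rho a) = pole_prim x (w a)).
  { destruct x as [z|]; simpl.
    - pose proof (spread_far g w rho (Fin z) t a z Hw Hs Ha eq_refl) as Hz.
      assert (Hzn : z - w a <> 0) by (apply Cmod_gt_0; lra).
      replace (z - w a) with (- (w a - z)) in Hz by ring. rewrite Cmod_opp in Hz.
      assert (Hzn' : w a - z <> 0) by (apply Cmod_gt_0; lra).
      transitivity ((-1) * taylor_inv (w a - z) 0 0).
      + rewrite <- (mean_inv_shift _ _ (radius rho a)) by lra. rewrite <- mean_scal; [|lra|].
        * apply mean_ext; [lra|]. intros u Hu. pose proof (taylor_inv_nz (w a - z) u (radius rho a) ltac:(lra) Hu) as Hnz.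
          simpl. field. split; [exact Hnz|]. intros E. apply Hnz.
          replace (w a - z + u) with (- (z - (w a + u))) by ring. rewrite E. ring.
        * apply circ_cont_mult; [|apply circ_cont_pow_inv; auto]. apply holo_circ. intros u Hu.
          apply (holo_comp (fun v => / v ^ 1) (fun u => w a - z + u)); auto.
          apply holo_pow_inv, (taylor_inv_nz _ u (radius rho a)); auto.
      + unfold taylor_inv. rewrite nb_0_l. simpl. rewrite Rmult_1_l. field. split; auto.
    - rewrite (mean_ext _ (fun u => (-1) * w a + (-1) * u ^ 1)) by (try lra; intros; simpl; ring).
      rewrite mean_plus, mean_const, mean_scal, mean_pow; try lra; [simpl; ring|apply circ_cont_pow|apply circ_cont_const|].
      apply circ_cont_scal, circ_cont_pow. }
  assert (E : forall u, omega_prim g w c x (w a + u) = pole_prim x (w a + u) - csum (letters g) (fun e => P e u)).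
  { intros u. unfold omega_prim. f_equal. apply csum_ext. intros e _. unfold P. f_equal. ring. }
  destruct (mean_csum (letters g) P (radius rho a) ltac:(lra)) as [H1 H2].
  { intros e He. apply HP, In_letters; auto. }
  split.
  - intros u Hu. apply (ccont_ext (fun u => pole_prim x (w a + u) - csum (letters g) (fun e => P e u))); [intros; auto|].
    apply (circ_cont_minus _ _ _ Hpp H1); auto.
  - rewrite (mean_ext _ (fun u => pole_prim x (w a + u) - csum (letters g) (fun e => P e u))) by (try lra; auto).
    rewrite mean_minus, Hpm, H2; auto; [|lra]. f_equal. apply csum_ext. intros e He. apply HP, In_letters; auto.
Qed.

(** Integrating the derivative along arcs shows that F is constant on the circle, hence equal to its
    mean. The result therefore does not depend on the point of C_b at which a path ends. *)
Lemma circle_constant (F : C -> C) r u : (0 < r)%R -> (forall v, Cmod v = r -> cderiv F v 0) ->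
  Cmod u = r -> F u = mean F r.
Proof.
  intros Hr HF.
  assert (H0 : forall v, Cmod v = r -> F v = F (circ r 0)).
  { intros v Hv. pose proof (Cmod_r_nz r v Hr Hv) as Hvn. assert (Hrn : RtoC r <> 0) by (apply RtoC_neq0; lra).
    destruct (arg_exists (v / r)) as (s & Hs & E).
    { rewrite Cmod_div, Hv, Cmod_R, Rabs_pos_eq by (auto; lra). field; lra. }
    replace v with (circ r s) by (unfold circ; rewrite <- E; field; auto).
    assert (E0 : F (circ r s) - F (circ r 0) = 0); [|rewrite <- (Cplus_0_r (F (circ r 0))), <- E0; ring].
    rewrite <- (Cint_FTC (fun t => F (circ r t)) (fun _ => 0) 0 s); [| lra | |].
    - rewrite Cint_const. ring.
    - intros t _. replace (RtoC 0) with (0 * (RtoC r * (ei t * Ci))) by ring.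
      apply (rderiv_comp F (circ r)); [|apply rderiv_circ]. apply HF, Cmod_circ; lra.
    - intros; apply rcont_const. }
  intros Hu. rewrite H0 by auto. rewrite <- (mean_const (F (circ r 0)) r).
  apply mean_ext; [lra|]. intros v Hv. symmetry; apply H0; auto.
Qed.

Lemma ccont_comp f g z : ccont f (g z) -> ccont g z -> ccont (fun z => f (g z)) z.
Proof.
  intros Hf Hg eps He. destruct (Hf eps He) as (d & Hd & H1). destruct (Hg d Hd) as (d' & Hd' & H2).
  exists d'; split; auto.
Qed.

(** On C_b the derivative of Phi - Phi o gamma_b is f - (f o gamma_b) gamma_b', which vanishes by
    invariance. The constant is a difference of means over C_b and C_{-b}, the latter obtained
    through [mean_inversion]. *)
Lemma omega_prim_jump g w rho omega x t c M b u : in_Schottky_domain g w rho -> is_canonical_bidiff g w rho omega ->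
  in_D g w rho x -> spread g w rho x t -> expansion g w rho omega x t c M -> is_letter g b ->
  Cmod u = radius rho b ->
  omega_prim g w c x (w b + u) - omega_prim g w c x (w (- b)%Z + rho b / u) =
  pole_prim x (w b) - pole_prim x (w (- b)%Z)
  - csum (letters g) (fun a =>
      (if Z.eq_dec a b then 0 else nser (cprim (c a)) (w b - w a))
      - (if Z.eq_dec a (- b) then 0 else nser (cprim (c a)) (w (- b)%Z - w a))).
Proof.
  intros Hw Ho Hx Hs HE Hb Hu. pose proof (letter_opp _ _ Hb) as Hb'.
  pose proof (radius_pos _ _ _ _ Hw Hb) as Hr. pose proof (radius_opp _ _ _ _ Hw Hb) as Hro.
  destruct (mean_omega_prim g w rho omega x t c M b Hw Ho Hx Hs HE Hb) as [H1 H2].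
  destruct (mean_omega_prim g w rho omega x t c M (- b) Hw Ho Hx Hs HE Hb') as [H3 H4].
  rewrite Hro in H3, H4.
  assert (Hinv : forall v, Cmod v = radius rho b -> Cmod (rho b / v) = radius rho b).
  { intros v Hv. rewrite Cmod_div, <- radius_sqr, Hv by (apply (Cmod_r_nz (radius rho b)); auto). field; lra. }
  rewrite (circle_constant (fun u => omega_prim g w c x (w b + u) - omega_prim g w c x (w (- b)%Z + rho b / u)) (radius rho b) u); auto.
  - rewrite mean_minus; auto; [|lra|].
    + rewrite (mean_inversion (fun v => omega_prim g w c x (w (- b)%Z + v)) (radius rho b) (rho b)); auto; [|rewrite radius_sqr; auto].
      rewrite H2, H4, csum_minus. ring.
    + intros v Hv. pose proof (Cmod_r_nz _ v Hr Hv) as Hvn.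
      apply (ccont_comp (fun v => omega_prim g w c x (w (- b)%Z + v)) (fun u => rho b / u)).
      * apply H3, Hinv; auto.
      * apply holo_ccont. apply holo_mult; [apply holo_const|apply holo_inv; auto].
  - intros v Hv. pose proof (Cmod_r_nz _ v Hr Hv) as Hvn.
    destruct (circle_collar g w rho x t b v Hw Hs Hb Hv) as (K1 & K2 & _).
    destruct (circle_collar g w rho x t (- b) (rho b / v) Hw Hs Hb' ltac:(rewrite Hro; auto)) as (K3 & K4 & _).
    pose proof (cderiv_omega_prim g w rho omega x t c M _ Hw Ho Hx Hs HE K1 K2) as D1.
    pose proof (cderiv_omega_prim g w rho omega x t c M _ Hw Ho Hx Hs HE K3 K4) as D2.
    pose proof (omega_invariant g w rho omega x b (w b + v) Hw Ho Hx Hb) as HI.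
    replace (w b + v - w b) with v in HI by ring. specialize (HI Hv).
    apply (cderiv_eq _ _ (omega x (Fin (w b + v)) * (0 + 1)
      - omega x (Fin (w (- b)%Z + rho b / v)) * (0 + rho b * (- / (v * v))))).
    { rewrite <- HI. field. auto. }
    apply cderiv_minus.
    + apply (cderiv_comp (omega_prim g w c x) (fun u => w b + u)); auto.
      apply cderiv_plus; [apply cderiv_const|apply cderiv_id].
    + apply (cderiv_comp (omega_prim g w c x) (fun u => w (- b)%Z + rho b / u)); auto.
      apply cderiv_plus; [apply cderiv_const|]. apply cderiv_scal, cderiv_inv; auto.
Qed.

(** The path ends at z on C_b, starts at gamma_b z and stays in the collar away from x, where Phi is
    a primitive; the end points themselves are on the boundary of D. *)
Lemma nu_omega_prim g w rho omega x t c M b beta : in_Schottky_domain g w rho -> is_canonical_bidiff g w rho omega ->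
  in_D g w rho x -> spread g w rho x t -> expansion g w rho omega x t c M -> is_letter g b ->
  is_beta g w rho b beta -> (forall s, (0 <= s <= 1)%R -> Fin (pos beta s) <> x) ->
  exists u, Cmod u = radius rho b /\
    nu omega beta x = omega_prim g w c x (w b + u) - omega_prim g w c x (w (- b)%Z + rho b / u).
Proof.
  intros Hw Ho Hx Hs HE Hb (HC & H1 & H0 & HD) Hn. pose proof (letter_opp _ _ Hb) as Hb'.
  pose proof (radius_pos _ _ _ _ Hw Hb) as Hr. pose proof (radius_opp _ _ _ _ Hw Hb) as Hro.
  set (u := pos beta 1 - w b). assert (Hu : Cmod u = radius rho b) by exact H1.
  pose proof (Cmod_r_nz _ u Hr Hu) as Hun.
  assert (E1 : pos beta 1 = w b + u) by (unfold u; ring).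
  assert (E0 : pos beta 0 = w (- b)%Z + rho b / u).
  { simpl in H0. destruct (Ceq_dec (pos beta 1) (w b)) as [E|_]; [discriminate|]. injection H0 as ->. auto. }
  exists u. split; auto. rewrite <- E0, <- E1.
  assert (Hinv : Cmod (rho b / u) = radius rho (- b)).
  { rewrite Hro, Cmod_div, <- radius_sqr, Hu by auto. field; lra. }
  assert (Hcol : forall s, (0 <= s <= 1)%R -> collar_D g w rho t (pos beta s)).
  { intros s Hs'. destruct (Req_dec s 0) as [->|Hs0]; [rewrite E0; apply (circle_collar g w rho x t (- b)); auto|].
    destruct (Req_dec s 1) as [->|Hs1]; [rewrite E1; apply (circle_collar g w rho x t b); auto|].
    intros a Ha. specialize (HD s ltac:(lra) a Ha). pose proof (radius_pos _ _ _ _ Hw Ha) as Hra.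
    pose proof (div_lt_self _ t Hra (proj1 Hs)). lra. }
  unfold nu. change (Cint (path_integrand (omega x) beta) 0 1 = omega_prim g w c x (pos beta 1) - omega_prim g w c x (pos beta 0)).
  apply (Cint_FTC (fun s => omega_prim g w c x (pos beta s))); [lra| |].
  - intros s Hs'. unfold path_integrand. apply (rderiv_comp (omega_prim g w c x) (pos beta)); [|apply HC; auto].
    apply (cderiv_omega_prim g w rho omega x t c M); auto. intros E; apply (Hn s Hs'); auto.
  - intros s Hs'. destruct (HC s Hs') as [D1 D2]. unfold path_integrand. apply rcont_mult.
    + apply (rcont_comp (fun y => omega x (Fin y)) (pos beta)).
      * apply (rderiv_rcont (pos beta) s (vel beta s)). exact D1.
      * apply holo_ccont. apply (omega_holo g w rho omega x t); auto.
        -- apply (in_D_regular g w rho x t); auto.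
        -- intros E; apply (Hn s Hs'); auto.
    + apply continuous_rcont. exact D2.
Qed.

Lemma nser_conv c rho M v : (0 < rho)%R -> geo rho M c -> (rho < Cmod v)%R ->
  exists t M', (0 <= t < 1)%R /\ geo t M' (fun k => c k * / v ^ S k).
Proof. intros Hr Hc Hv. destruct (nser_geo c rho M v Hr Hc Hv). eauto. Qed.

(** With the scaling of [sol], the factor s_a^k / sqrt k of [d_vec] times Y_a(k) is minus the
    primitive coefficient. The values of the tails at w_b and w_{-b} then match d term by term. *)
Lemma jump_series g w rho omega s x t c M b : in_Schottky_domain g w rho -> is_sqrt_choice g rho s ->
  spread g w rho x t -> expansion g w rho omega x t c M -> (1 <= b <= Z.of_nat g)%Z ->
  contractive g (A_mat w s) (/ t) ->
  csum (letters g) (fun a =>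
      (if Z.eq_dec a b then 0 else nser (cprim (c a)) (w b - w a))
      - (if Z.eq_dec a (- b) then 0 else nser (cprim (c a)) (w (- b)%Z - w a)))
  = index_sum g (fun i => d_vec w s b i * sol s c i).
Proof.
  intros Hw Hs Hsp HE Hb (Hti & _). pose proof HE as (Hc & _). pose proof Hsp as (Ht & _).
  assert (Hb1 : is_letter g b) by (unfold is_letter; lia). pose proof (letter_opp _ _ Hb1) as Hb2.
  pose proof (gbnd_d g w rho s x t b Hw Hs Hsp Hb) as Hd.
  pose proof (gbnd_sol g w rho omega s x t c M Hw Hs Ht HE) as HY. set (M0 := rsum (letters g) M) in *.
  rewrite index_sum_letters.
  rewrite (Cseries_csum (letters g) (/ t) (fun _ => 2 * M0)%R (fun a k => d_vec w s b (a, S k) * sol s c (a, S k))).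
  2: lra.
  2:{ intros a Ha k. apply In_letters in Ha.
      assert (Hi : is_index g (a, S k)) by (split; simpl; [auto|lia]).
      specialize (Hd _ Hi). specialize (HY _ Hi). simpl snd in Hd, HY.
      assert (HM0 : (0 <= M0)%R).
      { eapply (gbnd_M_pos g (/ t)); [lra| |eauto]. apply (gbnd_sol g w rho omega s x t c M); auto. }
      eapply Rle_trans; [apply (Cmod_mult_le _ _ _ _ Hd HY)|].
      replace (2 * (/ t) ^ S k * (M0 * (/ t) ^ S k))%R with (2 * M0 * (/ t) ^ k * (/ t * (/ t) ^ S k))%R by (simpl; ring).
      rewrite <- (Rmult_1_r (2 * M0 * (/ t) ^ k)) at 2.
      assert (0 <= (/ t) ^ k)%R by (apply pow_le; lra).
      apply Rmult_le_compat_l; [nra|]. change ((/ t) ^ S (S k) <= 1)%R. rewrite <- (pow1 (S (S k))). apply pow_incr; lra. }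
  apply csum_ext. intros a Ha. apply In_letters in Ha.
  pose proof (radius_pos _ _ _ _ Hw Ha) as Hra. pose proof (div_lt_self _ t Hra Ht) as Hrt.
  pose proof (sqrt_choice_nz g w rho s a Hw Hs Ha) as Hsn.
  assert (Hfar : forall e, is_letter g e -> e <> a -> (radius rho a / t < Cmod (w e - w a))%R).
  { intros e He Hn. destruct (spread_apart g w rho x t e a Hw Hsp He Ha ltac:(congruence)) as [_ H].
    pose proof (proj2 Hw e a He Ha Hn) as H'. pose proof (radius_pos _ _ _ _ Hw He). lra. }
  assert (Hser : forall e, is_letter g e -> e <> a -> exists q M', (0 <= q < 1)%R /\ geo q M' (fun k => cprim (c a) k * / (w e - w a) ^ S k)).
  { intros e He Hn. apply (nser_conv _ (radius rho a / t) (M a * (radius rho a / t))); [lra|apply geo_cprim; auto|auto]. }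
  (* The factor sqrt (k+1) occurs once in [d_vec] and once in [sol]; together they give the
     denominator of [cprim]. *)
  assert (Hterm : forall k, s a ^ S k / RtoC (sqrt (INR (S k))) * sol s c (a, S k) = - cprim (c a) k).
  { intros k. unfold sol, cprim. simpl fst; simpl snd. rewrite <- sqrt_S_sqr. field.
    repeat split; first [apply sqrt_S_nz | apply Cpow_nz; assumption]. }
  unfold d_vec. destruct (Z.eq_dec (Z.abs a) b) as [Eb|Hnb].
  - destruct (Z.eq_dec a b) as [->|Hab].
    + destruct (Z.eq_dec b (- b)); [lia|].
      replace (Z.sgn b) with 1%Z by lia. rewrite Z.mul_1_r.
      destruct (Hser (- b)%Z Hb2 ltac:(lia)) as (q & M' & Hq & Hg).
      replace (0 - nser (cprim (c b)) (w (- b)%Z - w b)) with ((-1) * nser (cprim (c b)) (w (- b)%Z - w b)) by ring.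
      unfold nser. rewrite <- (Cseries_scal q M') by auto. apply Cseries_ext. intros k.
      replace (RtoC 1 * (s b ^ S k / sqrt (INR (S k))) * / (w (- b)%Z - w b) ^ S k * sol s c (b, S k)) with
        (s b ^ S k / sqrt (INR (S k)) * sol s c (b, S k) * / (w (- b)%Z - w b) ^ S k) by (unfold Cdiv; ring).
      rewrite Hterm. ring.
    + assert (Eab : a = (- b)%Z) by lia. subst a. destruct (Z.eq_dec (- b) (- b)); [|congruence].
      replace (Z.sgn (- b)) with (-1)%Z by lia. replace (- (b * -1))%Z with b by lia.
      destruct (Hser b Hb1 ltac:(lia)) as (q & M' & Hq & Hg).
      replace (nser (cprim (c (- b)%Z)) (w b - w (- b)%Z) - 0) with (nser (cprim (c (- b)%Z)) (w b - w (- b)%Z)) by ring.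
      unfold nser. apply Cseries_ext. intros k.
      replace (RtoC (-1) * (s (- b)%Z ^ S k / sqrt (INR (S k))) * / (w b - w (- b)%Z) ^ S k * sol s c ((- b)%Z, S k)) with
        (RtoC (-1) * (s (- b)%Z ^ S k / sqrt (INR (S k)) * sol s c ((- b)%Z, S k)) * / (w b - w (- b)%Z) ^ S k) by (unfold Cdiv; ring).
      rewrite Hterm. ring.
  - destruct (Z.eq_dec a b); [lia|]. destruct (Z.eq_dec a (- b)); [lia|].
    destruct (Hser b Hb1 ltac:(lia)) as (q & M' & Hq & Hg). destruct (Hser (- b)%Z Hb2 ltac:(lia)) as (q' & M'' & Hq' & Hg').
    replace (nser (cprim (c a)) (w b - w a) - nser (cprim (c a)) (w (- b)%Z - w a)) with
      (nser (cprim (c a)) (w b - w a) + (-1) * nser (cprim (c a)) (w (- b)%Z - w a)) by ring.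
    unfold nser. rewrite <- (Cseries_scal q' M'') by auto.
    rewrite <- (Cseries_plus q M' _ q' M''); auto.
    2:{ intros k. rewrite Cmod_mult. replace (Cmod (-1)) with 1%R; [rewrite Rmult_1_l; apply Hg'|].
        rewrite Cmod_R, Rabs_left; lra. }
    apply Cseries_ext. intros k.
    replace (s a ^ S k / sqrt (INR (S k)) * (/ (w (- b)%Z - w a) ^ S k - / (w b - w a) ^ S k) * sol s c (a, S k)) with
      (s a ^ S k / sqrt (INR (S k)) * sol s c (a, S k) * (/ (w (- b)%Z - w a) ^ S k - / (w b - w a) ^ S k)) by ring.
    rewrite Hterm. ring.
Qed.

Theorem proposition3p4
  (g : nat) (w rho s : Z -> C) (omega : Chat -> Chat -> C)
  (b : Z) (beta : path) (x : Chat)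
  (hg : (1 <= g)%nat)
  (hw : in_Schottky_domain g w rho)
  (hs : is_sqrt_choice g rho s)
  (homega : is_canonical_bidiff g w rho omega)
  (hb : (1 <= b <= Z.of_nat g)%Z)
  (hbeta : is_beta g w rho b beta)
  (hx : in_D g w rho x)
  (hxbeta : forall t : R, (0 <= t <= 1)%R -> Fin (pos beta t) <> x) :
  let IAinv := neumann_inverse g (A_mat w s) in
  let L := L_vec w s x in
  let R := R_vec w s x in
  let d := d_vec w s b in
  let dbar := dbar_vec w s b in
  neumann_converges g (A_mat w s) /\
  sandwich_converges g d IAinv R /\
  sandwich_converges g L IAinv dbar /\
  nu omega beta x - omega0 (w b) (w (- b)%Z) x = - sandwich g d IAinv R /\
  nu omega beta x - omega0 (w b) (w (- b)%Z) x = - sandwich g L IAinv dbar.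
Proof.
  cbv zeta.
  assert (Hl : is_letter g b) by (unfold is_letter; lia).
  destruct (sandwich_values g w rho omega s x b hw homega hs hx hb)
    as (t & c & M & Hsp & HE & HA & C1 & C2 & V1 & V2).
  rewrite V1, V2.
  destruct (nu_omega_prim g w rho omega x t c M b beta hw homega hx Hsp HE Hl hbeta hxbeta) as (u & Hu & Hnu).
  rewrite (omega_prim_jump g w rho omega x t c M b u), (jump_series g w rho omega s x t c M b) in Hnu by auto.
  (* The primitive of the pole evaluated at a centre p is 1 / (x - p), or - p for x at infinity, so
     the pole part of the jump is the subtracted form. *)
  assert (E0 : omega0 (w b) (w (- b)%Z) x = pole_prim x (w b) - pole_prim x (w (- b)%Z)).
  { destruct x; simpl; [auto|ring]. }
  assert (E : nu omega beta x - omega0 (w b) (w (- b)%Z) x = - index_sum g (fun i => d_vec w s b i * sol s c i)).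
  { rewrite Hnu, E0. ring. }
  split; [apply (contractive_neumann _ _ _ HA)|]. auto.
Qed.
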